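(* Let $(a_1,a_2)\subset(0,1)$ be an open interval such that for each $\lambda\in(a_1,a_2)$ there exist $\lambda_1,\lambda_2$ with $1<\lambda_1<\lambda_2$ solving the period problem $\xi_1(\lambda_1,\lambda_2)=0$, $\xi_2(\lambda_1,\lambda_2)=0$. For each $\lambda\in(a_1,a_2)$ and corresponding $\lambda_1,\lambda_2$ (solving this period problem), the surface $M_\lambda\subset\mathbb{R}^3$ is embedded.
   Context: For real numbers $0<\lambda<1<\lambda_1<\lambda_2$ put $$g_1(z)=(z-\lambda)(z+1)(z-\lambda_1)(z+\lambda_2),\qquad g_2(z)=(z+\lambda)(z-1)(z+\lambda_1)(z-\lambda_2),$$ $$\alpha=\lambda+\lambda_1-\lambda_2-\lambda\lambda_1+\lambda\lambda_2+\lambda_1\lambda_2,\quad a=\sqrt{\frac{\alpha-\sqrt{\alpha^2-4\lambda\lambda_1\lambda_2}}{2}},\quad b=\sqrt{\frac{\alpha+\sqrt{\alpha^2-4\lambda\lambda_1\lambda_2}}{2}}$$ (it is known that $\alpha^2-4\lambda\lambda_1\lambda_2>0$, $\lambda<a<1$ and $\lambda_1<b<\lambda_2$). Let $\overline{R}=\{(z,w)\in(\mathbb{C}\cup\{\infty\})^2 : g_2(z)w^2=g_1(z)\}$, a compact Riemann surface of genus $3$, and $$R=\overline{R}\setminus\{(a,i),(-a,i),(a,-i),(-a,-i)\},\qquad G=w,\qquad dh=\frac{dz}{z^2-a^2},$$ $$(\phi_1,\phi_2,\phi_3)=\left(\frac12\left(\frac1G-G\right)dh,\ \frac i2\left(\frac1G+G\right)dh,\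 dh\right).$$ $M_\lambda$ is the minimal surface with Weierstrass data $(R,G,dh)$, i.e. the image in $\mathbb{R}^3$ of the (multivalued on $R$, single-valued on the universal cover) map $X(p)=\operatorname{Re}\int_{p_0}^{p}(\phi_1,\phi_2,\phi_3)$, $p_0\in R$ a base point. The period functions are $$\xi_1(\lambda_1,\lambda_2)=\int_1^{\lambda_1}\frac{t\big((1-\lambda-\lambda_1+\lambda_2)t^2+\lambda\lambda_1-\lambda\lambda_2-\lambda_1\lambda_2+\lambda\lambda_1\lambda_2\big)}{(t^2-a^2)\sqrt{(t^2-\lambda^2)(t^2-1)(\lambda_1^2-t^2)(\lambda_2^2-t^2)}}\,dt,$$ $$\xi_2(\lambda_1,\lambda_2)=\int_{\lambda_1}^{\lambda_2}\frac{t^2-b^2}{\sqrt{(t^2-\lambda^2)(t^2-1)(t^2-\lambda_1^2)(\lambda_2^2-t^2)}}\,dt.$$ When $\xi_1=\xi_2=0$, the map $X$ is well defined as a map from $R$ into $(\mathbb{R}^2/\Lambda)\times\mathbb{R}$, where $\Lambda$ is generated by $(\pi/a,0)$ and $(0,v_2)$ with $v_2=2\int_\lambda^1\frac{b^2-t^2}{\sqrt{(t^2-\lambda^2)(1-t^2)(\lambda_1^2-t^2)(\lambda_2^2-t^2)}}\,dt>0$, so that $M_\lambda$ is a doubly periodic minimal surface. *)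

(* Defs.v *)
(* Stdlib reals with Coquelicot; C is Coquelicot's field of complex numbers. *)
From Stdlib Require Import Reals.
From Coquelicot Require Import Coquelicot.
Open Scope R_scope.

(** The parameters [l], [l1], [l2] stand for lambda, lambda_1, lambda_2. *)

Definition g1 (l l1 l2 : R) (z : C) : C :=
  ((z - RtoC l) * (z + RtoC 1) * (z - RtoC l1) * (z + RtoC l2))%C.

Definition g2 (l l1 l2 : R) (z : C) : C :=
  ((z + RtoC l) * (z - RtoC 1) * (z + RtoC l1) * (z - RtoC l2))%C.

Definition alpha (l l1 l2 : R) : R :=
  l + l1 - l2 - l * l1 + l * l2 + l1 * l2.

Definition pa (l l1 l2 : R) : R :=
  sqrt ((alpha l l1 l2 - sqrt (alpha l l1 l2 ^ 2 - 4 * l * l1 * l2)) / 2).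

Definition pb (l l1 l2 : R) : R :=
  sqrt ((alpha l l1 l2 + sqrt (alpha l l1 l2 ^ 2 - 4 * l * l1 * l2)) / 2).

(** * The period problem *)

Definition xi1_integrand (l l1 l2 t : R) : R :=
  t * ((1 - l - l1 + l2) * t ^ 2 + l * l1 - l * l2 - l1 * l2 + l * l1 * l2)
  / ((t ^ 2 - pa l l1 l2 ^ 2)
     * sqrt ((t ^ 2 - l ^ 2) * (t ^ 2 - 1) * (l1 ^ 2 - t ^ 2) * (l2 ^ 2 - t ^ 2))).

Definition xi2_integrand (l l1 l2 t : R) : R :=
  (t ^ 2 - pb l l1 l2 ^ 2)
  / sqrt ((t ^ 2 - l ^ 2) * (t ^ 2 - 1) * (t ^ 2 - l1 ^ 2) * (l2 ^ 2 - t ^ 2)).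

(** [xi_1 = v] and [xi_2 = v]; the integrands are unbounded at both ends of
    the interval of integration, so these are improper integrals. *)
Definition is_xi1 (l l1 l2 v : R) : Prop :=
  is_RInt_gen (xi1_integrand l l1 l2) (at_right 1) (at_left l1) v.

Definition is_xi2 (l l1 l2 v : R) : Prop :=
  is_RInt_gen (xi2_integrand l l1 l2) (at_right l1) (at_left l2) v.

(** * The Riemann surface *)

Inductive Chat : Type :=
  | Fin (z : C)
  | Inf.

(** Neighbourhoods in the Riemann sphere.  Unlike [Rbar_locally p_infty], the
    neighbourhoods of [Inf] contain [Inf] itself. *)
Definition Chat_locally (p : Chat) : (Chat -> Prop) -> Prop :=
  match p with
  | Fin z => fun P => locally z (fun u => P (Fin u))
  | Inf => fun P => exists M : R,
      P Inf /\ forall u : C, M < Cmod u -> P (Fin u)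
  end.

Definition Chat2_locally (p : Chat * Chat) : (Chat * Chat -> Prop) -> Prop :=
  filter_prod (Chat_locally (fst p)) (Chat_locally (snd p)).

(** [g2 z * w ^ 2 = g1 z] on the product of two spheres, i.e. the zero set of
    its bihomogenization.  Both [g1] and [g2] are monic of degree 4, so above
    [z = Inf] the equation is [w ^ 2 = 1].  The curve is smooth in the product
    of spheres, so its topology as a Riemann surface is the subspace one. *)
Definition on_Rbar (l l1 l2 : R) (p : Chat * Chat) : Prop :=
  match p with
  | (Fin z, Fin w) => (g2 l l1 l2 z * (w * w))%C = g1 l l1 l2 z
  | (Fin z, Inf) => g2 l l1 l2 z = RtoC 0
  | (Inf, Fin w) => (w * w)%C = RtoC 1
  | (Inf, Inf) => False
  end.

Definition on_R (l l1 l2 : R) (p : Chat * Chat) : Prop :=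
  on_Rbar l l1 l2 p
  /\ p <> (Fin (RtoC (pa l l1 l2)), Fin Ci)
  /\ p <> (Fin (- RtoC (pa l l1 l2))%C, Fin Ci)
  /\ p <> (Fin (RtoC (pa l l1 l2)), Fin (- Ci)%C)
  /\ p <> (Fin (- RtoC (pa l l1 l2))%C, Fin (- Ci)%C).

(** The points of [R] at which [z] is a local coordinate: all points except
    the eight branch points ([w = 0] or [w = Inf]) and the two points above
    [z = Inf]. *)
Definition ordinary (l l1 l2 : R) (z w : C) : Prop :=
  on_R l l1 l2 (Fin z, Fin w) /\ w <> RtoC 0.

(** [c] restricted to the disc of radius [r] is a holomorphic parametrization
    of a neighbourhood of [c 0] in [R].  Complex differentiability is only
    asked away from [0], at ordinary points; as [c] is continuous, it is then
    holomorphic at [0] as well, and being injective it is biholomorphic onto an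
    open subset of [R]. *)
Definition local_param (l l1 l2 : R) (r : R) (c : C -> Chat * Chat) : Prop :=
  0 < r
  /\ (forall s : C, Cmod s < r ->
        on_R l l1 l2 (c s) /\ filterlim c (locally s) (Chat2_locally (c s)))
  /\ (forall s s' : C, Cmod s < r -> Cmod s' < r -> c s = c s' -> s = s')
  /\ exists z w : C -> C, forall s : C, 0 < Cmod s < r ->
       c s = (Fin (z s), Fin (w s))
       /\ ordinary l l1 l2 (z s) (w s)
       /\ ex_derive (K := C_AbsRing) (V := C_NormedModule) z s
       /\ ex_derive (K := C_AbsRing) (V := C_NormedModule) w s.

(** * The Weierstrass representation *)

(** The coefficients of [dh], [phi_1], [phi_2], [phi_3] with respect to [dz] at
    an ordinary point [(z, w)], where [G = w]. *)
Definition dh (l l1 l2 : R) (z : C) : C :=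
  (/ (z * z - RtoC (pa l l1 l2) * RtoC (pa l l1 l2)))%C.

Definition phi1 (l l1 l2 : R) (z w : C) : C :=
  (/ RtoC 2 * (/ w - w) * dh l l1 l2 z)%C.

Definition phi2 (l l1 l2 : R) (z w : C) : C :=
  (Ci / RtoC 2 * (/ w + w) * dh l l1 l2 z)%C.

Definition phi3 (l l1 l2 : R) (z w : C) : C := dh l l1 l2 z.

(** [t |-> (z t, w t)], for [0 < t < 1], is a [C^1] arc of ordinary points of
    [R] from [p] to [q]; the end points may be any points of [R].  [dz] is the
    derivative of [z]. *)
Definition is_arc (l l1 l2 : R) (z w dz : R -> C) (p q : Chat * Chat) : Prop :=
  on_R l l1 l2 p /\ on_R l l1 l2 q
  /\ (forall t : R, 0 < t < 1 ->
        ordinary l l1 l2 (z t) (w t)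
        /\ is_derive (K := R_AbsRing) (V := C_R_NormedModule) z t (dz t)
        /\ filterlim dz (locally t) (locally (dz t))
        /\ filterlim w (locally t) (locally (w t)))
  /\ filterlim (fun t => (Fin (z t), Fin (w t))) (at_right 0) (Chat2_locally p)
  /\ filterlim (fun t => (Fin (z t), Fin (w t))) (at_left 1) (Chat2_locally q).

(** [v] is the real part of the integral of [(phi_1, phi_2, phi_3)] along some
    arc from [p] to [q].  The forms are holomorphic at every point of [R], but
    their coefficients with respect to [dz] need not be bounded near the ends
    of the arc, hence the improper integrals. *)
Definition arc_integral (l l1 l2 : R) (p q : Chat * Chat) (v : R * R * R) : Prop :=
  exists z w dz : R -> C,
    is_arc l l1 l2 z w dz p q
    /\ is_RInt_gen (fun t => Re (phi1 l l1 l2 (z t) (w t) * dz t)%C)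
         (at_right 0) (at_left 1) (fst (fst v))
    /\ is_RInt_gen (fun t => Re (phi2 l l1 l2 (z t) (w t) * dz t)%C)
         (at_right 0) (at_left 1) (snd (fst v))
    /\ is_RInt_gen (fun t => Re (phi3 l l1 l2 (z t) (w t) * dz t)%C)
         (at_right 0) (at_left 1) (snd v).

(** The graph of the multivalued map [X] on [R] with base point [p0]: [x] is a
    value of [X] at [p] when it is the real part of the integral of
    [(phi_1, phi_2, phi_3)] along a path from [p0] to [p], paths being finite
    concatenations of arcs.  Every homotopy class of paths contains one of
    these. *)
Inductive X_value (l l1 l2 : R) (p0 : Chat * Chat) : Chat * Chat -> R * R * R -> Prop :=
  | X_base : X_value l l1 l2 p0 p0 (0, 0, 0)
  | X_step (p q : Chat * Chat) (x v : R * R * R) :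
      X_value l l1 l2 p0 p x -> arc_integral l l1 l2 p q v ->
      X_value l l1 l2 p0 q (plus x v).

(** * Embeddedness *)

(** The surface [M] is the image of the projection [(p, x) |-> x] from the
    graph of [X], which is the smallest covering of [R] on which [X] is
    single-valued.  Embeddedness says that this map is an injective immersion
    and a homeomorphism onto its image: around each point, [X] has a branch [Y]
    that is an immersion in a holomorphic parameter of [R], and arbitrarily
    small pieces of this sheet exhaust [M] near [x].  A branch is the real part
    of a holomorphic map, so its differentiability is of class [C^infty]. *)
Definition embedded (l l1 l2 : R) (p0 : Chat * Chat) : Prop :=
  (forall (p q : Chat * Chat) (x : R * R * R),
     X_value l l1 l2 p0 p x -> X_value l l1 l2 p0 q x -> p = q)
  /\ (forall (p : Chat * Chat) (x : R * R * R), X_value l l1 l2 p0 p x ->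
      exists (r : R) (c : C -> Chat * Chat) (Y : C -> R * R * R),
        local_param l l1 l2 r c /\ c (RtoC 0) = p /\ Y (RtoC 0) = x
        /\ (forall s : C, Cmod s < r ->
              X_value l l1 l2 p0 (c s) (Y s)
              /\ exists L : C -> R * R * R,
                   filterdiff (K := R_AbsRing) (U := C_R_NormedModule)
                     Y (locally s) L
                   /\ (forall h : C, L h = (0, 0, 0) -> h = RtoC 0))
        /\ (forall rho : R, 0 < rho < r ->
              locally x (fun y => forall q : Chat * Chat,
                X_value l l1 l2 p0 q y ->
                exists s : C, Cmod s < rho /\ q = c s /\ y = Y s))).

(* Main.v *)
Require Import Defs.
From Stdlib Require Import Reals Lra Psatz.
From Coquelicot Require Import Coquelicot.
Open Scope R_scope.

(** The coordinate [om = (z - a) / (z + a)] moves the ends to [0] and infinity, so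
    that [X_3 = ln |om| / (2 a)].  As the zeros and poles of [w ^ 2] interlace on
    the real axis, [w ^ 2] has negative imaginary part on the upper half plane;
    there [w] stays in an open quadrant, and [X_1], [X_2] have branches [H1], [H2]
    that extend continuously to the real axis and increase strictly from left to
    right on every half circle [|om| = k].  The period conditions and the symmetry
    [om |-> 1 / conj om] show that [(H1, H2)] maps the upper half plane into a box
    and that on the real axis [H1] (resp. [H2]) lies on a wall of the box exactly
    where [w] is imaginary (resp. real) or at a branch point.  Continuing the
    branches over [R] is reflecting in these walls.  Hence, with [k1], [k2] equal
    to [pi] divided by the side lengths, [exp (i k1 X_1)] and [exp (i k2 X_2)] are
    single-valued on [R]: their real parts and [X_3] determine [om] up to
    conjugation, and the signs of their imaginary parts are those of [Re w] and
    [- Im w].  So a point of the surface determines the point of [R] it comes from,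
    and the latter depends continuously on the former. *)

(** An arc of [R] may meet the real [om]-axis in an arbitrary closed set, so the continuation of
    [H1] and [H2] cannot be followed from one crossing to the next. Instead, the pair of the cosine
    of [k1 * X_1] and a signed sine is shown to satisfy the linear differential equation of a
    rotation at every ordinary point of an arc ([lift_deriv]). On a wall the sign vanishes together
    with the sine, and the loss of differentiability of the folded height is compensated by the
    change of sign. Integrating the equation gives a rotation by [k1] times the increment of [X_1],
    for every path and without any homotopy. Path independence inside a chart is obtained in the
    same spirit: two values of [X] at one point differ by periods, so they agree as soon as they are
    close. Near a branch point the forms are of order [1 / sqrt (Im om)]. This is integrable, hence
    [H1] and [H2] have continuous boundary values there, and the monotonicity arguments use
    derivatives only in the interior of intervals. *)

(** * Limits and derivatives of complex functions *)

Lemma C_ext (a b : C) : Re a = Re b -> Im a = Im b -> a = b.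
Proof. destruct a, b; simpl; intros -> ->; reflexivity. Qed.

Lemma Cmod_sqr (z : C) : Cmod z * Cmod z = Re z * Re z + Im z * Im z.
Proof.
  unfold Cmod. rewrite sqrt_sqrt; [unfold Re, Im; ring|].
  apply Rplus_le_le_0_compat; apply pow2_ge_0.
Qed.

Lemma Re_le (z : C) : Rabs (Re z) <= Cmod z.
Proof. apply re_le_Cmod. Qed.

Lemma Im_le (z : C) : Rabs (Im z) <= Cmod z.
Proof.
  apply Rle_trans with (2 := Rmax_Cmod z). apply Rmax_r.
Qed.

Lemma Cmod_le_abs (z : C) : Cmod z <= Rabs (Re z) + Rabs (Im z).
Proof.
  assert (H := Cmod_sqr z). assert (H0 := Cmod_ge_0 z).
  assert (H1 := Rabs_pos (Re z)). assert (H2 := Rabs_pos (Im z)).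
  apply Rsqr_incr_0_var; [|lra]. unfold Rsqr.
  assert (Re z * Re z = Rabs (Re z) * Rabs (Re z)) by (rewrite <- Rabs_mult; symmetry; apply Rabs_right; nra).
  assert (Im z * Im z = Rabs (Im z) * Rabs (Im z)) by (rewrite <- Rabs_mult; symmetry; apply Rabs_right; nra).
  nra.
Qed.

Lemma Cmod_minus_sym (a b : C) : Cmod (a - b) = Cmod (b - a).
Proof. rewrite <- (Cmod_opp (b - a)). f_equal. ring. Qed.

Lemma Cmod_neq0 (z : C) : z <> 0 -> 0 < Cmod z.
Proof. apply Cmod_gt_0. Qed.

(** The uniform structure of [C] is that of a product, whose balls are squares, whereas
    multiplicative estimates need discs. Each square of half side [d] contains the disc of radius
    [d], and the converse inclusion costs a factor 2. *)
Lemma locally_Cmod (a : C) (P : C -> Prop) :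
  locally a P <-> exists d, 0 < d /\ forall z, Cmod (z - a) < d -> P z.
Proof.
  split.
  - intros [d Hd]. exists d. split; [apply cond_pos|]. intros z Hz. apply Hd.
    split.
    + apply Rle_lt_trans with (2 := Hz). apply (Re_le (z - a)%C).
    + apply Rle_lt_trans with (2 := Hz). apply (Im_le (z - a)%C).
  - intros [d [Hd H]]. assert (Hd2 : 0 < d / 2) by lra.
    exists (mkposreal _ Hd2). intros z [H1 H2]. apply H.
    apply Rle_lt_trans with (1 := Cmod_le_abs _).
    change (Rabs (Re z - Re a) < d / 2) in H1.
    change (Rabs (Im z - Im a) < d / 2) in H2.
    change (Rabs (Re z - Re a) + Rabs (Im z - Im a) < d). lra.
Qed.

Lemma locally_Rabs (a : R) (P : R -> Prop) :
  locally a P <-> exists d, 0 < d /\ forall z, Rabs (z - a) < d -> P z.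
Proof.
  split.
  - intros [d Hd]. exists d. split; [apply cond_pos|]. intros z Hz. apply Hd, Hz.
  - intros [d [Hd H]]. exists (mkposreal _ Hd). intros z Hz. apply H, Hz.
Qed.

Section FilterLimits.

Context {T : Type} {F : (T -> Prop) -> Prop} {FF : Filter F}.

Lemma flim_Cmod (f : T -> C) (a : C) :
  filterlim f F (locally a) <-> forall e, 0 < e -> F (fun x => Cmod (f x - a) < e).
Proof.
  split.
  - intros H e He. apply (H (fun z => Cmod (z - a) < e)). apply locally_Cmod. exists e. auto.
  - intros H P HP. apply locally_Cmod in HP. destruct HP as [d [Hd HP]].
    unfold filtermap. apply filter_imp with (2 := H d Hd). auto.
Qed.

Lemma flim_Rabs (f : T -> R) (a : R) :
  filterlim f F (locally a) <-> forall e, 0 < e -> F (fun x => Rabs (f x - a) < e).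
Proof.
  split.
  - intros H e He. apply (H (fun z => Rabs (z - a) < e)). apply locally_Rabs. exists e. auto.
  - intros H P HP. apply locally_Rabs in HP. destruct HP as [d [Hd HP]].
    unfold filtermap. apply filter_imp with (2 := H d Hd). auto.
Qed.

Lemma flim_C (f : T -> C) (a : C) :
  filterlim f F (locally a) <->
  filterlim (fun x => Re (f x)) F (locally (Re a)) /\
  filterlim (fun x => Im (f x)) F (locally (Im a)).
Proof.
  rewrite flim_Cmod, !flim_Rabs. split.
  - intros H. split; intros e He; apply filter_imp with (2 := H e He); intros x Hx;
      apply Rle_lt_trans with (2 := Hx).
    + apply (Re_le (f x - a)%C).
    + apply (Im_le (f x - a)%C).
  - intros [H1 H2] e He. assert (He2 : 0 < e / 2) by lra.
    apply filter_imp with (2 := filter_and _ _ (H1 _ He2) (H2 _ He2)).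
    intros x [Hx1 Hx2]. apply Rle_lt_trans with (1 := Cmod_le_abs _).
    change (Rabs (Re (f x) - Re a) + Rabs (Im (f x) - Im a) < e). lra.
Qed.

Lemma flim_Rplus (f g : T -> R) (a b : R) :
  filterlim f F (locally a) -> filterlim g F (locally b) ->
  filterlim (fun x => f x + g x) F (locally (a + b)).
Proof.
  intros Hf Hg. eapply filterlim_comp_2; [exact Hf|exact Hg|].
  apply (filterlim_plus (K := R_AbsRing) (V := R_NormedModule) a b).
Qed.

Lemma flim_Ropp (f : T -> R) (a : R) :
  filterlim f F (locally a) -> filterlim (fun x => - f x) F (locally (- a)).
Proof.
  intros Hf. eapply filterlim_comp; [exact Hf|].
  apply (filterlim_opp (K := R_AbsRing) (V := R_NormedModule) a).
Qed.

Lemma flim_Rminus (f g : T -> R) (a b : R) :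
  filterlim f F (locally a) -> filterlim g F (locally b) ->
  filterlim (fun x => f x - g x) F (locally (a - b)).
Proof. intros Hf Hg. apply flim_Rplus; [|apply flim_Ropp]; assumption. Qed.

Lemma flim_Rmult (f g : T -> R) (a b : R) :
  filterlim f F (locally a) -> filterlim g F (locally b) ->
  filterlim (fun x => f x * g x) F (locally (a * b)).
Proof.
  intros Hf Hg. eapply filterlim_comp_2; [exact Hf|exact Hg|].
  apply (filterlim_mult (K := R_AbsRing) a b).
Qed.

Lemma flim_Rcomp (h : R -> R) (f : T -> R) (a : R) :
  continuous h a -> filterlim f F (locally a) ->
  filterlim (fun x => h (f x)) F (locally (h a)).
Proof. intros Hh Hf. eapply filterlim_comp; [exact Hf|exact Hh]. Qed.

Lemma flim_Rinv (f : T -> R) (a : R) :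
  a <> 0 -> filterlim f F (locally a) -> filterlim (fun x => / f x) F (locally (/ a)).
Proof.
  intros Ha Hf. apply (flim_Rcomp Rinv f a); [|assumption].
  apply continuity_pt_filterlim. apply continuity_pt_inv; [|assumption].
  apply derivable_continuous_pt, derivable_pt_id.
Qed.

Lemma flim_const {U : UniformSpace} (a : U) : filterlim (fun _ : T => a) F (locally a).
Proof. apply filterlim_const. Qed.

Lemma flim_Cplus (f g : T -> C) (a b : C) :
  filterlim f F (locally a) -> filterlim g F (locally b) ->
  filterlim (fun x => f x + g x)%C F (locally (a + b)%C).
Proof.
  rewrite !flim_C. intros [H1 H2] [H3 H4]. split; apply flim_Rplus; assumption.
Qed.

Lemma flim_Copp (f : T -> C) (a : C) :
  filterlim f F (locally a) -> filterlim (fun x => - f x)%C F (locally (- a)%C).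
Proof. rewrite !flim_C. intros [H1 H2]. split; apply flim_Ropp; assumption. Qed.

Lemma flim_Cminus (f g : T -> C) (a b : C) :
  filterlim f F (locally a) -> filterlim g F (locally b) ->
  filterlim (fun x => f x - g x)%C F (locally (a - b)%C).
Proof. intros. apply flim_Cplus; [|apply flim_Copp]; assumption. Qed.

Lemma flim_Cmult (f g : T -> C) (a b : C) :
  filterlim f F (locally a) -> filterlim g F (locally b) ->
  filterlim (fun x => f x * g x)%C F (locally (a * b)%C).
Proof.
  rewrite !flim_C. intros [H1 H2] [H3 H4]. split.
  - apply flim_Rminus; apply flim_Rmult; assumption.
  - apply flim_Rplus; apply flim_Rmult; assumption.
Qed.

Lemma flim_Cinv (f : T -> C) (a : C) : a <> 0 ->
  filterlim f F (locally a) -> filterlim (fun x => / f x)%C F (locally (/ a)%C).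
Proof.
  intros Ha. rewrite !flim_C. intros [H1 H2].
  assert (Hn : Re a ^ 2 + Im a ^ 2 <> 0).
  { intros H. apply Ha. assert (Re a = 0 /\ Im a = 0) as [E1 E2] by (split; nra).
    apply C_ext; simpl; assumption. }
  assert (Hl : filterlim (fun x => / (Re (f x) ^ 2 + Im (f x) ^ 2)) F
             (locally (/ (Re a ^ 2 + Im a ^ 2)))).
  { apply flim_Rinv; [assumption|]. simpl.
    apply flim_Rplus; (apply flim_Rmult; [|apply flim_Rmult; [|apply flim_const]]); assumption. }
  split.
  - apply flim_Rmult; assumption.
  - apply flim_Rmult; [apply flim_Ropp|]; assumption.
Qed.

Lemma flim_Cconj (f : T -> C) (a : C) :
  filterlim f F (locally a) -> filterlim (fun x => Cconj (f x)) F (locally (Cconj a)).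
Proof.
  rewrite !flim_C. intros [H1 H2]. split; [exact H1|apply flim_Ropp, H2].
Qed.

Lemma flim_RtoC (f : T -> R) (a : R) :
  filterlim f F (locally a) -> filterlim (fun x => RtoC (f x)) F (locally (RtoC a)).
Proof. intros H. apply flim_C. split; [exact H|apply flim_const]. Qed.

Lemma flim_pairC (f g : T -> R) (a b : R) :
  filterlim f F (locally a) -> filterlim g F (locally b) ->
  filterlim (fun x => (f x, g x) : C) F (locally ((a, b) : C)).
Proof. intros H1 H2. apply flim_C. split; assumption. Qed.

Lemma flim_Re (f : T -> C) (a : C) :
  filterlim f F (locally a) -> filterlim (fun x => Re (f x)) F (locally (Re a)).
Proof. rewrite flim_C. tauto. Qed.

Lemma flim_Im (f : T -> C) (a : C) :
  filterlim f F (locally a) -> filterlim (fun x => Im (f x)) F (locally (Im a)).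
Proof. rewrite flim_C. tauto. Qed.

Lemma flim_Cmod_comp (f : T -> C) (a : C) :
  filterlim f F (locally a) -> filterlim (fun x => Cmod (f x)) F (locally (Cmod a)).
Proof.
  rewrite flim_Cmod, flim_Rabs. intros H e He.
  apply filter_imp with (2 := H e He). intros x Hx.
  assert (H1 := Cmod_triangle (f x - a) a). assert (H2 := Cmod_triangle (a - f x) (f x)).
  replace (f x - a + a)%C with (f x) in H1 by ring.
  replace (a - f x + f x)%C with a in H2 by ring.
  rewrite Cmod_minus_sym in H2. apply Rabs_def1; lra.
Qed.

Lemma flim_nonzero (f : T -> C) (a : C) : a <> 0 ->
  filterlim f F (locally a) -> F (fun x => f x <> 0).
Proof.
  intros Ha H. rewrite flim_Cmod in H.
  apply filter_imp with (2 := H _ (Cmod_neq0 _ Ha)). intros x Hx E.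
  rewrite E in Hx. replace (0 - a)%C with (- a)%C in Hx by ring.
  rewrite Cmod_opp in Hx. lra.
Qed.

End FilterLimits.

Lemma flim_id {U : UniformSpace} (a : U) : filterlim (fun x => x) (locally a) (locally a).
Proof. apply filterlim_id. Qed.

(** Follows the syntax of the function. What remains are the nonvanishing of denominators and the
    limits of subterms that it cannot decompose. *)
Ltac flim :=
  try assumption;
  lazymatch goal with
  | |- filterlim (fun _ => ?a) _ (locally ?a) => apply flim_const
  | |- filterlim (fun x => x) (locally _) (locally _) => apply flim_id
  | |- filterlim (fun x => Cplus _ _) _ _ => apply flim_Cplus; flim
  | |- filterlim (fun x => Cminus _ _) _ _ => apply flim_Cminus; flim
  | |- filterlim (fun x => Copp _) _ _ => apply flim_Copp; flim
  | |- filterlim (fun x => Cmult _ _) _ _ => apply flim_Cmult; flim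
  | |- filterlim (fun x => Cinv _) _ _ => apply flim_Cinv; [|flim]
  | |- filterlim (fun x => Cdiv _ _) _ _ =>
      apply flim_Cmult; [flim|apply flim_Cinv; [|flim]]
  | |- filterlim (fun x => Cconj _) _ _ => apply flim_Cconj; flim
  | |- filterlim (fun x => RtoC _) _ _ => apply flim_RtoC; flim
  | |- filterlim RtoC _ _ => apply (flim_RtoC (fun x => x)); flim
  | |- filterlim (fun x => Rplus _ _) _ _ => apply flim_Rplus; flim
  | |- filterlim (fun x => Rminus _ _) _ _ => apply flim_Rminus; flim
  | |- filterlim (fun x => Ropp _) _ _ => apply flim_Ropp; flim
  | |- filterlim (fun x => Rmult _ _) _ _ => apply flim_Rmult; flim
  | |- filterlim (fun x => Rinv _) _ _ => apply flim_Rinv; [|flim]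
  | |- filterlim (fun x => Rdiv _ _) _ _ =>
      apply flim_Rmult; [flim|apply flim_Rinv; [|flim]]
  | |- filterlim (fun x => Re _) _ _ => apply flim_Re; flim
  | |- filterlim (fun x => Im _) _ _ => apply flim_Im; flim
  | |- filterlim (fun x => Cmod _) _ _ => apply flim_Cmod_comp; flim
  | |- _ => idtac
  end.

(* Caratheodory's form of complex differentiability. *)
Definition cderiv (f : C -> C) (s d : C) : Prop :=
  exists q : C -> C, filterlim q (locally s) (locally d) /\ q s = d /\
    locally s (fun h => f h - f s = q h * (h - s))%C.

Lemma cderiv_cont (f : C -> C) (s d : C) :
  cderiv f s d -> filterlim f (locally s) (locally (f s)).
Proof.
  intros [q [Hq [_ H]]].
  apply (filterlim_ext_loc (fun h => f s + q h * (h - s))%C).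
  - apply filter_imp with (2 := H). intros h Hh. rewrite <- Hh. ring.
  - pattern (f s) at 2; replace (f s) with (f s + d * (s - s))%C by ring. flim.
Qed.

Lemma cderiv_eq (f : C -> C) (s d d' : C) : cderiv f s d -> d = d' -> cderiv f s d'.
Proof. intros H <-. exact H. Qed.

Lemma cderiv_ext_loc (f g : C -> C) (s d : C) :
  locally s (fun h => f h = g h) -> cderiv f s d -> cderiv g s d.
Proof.
  intros He [q [Hq [Hs H]]]. exists q. split; [exact Hq|split; [exact Hs|]].
  assert (Es := locally_singleton _ _ He).
  apply filter_imp with (2 := filter_and _ _ He H). intros h [E1 E2].
  rewrite <- E1, <- Es. exact E2.
Qed.

Lemma cderiv_const (c s : C) : cderiv (fun _ => c) s 0.
Proof.
  exists (fun _ => 0%C). split; [apply flim_const|split; [reflexivity|]].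
  apply filter_forall. intros h. ring.
Qed.

Lemma cderiv_id (s : C) : cderiv (fun h => h) s 1.
Proof.
  exists (fun _ => 1%C). split; [apply flim_const|split; [reflexivity|]].
  apply filter_forall. intros h. ring.
Qed.

Lemma cderiv_plus (f g : C -> C) (s a b : C) :
  cderiv f s a -> cderiv g s b -> cderiv (fun h => f h + g h)%C s (a + b)%C.
Proof.
  intros [p [Hp [Ep Hf]]] [q [Hq [Eq Hg]]]. exists (fun h => p h + q h)%C.
  split; [flim|split; [congruence|]].
  apply filter_imp with (2 := filter_and _ _ Hf Hg). intros h [E1 E2].
  replace (f h + g h - (f s + g s))%C with ((f h - f s) + (g h - g s))%C by ring.
  rewrite E1, E2. ring.
Qed.

Lemma cderiv_mult (f g : C -> C) (s a b : C) :
  cderiv f s a -> cderiv g s b -> cderiv (fun h => f h * g h)%C s (a * g s + f s * b)%C.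
Proof.
  intros Hf0 Hg0. assert (Cg := cderiv_cont _ _ _ Hg0). revert Hf0 Hg0.
  intros [p [Hp [Ep Hf]]] [q [Hq [Eq Hg]]]. exists (fun h => p h * g h + f s * q h)%C.
  split; [flim|split; [congruence|]].
  apply filter_imp with (2 := filter_and _ _ Hf Hg). intros h [E1 E2].
  replace (f h * g h - (f s * g s))%C with ((f h - f s) * g h + f s * (g h - g s))%C by ring.
  rewrite E1, E2. ring.
Qed.

Lemma cderiv_opp (f : C -> C) (s a : C) :
  cderiv f s a -> cderiv (fun h => - f h)%C s (- a)%C.
Proof.
  intros H. apply (cderiv_ext_loc (fun h => RtoC (-1) * f h)%C).
  - apply filter_forall. intros h. ring.
  - apply (cderiv_eq _ _ _ _ (cderiv_mult _ _ _ _ _ (cderiv_const (RtoC (-1)) s) H)). ring.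
Qed.

Lemma cderiv_minus (f g : C -> C) (s a b : C) :
  cderiv f s a -> cderiv g s b -> cderiv (fun h => f h - g h)%C s (a - b)%C.
Proof. intros Hf Hg. apply cderiv_plus; [exact Hf|apply cderiv_opp, Hg]. Qed.

Lemma cderiv_inv (f : C -> C) (s a : C) : f s <> 0 ->
  cderiv f s a -> cderiv (fun h => / f h)%C s (- a / (f s * f s))%C.
Proof.
  intros Hn Hf0. assert (Cf := cderiv_cont _ _ _ Hf0).
  assert (Nf := flim_nonzero _ _ Hn Cf). revert Hf0.
  intros [p [Hp [Ep Hf]]]. exists (fun h => - p h / (f h * f s))%C.
  split; [|split; [congruence|]].
  - unfold Cdiv. flim. apply Cmult_neq_0; assumption.
  - apply filter_imp with (2 := filter_and _ _ Hf Nf). intros h [E1 E2].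
    replace (/ f h - / f s)%C with (- (f h - f s) / (f h * f s))%C by (field; auto).
    rewrite E1. field. auto.
Qed.

(** The slope functions multiply, so that no case distinction for [f h = f s] arises. *)
Lemma cderiv_comp (f g : C -> C) (s a b : C) :
  cderiv f s a -> cderiv g (f s) b -> cderiv (fun h => g (f h)) s (b * a)%C.
Proof.
  intros Hf0. assert (Cf := cderiv_cont _ _ _ Hf0). revert Hf0.
  intros [p [Hp [Ep Hf]]] [q [Hq [Eq Hg]]]. exists (fun h => q (f h) * p h)%C.
  assert (H : filterlim (fun h => q (f h)) (locally s) (locally b)).
  { eapply filterlim_comp; [exact Cf|exact Hq]. }
  split; [flim|split; [congruence|]].
  apply filter_imp with (2 := filter_and _ _ Hf (Cf _ Hg)). intros h [E1 E2].
  rewrite E2, E1. ring.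
Qed.

(** [W h - W s] is [V h - V s] divided by [W h + W s], whose limit [2 * W s] is not zero. So a
    continuous square root inherits differentiability, whatever the branch. *)
Lemma cderiv_sqrt (W V : C -> C) (s d : C) :
  filterlim W (locally s) (locally (W s)) -> W s <> 0 ->
  locally s (fun h => W h * W h = V h)%C -> cderiv V s d ->
  cderiv W s (d / (2 * W s))%C.
Proof.
  intros HW Hn He [q [Hq [Eq HV]]]. assert (Es := locally_singleton _ _ He).
  assert (N2 : (W s + W s <> 0)%C).
  { intros E. apply Hn. replace (W s) with (/ RtoC 2 * (W s + W s))%C.
    - rewrite E. ring.
    - field. }
  assert (Hl : filterlim (fun h => W h + W s)%C (locally s) (locally (W s + W s)%C)) by flim.
  assert (N := flim_nonzero _ _ N2 Hl).
  replace (2 * W s)%C with (W s + W s)%C by ring.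
  exists (fun h => q h / (W h + W s))%C. split; [|split; [rewrite Eq; reflexivity|]].
  - unfold Cdiv. flim. exact N2.
  - apply filter_imp with (2 := filter_and _ _ (filter_and _ _ He HV) N).
    intros h [[E1 E2] E3].
    replace (W h - W s)%C with ((W h * W h - W s * W s) / (W h + W s))%C by (field; auto).
    rewrite E1, Es, E2. field. auto.
Qed.

Lemma cderiv_is_derive (f : C -> C) (s d : C) :
  cderiv f s d -> is_derive (K := C_AbsRing) (V := C_NormedModule) f s d.
Proof.
  intros [q [Hq [Eq H]]]. split.
  - apply (is_linear_scal_l (K := C_AbsRing) (V := C_NormedModule)).
  - intros x Hx.
    assert (x = s) as ->.
    { symmetry. apply (is_filter_lim_locally_unique (K := C_AbsRing) (V := AbsRing_NormedModule C_AbsRing)). exact Hx. }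
    intros e.
    (* [is_derive] over [C_AbsRing] refers to the neighbourhoods given by [Cmod], not to those of
       the product. *)
    apply (locally_C s).
    rewrite (flim_Cmod (F := locally s)) in Hq.
    apply filter_imp with (2 := filter_and _ _ (Hq e (cond_pos e)) H). intros h [E1 E2].
    change (Cmod (f h - f s - (h - s) * d) <= e * Cmod (h - s)).
    rewrite E2. replace (q h * (h - s) - (h - s) * d)%C with ((q h - d) * (h - s))%C by ring.
    rewrite Cmod_mult. apply Rmult_le_compat_r; [apply Cmod_ge_0|lra].
Qed.

Lemma is_derive_eps (f : R -> R) (t l : R) :
  is_derive f t l <->
  forall e, 0 < e -> locally t (fun h => Rabs (f h - f t - (h - t) * l) <= e * Rabs (h - t)).
Proof.
  split.
  - intros [_ H] e He. specialize (H t (fun P HP => HP) (mkposreal e He)). exact H.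
  - intros H. split; [apply is_linear_scal_l|]. intros x Hx.
    assert (x = t) as ->.
    { symmetry. apply (is_filter_lim_locally_unique (K := R_AbsRing) (V := R_NormedModule)). exact Hx. }
    intros e. exact (H e (cond_pos e)).
Qed.

(** The analogue of [cderiv] for curves. It is equivalent to the derivative in [C_R_NormedModule]
    that defines arcs ([rderiv_is_derive]). *)
Definition rderiv (c : R -> C) (t : R) (d : C) : Prop :=
  exists q : R -> C, filterlim q (locally t) (locally d) /\ q t = d /\
    locally t (fun h => c h - c t = q h * RtoC (h - t))%C.

Lemma rderiv_cont (c : R -> C) (t : R) (d : C) :
  rderiv c t d -> filterlim c (locally t) (locally (c t)).
Proof.
  intros [q [Hq [_ H]]].
  apply (filterlim_ext_loc (fun h => c t + q h * RtoC (h - t))%C).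
  - apply filter_imp with (2 := H). intros h Hh. rewrite <- Hh. ring.
  - pattern (c t) at 2. replace (c t) with (c t + d * RtoC (t - t))%C.
    + flim.
    + replace (t - t) with 0 by ring. ring.
Qed.

Lemma is_derive_cara (f : R -> R) (t l : R) :
  is_derive f t l <->
  exists q : R -> R, filterlim q (locally t) (locally l) /\ q t = l /\
    forall h, f h - f t = q h * (h - t).
Proof.
  rewrite is_derive_eps. split.
  - intros H. exists (fun h => if Req_EM_T h t then l else (f h - f t) / (h - t)).
    split; [|split].
    + apply flim_Rabs. intros e He. assert (He2 : 0 < e / 2) by lra.
      apply filter_imp with (2 := H _ He2). intros h Hh.
      destruct (Req_EM_T h t) as [E|E].
      * replace (l - l) with 0 by ring. rewrite Rabs_R0. exact He.
      * assert (Hp : 0 < Rabs (h - t)) by (apply Rabs_pos_lt; lra).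
        assert (Hlt : Rabs ((f h - f t) / (h - t) - l) * Rabs (h - t) <= e / 2 * Rabs (h - t)).
        { rewrite <- Rabs_mult. replace (((f h - f t) / (h - t) - l) * (h - t)) with (f h - f t - (h - t) * l)
            by (field; lra). exact Hh. }
        apply Rmult_le_reg_r in Hlt; lra.
    + destruct (Req_EM_T t t); [reflexivity|lra].
    + intros h. destruct (Req_EM_T h t) as [->|E]; [ring|field; lra].
  - intros [q [Hq [Eq H]]] e He. rewrite (flim_Rabs (F := locally t)) in Hq.
    apply filter_imp with (2 := Hq e He). intros h Hh. rewrite H.
    replace (q h * (h - t) - (h - t) * l) with ((q h - l) * (h - t)) by ring.
    rewrite Rabs_mult. apply Rmult_le_compat_r; [apply Rabs_pos|lra].
Qed.

Lemma rderiv_parts (c : R -> C) (t : R) (d : C) :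
  rderiv c t d <->
  is_derive (fun s => Re (c s)) t (Re d) /\ is_derive (fun s => Im (c s)) t (Im d).
Proof.
  split.
  - intros [q [Hq [Eq H]]].
    split; apply is_derive_eps; intros e He; rewrite (flim_Cmod (F := locally t)) in Hq;
      apply filter_imp with (2 := filter_and _ _ (Hq e He) H); intros h [E1 E2].
    + replace (Re (c h) - Re (c t) - (h - t) * Re d) with (Re ((q h - d) * RtoC (h - t))%C).
      * apply Rle_trans with (1 := Re_le _). rewrite Cmod_mult, Cmod_R.
        apply Rmult_le_compat_r; [apply Rabs_pos|lra].
      * change (Re (c h) - Re (c t)) with (Re (c h - c t)%C). rewrite E2. unfold Re, Im; simpl; ring.
    + replace (Im (c h) - Im (c t) - (h - t) * Im d) with (Im ((q h - d) * RtoC (h - t))%C).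
      * apply Rle_trans with (1 := Im_le _). rewrite Cmod_mult, Cmod_R.
        apply Rmult_le_compat_r; [apply Rabs_pos|lra].
      * change (Im (c h) - Im (c t)) with (Im (c h - c t)%C). rewrite E2. unfold Re, Im; simpl; ring.
  - rewrite !is_derive_cara. intros [[p [Hp [Ep H1]]] [q [Hq [Eq H2]]]].
    exists (fun h => (p h, q h)). split; [|split].
    + apply (flim_C (F := locally t)). split; assumption.
    + apply C_ext; assumption.
    + apply filter_forall. intros h. apply C_ext; simpl.
      * transitivity (Re (c h) - Re (c t)); [reflexivity|]. rewrite (H1 h). unfold Re, Im; simpl; ring.
      * transitivity (Im (c h) - Im (c t)); [reflexivity|]. rewrite (H2 h). unfold Re, Im; simpl; ring.
Qed.

Lemma rderiv_is_derive (c : R -> C) (t : R) (d : C) :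
  rderiv c t d <-> is_derive (K := R_AbsRing) (V := C_R_NormedModule) c t d.
Proof.
  split.
  - rewrite rderiv_parts, !is_derive_eps. intros [H1 H2]. split; [apply is_linear_scal_l|].
    intros x Hx.
    assert (x = t) as ->.
    { symmetry. apply (is_filter_lim_locally_unique (K := R_AbsRing) (V := R_NormedModule)). exact Hx. }
    intros e. assert (He : 0 < e / 2) by (assert (H := cond_pos e); lra).
    apply filter_imp with (2 := filter_and _ _ (H1 _ He) (H2 _ He)). intros h [E1 E2].
    change (sqrt ((Rabs (Re (c h) - Re (c t) - (h - t) * Re d)) ^ 2 +
                  (Rabs (Im (c h) - Im (c t) - (h - t) * Im d)) ^ 2) <= e * Rabs (h - t)).
    set (A := Rabs (Re (c h) - _ - _)) in *. set (B := Rabs (Im (c h) - _ - _)) in *.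
    assert (0 <= A) by apply Rabs_pos. assert (0 <= B) by apply Rabs_pos.
    assert (0 <= Rabs (h - t)) by apply Rabs_pos.
    apply Rle_trans with (A + B); [|lra].
    rewrite <- (sqrt_pow2 (A + B)) by lra. apply sqrt_le_1_alt. nra.
  - intros [_ H]. rewrite rderiv_parts, !is_derive_eps.
    split; intros e He; specialize (H t (fun P HP => HP) (mkposreal e He));
      apply filter_imp with (2 := H); intros h Hh;
      change (sqrt ((Rabs (Re (c h) - Re (c t) - (h - t) * Re d)) ^ 2 +
                  (Rabs (Im (c h) - Im (c t) - (h - t) * Im d)) ^ 2) <= e * Rabs (h - t)) in Hh;
      apply Rle_trans with (2 := Hh);
      [set (A := Rabs (Re (c h) - _ - _)) in * | set (A := Rabs (Im (c h) - _ - _)) in *];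
      assert (0 <= A) by apply Rabs_pos; rewrite <- (sqrt_pow2 A) at 1 by assumption;
      apply sqrt_le_1_alt;
      [assert (H1 := pow2_ge_0 (Rabs (Im (c h) - Im (c t) - (h - t) * Im d)))
      |assert (H1 := pow2_ge_0 (Rabs (Re (c h) - Re (c t) - (h - t) * Re d)))]; lra.
Qed.

Lemma rderiv_comp (c : R -> C) (f : C -> C) (t : R) (d b : C) :
  rderiv c t d -> cderiv f (c t) b -> rderiv (fun s => f (c s)) t (b * d)%C.
Proof.
  intros Hc0. assert (Cc := rderiv_cont _ _ _ Hc0). revert Hc0.
  intros [p [Hp [Ep Hc]]] [q [Hq [Eq Hf]]]. exists (fun h => q (c h) * p h)%C.
  assert (H : filterlim (fun h => q (c h)) (locally t) (locally b)).
  { eapply filterlim_comp; [exact Cc|exact Hq]. }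
  split; [flim|split; [congruence|]].
  apply filter_imp with (2 := filter_and _ _ Hc (Cc _ Hf)). intros h [E1 E2].
  rewrite E2, E1. ring.
Qed.

(* On the negative reals the value is on the negative imaginary axis, so that
   [csqrt] is continuous on the closed lower half plane. *)
Definition csqrt (c : C) : C :=
  (sqrt ((Cmod c + Re c) / 2),
   (if Rlt_dec 0 (Im c) then 1 else -1) * sqrt ((Cmod c - Re c) / 2)).

Lemma csqrt_sqr (c : C) : (csqrt c * csqrt c)%C = c.
Proof.
  assert (H := Re_le c). apply Rabs_le_between in H.
  assert (Hs := Cmod_sqr c).
  assert (H1 : 0 <= (Cmod c + Re c) / 2) by lra.
  assert (H2 : 0 <= (Cmod c - Re c) / 2) by lra.
  assert (Hp : sqrt ((Cmod c + Re c) / 2) * sqrt ((Cmod c - Re c) / 2) = Rabs (Im c) / 2).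
  { rewrite <- sqrt_mult by assumption.
    replace ((Cmod c + Re c) / 2 * ((Cmod c - Re c) / 2)) with ((Im c / 2) ^ 2) by nra.
    rewrite <- Rsqr_pow2. rewrite sqrt_Rsqr_abs. unfold Rdiv. rewrite Rabs_mult.
    rewrite (Rabs_right (/ 2)) by lra. reflexivity. }
  assert (S1 := sqrt_sqrt _ H1). assert (S2 := sqrt_sqrt _ H2).
  set (A := sqrt ((Cmod c + Re c) / 2)) in *. set (B := sqrt ((Cmod c - Re c) / 2)) in *.
  unfold csqrt. fold A B. destruct (Rlt_dec 0 (Im c)) as [Hi|Hi]; apply C_ext; simpl.
  - nra.
  - rewrite Rabs_right in Hp by lra. nra.
  - nra.
  - rewrite Rabs_left1 in Hp by lra. nra.
Qed.

Lemma csqrt_Re (c : C) : 0 <= Re (csqrt c).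
Proof. apply sqrt_pos. Qed.

Lemma csqrt_Im (c : C) : Im c <= 0 -> Im (csqrt c) <= 0.
Proof.
  intros H. simpl. destruct (Rlt_dec 0 (Im c)); [lra|].
  assert (H1 := sqrt_pos ((Cmod c - Re c) / 2)). lra.
Qed.

Lemma csqrt_Re_pos (c : C) : 0 < Re c -> 0 < Re (csqrt c).
Proof.
  intros H. apply sqrt_lt_R0. assert (H1 := Cmod_ge_0 c). lra.
Qed.

Lemma Re_sqr (s : C) : Re (s * s)%C = Re s * Re s - Im s * Im s.
Proof. reflexivity. Qed.

Lemma Im_sqr (s : C) : Im (s * s)%C = 2 * (Re s * Im s).
Proof. unfold Re, Im; simpl. ring. Qed.

(** In a common closed quadrant the cross terms [Re s * Re t] and [Im s * Im t] are nonnegative, so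
    [|s + t| >= |t|]. This yields continuity of the square root up to the imaginary axis. *)
Lemma quadrant_sqrt_lip (s t : C) :
  0 <= Re s * Re t -> 0 <= Im s * Im t ->
  Cmod (s - t) * Cmod t <= Cmod (s * s - t * t).
Proof.
  intros H1 H2. replace (s * s - t * t)%C with ((s - t) * (s + t))%C by ring.
  rewrite Cmod_mult. apply Rmult_le_compat_l; [apply Cmod_ge_0|].
  apply Rsqr_incr_0; [|apply Cmod_ge_0|apply Cmod_ge_0]. unfold Rsqr.
  rewrite !Cmod_sqr. destruct s as [a b], t as [c d]. unfold Re, Im in *; simpl in *. nra.
Qed.

(** Here [|s + t| >= Re t], which suffices in the open right half plane and asks nothing of the
    imaginary parts. *)
Lemma halfplane_sqrt_lip (s t : C) :
  0 <= Re s -> 0 <= Re t -> Cmod (s - t) * Re t <= Cmod (s * s - t * t).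
Proof.
  intros H1 H2. replace (s * s - t * t)%C with ((s - t) * (s + t))%C by ring.
  rewrite Cmod_mult. apply Rmult_le_compat_l; [apply Cmod_ge_0|].
  assert (H := Re_le (s + t)%C).
  change (Re (s + t)%C) with (Re s + Re t) in H.
  assert (H0 := Rle_abs (Re s + Re t)). lra.
Qed.

Lemma csqrt_flim {T : Type} {F : (T -> Prop) -> Prop} {FF : Filter F}
  (f : T -> C) (c : C) :
  0 < Re (csqrt c) -> filterlim f F (locally c) ->
  filterlim (fun x => csqrt (f x)) F (locally (csqrt c)).
Proof.
  intros Hp. rewrite !flim_Cmod. intros H e He.
  assert (He' : 0 < e * Re (csqrt c)) by (apply Rmult_lt_0_compat; assumption).
  apply filter_imp with (2 := H _ He'). intros x Hx.
  assert (L := halfplane_sqrt_lip (csqrt (f x)) (csqrt c) (csqrt_Re _) (csqrt_Re _)).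
  rewrite !csqrt_sqr in L. apply Rmult_lt_reg_r with (Re (csqrt c)); lra.
Qed.

Lemma csqrt_flim_lower {T : Type} {F : (T -> Prop) -> Prop} {FF : Filter F}
  (f : T -> C) (c : C) :
  c <> 0%C -> Im c <= 0 -> F (fun x => Im (f x) <= 0) -> filterlim f F (locally c) ->
  filterlim (fun x => csqrt (f x)) F (locally (csqrt c)).
Proof.
  intros Hc Hi HF. rewrite !flim_Cmod. intros H e He.
  assert (Hp : 0 < Cmod (csqrt c)).
  { apply Cmod_neq0. intros E. apply Hc. rewrite <- (csqrt_sqr c), E. ring. }
  assert (He' : 0 < e * Cmod (csqrt c)) by (apply Rmult_lt_0_compat; assumption).
  apply filter_imp with (2 := filter_and _ _ HF (H _ He')). intros x [Hx1 Hx].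
  assert (L := quadrant_sqrt_lip (csqrt (f x)) (csqrt c)).
  rewrite !csqrt_sqr in L.
  assert (A1 := csqrt_Re (f x)). assert (A2 := csqrt_Re c).
  assert (A3 := csqrt_Im _ Hx1). assert (A4 := csqrt_Im _ Hi).
  specialize (L ltac:(nra) ltac:(nra)).
  apply Rmult_lt_reg_r with (Cmod (csqrt c)); lra.
Qed.

(** * Holomorphic functions with continuous derivative *)

(** Continuity of the derivative is part of the notion because [prim_dx] differentiates under the
    integral sign; deducing it from differentiability alone would take Cauchy's theory. *)
Definition hol_at (f : C -> C) (s : C) : Prop :=
  exists f' : C -> C, filterlim f' (locally s) (locally (f' s)) /\
    locally s (fun h => cderiv f h (f' h)).

Lemma hol_cderiv (f : C -> C) (s : C) : hol_at f s -> exists d, cderiv f s d.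
Proof. intros [f' [_ H]]. exists (f' s). exact (locally_singleton _ _ H). Qed.

Lemma hol_cont (f : C -> C) (s : C) : hol_at f s -> filterlim f (locally s) (locally (f s)).
Proof. intros H. destruct (hol_cderiv _ _ H) as [d Hd]. exact (cderiv_cont _ _ _ Hd). Qed.

Lemma hol_const (c s : C) : hol_at (fun _ => c) s.
Proof.
  exists (fun _ => 0%C). split; [apply flim_const|]. apply filter_forall. intros; apply cderiv_const.
Qed.

Lemma hol_id (s : C) : hol_at (fun h => h) s.
Proof.
  exists (fun _ => 1%C). split; [apply flim_const|]. apply filter_forall. intros; apply cderiv_id.
Qed.

Lemma hol_plus (f g : C -> C) (s : C) :
  hol_at f s -> hol_at g s -> hol_at (fun h => f h + g h)%C s.
Proof.
  intros [f' [Cf Hf]] [g' [Cg Hg]]. exists (fun h => f' h + g' h)%C. split; [flim|].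
  apply filter_imp with (2 := filter_and _ _ Hf Hg). intros h [E1 E2]. apply cderiv_plus; assumption.
Qed.

Lemma hol_mult (f g : C -> C) (s : C) :
  hol_at f s -> hol_at g s -> hol_at (fun h => f h * g h)%C s.
Proof.
  intros Hf0 Hg0. assert (Cf0 := hol_cont _ _ Hf0). assert (Cg0 := hol_cont _ _ Hg0).
  destruct Hf0 as [f' [Cf Hf]], Hg0 as [g' [Cg Hg]].
  exists (fun h => f' h * g h + f h * g' h)%C. split; [flim|].
  apply filter_imp with (2 := filter_and _ _ Hf Hg). intros h [E1 E2]. apply cderiv_mult; assumption.
Qed.

Lemma hol_inv (f : C -> C) (s : C) : f s <> 0%C -> hol_at f s -> hol_at (fun h => / f h)%C s.
Proof.
  intros Hn Hf0. assert (Cf0 := hol_cont _ _ Hf0). assert (N := flim_nonzero _ _ Hn Cf0).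
  destruct Hf0 as [f' [Cf Hf]].
  exists (fun h => - f' h / (f h * f h))%C. split.
  - unfold Cdiv. flim. apply Cmult_neq_0; assumption.
  - apply filter_imp with (2 := filter_and _ _ Hf N). intros h [E1 E2]. apply cderiv_inv; assumption.
Qed.

Lemma hol_comp (f g : C -> C) (s : C) : hol_at f s -> hol_at g (f s) -> hol_at (fun h => g (f h)) s.
Proof.
  intros Hf0 Hg0. assert (Cf0 := hol_cont _ _ Hf0).
  destruct Hf0 as [f' [Cf Hf]], Hg0 as [g' [Cg Hg]].
  exists (fun h => g' (f h) * f' h)%C. split.
  - assert (H : filterlim (fun h => g' (f h)) (locally s) (locally (g' (f s)))).
    { eapply filterlim_comp; [exact Cf0|exact Cg]. }
    flim.
  - apply filter_imp with (2 := filter_and _ _ Hf (Cf0 _ Hg)). intros h [E1 E2].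
    apply cderiv_comp; assumption.
Qed.

Lemma RtoC_neq (x : R) : x <> 0 -> RtoC x <> 0%C.
Proof. intros H E. apply H. injection E. auto. Qed.

Lemma hol_sqrt (W V : C -> C) (s : C) :
  locally s (fun h => filterlim W (locally h) (locally (W h))) -> W s <> 0%C ->
  locally s (fun h => W h * W h = V h)%C -> hol_at V s -> hol_at W s.
Proof.
  intros HW Hn He [V' [CV HV]]. assert (CW := locally_singleton _ _ HW).
  assert (N := flim_nonzero _ _ Hn CW).
  exists (fun h => V' h / (2 * W h))%C. split.
  - unfold Cdiv. flim. apply Cmult_neq_0; [apply RtoC_neq; lra|assumption].
  - apply filter_imp with (2 := filter_and _ _ (filter_and _ _ HW (locally_locally _ _ He)) (filter_and _ _ HV N)).
    intros h [[E1 E2] [E3 E4]]. apply (cderiv_sqrt W V); assumption.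
Qed.

Lemma rderiv_eq (c : R -> C) (t : R) (d d' : C) : rderiv c t d -> d = d' -> rderiv c t d'.
Proof. intros H <-. exact H. Qed.

Lemma is_derive_eq (f : R -> R) (t l l' : R) : is_derive f t l -> l = l' -> is_derive f t l'.
Proof. intros H <-. exact H. Qed.

Lemma rderiv_pair (f g : R -> R) (t a b : R) :
  is_derive f t a -> is_derive g t b -> rderiv (fun s => (f s, g s)) t (a, b).
Proof. intros Hf Hg. apply rderiv_parts. split; assumption. Qed.

Lemma is_derive_const_R (a t : R) : is_derive (fun _ => a) t 0.
Proof. apply (is_derive_const (K := R_AbsRing) (V := R_NormedModule)). Qed.

Lemma is_derive_id_R (t : R) : is_derive (fun s => s) t 1.
Proof. apply (is_derive_id (K := R_AbsRing)). Qed.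

(** These are the Cauchy-Riemann equations. *)
Lemma cderiv_partials (f : C -> C) (x y : R) (d : C) :
  cderiv f (x, y) d ->
  rderiv (fun s => f (s, y)) x d /\ rderiv (fun s => f (x, s)) y (Ci * d)%C.
Proof.
  intros H. split.
  - apply (rderiv_eq _ _ (d * (1, 0))%C).
    + apply (rderiv_comp (fun s => (s, y)) f); [|exact H].
      apply rderiv_pair; [apply is_derive_id_R|apply is_derive_const_R].
    + change ((1, 0) : C) with (RtoC 1). ring.
  - apply (rderiv_eq _ _ (d * (0, 1))%C).
    + apply (rderiv_comp (fun s => (x, s)) f); [|exact H].
      apply rderiv_pair; [apply is_derive_const_R|apply is_derive_id_R].
    + change ((0, 1) : C) with Ci. ring.
Qed.

(** * Primitives on the upper half plane and their boundary values *)

Lemma is_derive_continuity_pt (f : R -> R) (x l : R) : is_derive f x l -> continuity_pt f x.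
Proof.
  intros H. apply derivable_continuous_pt. exists l. apply is_derive_Reals, H.
Qed.

Lemma mvt_closed (f df : R -> R) (a b : R) : a <= b ->
  (forall x, a <= x <= b -> is_derive f x (df x)) ->
  exists c, a <= c <= b /\ f b - f a = df c * (b - a).
Proof.
  intros Hab H. destruct (MVT_gen f a b df) as [c [Hc E]].
  - rewrite Rmin_left, Rmax_right by assumption. intros x Hx. apply H. lra.
  - rewrite Rmin_left, Rmax_right by assumption. intros x Hx.
    apply (is_derive_continuity_pt _ _ (df x)). apply H. lra.
  - rewrite Rmin_left, Rmax_right in Hc by assumption. exists c. split; assumption.
Qed.

Lemma deriv_bound (f df : R -> R) (a b M : R) :
  (forall x, Rmin a b <= x <= Rmax a b -> is_derive f x (df x) /\ Rabs (df x) <= M) ->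
  Rabs (f b - f a) <= M * Rabs (b - a).
Proof.
  intros H. destruct (MVT_gen f a b df) as [c [Hc E]].
  - intros x Hx. apply H. lra.
  - intros x Hx. apply (is_derive_continuity_pt _ _ (df x)). apply H. lra.
  - rewrite E, Rabs_mult. apply Rmult_le_compat_r; [apply Rabs_pos|]. apply H. exact Hc.
Qed.

Lemma between_close (a b c x d : R) :
  Rabs (a - c) < d -> Rabs (b - c) < d -> Rmin a b <= x <= Rmax a b -> Rabs (x - c) < d.
Proof.
  intros Ha Hb [H1 H2]. apply Rabs_def2 in Ha. apply Rabs_def2 in Hb. revert H1 H2.
  apply Rmin_case; apply Rmax_case; intros; apply Rabs_def1; lra.
Qed.

Lemma is_derive_RInt_upper (g : R -> R) (a b : R) :
  locally b (fun z => ex_RInt g a z) -> continuous g b ->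
  is_derive (fun z => RInt g a z) b (g b).
Proof.
  intros H Hg. apply (is_derive_RInt g (fun z => RInt g a z) a b); [|exact Hg].
  apply filter_imp with (2 := H). intros z Hz. apply (RInt_correct (V := R_CompleteNormedModule) g a z Hz).
Qed.

Lemma Rmin_pos2 (a b x : R) : 0 < a -> 0 < b -> Rmin a b <= x -> 0 < x.
Proof. intros Ha Hb Hx. assert (H := Rmin_glb_lt a b 0 Ha Hb). lra. Qed.

Section Primitive.

Variable f : C -> C.
Hypothesis Hf : forall z : C, 0 < Im z -> hol_at f z.

Lemma hol_C_derive (s : C) : hol_at f s ->
  cderiv f s (C_derive f s) /\ filterlim (C_derive f) (locally s) (locally (C_derive f s)).
Proof.
  intros [f' [H1 H2]].
  assert (H3 : locally s (fun h => f' h = C_derive f h)).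
  { apply filter_imp with (2 := H2). intros h Hh. symmetry.
    apply is_C_derive_unique, cderiv_is_derive, Hh. }
  assert (E := locally_singleton _ _ H3). split.
  - rewrite <- E. exact (locally_singleton _ _ H2).
  - rewrite <- E. apply (filterlim_ext_loc f'); assumption.
Qed.

Lemma pair_flim_x (x y : R) : filterlim (fun s => (s, y) : C) (locally x) (locally ((x, y) : C)).
Proof. apply flim_pairC; [apply flim_id|apply flim_const]. Qed.

Lemma pair_flim_y (x y : R) : filterlim (fun s => (x, s) : C) (locally y) (locally ((x, y) : C)).
Proof. apply flim_pairC; [apply flim_const|apply flim_id]. Qed.

(** The real part of the integral of [f] along the path from [Ci] to [z] that first runs
    horizontally at height 1 and then vertically. *)
Definition prim (z : C) : R :=
  RInt (fun s => Re (f (s, 1))) 0 (Re z) - RInt (fun t => Im (f (Re z, t))) 1 (Im z).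

Lemma cont_Im_y (x y : R) : 0 < y -> continuous (fun t => Im (f (x, t))) y.
Proof.
  intros Hy. apply flim_Im. eapply filterlim_comp; [apply pair_flim_y|].
  apply hol_cont, Hf, Hy.
Qed.

Lemma prim_dy (x y : R) : 0 < y -> is_derive (fun s => prim (x, s)) y (- Im (f (x, y))).
Proof.
  intros Hy. unfold prim; simpl.
  apply (is_derive_eq _ _ (0 - Im (f (x, y)))); [|ring].
  apply (is_derive_minus (K := R_AbsRing) (V := R_NormedModule)); [apply is_derive_const_R|].
  apply (is_derive_RInt_upper (fun t => Im (f (x, t)))).
  - apply locally_Rabs. exists y. split; [exact Hy|]. intros z Hz.
    apply (ex_RInt_continuous (V := R_CompleteNormedModule)). intros t Ht.
    apply cont_Im_y. apply Rabs_def2 in Hz. apply (Rmin_pos2 1 z); lra.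
  - apply cont_Im_y, Hy.
Qed.

(** By the Cauchy-Riemann equations the [x]-derivative of [Im f] is minus the [t]-derivative of
    [Re f]. Differentiating the vertical integral therefore gives [Re (f (x, 1)) - Re (f (x, y))],
    and the first term cancels against the horizontal part. *)
Lemma prim_dx (x y : R) : 0 < y -> is_derive (fun s => prim (s, y)) x (Re (f (x, y))).
Proof.
  intros Hy. unfold prim; simpl.
  assert (Hpos : forall t, Rmin 1 y <= t <= Rmax 1 y -> 0 < t) by (intros t Ht; apply (Rmin_pos2 1 y); lra).
  assert (Dx : forall u t, 0 < t -> is_derive (fun z => Im (f (z, t))) u (Im (C_derive f (u, t)))).
  { intros u t Ht. destruct (hol_C_derive (u, t) (Hf (u, t) Ht)) as [H _].
    apply cderiv_partials in H. destruct H as [H _]. apply rderiv_parts in H. apply H. }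
  assert (Dy : forall u t, 0 < t -> is_derive (fun z => Re (f (u, z))) t (- Im (C_derive f (u, t)))).
  { intros u t Ht. destruct (hol_C_derive (u, t) (Hf (u, t) Ht)) as [H _].
    apply cderiv_partials in H. destruct H as [_ H]. apply rderiv_parts in H.
    apply (is_derive_eq _ _ _ _ (proj1 H)). unfold Re, Im; simpl. ring. }
  apply (is_derive_eq _ _ (Re (f (x, 1)) - (Re (f (x, 1)) - Re (f (x, y))))); [|ring].
  apply (is_derive_minus (K := R_AbsRing) (V := R_NormedModule)).
  - apply (is_derive_RInt_upper (fun s => Re (f (s, 1)))).
    + apply filter_forall. intros z.
      apply (ex_RInt_continuous (V := R_CompleteNormedModule)). intros t Ht.
      apply flim_Re. eapply filterlim_comp; [apply pair_flim_x|]. apply hol_cont, Hf. simpl; lra.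
    + apply flim_Re. eapply filterlim_comp; [apply pair_flim_x|]. apply hol_cont, Hf. simpl; lra.
  - apply (is_derive_eq _ _ (RInt (fun t => Derive (fun u => Im (f (u, t))) x) 1 y)).
    + apply (is_derive_RInt_param (fun u t => Im (f (u, t)))).
      * apply filter_forall. intros u t Ht. exists (Im (C_derive f (u, t))). apply Dx, Hpos, Ht.
      * intros t Ht. apply Hpos in Ht.
        apply (continuity_2d_pt_ext_loc (fun u v => Im (C_derive f (u, v)))).
        -- exists (mkposreal t Ht). intros u v Hu Hv. symmetry. apply is_derive_unique, Dx.
           simpl in Hv. apply Rabs_def2 in Hv. lra.
        -- apply continuity_2d_pt_filterlim.
           apply (filterlim_ext (fun z : C => Im (C_derive f z))).
           { intros [a b]. reflexivity. }
           apply (flim_Im (F := locally ((x, t) : C))). apply hol_C_derive, Hf, Ht.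
      * apply filter_forall. intros u. apply (ex_RInt_continuous (V := R_CompleteNormedModule)).
        intros t Ht. apply cont_Im_y, Hpos, Ht.
    + apply is_RInt_unique.
      apply (is_RInt_ext (fun t => Im (C_derive f (x, t)))).
      * intros t Ht. symmetry. apply is_derive_unique, Dx, Hpos. lra.
      * replace (Re (f (x, 1)) - Re (f (x, y))) with
          (minus (- Re (f (x, y))) (- Re (f (x, 1)))) by (unfold minus, plus, opp; simpl; ring).
        apply (is_RInt_derive (V := R_CompleteNormedModule) (fun t => - Re (f (x, t)))).
        -- intros t Ht. apply (is_derive_eq _ _ (- - Im (C_derive f (x, t)))); [|ring].
           apply (is_derive_opp (K := R_AbsRing) (V := R_NormedModule)). apply Dy, Hpos, Ht.
        -- intros t Ht. apply flim_Im. eapply filterlim_comp; [apply pair_flim_y|].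
           apply hol_C_derive, Hf. apply Hpos, Ht.
Qed.

(** The primitive is compared along the path from [z'] to [z] with the corner [(x, y')]. Each leg is
    at most [Cmod (z - z')] long, hence the factor 2, and the halved radius keeps both legs within
    distance [d] of [z0]. The centre may be real, where [f] is not controlled. *)
Lemma lpath_bound (z0 f0 : C) (d e : R) :
  (forall z, 0 < Im z -> Cmod (z - z0) < d -> Cmod (f z - f0) <= e) ->
  forall z z', 0 < Im z -> 0 < Im z' -> Cmod (z - z0) < d / 2 -> Cmod (z' - z0) < d / 2 ->
  Rabs (prim z - prim z' - Re (f0 * (z - z'))%C) <= 2 * e * Cmod (z - z').
Proof.
  intros H [x y] [x' y'] Hy Hy' Hz Hz'. simpl in Hy, Hy'.
  assert (X1 := Rle_lt_trans _ _ _ (Re_le _) Hz). assert (Y1 := Rle_lt_trans _ _ _ (Im_le _) Hz).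
  assert (X2 := Rle_lt_trans _ _ _ (Re_le _) Hz'). assert (Y2 := Rle_lt_trans _ _ _ (Im_le _) Hz').
  change (Rabs (x - Re z0) < d / 2) in X1. change (Rabs (y - Im z0) < d / 2) in Y1.
  change (Rabs (x' - Re z0) < d / 2) in X2. change (Rabs (y' - Im z0) < d / 2) in Y2.
  assert (Hb : forall a b, 0 < b -> Rabs (a - Re z0) < d / 2 -> Rabs (b - Im z0) < d / 2 ->
     Cmod (f (a, b) - f0) <= e).
  { intros a b Hb Ha1 Hb1. apply H; [exact Hb|].
    apply Rle_lt_trans with (1 := Cmod_le_abs _).
    change (Rabs (a - Re z0) + Rabs (b - Im z0) < d). lra. }
  assert (B1 := deriv_bound (fun s => prim (s, y') - Re f0 * s) (fun s => Re (f (s, y')) - Re f0 * 1) x' x e).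
  assert (B2 := deriv_bound (fun s => prim (x, s) + Im f0 * s) (fun s => - Im (f (x, s)) + Im f0 * 1) y' y e).
  assert (Q1 := Re_le ((x, y) - (x', y'))%C). assert (Q2 := Im_le ((x, y) - (x', y'))%C).
  change (Rabs (x - x') <= Cmod ((x, y) - (x', y'))%C) in Q1.
  change (Rabs (y - y') <= Cmod ((x, y) - (x', y'))%C) in Q2.
  assert (He : 0 <= e). { apply Rle_trans with (2 := Hb x y Hy X1 Y1). apply Cmod_ge_0. }
  replace (prim (x, y) - prim (x', y') - Re (f0 * ((x, y) - (x', y')))%C) with
    ((prim (x, y') - Re f0 * x - (prim (x', y') - Re f0 * x')) +
     (prim (x, y) + Im f0 * y - (prim (x, y') + Im f0 * y'))) by (unfold Re, Im; simpl; ring).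
  apply Rle_trans with (1 := Rabs_triang _ _).
  apply Rle_trans with (e * Rabs (x - x') + e * Rabs (y - y')).
  - apply Rplus_le_compat.
    + apply B1. intros s Hs. split.
      * apply (is_derive_minus (K := R_AbsRing) (V := R_NormedModule)); [apply prim_dx, Hy'|].
        apply is_derive_scal, is_derive_id_R.
      * rewrite Rmult_1_r. apply Rle_trans with (2 := Hb s y' Hy' (between_close _ _ _ _ _ X2 X1 Hs) Y2).
        apply (Re_le (f (s, y') - f0)%C).
    + apply B2. intros s Hs. assert (Hs0 : 0 < s) by (apply (Rmin_pos2 y' y); lra). split.
      * apply (is_derive_plus (K := R_AbsRing) (V := R_NormedModule)); [apply prim_dy, Hs0|].
        apply is_derive_scal, is_derive_id_R.
      * rewrite Rmult_1_r. apply Rle_trans with (2 := Hb x s Hs0 X1 (between_close _ _ _ _ _ Y2 Y1 Hs)).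
        replace (- Im (f (x, s)) + Im f0) with (- Im (f (x, s) - f0)%C) by (unfold Im; simpl; ring).
        rewrite Rabs_Ropp. apply Im_le.
  - nra.
Qed.

(** The growth of the forms at a branch point. The point 0 is left out because it is an end of the
    surface. *)
Hypothesis Hb : forall x0 : R, x0 <> 0 -> exists r K, 0 < r /\ 0 <= K /\
  forall z, 0 < Im z -> Cmod (z - RtoC x0) < r -> Cmod (f z) <= K / sqrt (Im z).

(** [2 * K * sqrt s] has derivative [K / sqrt s], so adding it to [prim] or to its opposite gives a
    nondecreasing function of the height. *)
Lemma prim_vertical (x K y y' : R) : 0 < y <= y' ->
  (forall s, 0 < s <= y' -> Cmod (f (x, s)) <= K / sqrt s) ->
  Rabs (prim (x, y') - prim (x, y)) <= 2 * K * (sqrt y' - sqrt y).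
Proof.
  intros Hy H.
  assert (D : forall k s, y <= s <= y' -> is_derive (fun s : R => k * prim (x, s) + 2 * K * sqrt s) s
     (k * - Im (f (x, s)) + 2 * K * (1 / (2 * sqrt s)))).
  { intros k s Hs. apply (is_derive_plus (K := R_AbsRing) (V := R_NormedModule)).
    - apply is_derive_scal, prim_dy. lra.
    - apply is_derive_scal. apply (is_derive_sqrt (fun s => s)); [apply is_derive_id_R|lra]. }
  assert (M : forall k, k = 1 \/ k = -1 -> k * prim (x, y) + 2 * K * sqrt y <= k * prim (x, y') + 2 * K * sqrt y').
  { intros k Hk. destruct (mvt_closed _ _ y y' (proj2 Hy) (D k)) as [c [Hc E]]. cbv beta in E.
    assert (H0 : 0 <= (k * - Im (f (x, c)) + 2 * K * (1 / (2 * sqrt c))) * (y' - y)); [|rewrite <- E in H0; lra].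
    apply Rmult_le_pos; [|lra].
    assert (Hc0 : 0 < c <= y') by lra. specialize (H c Hc0).
    assert (H1 := Rle_trans _ _ _ (Im_le _) H). apply Rabs_le_between in H1.
    assert (Hs : 0 < sqrt c) by (apply sqrt_lt_R0; lra).
    replace (2 * K * (1 / (2 * sqrt c))) with (K / sqrt c) by (field; lra).
    destruct Hk as [-> | ->]; lra. }
  assert (M1 := M 1 (or_introl eq_refl)). assert (M2 := M (-1) (or_intror eq_refl)).
  apply Rabs_le. lra.
Qed.

(** Two points near [x0] are joined by going up to height [d], across, and down. Each vertical leg
    costs at most [2 * K * sqrt d], and so does the horizontal one, whose length is at most
    [2 * d]. *)
Lemma prim_boundary_cauchy (x0 e : R) : x0 <> 0 -> 0 < e -> exists d, 0 < d /\
  forall z z', 0 < Im z -> 0 < Im z' -> Cmod (z - RtoC x0) < d -> Cmod (z' - RtoC x0) < d ->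
  Rabs (prim z - prim z') <= e.
Proof.
  intros Hx0 He. destruct (Hb x0 Hx0) as [r [K [Hr [HK HB]]]].
  (* Chosen so that the total cost [6 * K * sqrt d] is at most [e]; the summand 1 covers [K = 0]. *)
  set (q := e / (6 * K + 1)). assert (Hq : 0 < q) by (apply Rdiv_lt_0_compat; lra).
  set (d := Rmin (r / 2) (q * q)).
  assert (Hd : 0 < d) by (apply Rmin_glb_lt; nra).
  assert (Hdr : d <= r / 2) by apply Rmin_l.
  assert (Hdq : sqrt d <= q).
  { rewrite <- (sqrt_square q) by lra. apply sqrt_le_1_alt, Rmin_r. }
  assert (Hsd : 0 < sqrt d) by (apply sqrt_lt_R0, Hd).
  assert (He6 : 6 * K * sqrt d <= e).
  { apply Rle_trans with (6 * K * q); [apply Rmult_le_compat_l; lra|].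
    unfold q. apply Rle_trans with ((6 * K + 1) * (e / (6 * K + 1))); [|right; field; lra].
    apply Rmult_le_compat_r; [apply Rlt_le, Hq|lra]. }
  exists d. split; [exact Hd|].
  intros [x y] [x' y'] Hy Hy' Hz Hz'. simpl in Hy, Hy'.
  assert (X1 := Rle_lt_trans _ _ _ (Re_le _) Hz). assert (Y1 := Rle_lt_trans _ _ _ (Im_le _) Hz).
  assert (X2 := Rle_lt_trans _ _ _ (Re_le _) Hz'). assert (Y2 := Rle_lt_trans _ _ _ (Im_le _) Hz').
  change (Rabs (x - x0) < d) in X1. change (Rabs (y - 0) < d) in Y1.
  change (Rabs (x' - x0) < d) in X2. change (Rabs (y' - 0) < d) in Y2.
  rewrite Rminus_0_r, Rabs_right in Y1, Y2 by lra.
  assert (HB' : forall a b, 0 < b <= d -> Rabs (a - x0) < d -> Cmod (f (a, b)) <= K / sqrt b).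
  { intros a b Hbb Ha. apply (HB (a, b)); [simpl; lra|].
    apply Rle_lt_trans with (1 := Cmod_le_abs _).
    change (Rabs (a - x0) + Rabs (b - 0) < r). rewrite Rminus_0_r, (Rabs_right b) by lra. lra. }
  assert (V1 := prim_vertical x K y d (conj Hy (Rlt_le _ _ Y1)) (fun s Hs => HB' x s Hs X1)).
  assert (V2 := prim_vertical x' K y' d (conj Hy' (Rlt_le _ _ Y2)) (fun s Hs => HB' x' s Hs X2)).
  assert (Hor : Rabs (prim (x, d) - prim (x', d)) <= K / sqrt d * Rabs (x - x')).
  { apply (deriv_bound (fun s => prim (s, d)) (fun s => Re (f (s, d)))). intros s Hs.
    split; [apply prim_dx, Hd|]. apply Rle_trans with (1 := Re_le _).
    apply HB'; [lra|]. apply (between_close _ _ _ _ _ X2 X1 Hs). }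
  assert (Hxx : Rabs (x - x') <= 2 * d).
  { apply Rabs_def2 in X1. apply Rabs_def2 in X2. apply Rabs_le. lra. }
  assert (Hor2 : Rabs (prim (x, d) - prim (x', d)) <= 2 * K * sqrt d).
  { apply Rle_trans with (1 := Hor). apply Rle_trans with (K / sqrt d * (2 * d)).
    - apply Rmult_le_compat_l; [apply Rdiv_le_0_compat; assumption|assumption].
    - right. rewrite <- (sqrt_sqrt d) at 2 by lra. field. lra. }
  assert (0 <= sqrt y) by apply sqrt_pos. assert (0 <= sqrt y') by apply sqrt_pos.
  assert (V1' : Rabs (prim (x, d) - prim (x, y)) <= 2 * K * sqrt d) by nra.
  assert (V2' : Rabs (prim (x', d) - prim (x', y')) <= 2 * K * sqrt d) by nra.
  apply Rabs_le_between in V1'. apply Rabs_le_between in V2'. apply Rabs_le_between in Hor2.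
  apply Rabs_le. lra.
Qed.

(* At a real point the limit from above: it exists since [f] is of order
   [1 / sqrt y] at height [y]. *)
Definition ext_prim (z : C) : R :=
  if Rlt_dec 0 (Im z) then prim z else Lim_seq (fun n => prim (Re z, / (INR n + 1))).

Lemma ext_prim_near (z0 : C) (e : R) : 0 <= Im z0 -> z0 <> 0%C -> 0 < e ->
  exists d, 0 < d /\ forall z, 0 < Im z -> Cmod (z - z0) < d -> Rabs (prim z - ext_prim z0) <= e.
Proof.
  intros Hi Hz0 He. unfold ext_prim. destruct (Rlt_dec 0 (Im z0)) as [Hp|Hp].
  - assert (Hc := hol_cont _ _ (Hf z0 Hp)). rewrite (flim_Cmod (F := locally z0)) in Hc.
    specialize (Hc 1 Rlt_0_1). apply locally_Cmod in Hc. destruct Hc as [d [Hd H]].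
    assert (L := lpath_bound z0 (f z0) d 1 (fun z Hz Hzd => Rlt_le _ _ (H z Hzd))).
    set (M := 2 + Cmod (f z0)). assert (HM : 0 < M) by (assert (H0 := Cmod_ge_0 (f z0)); unfold M; lra).
    exists (Rmin (d / 2) (e / M)). split.
    + apply Rmin_glb_lt; [lra|apply Rdiv_lt_0_compat; assumption].
    + intros z Hz Hzd. assert (A1 := Rmin_l (d / 2) (e / M)). assert (A2 := Rmin_r (d / 2) (e / M)).
      assert (E0 : Cmod (z0 - z0) = 0) by (replace (z0 - z0)%C with (RtoC 0) by ring; apply Cmod_0).
      specialize (L z z0 Hz Hp ltac:(lra) ltac:(lra)).
      assert (B := Re_le (f z0 * (z - z0))%C). rewrite Cmod_mult in B.
      assert (T := Rabs_triang (prim z - prim z0 - Re (f z0 * (z - z0))%C) (Re (f z0 * (z - z0))%C)).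
      replace (prim z - prim z0 - Re (f z0 * (z - z0))%C + Re (f z0 * (z - z0))%C) with (prim z - prim z0) in T by ring.
      assert (Hm : Cmod (z - z0) * M <= e).
      { apply Rle_trans with (e / M * M); [apply Rmult_le_compat_r; lra|right; field; lra]. }
      unfold M in Hm. nra.
  - assert (Hi0 : Im z0 = 0) by lra.
    assert (Ez : z0 = RtoC (Re z0)) by (apply C_ext; [reflexivity|exact Hi0]).
    assert (Hr : Re z0 <> 0). { intros E. apply Hz0. rewrite Ez, E. reflexivity. }
    set (u := fun n => prim (Re z0, / (INR n + 1))).
    assert (Hsmall : forall d, 0 < d -> exists N, forall n, (N <= n)%nat -> 0 < / (INR n + 1) < d).
    { intros d Hd. destruct (archimed_cor1 d Hd) as [N [HN1 HN2]]. exists N. intros n Hn.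
      apply le_INR in Hn. apply lt_INR in HN2. simpl in HN2. split; [apply Rinv_0_lt_compat; lra|].
      apply Rlt_trans with (2 := HN1). apply Rinv_lt_contravar; [apply Rmult_lt_0_compat; lra|lra]. }
    assert (Hdist : forall t, 0 < t -> Cmod ((Re z0, t) - RtoC (Re z0)) = t).
    { intros t Ht. replace ((Re z0, t) - RtoC (Re z0))%C with (Ci * RtoC t)%C.
      - rewrite Cmod_mult, Cmod_R, Rabs_right by lra. replace (Cmod Ci) with 1; [ring|].
        unfold Cmod; simpl. replace (0 * (0 * 1) + 1 * (1 * 1)) with 1 by ring. symmetry; apply sqrt_1.
      - apply C_ext; unfold Re, Im; simpl; ring. }
    assert (Hlim : is_lim_seq u (Finite (real (Lim_seq u)))).
    { apply Lim_seq_correct'. apply ex_lim_seq_cauchy_corr. intros eps.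
      assert (He2 : 0 < eps / 2) by (assert (H := cond_pos eps); lra).
      destruct (prim_boundary_cauchy _ _ Hr He2) as [d [Hd H]].
      destruct (Hsmall d Hd) as [N HN]. exists N. intros n m Hn Hm.
      destruct (HN n Hn) as [n1 n2], (HN m Hm) as [m1 m2].
      apply Rle_lt_trans with (eps / 2); [|lra].
      apply H; simpl; try assumption; rewrite Hdist; assumption. }
    destruct (prim_boundary_cauchy _ _ Hr (proj1 (conj (ltac:(lra) : 0 < e / 2) I))) as [d [Hd H]].
    exists d. split; [exact Hd|]. intros z Hz Hzd.
    apply (is_lim_seq_spec u) in Hlim. specialize (Hlim (mkposreal (e / 2) (ltac:(lra)))).
    destruct Hlim as [N1 HN1]. simpl in HN1. destruct (Hsmall d Hd) as [N2 HN2].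
    set (n := (N1 + N2)%nat).
    specialize (HN1 n (Nat.le_add_r _ _)). specialize (HN2 n (Nat.le_add_l _ _)).
    rewrite Ez in Hzd. specialize (H z (Re z0, / (INR n + 1)) Hz (proj1 HN2) Hzd).
    rewrite Hdist in H by apply HN2. specialize (H (proj2 HN2)).
    change (prim (Re z0, / (INR n + 1))) with (u n) in H. fold u.
    apply Rabs_def2 in HN1. apply Rabs_le_between in H. apply Rabs_le. lra.
Qed.

Lemma upper_approx (z : C) (d : R) : 0 <= Im z -> 0 < d -> exists z', 0 < Im z' /\ Cmod (z' - z) < d.
Proof.
  intros Hz Hd. exists (Re z, Im z + d / 2). split; [simpl; lra|].
  apply Rle_lt_trans with (1 := Cmod_le_abs _).
  change (Rabs (Re z - Re z) + Rabs (Im z + d / 2 - Im z) < d).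
  replace (Re z - Re z) with 0 by ring. rewrite Rabs_R0.
  replace (Im z + d / 2 - Im z) with (d / 2) by ring. rewrite Rabs_right; lra.
Qed.

Lemma Cmod_dist_triangle (a b c : C) : Cmod (a - c) <= Cmod (a - b) + Cmod (b - c).
Proof. replace (a - c)%C with ((a - b) + (b - c))%C by ring. apply Cmod_triangle. Qed.

Lemma ext_prim_cont (z0 : C) : 0 <= Im z0 -> z0 <> 0%C ->
  filterlim ext_prim (within (fun z => 0 <= Im z) (locally z0)) (locally (ext_prim z0)).
Proof.
  intros Hi Hz0. apply flim_Rabs. intros e He. assert (He3 : 0 < e / 3) by lra.
  destruct (ext_prim_near z0 _ Hi Hz0 He3) as [d [Hd H]].
  assert (Hm := Cmod_neq0 _ Hz0).
  apply locally_Cmod. exists (Rmin d (Cmod z0)). split; [apply Rmin_glb_lt; assumption|].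
  intros z Hzd Hzi. assert (A1 := Rmin_l d (Cmod z0)). assert (A2 := Rmin_r d (Cmod z0)).
  assert (Hz : z <> 0%C).
  { intros ->. rewrite Cmod_minus_sym in Hzd. replace (z0 - 0)%C with z0 in Hzd by ring. lra. }
  destruct (ext_prim_near z _ Hzi Hz He3) as [d' [Hd' H']].
  destruct (upper_approx z (Rmin d' (d - Cmod (z - z0))) Hzi) as [z' [Hi' Hz']].
  { apply Rmin_glb_lt; lra. }
  assert (A3 := Rmin_l d' (d - Cmod (z - z0))). assert (A4 := Rmin_r d' (d - Cmod (z - z0))).
  specialize (H' z' Hi' ltac:(lra)).
  assert (T := Cmod_dist_triangle z' z z0). specialize (H z' Hi' ltac:(lra)).
  apply Rabs_le_between in H. apply Rabs_le_between in H'. apply Rabs_def1; lra.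
Qed.

(** At a real point the increment is estimated through nearby points of the open half plane, where
    [lpath_bound] applies with slope [f0]. If the bound failed by a positive [gap], it would also
    fail at points close enough to [z] and [z0]. *)
Lemma ext_prim_diff (z0 f0 : C) : 0 <= Im z0 -> z0 <> 0%C ->
  filterlim f (within (fun z => 0 < Im z) (locally z0)) (locally f0) ->
  forall e, 0 < e -> locally z0 (fun z => 0 <= Im z ->
    Rabs (ext_prim z - ext_prim z0 - Re (f0 * (z - z0))%C) <= e * Cmod (z - z0)).
Proof.
  intros Hi Hz0 Hl e He. assert (He2 : 0 < e / 2) by lra.
  rewrite (flim_Cmod (F := within _ (locally z0))) in Hl. specialize (Hl _ He2).
  apply locally_Cmod in Hl. destruct Hl as [d [Hd Hl]].
  assert (L := lpath_bound z0 f0 d (e / 2) (fun z Hz Hzd => Rlt_le _ _ (Hl z Hzd Hz))).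
  assert (Hm := Cmod_neq0 _ Hz0).
  apply locally_Cmod. exists (Rmin (d / 2) (Cmod z0)). split; [apply Rmin_glb_lt; lra|].
  intros z Hzd Hzi. assert (A1 := Rmin_l (d / 2) (Cmod z0)). assert (A2 := Rmin_r (d / 2) (Cmod z0)).
  assert (Hz : z <> 0%C).
  { intros ->. rewrite Cmod_minus_sym in Hzd. replace (z0 - 0)%C with z0 in Hzd by ring. lra. }
  apply Rnot_lt_le. intros Hlt.
  set (gap := Rabs (ext_prim z - ext_prim z0 - Re (f0 * (z - z0))%C) - e * Cmod (z - z0)).
  assert (Hgap : 0 < gap) by (unfold gap; lra).
  (* Replacing [z] and [z0] by points at distance less than [k] costs at most
     [k * (2 + 2 * Cmod f0 + 2 * e)], which is less than [k * M = gap]. *)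
  set (M := 4 + 2 * Cmod f0 + 2 * e).
  assert (HM : 0 < M) by (assert (H0 := Cmod_ge_0 f0); unfold M; lra).
  set (k := gap / M). assert (Hk : 0 < k) by (apply Rdiv_lt_0_compat; assumption).
  destruct (ext_prim_near z _ Hzi Hz Hk) as [d1 [Hd1 H1]].
  destruct (ext_prim_near z0 _ Hi Hz0 Hk) as [d2 [Hd2 H2]].
  destruct (upper_approx z (Rmin (Rmin d1 k) (d / 2 - Cmod (z - z0))) Hzi) as [z1 [Hi1 Hz1]].
  { repeat apply Rmin_glb_lt; lra. }
  destruct (upper_approx z0 (Rmin (Rmin d2 k) (d / 2)) Hi) as [z2 [Hi2 Hz2]].
  { repeat apply Rmin_glb_lt; lra. }
  assert (B1 := Rmin_l (Rmin d1 k) (d / 2 - Cmod (z - z0))).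
  assert (B2 := Rmin_r (Rmin d1 k) (d / 2 - Cmod (z - z0))).
  assert (B3 := Rmin_l d1 k). assert (B4 := Rmin_r d1 k).
  assert (C1 := Rmin_l (Rmin d2 k) (d / 2)). assert (C2 := Rmin_r (Rmin d2 k) (d / 2)).
  assert (C3 := Rmin_l d2 k). assert (C4 := Rmin_r d2 k).
  specialize (H1 z1 Hi1 ltac:(lra)). specialize (H2 z2 Hi2 ltac:(lra)).
  assert (T1 := Cmod_dist_triangle z1 z z0).
  specialize (L z1 z2 Hi1 Hi2 ltac:(lra) ltac:(lra)).
  assert (Hdiff : Cmod ((z1 - z2) - (z - z0)) <= 2 * k).
  { replace ((z1 - z2) - (z - z0))%C with ((z1 - z) + (z0 - z2))%C by ring.
    apply Rle_trans with (1 := Cmod_triangle _ _). rewrite (Cmod_minus_sym z0 z2). lra. }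
  assert (D1 : Cmod (z1 - z2) <= Cmod (z - z0) + 2 * k).
  { replace (z1 - z2)%C with (((z1 - z2) - (z - z0)) + (z - z0))%C by ring.
    apply Rle_trans with (1 := Cmod_triangle _ _). lra. }
  assert (D2 := Re_le (f0 * ((z1 - z2) - (z - z0)))%C). rewrite Cmod_mult in D2.
  assert (D3 : Re (f0 * ((z1 - z2) - (z - z0)))%C = Re (f0 * (z1 - z2))%C - Re (f0 * (z - z0))%C).
  { unfold Re, Im; simpl; ring. }
  rewrite D3 in D2.
  assert (D4 : Cmod f0 * Cmod ((z1 - z2) - (z - z0)) <= Cmod f0 * (2 * k)).
  { apply Rmult_le_compat_l; [apply Cmod_ge_0|exact Hdiff]. }
  assert (Fin : Rabs (ext_prim z - ext_prim z0 - Re (f0 * (z - z0))%C) <=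
     2 * (e / 2) * (Cmod (z - z0) + 2 * k) + 2 * k + Cmod f0 * (2 * k)).
  { apply Rabs_le_between in H1. apply Rabs_le_between in H2.
    assert (L' := Rle_trans _ _ _ L (Rmult_le_compat_l (2 * (e / 2)) _ _ ltac:(lra) D1)).
    apply Rabs_le_between in L'. apply Rabs_le_between in D2.
    apply Rabs_le. lra. }
  assert (Ek : gap = k * M) by (unfold k; field; lra).
  unfold gap, M in Ek. nra.
Qed.

End Primitive.

(** * Local square roots and inversion on the sphere *)

(** Division by [m z0] brings the values near 1, where [csqrt] is holomorphic; the factor [h0] then
    restores the root. The last clause says that [h z] is nearer to [h0] than the opposite root
    is. *)
Lemma hol_sqrt_germ (m : C -> C) (z0 h0 : C) :
  locally z0 (fun z => hol_at m z) -> m z0 <> 0%C -> (h0 * h0 = m z0)%C ->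
  exists (h : C -> C) (r : R), 0 < r /\ h z0 = h0 /\ forall z, Cmod (z - z0) < r ->
    hol_at h z /\ h z <> 0%C /\ (h z * h z = m z)%C /\ 0 < Re (h z * Cconj h0)%C.
Proof.
  intros Hm Hn Hh. set (V := fun z => (m z / m z0)%C).
  assert (V0 : V z0 = RtoC 1) by (unfold V; field; exact Hn).
  assert (HV : locally z0 (fun z => hol_at V z)).
  { apply filter_imp with (2 := Hm). intros z Hz. unfold V, Cdiv. apply hol_mult; [exact Hz|apply hol_const]. }
  assert (CV := hol_cont _ _ (locally_singleton _ _ HV)).
  assert (HP : locally z0 (fun z => 0 < Re (V z))).
  { assert (CR := flim_Re _ _ CV). rewrite V0 in CR. rewrite (flim_Rabs (F := locally z0)) in CR.
    apply filter_imp with (2 := CR 1 Rlt_0_1). intros z Hz. change (Re (RtoC 1)) with 1 in Hz. apply Rabs_def2 in Hz. lra. }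
  destruct (proj1 (locally_Cmod _ _) (filter_and _ _ HV HP)) as [r [Hr H]].
  assert (H0n : h0 <> 0%C). { intros E. apply Hn. rewrite <- Hh, E. ring. }
  assert (S : csqrt (RtoC 1) = RtoC 1).
  { assert (B := csqrt_Re_pos (RtoC 1) Rlt_0_1). assert (Q := csqrt_sqr (RtoC 1)).
    assert (E : ((csqrt (RtoC 1) - 1) * (csqrt (RtoC 1) + 1) = 0)%C).
    { transitivity (csqrt (RtoC 1) * csqrt (RtoC 1) - 1)%C; [ring|]. rewrite Q. ring. }
    destruct (Ceq_dec (csqrt (RtoC 1) - 1)%C 0%C) as [D|D].
    - transitivity (csqrt (RtoC 1) - 1 + 1)%C; [ring|]. rewrite D. ring.
    - exfalso. apply (Cmult_neq_0 _ (csqrt (RtoC 1) + 1)%C D); [|exact E].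
      intros E1. apply (f_equal Re) in E1. change (Re (csqrt (RtoC 1)) + 1 = 0) in E1. lra. }
  exists (fun z => h0 * csqrt (V z))%C, r. split; [exact Hr|split].
  - rewrite V0, S. ring.
  - intros z Hz. destruct (H z Hz) as [Hv Hp]. assert (Sp := csqrt_Re_pos _ Hp).
    assert (Sn : csqrt (V z) <> 0%C). { intros E. rewrite E in Sp. change (0 < 0) in Sp. lra. }
    split; [|split; [|split]].
    + apply hol_mult; [apply hol_const|]. apply (hol_sqrt _ V); [|exact Sn| |exact Hv].
      * apply locally_Cmod. exists (r - Cmod (z - z0)). split; [lra|]. intros u Hu.
        assert (Hur : Cmod (u - z0) < r).
        { replace (u - z0)%C with ((u - z) + (z - z0))%C by ring. eapply Rle_lt_trans; [apply Cmod_triangle|lra]. }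
        destruct (H u Hur) as [Hvu Hpu]. apply csqrt_flim; [apply csqrt_Re_pos, Hpu|apply hol_cont, Hvu].
      * apply filter_forall. intros u. apply csqrt_sqr.
    + apply Cmult_neq_0; assumption.
    + transitivity (h0 * h0 * (csqrt (V z) * csqrt (V z)))%C; [ring|]. rewrite csqrt_sqr, Hh. unfold V. field. exact Hn.
    + replace (h0 * csqrt (V z) * Cconj h0)%C with (RtoC (Cmod h0 ^ 2) * csqrt (V z))%C.
      * assert (Q := Cmod_neq0 _ H0n). replace (Re (RtoC (Cmod h0 ^ 2) * csqrt (V z))%C) with (Cmod h0 ^ 2 * Re (csqrt (V z))) by (unfold Re; simpl; ring).
        apply Rmult_lt_0_compat; [apply pow_lt, Q|exact Sp].
      * transitivity (h0 * Cconj h0 * csqrt (V z))%C; [|ring]. f_equal.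
        assert (Q := Cmod_sqr h0). apply C_ext; destruct h0; unfold Re, Im in *; simpl in *; lra.
Qed.

(** Passes from a local coordinate [u] on the sphere of values of [w] to [w]; near a pole of [w] the
    coordinate is [1 / w]. *)
Definition flip (inv : bool) (u : C) : Chat :=
  if inv then (if Ceq_dec u 0%C then Inf else Fin (/ u)%C) else Fin u.

Lemma flip_inj (inv : bool) (u v : C) : flip inv u = flip inv v -> u = v.
Proof.
  assert (F : forall x y : C, Fin x = Fin y -> x = y).
  { intros x y E. apply (f_equal (fun z => match z with Fin z => z | Inf => x end)) in E. exact E. }
  destruct inv; unfold flip; [|apply F].
  destruct (Ceq_dec u 0%C) as [Eu|Eu], (Ceq_dec v 0%C) as [Ev|Ev]; intros E; try discriminate.
  - congruence.
  - apply F in E. replace u with (/ / u)%C by (field; exact Eu). rewrite E. field. exact Ev.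
Qed.

Lemma flip_cont (inv : bool) (u : C) : filterlim (flip inv) (locally u) (Chat_locally (flip inv u)).
Proof.
  destruct inv; simpl; [|intros P HP; exact HP].
  destruct (Ceq_dec u 0%C) as [E|E].
  - intros P [M [HI HM]]. rewrite E. unfold filtermap. apply locally_Cmod.
    assert (B := Rabs_pos M). assert (B2 := Rle_abs M).
    exists (/ (Rabs M + 1)). split; [apply Rinv_0_lt_compat; lra|]. intros v Hv.
    unfold flip. destruct (Ceq_dec v 0%C) as [Ev|Ev]; [exact HI|]. apply HM.
    replace (v - 0)%C with v in Hv by ring. rewrite Cmod_inv by exact Ev. assert (Q := Cmod_neq0 _ Ev).
    apply Rlt_trans with (Rabs M + 1); [lra|].
    rewrite <- (Rinv_inv (Rabs M + 1)). apply Rinv_lt_contravar; [|exact Hv].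
    apply Rmult_lt_0_compat; [exact Q|apply Rinv_0_lt_compat; lra].
  - intros P HP. unfold filtermap. simpl in HP.
    assert (L : filterlim (fun v : C => / v)%C (locally u) (locally (/ u)%C)) by (apply flim_Cinv; [exact E|apply flim_id]).
    assert (N : locally u (fun v : C => v <> 0%C)) by (apply (flim_nonzero (fun v => v) u E), flim_id).
    assert (L2 : locally u (fun v : C => P (Fin (/ v)%C))) by exact (L (fun v : C => P (Fin v)) HP).
    apply filter_imp with (2 := filter_and _ _ L2 N).
    intros v [Hv Nv]. unfold flip. destruct (Ceq_dec v 0%C); [contradiction|exact Hv].
Qed.

(** * The square root [w] over the upper half plane *)

Lemma Cneq0_Im (z : C) : Im z <> 0 -> z <> 0%C.
Proof. intros H ->. apply H. reflexivity. Qed.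

Lemma RtoC_inj_neq (x y : R) : x <> y -> RtoC x <> RtoC y.
Proof. intros H E. apply H. injection E. auto. Qed.

(* The zeros are the opposites of the poles; [X / Y] is a homogeneous coordinate. *)
Lemma partial_fractions (p1 p2 p3 p4 X Y : C) :
  p1 <> p2 -> p1 <> p3 -> p1 <> p4 -> p2 <> p3 -> p2 <> p4 -> p3 <> p4 ->
  (X - p1 * Y <> 0 -> X - p2 * Y <> 0 -> X - p3 * Y <> 0 -> X - p4 * Y <> 0 ->
  (X + p1 * Y) * (X + p2 * Y) * (X + p3 * Y) * (X + p4 * Y) /
  ((X - p1 * Y) * (X - p2 * Y) * (X - p3 * Y) * (X - p4 * Y)) =
  1 + 2 * p1 * (p1 + p2) * (p1 + p3) * (p1 + p4) / ((p1 - p2) * (p1 - p3) * (p1 - p4)) * (Y / (X - p1 * Y))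
    + 2 * p2 * (p2 + p1) * (p2 + p3) * (p2 + p4) / ((p2 - p1) * (p2 - p3) * (p2 - p4)) * (Y / (X - p2 * Y))
    + 2 * p3 * (p3 + p1) * (p3 + p2) * (p3 + p4) / ((p3 - p1) * (p3 - p2) * (p3 - p4)) * (Y / (X - p3 * Y))
    + 2 * p4 * (p4 + p1) * (p4 + p2) * (p4 + p3) / ((p4 - p1) * (p4 - p2) * (p4 - p3)) * (Y / (X - p4 * Y)))%C.
Proof.
  intros.
  assert (D : forall u v : C, u <> v -> (u - v <> 0)%C).
  { intros u v Huv E. apply Huv. replace u with (u - v + v)%C by ring. rewrite E. ring. }
  field. repeat split; try assumption; apply D; auto.
Qed.

Lemma residue_pos (x y z t : R) :
  0 < x * (x + y) * (x + z) * (x + t) * ((x - y) * (x - z) * (x - t)) ->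
  0 < 2 * x * (x + y) * (x + z) * (x + t) / ((x - y) * (x - z) * (x - t)).
Proof.
  intros H. set (D := (x - y) * (x - z) * (x - t)) in *.
  assert (HD : D <> 0) by (intros E; rewrite E in H; lra).
  replace (2 * x * (x + y) * (x + z) * (x + t) / D) with
    (2 * (x * (x + y) * (x + z) * (x + t) * D) * (/ D * / D)) by (field; exact HD).
  apply Rmult_lt_0_compat; [lra|]. assert (/ D <> 0) by (apply Rinv_neq_0_compat, HD). nra.
Qed.

Lemma Im_Cdiv (u v : C) : v <> 0%C ->
  Im (u / v) = (Im u * Re v - Re u * Im v) / (Re v * Re v + Im v * Im v).
Proof.
  intros Hv. assert (H := Cmod_neq0 _ Hv). assert (H1 := Cmod_sqr v).
  destruct u as [p q], v as [r s]. unfold Re, Im in *; simpl in *. field. nra.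
Qed.

Lemma Re_shift (k q d : C) (h : R) :
  Re (k * (q * RtoC h))%C = Re (k * ((q - d) * RtoC h))%C + h * Re (k * d)%C.
Proof. destruct k, q, d. unfold Re, Im; simpl. ring. Qed.

Lemma Re_mCi (u v : C) : Re (- Ci * (u - v))%C = Im u - Im v.
Proof. destruct u, v. unfold Re, Im; simpl. ring. Qed.

Lemma Re_mCiCi (u : C) : Re (- (Ci * Ci) * u)%C = Re u.
Proof. destruct u. unfold Re, Im; simpl. ring. Qed.

(** * The parameters [a] and [b] *)

Section Surface.

Variables l l1 l2 : R.
Hypothesis Hl : 0 < l < 1.
Hypothesis Hl12 : 1 < l1 < l2.

Notation a := (pa l l1 l2).
Notation b := (pb l l1 l2).

(** The quadratic with roots [a ^ 2] and [b ^ 2]. Its signs at the squares of [l], 1, [l1], [l2]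
    locate [a] and [b]. *)
Definition quad (t : R) : R := t ^ 2 - alpha l l1 l2 * t + l * l1 * l2.

Lemma quad_l : 0 < quad (l ^ 2).
Proof.
  unfold quad, alpha.
  replace ((l ^ 2) ^ 2 - (l + l1 - l2 - l * l1 + l * l2 + l1 * l2) * l ^ 2 + l * l1 * l2)
    with (l * ((1 - l) * (l1 + l) * (l2 - l))) by ring.
  repeat apply Rmult_lt_0_compat; lra.
Qed.

Lemma quad_1 : quad 1 < 0.
Proof.
  unfold quad, alpha.
  replace (1 ^ 2 - (l + l1 - l2 - l * l1 + l * l2 + l1 * l2) * 1 + l * l1 * l2)
    with (- ((1 - l) * (l1 - 1) * (1 + l2))) by ring.
  apply Ropp_lt_gt_0_contravar. repeat apply Rmult_lt_0_compat; lra.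
Qed.

Lemma quad_l1 : quad (l1 ^ 2) < 0.
Proof.
  unfold quad, alpha.
  replace ((l1 ^ 2) ^ 2 - (l + l1 - l2 - l * l1 + l * l2 + l1 * l2) * l1 ^ 2 + l * l1 * l2)
    with (- (l1 * ((l1 + l) * (l1 - 1) * (l2 - l1)))) by ring.
  apply Ropp_lt_gt_0_contravar. repeat apply Rmult_lt_0_compat; lra.
Qed.

Lemma quad_l2 : 0 < quad (l2 ^ 2).
Proof.
  unfold quad, alpha.
  replace ((l2 ^ 2) ^ 2 - (l + l1 - l2 - l * l1 + l * l2 + l1 * l2) * l2 ^ 2 + l * l1 * l2)
    with (l2 * ((l2 - l) * (l2 + 1) * (l2 - l1))) by ring.
  repeat apply Rmult_lt_0_compat; lra.
Qed.

Lemma ab_sqr : a ^ 2 + b ^ 2 = alpha l l1 l2 /\ a ^ 2 * b ^ 2 = l * l1 * l2 /\ a ^ 2 < b ^ 2.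
Proof.
  assert (Hd : 0 < alpha l l1 l2 ^ 2 - 4 * l * l1 * l2).
  { assert (H := quad_1). unfold quad in H.
    assert (0 < l * l1 * l2) by (repeat apply Rmult_lt_0_compat; lra).
    (* [quad 1 < 0] means [alpha > 1 + p] with [p = l * l1 * l2], and [(1 + p) ^ 2 >= 4 * p]. *)
    set (A := alpha l l1 l2) in *. assert (Hpr : 0 < (A - (1 + l * l1 * l2)) * (A + (1 + l * l1 * l2)))
      by (apply Rmult_lt_0_compat; lra).
    assert (H1 := pow2_ge_0 (1 - l * l1 * l2)). lra. }
  assert (Hal : 0 < alpha l l1 l2).
  { assert (H := quad_1). unfold quad in H.
    assert (0 < l * l1 * l2) by (repeat apply Rmult_lt_0_compat; lra). lra. }
  assert (Hp : 0 < l * l1 * l2) by (repeat apply Rmult_lt_0_compat; lra).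
  unfold pa, pb. set (A := alpha l l1 l2) in *. set (s := sqrt (A ^ 2 - 4 * l * l1 * l2)).
  assert (Hs : s * s = A ^ 2 - 4 * l * l1 * l2) by (apply sqrt_sqrt; lra).
  assert (Hs0 : 0 < s) by (apply sqrt_lt_R0, Hd).
  assert (s < A) by nra.
  rewrite !pow2_sqrt by lra. repeat split; nra.
Qed.

Lemma quad_factor (t : R) : quad t = (t - a ^ 2) * (t - b ^ 2).
Proof. destruct ab_sqr as [H1 [H2 _]]. unfold quad. rewrite <- H1, <- H2. ring. Qed.

Lemma ab_range : l < a < 1 /\ l1 < b < l2.
Proof.
  assert (H1 := quad_l). assert (H2 := quad_1). assert (H3 := quad_l1). assert (H4 := quad_l2).
  rewrite quad_factor in H1, H2, H3, H4. destruct ab_sqr as [_ [_ H]].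
  assert (Ha : 0 <= a) by apply sqrt_pos. assert (Hb : 0 <= b) by apply sqrt_pos.
  assert (In : forall x y t : R, x < y -> (t - x) * (t - y) < 0 -> x < t < y) by (intros; split; nra).
  assert (Lo : forall x y t : R, x < y -> t < y -> 0 < (t - x) * (t - y) -> t < x) by (intros; nra).
  assert (Hi : forall x y t : R, x < y -> x < t -> 0 < (t - x) * (t - y) -> y < t) by (intros; nra).
  assert (A1 := In _ _ _ H H2). assert (A3 := In _ _ _ H H3).
  assert (A2 : l ^ 2 < a ^ 2) by (apply Lo with (b ^ 2); nra).
  assert (A4 : b ^ 2 < l2 ^ 2) by (apply Hi with (a ^ 2); nra).
  repeat split; nra.
Qed.

Lemma a_pos : 0 < a.
Proof. assert (H := ab_range). lra. Qed.

(* The coordinate [om = (z - a) / (z + a)] on the sphere puts the ends at [0]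
   and infinity; the level sets of the third coordinate become circles around
   [0].  Up to the factor [1 - om], [lin p om] is [z - p]. *)
Definition lin (p : R) (om : C) : C := (RtoC (a - p) + om * RtoC (a + p))%C.

Definition num (om : C) : C := (lin l om * lin (-1) om * lin l1 om * lin (- l2) om)%C.
Definition den (om : C) : C := (lin (- l) om * lin 1 om * lin (- l1) om * lin l2 om)%C.
Definition gsq (om : C) : C := (num om / den om)%C.

Definition gw (om : C) : C := csqrt (gsq om).

Lemma lin_hom (p : R) (om : C) : lin p om = (RtoC a * (1 + om) - RtoC p * (1 - om))%C.
Proof. unfold lin. rewrite RtoC_minus, RtoC_plus. ring. Qed.

Lemma lin_Im (p : R) (om : C) : Im (lin p om) = Im om * (a + p).
Proof. unfold lin, Re, Im; simpl. ring. Qed.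

Lemma lin_Re (p : R) (om : C) : Re (lin p om) = (a - p) + Re om * (a + p).
Proof. unfold lin, Re, Im; simpl. ring. Qed.

Lemma lin_neq0 (p : R) (om : C) : Im om <> 0 -> a + p <> 0 -> lin p om <> 0%C.
Proof.
  intros H1 H2. apply Cneq0_Im. rewrite lin_Im. apply Rmult_integral_contrapositive. split; assumption.
Qed.

(** This is [1 / (z - p)] written in [om]. In this form it makes sense at [om = 1], where [z] is
    infinite. *)
Definition hres (p om : C) : C := ((1 - om) / (RtoC a * (1 + om) - p * (1 - om)))%C.

Lemma hres_Im (p : R) (om : C) : lin p om <> 0%C ->
  Im (hres p om) = - (2 * a * Im om) / (Cmod (lin p om) * Cmod (lin p om)).
Proof.
  intros H. unfold hres. rewrite <- lin_hom.
  rewrite Cmod_sqr. set (D := lin p om) in *.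
  assert (HD : Re D * Re D + Im D * Im D <> 0).
  { rewrite <- Cmod_sqr. assert (H1 := Cmod_neq0 _ H). nra. }
  assert (E1 : Re D = (a - p) + Re om * (a + p)) by apply lin_Re.
  assert (E2 : Im D = Im om * (a + p)) by apply lin_Im.
  rewrite Im_Cdiv by exact H. f_equal.
  change (Im (1 - om)%C) with (0 - Im om). change (Re (1 - om)%C) with (1 - Re om).
  rewrite E1, E2. ring.
Qed.

Lemma hres_bound (p : R) (om : C) (M : R) : 0 < Im om -> a + p <> 0 -> Cmod (1 - om) <= M ->
  Cmod (hres p om) <= M / Rabs (a + p) / Im om.
Proof.
  intros Hi Hp HM. assert (Hn : lin p om <> 0%C) by (apply lin_neq0; lra).
  unfold hres. rewrite <- lin_hom. unfold Cdiv. rewrite Cmod_mult, Cmod_inv by exact Hn.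
  assert (H1 := Im_le (lin p om)). rewrite lin_Im, Rabs_mult, (Rabs_right (Im om)) in H1 by lra.
  assert (H2 : 0 < Rabs (a + p)) by (apply Rabs_pos_lt, Hp).
  assert (H3 := Cmod_ge_0 (1 - om)%C).
  unfold Rdiv. rewrite Rmult_assoc, <- Rinv_mult.
  apply Rmult_le_compat; [exact H3| |exact HM|].
  - apply Rlt_le, Rinv_0_lt_compat. apply Cmod_neq0, Hn.
  - apply Rinv_le_contravar; [apply Rmult_lt_0_compat; lra|lra].
Qed.

(* The residues are positive because zeros and poles interlace. *)
Lemma residues : exists r1 r2 r3 r4 : R, (0 < r1 /\ 0 < r2 /\ 0 < r3 /\ 0 < r4) /\
  (forall om : C, lin (- l1) om <> 0%C -> lin (- l) om <> 0%C -> lin 1 om <> 0%C -> lin l2 om <> 0%C ->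
    gsq om = 1 + r1 * hres (RtoC (- l1)) om + r2 * hres (RtoC (- l)) om
             + r3 * hres (RtoC 1) om + r4 * hres (RtoC l2) om)%C /\
  (forall om : C, lin l1 om <> 0%C -> lin l om <> 0%C -> lin (-1) om <> 0%C -> lin (- l2) om <> 0%C ->
    (den om / num om) = 1 - r1 * hres (RtoC l1) om - r2 * hres (RtoC l) om
             - r3 * hres (RtoC (-1)) om - r4 * hres (RtoC (- l2)) om)%C.
Proof.
  set (rr := fun x y z t => 2 * x * (x + y) * (x + z) * (x + t) / ((x - y) * (x - z) * (x - t))).
  exists (rr (- l1) (- l) 1 l2), (rr (- l) (- l1) 1 l2), (rr 1 (- l1) (- l) l2), (rr l2 (- l1) (- l) 1).
  assert (P : forall x y z t : R, 0 < x -> 0 < y -> 0 < z -> 0 < t -> 0 < x * y * z * t)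
    by (intros; repeat apply Rmult_lt_0_compat; assumption).
  split; [repeat split; apply residue_pos|].
  - replace (- l1 * (- l1 + - l) * (- l1 + 1) * (- l1 + l2) * ((- l1 - - l) * (- l1 - 1) * (- l1 - l2)))
      with ((l1 * (l1 + l) * (l1 - 1) * (l2 - l1)) * (1 * (l1 - l) * (l1 + 1) * (l1 + l2))) by ring.
    apply Rmult_lt_0_compat; apply P; lra.
  - replace (- l * (- l + - l1) * (- l + 1) * (- l + l2) * ((- l - - l1) * (- l - 1) * (- l - l2)))
      with ((l * (l1 + l) * (1 - l) * (l2 - l)) * (1 * (l1 - l) * (l + 1) * (l + l2))) by ring.
    apply Rmult_lt_0_compat; apply P; lra.
  - replace (1 * (1 + - l1) * (1 + - l) * (1 + l2) * ((1 - - l1) * (1 - - l) * (1 - l2)))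
      with ((1 * (l1 - 1) * (1 - l) * (1 + l2)) * (1 * (1 + l1) * (1 + l) * (l2 - 1))) by ring.
    apply Rmult_lt_0_compat; apply P; lra.
  - replace (l2 * (l2 + - l1) * (l2 + - l) * (l2 + 1) * ((l2 - - l1) * (l2 - - l) * (l2 - 1)))
      with ((l2 * (l2 - l1) * (l2 - l) * (l2 + 1)) * (1 * (l2 + l1) * (l2 + l) * (l2 - 1))) by ring.
    apply Rmult_lt_0_compat; apply P; lra.
  - assert (E : forall x y z t : R, x <> y -> x <> z -> x <> t -> RtoC (rr x y z t) =
      (2 * x * (x + y) * (x + z) * (x + t) / ((x - y) * (x - z) * (x - t)))%C).
    { intros x y z t H1 H2 H3. unfold rr. rewrite RtoC_div, !RtoC_mult, !RtoC_minus, !RtoC_plus; [reflexivity|].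
      repeat apply Rmult_integral_contrapositive_currified; lra. }
    rewrite !E by lra.
    assert (N : forall x y : R, x <> y -> RtoC x <> RtoC y) by apply RtoC_inj_neq.
    split; intros om H1 H2 H3 H4; unfold gsq, num, den, hres in *; rewrite !lin_hom in *.
    + assert (PF := partial_fractions (RtoC (- l1)) (RtoC (- l)) (RtoC 1) (RtoC l2) (RtoC a * (1 + om)) (1 - om)
        ltac:(apply N; lra) ltac:(apply N; lra) ltac:(apply N; lra) ltac:(apply N; lra) ltac:(apply N; lra) ltac:(apply N; lra)
        H1 H2 H3 H4).
      rewrite <- PF. f_equal.
      * rewrite !RtoC_opp. ring.
      * ring.
    (* The map [z |-> - z] exchanges zeros and poles, so the same expansion with the first
       homogeneous coordinate negated serves for [den / num]; the residues change sign. *)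
    + assert (PF := partial_fractions (RtoC (- l1)) (RtoC (- l)) (RtoC 1) (RtoC l2) (- (RtoC a * (1 + om))) (1 - om)
        ltac:(apply N; lra) ltac:(apply N; lra) ltac:(apply N; lra) ltac:(apply N; lra) ltac:(apply N; lra) ltac:(apply N; lra)).
      assert (X1 : forall x : R, (- (RtoC a * (1 + om)) - RtoC (- x) * (1 - om) = - (RtoC a * (1 + om) - RtoC x * (1 - om)))%C).
      { intros x. rewrite RtoC_opp. ring. }
      assert (X2 : forall x : R, (- (RtoC a * (1 + om)) - RtoC x * (1 - om) = - (RtoC a * (1 + om) - RtoC (- x) * (1 - om)))%C).
      { intros x. rewrite RtoC_opp. ring. }
      rewrite !X1, !X2 in PF. replace (Ropp 1) with (-1) in PF by ring.
      assert (NO : forall u : C, u <> 0%C -> (- u)%C <> 0%C).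
      { intros u Hu Eu. apply Hu. replace u with (- - u)%C by ring. rewrite Eu. ring. }
      specialize (PF (NO _ H1) (NO _ H2) (NO _ H3) (NO _ H4)).
      set (Y := (1 - om)%C) in *. set (D1 := (RtoC a * (1 + om) - RtoC l1 * Y)%C) in *.
      set (D2 := (RtoC a * (1 + om) - RtoC l * Y)%C) in *.
      set (D3 := (RtoC a * (1 + om) - RtoC (-1) * Y)%C) in *.
      set (D4 := (RtoC a * (1 + om) - RtoC (- l2) * Y)%C) in *.
      assert (Q : forall u : C, u <> 0%C -> (Y / - u = - (Y / u))%C).
      { intros u Hu. field. exact Hu. }
      rewrite !Q in PF by assumption.
      etransitivity; [|etransitivity; [exact PF|ring]].
      f_equal; [unfold Y; rewrite !RtoC_opp; ring|ring].
Qed.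

Lemma a_plus_neq : a + l <> 0 /\ a + -1 <> 0 /\ a + l1 <> 0 /\ a + - l2 <> 0 /\
  a + - l <> 0 /\ a + 1 <> 0 /\ a + - l1 <> 0 /\ a + l2 <> 0.
Proof. assert (H := ab_range). repeat split; lra. Qed.

Lemma num_neq0_H (om : C) : Im om <> 0 -> num om <> 0%C.
Proof.
  intros H. destruct a_plus_neq as [A1 [A2 [A3 [A4 _]]]]. unfold num.
  repeat apply Cmult_neq_0; apply lin_neq0; assumption.
Qed.

Lemma den_neq0_H (om : C) : Im om <> 0 -> den om <> 0%C.
Proof.
  intros H. destruct a_plus_neq as [_ [_ [_ [_ [A1 [A2 [A3 A4]]]]]]]. unfold den.
  repeat apply Cmult_neq_0; apply lin_neq0; assumption.
Qed.

Lemma Im_scal (r : R) (z : C) : Im (RtoC r * z)%C = r * Im z.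
Proof. unfold Re, Im; simpl. ring. Qed.

Lemma Re_scal (r : R) (z : C) : Re (RtoC r * z)%C = r * Re z.
Proof. unfold Re, Im; simpl. ring. Qed.

Lemma Im_plus (u v : C) : Im (u + v)%C = Im u + Im v.
Proof. reflexivity. Qed.

Lemma Re_plus (u v : C) : Re (u + v)%C = Re u + Re v.
Proof. reflexivity. Qed.

(** In the partial fraction expansion each [hres p] has negative imaginary part on the upper half
    plane, and each coefficient is positive. *)
Lemma gsq_Im_neg (om : C) : 0 < Im om -> Im (gsq om) < 0.
Proof.
  intros H. destruct a_plus_neq as [_ [_ [_ [_ [A1 [A2 [A3 A4]]]]]]].
  destruct residues as [r1 [r2 [r3 [r4 [[R1 [R2 [R3 R4]]] [E _]]]]]].
  assert (N : forall p, a + p <> 0 -> lin p om <> 0%C) by (intros; apply lin_neq0; lra).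
  rewrite E by (apply N; assumption).
  assert (I : forall p, a + p <> 0 -> Im (hres p om) < 0).
  { intros p Hp. specialize (N p Hp). rewrite hres_Im by exact N.
    assert (Hm := Cmod_neq0 _ N). assert (Ha := a_pos).
    apply Ropp_lt_cancel. rewrite Ropp_0. unfold Rdiv.
    rewrite Ropp_mult_distr_l, Ropp_involutive.
    apply Rmult_lt_0_compat; [nra|apply Rinv_0_lt_compat; nra]. }
  rewrite !Im_plus, !Im_scal. assert (I1 := I _ A1). assert (I2 := I _ A2).
  assert (I3 := I _ A3). assert (I4 := I _ A4). simpl (Im (RtoC 1)). nra.
Qed.

Definition regular (om : C) : Prop := num om <> 0%C /\ den om <> 0%C.

Lemma regular_H (om : C) : Im om <> 0 -> regular om.
Proof. intros H. split; [apply num_neq0_H|apply den_neq0_H]; exact H. Qed.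

Lemma hol_lin (p : R) (om : C) : hol_at (lin p) om.
Proof. apply hol_plus; [apply hol_const|apply hol_mult; [apply hol_id|apply hol_const]]. Qed.

Lemma hol_num (om : C) : hol_at num om.
Proof. unfold num. repeat apply hol_mult; apply hol_lin. Qed.

Lemma hol_den (om : C) : hol_at den om.
Proof. unfold den. repeat apply hol_mult; apply hol_lin. Qed.

Lemma hol_gsq (om : C) : den om <> 0%C -> hol_at gsq om.
Proof. intros H. apply hol_mult; [apply hol_num|apply hol_inv; [exact H|apply hol_den]]. Qed.

Lemma gw_sqr (om : C) : (gw om * gw om = gsq om)%C.
Proof. apply csqrt_sqr. Qed.

Lemma gw_H (om : C) : 0 < Im om -> 0 < Re (gw om) /\ Im (gw om) < 0.
Proof.
  intros H. assert (H1 := gsq_Im_neg om H). rewrite <- gw_sqr, Im_sqr in H1.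
  assert (H2 := csqrt_Re (gsq om)). fold (gw om) in H2.
  assert (H3 : Re (gw om) <> 0) by (intros E; rewrite E in H1; lra).
  split; [lra|]. apply Rnot_le_lt. intros H4. assert (0 <= Re (gw om) * Im (gw om)) by (apply Rmult_le_pos; assumption). lra.
Qed.

Lemma hol_gw (om : C) : 0 < Im om -> hol_at gw om.
Proof.
  intros H. apply (hol_sqrt gw gsq).
  - apply locally_Cmod. exists (Im om). split; [exact H|]. intros z Hz.
    assert (Hz2 := Rle_lt_trans _ _ _ (Im_le _) Hz).
    change (Rabs (Im z - Im om) < Im om) in Hz2. apply Rabs_def2 in Hz2.
    assert (Hi : 0 < Im z) by lra.
    apply csqrt_flim; [apply gw_H, Hi|]. apply hol_cont, hol_gsq, den_neq0_H. lra.
  - intros E. assert (H1 := gw_H om H). rewrite E in H1. simpl in H1. lra.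
  - apply filter_forall. intros z. apply gw_sqr.
  - apply hol_gsq, den_neq0_H. lra.
Qed.

Definition rlin (p x : R) : R := (a - p) + x * (a + p).
Definition rnum (x : R) : R := rlin l x * rlin (-1) x * rlin l1 x * rlin (- l2) x.
Definition rden (x : R) : R := rlin (- l) x * rlin 1 x * rlin (- l1) x * rlin l2 x.

Lemma lin_real (p x : R) : lin p (RtoC x) = RtoC (rlin p x).
Proof. unfold lin, rlin. rewrite !RtoC_plus, RtoC_mult, RtoC_plus. reflexivity. Qed.

Lemma num_real (x : R) : num (RtoC x) = RtoC (rnum x).
Proof. unfold num, rnum. rewrite !lin_real, !RtoC_mult. reflexivity. Qed.

Lemma den_real (x : R) : den (RtoC x) = RtoC (rden x).
Proof. unfold den, rden. rewrite !lin_real, !RtoC_mult. reflexivity. Qed.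

Lemma gsq_real (x : R) : rden x <> 0 -> gsq (RtoC x) = RtoC (rnum x / rden x).
Proof. intros H. unfold gsq. rewrite num_real, den_real, RtoC_div by exact H. reflexivity. Qed.

Lemma real_of_Im0 (om : C) : Im om = 0 -> om = RtoC (Re om).
Proof. intros H. apply C_ext; [reflexivity|exact H]. Qed.

Lemma gsq_lower (om : C) : 0 <= Im om -> regular om -> Im (gsq om) <= 0.
Proof.
  intros H [_ Hd]. destruct (Rle_lt_or_eq_dec _ _ H) as [H1|H1].
  - apply Rlt_le, gsq_Im_neg, H1.
  - revert Hd. rewrite (real_of_Im0 om) by auto. intros Hd. rewrite gsq_real; [right; reflexivity|].
    intros E. apply Hd. rewrite den_real, E. reflexivity.
Qed.

Lemma gsq_neq0 (om : C) : regular om -> gsq om <> 0%C.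
Proof.
  intros [H1 H2]. apply Cmult_neq_0; [exact H1|]. intros E.
  assert (E1 := Cinv_r _ H2). rewrite E in E1.
  apply (RtoC_neq 1 R1_neq_R0). rewrite <- E1. ring.
Qed.

Lemma gw_neq0 (om : C) : regular om -> gw om <> 0%C.
Proof. intros H E. apply (gsq_neq0 om H). rewrite <- gw_sqr, E. ring. Qed.

Lemma gw_closed (om : C) : 0 <= Im om -> regular om -> 0 <= Re (gw om) /\ Im (gw om) <= 0.
Proof.
  intros H1 H2. split; [apply csqrt_Re|]. apply csqrt_Im, gsq_lower; assumption.
Qed.

Lemma regular_near (om : C) : regular om -> locally om regular.
Proof.
  intros [H1 H2]. apply filter_and.
  - apply (flim_nonzero num (num om)); [exact H1|apply hol_cont, hol_num].
  - apply (flim_nonzero den (den om)); [exact H2|apply hol_cont, hol_den].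
Qed.

Lemma gw_within (om : C) : 0 <= Im om -> regular om ->
  filterlim gw (within (fun z => 0 <= Im z) (locally om)) (locally (gw om)).
Proof.
  intros H1 H2. apply csqrt_flim_lower.
  - apply gsq_neq0, H2.
  - apply gsq_lower; assumption.
  - unfold within. apply filter_imp with (2 := regular_near om H2).
    intros z Hz Hi. apply gsq_lower; assumption.
  - apply (filterlim_filter_le_1 (F := locally om)).
    + intros P HP. unfold within. apply filter_imp with (2 := HP). auto.
    + apply hol_cont, hol_gsq, H2.
Qed.

(* With [c = 1 / (4 a)], [e = -1] this is the coefficient of [phi_1] with
   respect to [d om], and with [c = i / (4 a)], [e = 1] that of [phi_2]. *)
Definition form (c : C) (e : R) (om : C) : C := (c * (/ gw om + RtoC e * gw om) / om)%C.

Lemma hol_form (c : C) (e : R) (om : C) : 0 < Im om -> hol_at (form c e) om.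
Proof.
  intros H. assert (Hw : gw om <> 0%C) by (apply gw_neq0, regular_H; lra).
  apply hol_mult.
  - apply hol_mult; [apply hol_const|]. apply hol_plus.
    + apply hol_inv; [exact Hw|apply hol_gw, H].
    + apply hol_mult; [apply hol_const|apply hol_gw, H].
  - apply hol_inv; [apply Cneq0_Im; lra|apply hol_id].
Qed.

Lemma form_within (c : C) (e : R) (om : C) : 0 <= Im om -> om <> 0%C -> regular om ->
  filterlim (form c e) (within (fun z => 0 <= Im z) (locally om)) (locally (form c e om)).
Proof.
  intros H1 H0 H2. assert (Hw := gw_neq0 om H2). assert (Hc := gw_within om H1 H2).
  assert (Hi : filterlim (fun z : C => z) (within (fun z => 0 <= Im z) (locally om)) (locally om)).
  { intros P HP. unfold filtermap, within. apply filter_imp with (2 := HP). auto. }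
  unfold form. flim; assumption.
Qed.

(** The zeros and poles of [gsq] are real and simple, so [gsq] and its inverse are of order
    [1 / Im om]. The partial fractions give this with one constant for all of them, without a local
    study. A square root is then of order [1 / sqrt (Im om)]. *)
Lemma gsq_bound : exists B, 0 <= B /\ forall om M, 0 < Im om -> 1 <= M -> Cmod (1 - om) <= M ->
  Im om <= M -> Cmod (gsq om) <= B * M / Im om /\ Cmod (den om / num om) <= B * M / Im om.
Proof.
  destruct a_plus_neq as [A1 [A2 [A3 [A4 [A5 [A6 [A7 A8]]]]]]].
  destruct residues as [r1 [r2 [r3 [r4 [[R1 [R2 [R3 R4]]] [E1 E2]]]]]].
  assert (P : forall r p, 0 < r -> a + p <> 0 -> 0 <= r / Rabs (a + p)).
  { intros r p Hr Hp. apply Rlt_le, Rdiv_lt_0_compat; [exact Hr|apply Rabs_pos_lt, Hp]. }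
  assert (P1 := P _ _ R1 A7). assert (P2 := P _ _ R2 A5). assert (P3 := P _ _ R3 A6). assert (P4 := P _ _ R4 A8).
  assert (Q1 := P _ _ R1 A3). assert (Q2 := P _ _ R2 A1). assert (Q3 := P _ _ R3 A2). assert (Q4 := P _ _ R4 A4).
  set (B1 := r1 / Rabs (a + - l1) + r2 / Rabs (a + - l) + r3 / Rabs (a + 1) + r4 / Rabs (a + l2)).
  set (B2 := r1 / Rabs (a + l1) + r2 / Rabs (a + l) + r3 / Rabs (a + -1) + r4 / Rabs (a + - l2)).
  assert (HB1 : 0 <= B1) by (unfold B1; lra). assert (HB2 : 0 <= B2) by (unfold B2; lra).
  exists (1 + B1 + B2). split; [lra|]. intros om M Hi HM1 HM Him.
  assert (N : forall p, a + p <> 0 -> lin p om <> 0%C) by (intros; apply lin_neq0; lra).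
  assert (One : 1 <= M / Im om).
  { apply Rmult_le_reg_r with (Im om); [exact Hi|]. replace (M / Im om * Im om) with M by (field; lra). lra. }
  assert (T : forall r p, 0 < r -> a + p <> 0 -> Cmod (RtoC r * hres p om) <= r / Rabs (a + p) * (M / Im om)).
  { intros r p Hr Hp. rewrite Cmod_mult, Cmod_R, Rabs_right by lra.
    apply Rle_trans with (r * (M / Rabs (a + p) / Im om)).
    - apply Rmult_le_compat_l; [lra|]. apply hres_bound; assumption.
    - right. field. split; [lra|]. assert (H := Rabs_pos_lt _ Hp). lra. }
  assert (Z : 1 + B1 + B2 >= 0) by lra.
  split.
  - rewrite E1 by (apply N; assumption).
    assert (T1 := T _ _ R1 A7). assert (T2 := T _ _ R2 A5). assert (T3 := T _ _ R3 A6). assert (T4 := T _ _ R4 A8).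
    apply Rle_trans with (1 * (M / Im om) + B1 * (M / Im om)).
    + unfold B1. rewrite Rmult_1_l, !Rmult_plus_distr_r.
      repeat (eapply Rle_trans; [apply Cmod_triangle|]).
      assert (C1 := Cmod_1).
      assert (S1 := Cmod_triangle (1 + RtoC r1 * hres (RtoC (- l1)) om + RtoC r2 * hres (RtoC (- l)) om) (RtoC r3 * hres (RtoC 1) om)).
      assert (S2 := Cmod_triangle (1 + RtoC r1 * hres (RtoC (- l1)) om) (RtoC r2 * hres (RtoC (- l)) om)).
      assert (S3 := Cmod_triangle 1 (RtoC r1 * hres (RtoC (- l1)) om)). lra.
    + unfold Rdiv. nra.
  - rewrite E2 by (apply N; assumption).
    assert (T1 := T _ _ R1 A3). assert (T2 := T _ _ R2 A1). assert (T3 := T _ _ R3 A2). assert (T4 := T _ _ R4 A4).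
    apply Rle_trans with (1 * (M / Im om) + B2 * (M / Im om)).
    + unfold B2. rewrite Rmult_1_l, !Rmult_plus_distr_r. unfold Cminus.
      rewrite <- Cmod_opp in T1, T2, T3, T4.
      repeat (eapply Rle_trans; [apply Cmod_triangle|]).
      assert (C1 := Cmod_1).
      assert (S1 := Cmod_triangle (1 + - (RtoC r1 * hres (RtoC l1) om) + - (RtoC r2 * hres (RtoC l) om)) (- (RtoC r3 * hres (RtoC (-1)) om))).
      assert (S2 := Cmod_triangle (1 + - (RtoC r1 * hres (RtoC l1) om)) (- (RtoC r2 * hres (RtoC l) om))).
      assert (S3 := Cmod_triangle 1 (- (RtoC r1 * hres (RtoC l1) om))). lra.
    + unfold Rdiv. nra.
Qed.

Lemma form_bound (c : C) (e : R) : Rabs e <= 1 ->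
  forall x0 : R, x0 <> 0 -> exists r K, 0 < r /\ 0 <= K /\
  forall z, 0 < Im z -> Cmod (z - RtoC x0) < r -> Cmod (form c e z) <= K / sqrt (Im z).
Proof.
  intros He x0 Hx0. destruct gsq_bound as [B [HB H]].
  assert (Hp : 0 < Rabs x0) by (apply Rabs_pos_lt, Hx0).
  set (M := 1 + 2 * Rabs x0).
  (* The radius keeps [z] at distance at least [Rabs x0 / 2] from 0, which bounds the factor [/ z]
     of the form; [2 * sqrt (B * M) / sqrt (Im z)] bounds [/ gw z + e * gw z]. *)
  exists (Rabs x0 / 2), (Cmod c * (2 * sqrt (B * M)) / (Rabs x0 / 2)).
  assert (HK := Cmod_ge_0 c). assert (Hs := sqrt_pos (B * M)).
  split; [lra|split].
  { apply Rmult_le_pos; [apply Rmult_le_pos; lra|apply Rlt_le, Rinv_0_lt_compat; lra]. }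
  intros z Hz Hd.
  assert (Z1 : Cmod z < 2 * Rabs x0).
  { assert (T := Cmod_triangle (z - RtoC x0) (RtoC x0)). rewrite Cmod_R in T.
    replace (z - RtoC x0 + RtoC x0)%C with z in T by ring. lra. }
  assert (Z2 : Rabs x0 / 2 <= Cmod z).
  { assert (T := Cmod_triangle (RtoC x0 - z) z). rewrite Cmod_minus_sym in T.
    replace (RtoC x0 - z + z)%C with (RtoC x0) in T by ring. rewrite Cmod_R in T. lra. }
  assert (Z3 := Im_le z). rewrite Rabs_right in Z3 by lra.
  destruct (H z M) as [H1 H2]; [exact Hz|unfold M; lra| |unfold M; lra|].
  { unfold Cminus. eapply Rle_trans; [apply Cmod_triangle|]. rewrite Cmod_opp, Cmod_1. unfold M. lra. }
  assert (Hw : gw z <> 0%C) by (apply gw_neq0, regular_H; lra).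
  assert (Hsi : 0 < sqrt (Im z)) by (apply sqrt_lt_R0, Hz).
  assert (HBM : 0 <= B * M) by (apply Rmult_le_pos; [exact HB|unfold M; lra]).
  assert (SQ : forall u : C, Cmod (u * u) <= B * M / Im z -> Cmod u <= sqrt (B * M) / sqrt (Im z)).
  { intros u Hu. rewrite <- sqrt_div by assumption. rewrite Cmod_mult in Hu.
    rewrite <- (sqrt_square (Cmod u)) by apply Cmod_ge_0. apply sqrt_le_1_alt, Hu. }
  assert (W1 : Cmod (gw z) <= sqrt (B * M) / sqrt (Im z)) by (apply SQ; rewrite gw_sqr; exact H1).
  assert (W2 : Cmod (/ gw z) <= sqrt (B * M) / sqrt (Im z)).
  { apply SQ. replace (/ gw z * / gw z)%C with (/ (gw z * gw z))%C by (field; exact Hw).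
    rewrite gw_sqr. unfold gsq. replace (/ (num z / den z))%C with (den z / num z)%C; [exact H2|].
    field. split; [apply den_neq0_H|apply num_neq0_H]; lra. }
  unfold form, Cdiv. rewrite !Cmod_mult, Cmod_inv by (apply Cneq0_Im; lra).
  apply Rle_trans with (Cmod c * (2 * (sqrt (B * M) / sqrt (Im z))) * / (Rabs x0 / 2)).
  - apply Rmult_le_compat.
    + apply Rmult_le_pos; apply Cmod_ge_0.
    + apply Rlt_le, Rinv_0_lt_compat. lra.
    + apply Rmult_le_compat_l; [exact HK|].
      eapply Rle_trans; [apply Cmod_triangle|]. rewrite Cmod_mult, Cmod_R.
      assert (Rabs e * Cmod (gw z) <= 1 * Cmod (gw z)) by (apply Rmult_le_compat_r; [apply Cmod_ge_0|exact He]). lra.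
    + apply Rinv_le_contravar; lra.
  - right. field. split; lra.
Qed.

Lemma within_upper (om : C) (P : C -> Prop) :
  within (fun z => 0 <= Im z) (locally om) P -> within (fun z => 0 < Im z) (locally om) P.
Proof. unfold within. apply filter_imp. intros z H Hz. apply H, Rlt_le, Hz. Qed.

(** * The branches [H1] and [H2] on the closed half plane and their monotonicity *)

Definition height (c : C) (e : R) : C -> R := ext_prim (form c e).

Lemma height_cont (c : C) (e : R) (om : C) : Rabs e <= 1 -> 0 <= Im om -> om <> 0%C ->
  filterlim (height c e) (within (fun z => 0 <= Im z) (locally om)) (locally (height c e om)).
Proof.
  intros He. apply ext_prim_cont; [intros z Hz; apply hol_form, Hz|apply form_bound, He].
Qed.

Lemma height_diff (c : C) (e : R) (om : C) : Rabs e <= 1 -> 0 <= Im om -> om <> 0%C -> regular om ->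
  forall eps, 0 < eps -> locally om (fun z => 0 <= Im z ->
    Rabs (height c e z - height c e om - Re (form c e om * (z - om))%C) <= eps * Cmod (z - om)).
Proof.
  intros He H1 H0 H2. apply ext_prim_diff; [intros z Hz; apply hol_form, Hz|apply form_bound, He|exact H1|exact H0|].
  apply (filterlim_filter_le_1 (F := within (fun z => 0 <= Im z) (locally om))).
  - intros P. apply within_upper.
  - apply form_within; assumption.
Qed.

(** At a real point [height] is differentiable only from within the closed half plane, so the usual
    chain rule does not apply. The curve is required to stay in that half plane near [t], and the
    expansions are composed by hand. *)
Lemma height_curve (c : C) (e : R) (g : R -> C) (t : R) (d : C) : Rabs e <= 1 ->
  rderiv g t d -> locally t (fun s => 0 <= Im (g s)) -> g t <> 0%C -> regular (g t) ->
  is_derive (fun s => height c e (g s)) t (Re (form c e (g t) * d)%C).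
Proof.
  intros He Hg Hi H0 H2. assert (Hc := rderiv_cont _ _ _ Hg).
  assert (D := height_diff c e (g t) He (locally_singleton _ _ Hi) H0 H2).
  apply is_derive_eps. intros eps Heps.
  destruct Hg as [q [Hq [Eq Hg]]].
  set (k := form c e (g t)) in *.
  set (M := 1 + Cmod d + Cmod k).
  assert (HM : 0 < M) by (assert (A1 := Cmod_ge_0 d); assert (A2 := Cmod_ge_0 k); unfold M; lra).
  assert (He2 : 0 < eps / (2 * M)) by (apply Rdiv_lt_0_compat; lra).
  assert (He1 : 0 < Rmin 1 (eps / (2 * M))) by (apply Rmin_glb_lt; lra).
  rewrite (flim_Cmod (F := locally t)) in Hq.
  apply filter_imp with (2 := filter_and _ _ (filter_and _ _ (Hq _ He1) Hg) (filter_and _ _ Hi (Hc _ (D _ He2)))).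
  intros s [[E1 E2] [E3 E4]]. specialize (E4 E3). rewrite E2 in E4.
  assert (A0 := Rmin_l 1 (eps / (2 * M))). assert (A1 := Rmin_r 1 (eps / (2 * M))).
  assert (Hqd : Cmod (q s) <= M).
  { replace (q s) with ((q s - d) + d)%C by ring. eapply Rle_trans; [apply Cmod_triangle|].
    assert (A2 := Cmod_ge_0 k). unfold M. lra. }
  assert (T := Rabs_triang (height c e (g s) - height c e (g t) - Re (k * (q s * RtoC (s - t)))%C) (Re (k * ((q s - d) * RtoC (s - t)))%C)).
  assert (Sh := Re_shift k (q s) d (s - t)).
  assert (T2 := Re_le (k * ((q s - d) * RtoC (s - t)))%C).
  rewrite !Cmod_mult in T2. rewrite Cmod_R in T2. rewrite !Cmod_mult, Cmod_R in E4.
  set (h := Rabs (s - t)) in *. assert (Hh : 0 <= h) by apply Rabs_pos.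
  assert (K1 : Cmod k * (Cmod (q s - d) * h) <= M * (eps / (2 * M) * h)).
  { apply Rmult_le_compat.
    - apply Cmod_ge_0.
    - apply Rmult_le_pos; [apply Cmod_ge_0|exact Hh].
    - assert (A2 := Cmod_ge_0 d). unfold M. lra.
    - apply Rmult_le_compat_r; lra. }
  assert (K2 : eps / (2 * M) * (Cmod (q s) * h) <= eps / (2 * M) * (M * h)).
  { apply Rmult_le_compat_l; [lra|]. apply Rmult_le_compat_r; assumption. }
  replace (M * (eps / (2 * M) * h)) with (eps / 2 * h) in K1 by (field; lra).
  replace (eps / (2 * M) * (M * h)) with (eps / 2 * h) in K2 by (field; lra).
  replace (height c e (g s) - height c e (g t) - (s - t) * Re (k * d)%C) with
    (height c e (g s) - height c e (g t) - Re (k * (q s * RtoC (s - t)))%C + Re (k * ((q s - d) * RtoC (s - t)))%C)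
    by (rewrite Sh; ring).
  lra.
Qed.

Lemma height_flim {T : Type} {F : (T -> Prop) -> Prop} {FF : Filter F}
  (c : C) (e : R) (g : T -> C) (om : C) :
  Rabs e <= 1 -> 0 <= Im om -> om <> 0%C -> F (fun x => 0 <= Im (g x)) ->
  filterlim g F (locally om) ->
  filterlim (fun x => height c e (g x)) F (locally (height c e om)).
Proof.
  intros He H1 H0 Hg Hl'. eapply filterlim_comp with (2 := height_cont c e om He H1 H0).
  intros P HP. unfold filtermap. specialize (Hl' _ HP). unfold filtermap in Hl'.
  apply filter_imp with (2 := filter_and _ _ Hg Hl'). intros x [A1 A2]. apply A2, A1.
Qed.

Definition cc1 : C := RtoC (/ (4 * a)).
Definition cc2 : C := (Ci * RtoC (/ (4 * a)))%C.
Definition form1 : C -> C := form cc1 (-1).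
Definition form2 : C -> C := form cc2 1.
Definition H1 : C -> R := height cc1 (-1).
Definition H2 : C -> R := height cc2 1.

Lemma Rabs_m1 : Rabs (-1) <= 1.
Proof. rewrite Rabs_left; lra. Qed.

Lemma Rabs_p1 : Rabs 1 <= 1.
Proof. rewrite Rabs_right; lra. Qed.

Lemma inv4a_pos : 0 < / (4 * a).
Proof. apply Rinv_0_lt_compat. assert (H := a_pos). lra. Qed.

Lemma Cinv_parts (u : C) : u <> 0%C ->
  Re (/ u)%C = Re u / (Cmod u * Cmod u) /\ Im (/ u)%C = - Im u / (Cmod u * Cmod u).
Proof.
  intros Hu. rewrite Cmod_sqr. split; unfold Re, Im; simpl; f_equal; f_equal; ring.
Qed.

(** [- Ci * om] is the velocity along the half circle through [om], from left to right. In this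
    direction the form has real part [Im (/ w - w) / (4 * a)] with [w = gw om], positive because
    [Im w < 0]. *)
Lemma form1_turn (om : C) : 0 < Im om -> 0 < Re (form1 om * (- Ci * om))%C.
Proof.
  intros H. destruct (gw_H om H) as [A1 A2].
  assert (Hw : gw om <> 0%C) by (apply gw_neq0, regular_H; lra).
  assert (Ho : om <> 0%C) by (apply Cneq0_Im; lra).
  unfold form1, form, cc1.
  replace (RtoC (/ (4 * a)) * (/ gw om + RtoC (-1) * gw om) / om * (- Ci * om))%C
    with (RtoC (/ (4 * a)) * (- Ci * (/ gw om - gw om)))%C by (field; auto).
  rewrite Re_scal. apply Rmult_lt_0_compat; [apply inv4a_pos|].
  rewrite Re_mCi,  (proj2 (Cinv_parts _ Hw)).
  assert (0 < - Im (gw om) / (Cmod (gw om) * Cmod (gw om))); [|lra].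
  assert (Hm := Cmod_neq0 _ Hw). apply Rdiv_lt_0_compat; [lra|nra].
Qed.

(** Here the real part is [Re (/ w + w) / (4 * a)], positive because [Re w > 0]. *)
Lemma form2_turn (om : C) : 0 < Im om -> 0 < Re (form2 om * (- Ci * om))%C.
Proof.
  intros H. destruct (gw_H om H) as [A1 A2].
  assert (Hw : gw om <> 0%C) by (apply gw_neq0, regular_H; lra).
  assert (Ho : om <> 0%C) by (apply Cneq0_Im; lra).
  unfold form2, form, cc2.
  replace (Ci * RtoC (/ (4 * a)) * (/ gw om + 1 * gw om) / om * (- Ci * om))%C
    with (RtoC (/ (4 * a)) * (- (Ci * Ci) * (/ gw om + gw om)))%C by (field; auto).
  rewrite Re_scal. apply Rmult_lt_0_compat; [apply inv4a_pos|].
  rewrite Re_mCiCi, Re_plus,  (proj1 (Cinv_parts _ Hw)).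
  assert (0 < Re (gw om) / (Cmod (gw om) * Cmod (gw om))); [|lra].
  assert (Hm := Cmod_neq0 _ Hw). apply Rdiv_lt_0_compat; [lra|nra].
Qed.

(* The upper half circle of radius [k], parametrized by [cos (arg om)]. *)
Definition arc (k s : R) : C := (k * s, k * sqrt (1 - s ^ 2)).

Lemma arc_Im (k s : R) : 0 < k -> 0 <= Im (arc k s).
Proof. intros H. apply Rmult_le_pos; [lra|apply sqrt_pos]. Qed.

Lemma arc_flim {T : Type} {F : (T -> Prop) -> Prop} {FF : Filter F} (k s : T -> R) (k0 s0 : R) :
  filterlim k F (locally k0) -> filterlim s F (locally s0) ->
  filterlim (fun x => arc (k x) (s x)) F (locally (arc k0 s0)).
Proof.
  intros Hk Hs. apply flim_pairC; apply flim_Rmult; try assumption.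
  apply (flim_Rcomp (fun s => sqrt (1 - s ^ 2)) s s0); [|exact Hs].
  apply (continuous_sqrt_comp (fun s => 1 - s ^ 2)).
  apply (ex_derive_continuous (K := R_AbsRing) (V := R_NormedModule)). auto_derive. auto.
Qed.

Lemma arc_neq0 (k s : R) : 0 < k -> -1 <= s <= 1 -> arc k s <> 0%C.
Proof.
  intros Hk Hs E. injection E as E1 E2.
  assert (s = 0) by (apply Rmult_integral in E1; lra). subst s.
  change (k * sqrt (1 - 0 ^ 2) = 0) in E2. replace (1 - 0 ^ 2) with 1 in E2 by ring. rewrite sqrt_1 in E2. lra.
Qed.

Lemma arc_m1 (k : R) : arc k (-1) = RtoC (- k).
Proof. unfold arc. replace (1 - (-1) ^ 2) with 0 by ring. rewrite sqrt_0. apply C_ext; simpl; ring. Qed.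

Lemma arc_p1 (k : R) : arc k 1 = RtoC k.
Proof. unfold arc. replace (1 - 1 ^ 2) with 0 by ring. rewrite sqrt_0. apply C_ext; simpl; ring. Qed.

Lemma arc_surj (om : C) : 0 <= Im om -> om <> 0%C ->
  -1 <= Re om / Cmod om <= 1 /\ arc (Cmod om) (Re om / Cmod om) = om.
Proof.
  intros Hi H0. assert (Hm := Cmod_neq0 _ H0). assert (Hs := Cmod_sqr om).
  set (s := Re om / Cmod om). assert (E : Re om = Cmod om * s) by (unfold s; field; lra).
  assert (Hs1 : -1 <= s <= 1).
  { assert (B := Re_le om). apply Rabs_le_between in B.
    split; apply Rmult_le_reg_l with (Cmod om); try exact Hm; lra. }
  split; [exact Hs1|]. apply C_ext; [symmetry; exact E|].
  change (Cmod om * sqrt (1 - s ^ 2) = Im om).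
  assert (Hq : 0 <= 1 - s ^ 2) by nra.
  assert (S := sqrt_sqrt _ Hq). assert (S0 := sqrt_pos (1 - s ^ 2)).
  assert (P0 : 0 <= Cmod om * sqrt (1 - s ^ 2)) by nra.
  apply Rsqr_inj; [exact P0|exact Hi|]. unfold Rsqr.
  rewrite E in Hs.
  replace (Cmod om * sqrt (1 - s ^ 2) * (Cmod om * sqrt (1 - s ^ 2))) with
    (Cmod om * Cmod om * (sqrt (1 - s ^ 2) * sqrt (1 - s ^ 2))) by ring.
  rewrite S. lra.
Qed.

(** At the end points, which will be branch points or real points of an arc, only continuity is
    available. The middle third gives the strict inequality, the outer thirds give weak ones by
    continuity. *)
Lemma strict_incr (f df : R -> R) (x y : R) : x < y ->
  (forall t, x < t < y -> is_derive f t (df t)) ->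
  (forall t, x <= t <= y -> continuity_pt f t) ->
  (forall t, x < t < y -> 0 < df t) -> f x < f y.
Proof.
  intros Hxy H1' H2' H3'.
  assert (M : forall u v, x < u < v /\ v < y -> f u < f v).
  { intros u v [Huv Hv]. destruct (mvt_closed f df u v) as [c0 [Hc E]]; [lra| |].
    - intros t Ht. apply H1'. lra.
    - assert (0 < df c0 * (v - u)); [|lra]. apply Rmult_lt_0_compat; [apply H3'|]; lra. }
  set (m1 := x + (y - x) / 3). set (m2 := x + 2 * (y - x) / 3).
  assert (Hm : f m1 < f m2) by (apply M; unfold m1, m2; lra).
  assert (L : f x <= f m1).
  { destruct (MVT_gen f x m1 df) as [c0 [Hc E]];
      rewrite ?Rmin_left, ?Rmax_right in * by (unfold m1; lra).
    - intros t Ht. apply H1'. unfold m1 in Ht. lra.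
    - intros t Ht. apply H2'. unfold m1 in Ht. lra.
    - apply Rnot_lt_le. intros Hlt.
      assert (Hco := H2' x ltac:(lra)). apply continuity_pt_filterlim in Hco.
      rewrite (flim_Rabs (F := locally x)) in Hco.
      specialize (Hco (f x - f m1) ltac:(lra)). apply locally_Rabs in Hco.
      destruct Hco as [d [Hd Hco]].
      set (u := x + Rmin (d / 2) ((y - x) / 6)).
      assert (Q1 := Rmin_l (d / 2) ((y - x) / 6)). assert (Q2 := Rmin_r (d / 2) ((y - x) / 6)).
      assert (Q3 : 0 < Rmin (d / 2) ((y - x) / 6)) by (apply Rmin_glb_lt; lra).
      assert (Hu := Hco u). unfold u in Hu at 1. rewrite Rabs_right in Hu by lra.
      specialize (Hu ltac:(lra)). apply Rabs_def2 in Hu.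
      assert (f u < f m1) by (apply M; unfold u, m1; lra). lra. }
  assert (U : f m2 <= f y).
  { apply Rnot_lt_le. intros Hlt.
    assert (Hco := H2' y ltac:(lra)). apply continuity_pt_filterlim in Hco.
    rewrite (flim_Rabs (F := locally y)) in Hco.
    specialize (Hco (f m2 - f y) ltac:(lra)). apply locally_Rabs in Hco.
    destruct Hco as [d [Hd Hco]].
    set (u := y - Rmin (d / 2) ((y - x) / 6)).
    assert (Q1 := Rmin_l (d / 2) ((y - x) / 6)). assert (Q2 := Rmin_r (d / 2) ((y - x) / 6)).
    assert (Q3 : 0 < Rmin (d / 2) ((y - x) / 6)) by (apply Rmin_glb_lt; lra).
    assert (Hu := Hco u). unfold u in Hu at 1. rewrite Rabs_left in Hu by lra.
    specialize (Hu ltac:(lra)). apply Rabs_def2 in Hu.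
    assert (f m2 < f u) by (apply M; unfold u, m2; lra). lra. }
  lra.
Qed.

Lemma strict_decr (f df : R -> R) (x y : R) : x < y ->
  (forall t, x < t < y -> is_derive f t (df t)) ->
  (forall t, x <= t <= y -> continuity_pt f t) ->
  (forall t, x < t < y -> df t < 0) -> f y < f x.
Proof.
  intros Hxy H1' H2' H3'. apply Ropp_lt_cancel.
  apply (strict_incr (fun t => - f t) (fun t => - df t)); [exact Hxy| | |].
  - intros t Ht. apply (is_derive_opp (K := R_AbsRing) (V := R_NormedModule)). apply H1', Ht.
  - intros t Ht. apply continuity_pt_opp, H2', Ht.
  - intros t Ht. specialize (H3' t Ht). lra.
Qed.

Lemma const_deriv0 (f : R -> R) (x y : R) : x <= y ->
  (forall t, x < t < y -> is_derive f t 0) ->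
  (forall t, x <= t <= y -> continuity_pt f t) -> f y = f x.
Proof.
  intros Hxy A1 A2. destruct (MVT_gen f x y (fun _ => 0)) as [c0 [_ E]]; [| |lra];
    rewrite Rmin_left, Rmax_right by exact Hxy; assumption.
Qed.

Lemma height_continuity_pt (c : C) (e : R) (g : R -> C) (t : R) : Rabs e <= 1 ->
  (forall s, 0 <= Im (g s)) -> g t <> 0%C -> filterlim g (locally t) (locally (g t)) ->
  continuity_pt (fun s => height c e (g s)) t.
Proof.
  intros He Hg H0 Hc. apply continuity_pt_filterlim.
  apply (height_flim (F := locally t)); [exact He|apply Hg|exact H0| |exact Hc].
  apply filter_forall, Hg.
Qed.

(** As [s] is the cosine of the argument, the velocity of [arc k] is [- Ci * om] divided by
    [sqrt (1 - s ^ 2)]. It is infinite at the two real ends, where continuity replaces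
    differentiability. *)
Lemma arc_strict (c : C) (e : R) (k s1 s2 : R) : Rabs e <= 1 ->
  (forall om, 0 < Im om -> 0 < Re (form c e om * (- Ci * om))%C) ->
  0 < k -> -1 <= s1 < s2 -> s2 <= 1 -> height c e (arc k s1) < height c e (arc k s2).
Proof.
  intros He Ht Hk Hs1 Hs2.
  assert (Hq : forall s, s1 < s < s2 -> 0 < sqrt (1 - s ^ 2)) by (intros s Hs; apply sqrt_lt_R0; nra).
  apply (strict_incr (fun s => height c e (arc k s))
    (fun s => Re (form c e (arc k s) * ((- Ci * arc k s) * RtoC (/ sqrt (1 - s ^ 2))))%C)); [lra| | |].
  - intros s Hs. assert (Hq' := Hq s Hs).
    apply (height_curve c e (arc k)).
    + exact He.
    + apply rderiv_parts. split.
      * apply (is_derive_eq _ _ k).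
        -- unfold arc; simpl. apply (is_derive_eq _ _ (k * 1)); [|ring]. apply is_derive_scal, is_derive_id_R.
        -- unfold arc, Re, Im; simpl. simpl in Hq'. field. lra.
      * apply (is_derive_eq _ _ (k * (- (2 * s) / (2 * sqrt (1 - s ^ 2))))).
        -- unfold arc; simpl. apply is_derive_scal.
           apply (is_derive_sqrt (fun s => 1 - s * (s * 1))); [|nra].
           auto_derive; [auto|ring].
        -- unfold arc, Re, Im; simpl. simpl in Hq'. field. lra.
    + apply filter_forall. intros t. apply arc_Im, Hk.
    + apply arc_neq0; lra.
    + apply regular_H. assert (0 < Im (arc k s)) by (apply Rmult_lt_0_compat; assumption). lra.
  - intros s Hs. apply (height_continuity_pt c e (arc k)); [exact He|intros; apply arc_Im, Hk|apply arc_neq0; lra|].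
    apply (arc_flim (F := locally s) (fun _ => k) (fun s => s)); [apply flim_const|apply flim_id].
  - intros s Hs. assert (Hq' := Hq s Hs).
    rewrite Cmult_assoc, Cmult_comm, Re_scal.
    apply Rmult_lt_0_compat; [apply Rinv_0_lt_compat, Hq'|].
    apply Ht. apply Rmult_lt_0_compat; assumption.
Qed.

(** * Boundary values and the period conditions *)

Definition om_of (z : R) : R := (z - a) / (z + a).
Definition rg1 (z : R) : R := (z - l) * (z + 1) * (z - l1) * (z + l2).
Definition rg2 (z : R) : R := (z + l) * (z - 1) * (z + l1) * (z - l2).
Definition rsq (z : R) : R := rg1 z / rg2 z.
(** On the real axis the heights are studied in [z], the variable of the period integrals. *)
Definition K1 (z : R) : R := H1 (RtoC (om_of z)).
Definition K2 (z : R) : R := H2 (RtoC (om_of z)).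
(** The odd part of [rg1] divided by [z], since [rg2 z = rg1 (- z)]. It is the bracket in the
    numerator of [xi1_integrand]. *)
Definition odd_part (z : R) : R :=
  (1 - l - l1 + l2) * z ^ 2 + l * l1 - l * l2 - l1 * l2 + l * l1 * l2.

Lemma rlin_om_of (p z : R) : z + a <> 0 -> rlin p (om_of z) = 2 * a / (z + a) * (z - p).
Proof. intros H. unfold rlin, om_of. field. exact H. Qed.

Lemma rnum_om_of (z : R) : z + a <> 0 -> rnum (om_of z) = (2 * a / (z + a)) ^ 4 * rg1 z.
Proof. intros H. unfold rnum, rg1. rewrite !rlin_om_of by exact H. ring. Qed.

Lemma rden_om_of (z : R) : z + a <> 0 -> rden (om_of z) = (2 * a / (z + a)) ^ 4 * rg2 z.
Proof. intros H. unfold rden, rg2. rewrite !rlin_om_of by exact H. ring. Qed.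

Lemma scale_neq0 (z : R) : z + a <> 0 -> (2 * a / (z + a)) ^ 4 <> 0.
Proof.
  intros H. apply pow_nonzero. unfold Rdiv.
  apply Rmult_integral_contrapositive_currified; [assert (Ha := a_pos); lra|].
  apply Rinv_neq_0_compat, H.
Qed.

Lemma gsq_om_of (z : R) : z + a <> 0 -> rg2 z <> 0 -> gsq (RtoC (om_of z)) = RtoC (rsq z).
Proof.
  intros H Hg. assert (Hs := scale_neq0 z H). rewrite gsq_real.
  - rewrite rnum_om_of, rden_om_of by exact H. unfold rsq. f_equal.
    set (k := (2 * a / (z + a)) ^ 4) in *. field. split; assumption.
  - rewrite rden_om_of by exact H. apply Rmult_integral_contrapositive_currified; assumption.
Qed.

Lemma regular_om_of (z : R) : z + a <> 0 ->
  (regular (RtoC (om_of z)) <-> rg1 z <> 0 /\ rg2 z <> 0).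
Proof.
  intros H. assert (Hs := scale_neq0 z H). unfold regular.
  rewrite num_real, den_real, rnum_om_of, rden_om_of by exact H. split.
  - intros [A1 A2]. split; intros E; [apply A1|apply A2]; rewrite E, Rmult_0_r; reflexivity.
  - intros [A1 A2]. split; apply RtoC_neq, Rmult_integral_contrapositive_currified; assumption.
Qed.

Lemma csqrt_pos (r : R) : 0 < r -> csqrt (RtoC r) = RtoC (sqrt r).
Proof.
  intros H. unfold csqrt. rewrite Cmod_R, Rabs_right by lra. simpl.
  destruct (Rlt_dec 0 0) as [H0|H0]; [lra|].
  replace ((r + r) / 2) with r by field. replace ((r - r) / 2) with 0 by field.
  rewrite sqrt_0. apply C_ext; simpl; ring.
Qed.

Lemma csqrt_neg (r : R) : r < 0 -> csqrt (RtoC r) = (- Ci * RtoC (sqrt (- r)))%C.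
Proof.
  intros H. unfold csqrt. rewrite Cmod_R, Rabs_left by lra. simpl.
  destruct (Rlt_dec 0 0) as [H0|H0]; [lra|].
  replace ((- r + r) / 2) with 0 by field. replace ((- r - r) / 2) with (- r) by field.
  rewrite sqrt_0. apply C_ext; unfold Re, Im; simpl; ring.
Qed.

Lemma gw_om_pos (z : R) : z + a <> 0 -> rg2 z <> 0 -> 0 < rsq z ->
  gw (RtoC (om_of z)) = RtoC (sqrt (rsq z)).
Proof. intros H Hg Hr. unfold gw. rewrite gsq_om_of by assumption. apply csqrt_pos, Hr. Qed.

Lemma gw_om_neg (z : R) : z + a <> 0 -> rg2 z <> 0 -> rsq z < 0 ->
  gw (RtoC (om_of z)) = (- Ci * RtoC (sqrt (- rsq z)))%C.
Proof. intros H Hg Hr. unfold gw. rewrite gsq_om_of by assumption. apply csqrt_neg, Hr. Qed.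

Lemma om_of_deriv (z : R) : z + a <> 0 ->
  rderiv (fun z => RtoC (om_of z)) z (RtoC (2 * a / (z + a) ^ 2)).
Proof.
  intros H. apply rderiv_parts. split; simpl.
  - unfold om_of. auto_derive; [exact H|]. field. exact H.
  - apply is_derive_const_R.
Qed.

Lemma om_of_neq0 (z : R) : z + a <> 0 -> z <> a -> RtoC (om_of z) <> 0%C.
Proof.
  intros H1' H2'. apply RtoC_neq. unfold om_of, Rdiv.
  apply Rmult_integral_contrapositive_currified; [lra|]. apply Rinv_neq_0_compat, H1'.
Qed.

Lemma axis_deriv (c : C) (e z : R) : Rabs e <= 1 -> z + a <> 0 -> z <> a -> rg1 z <> 0 -> rg2 z <> 0 ->
  is_derive (fun z => height c e (RtoC (om_of z))) z
    (Re (form c e (RtoC (om_of z)) * RtoC (2 * a / (z + a) ^ 2))%C).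
Proof.
  intros He Hz Hza A1 A2. apply (height_curve c e (fun z => RtoC (om_of z))).
  - exact He.
  - apply om_of_deriv, Hz.
  - apply filter_forall. intros t. simpl. lra.
  - apply om_of_neq0; assumption.
  - apply regular_om_of; auto.
Qed.

Lemma axis_cont (c : C) (e z : R) : Rabs e <= 1 -> z + a <> 0 -> z <> a ->
  continuity_pt (fun z => height c e (RtoC (om_of z))) z.
Proof.
  intros He Hz Hza. apply (height_continuity_pt c e (fun z => RtoC (om_of z))).
  - exact He.
  - intros s. simpl. lra.
  - apply om_of_neq0; assumption.
  - apply (rderiv_cont _ _ _ (om_of_deriv z Hz)).
Qed.

Lemma odd_part_eq (z : R) : rg1 z - rg2 z = 2 * z * odd_part z.
Proof. unfold rg1, rg2, odd_part. ring. Qed.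

(** The points with [w ^ 2 = -1], the zeros of [/ w + w], thus lie over the two values [a], [- a],
    which carry the ends, and over [b], [- b], where [phi_2] vanishes. *)
Lemma even_part_eq (z : R) : rg1 z + rg2 z = 2 * ((z ^ 2 - a ^ 2) * (z ^ 2 - b ^ 2)).
Proof. rewrite <- quad_factor. unfold rg1, rg2, quad, alpha. ring. Qed.

Lemma sq_diff_neq (z : R) : z + a <> 0 -> z <> a -> z ^ 2 - a ^ 2 <> 0.
Proof.
  intros A1 A2. replace (z ^ 2 - a ^ 2) with ((z - a) * (z + a)) by ring.
  apply Rmult_integral_contrapositive_currified; lra.
Qed.

Lemma rsq_neq0 (z : R) : rsq z <> 0 -> rg1 z <> 0.
Proof. intros H E. apply H. unfold rsq. rewrite E. unfold Rdiv. ring. Qed.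

Lemma RtoC_inv' (x : R) : x <> 0 -> (/ RtoC x)%C = RtoC (/ x).
Proof. intros H. symmetry. apply RtoC_inv, H. Qed.

Lemma inv_mCi (u : C) : u <> 0%C -> (/ (- Ci * u) = Ci * / u)%C.
Proof.
  intros Hu. assert (E : (- Ci * u * (Ci * / u) = 1)%C).
  { transitivity (- (Ci * Ci))%C; [field; exact Hu|]. apply C_ext; unfold Re, Im; simpl; ring. }
  assert (Hn : (- Ci * u <> 0)%C).
  { intros E0. rewrite E0 in E. apply (RtoC_neq 1 R1_neq_R0). rewrite <- E. ring. }
  transitivity (/ (- Ci * u) * (- Ci * u * (Ci * / u)))%C.
  - rewrite E. ring.
  - field. split; [exact Hu|]. intros E0. apply Hn. rewrite E0. ring.
Qed.

(** For real [w] the factor [/ w - w] is [(1 - w ^ 2) / w], and [odd_part_eq] rewrites [1 - w ^ 2].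
    On the interval from 1 to [l1] the derivative is the integrand of [xi_1]. *)
Lemma K1_deriv_pos (z : R) : z + a <> 0 -> z <> a -> rg2 z <> 0 -> 0 < rsq z ->
  is_derive K1 z (- (z * odd_part z) / (rg2 z * sqrt (rsq z) * (z ^ 2 - a ^ 2))).
Proof.
  intros Hz Hza Hg Hr. assert (Ha := a_pos).
  apply (is_derive_eq _ _ _ _ (axis_deriv cc1 (-1) z Rabs_m1 Hz Hza (rsq_neq0 z ltac:(lra)) Hg)).
  unfold form, cc1. rewrite gw_om_pos by assumption.
  assert (Hs : 0 < sqrt (rsq z)) by (apply sqrt_lt_R0, Hr).
  assert (Ss : sqrt (rsq z) * sqrt (rsq z) = rsq z) by (apply sqrt_sqrt; lra).
  assert (Ho : om_of z <> 0). { intros E. apply (om_of_neq0 z Hz Hza). rewrite E. reflexivity. }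
  assert (Hd := sq_diff_neq z Hz Hza).
  unfold Cdiv. rewrite !RtoC_inv' by lra. rewrite <- ?RtoC_mult, <- ?RtoC_plus, <- ?RtoC_mult.
  change (Re (RtoC ?x)) with x.
  set (s := sqrt (rsq z)) in *.
  assert (E1 : z * odd_part z = (s * s - 1) * rg2 z / 2).
  { rewrite Ss. replace (z * odd_part z) with ((rg1 z - rg2 z) / 2) by (rewrite odd_part_eq; field).
    unfold rsq. field. exact Hg. }
  rewrite E1. replace (z ^ 2 - a ^ 2) with ((z - a) * (z + a)) by ring.
  unfold om_of. field. repeat split; lra.
Qed.

(** Since [w] is imaginary, so are [/ w - w] and the value of the form on the real axis. *)
Lemma K1_deriv_neg (z : R) : z + a <> 0 -> z <> a -> rg2 z <> 0 -> rsq z < 0 -> is_derive K1 z 0.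
Proof.
  intros Hz Hza Hg Hr. assert (Ha := a_pos).
  apply (is_derive_eq _ _ _ _ (axis_deriv cc1 (-1) z Rabs_m1 Hz Hza (rsq_neq0 z ltac:(lra)) Hg)).
  unfold form, cc1. rewrite gw_om_neg by assumption.
  assert (Hs : 0 < sqrt (- rsq z)) by (apply sqrt_lt_R0; lra).
  assert (Ho : om_of z <> 0). { intros E. apply (om_of_neq0 z Hz Hza). rewrite E. reflexivity. }
  set (s := sqrt (- rsq z)) in *.
  assert (HC : RtoC s <> 0%C) by (apply RtoC_neq; lra).
  rewrite inv_mCi by exact HC.
  unfold Cdiv. rewrite !RtoC_inv' by lra. unfold Re; simpl. ring.
Qed.

(** Since [w] is real, the factor [Ci] in [cc2] makes the form imaginary on the real axis. *)
Lemma K2_deriv_pos (z : R) : z + a <> 0 -> z <> a -> rg2 z <> 0 -> 0 < rsq z -> is_derive K2 z 0.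
Proof.
  intros Hz Hza Hg Hr. assert (Ha := a_pos).
  apply (is_derive_eq _ _ _ _ (axis_deriv cc2 1 z Rabs_p1 Hz Hza (rsq_neq0 z ltac:(lra)) Hg)).
  unfold form, cc2. rewrite gw_om_pos by assumption.
  assert (Hs : 0 < sqrt (rsq z)) by (apply sqrt_lt_R0; lra).
  assert (Ho : om_of z <> 0). { intros E. apply (om_of_neq0 z Hz Hza). rewrite E. reflexivity. }
  set (s := sqrt (rsq z)) in *.
  unfold Cdiv. rewrite !RtoC_inv' by lra. unfold Re; simpl. ring.
Qed.

(** Here [even_part_eq] rewrites [1 + w ^ 2]. Its factor [z ^ 2 - a ^ 2] cancels against [dh], which
    leaves the integrand of [xi_2] on the interval from [l1] to [l2]. *)
Lemma K2_deriv_neg (z : R) : z + a <> 0 -> z <> a -> rg2 z <> 0 -> rsq z < 0 ->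
  is_derive K2 z (- (z ^ 2 - b ^ 2) / (rg2 z * sqrt (- rsq z))).
Proof.
  intros Hz Hza Hg Hr. assert (Ha := a_pos).
  apply (is_derive_eq _ _ _ _ (axis_deriv cc2 1 z Rabs_p1 Hz Hza (rsq_neq0 z ltac:(lra)) Hg)).
  unfold form, cc2. rewrite gw_om_neg by assumption.
  assert (Hs : 0 < sqrt (- rsq z)) by (apply sqrt_lt_R0; lra).
  assert (Ss : sqrt (- rsq z) * sqrt (- rsq z) = - rsq z) by (apply sqrt_sqrt; lra).
  assert (Ho : om_of z <> 0). { intros E. apply (om_of_neq0 z Hz Hza). rewrite E. reflexivity. }
  set (s := sqrt (- rsq z)) in *.
  assert (HC : RtoC s <> 0%C) by (apply RtoC_neq; lra).
  assert (Hd := sq_diff_neq z Hz Hza).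
  rewrite inv_mCi by exact HC.
  unfold Cdiv. rewrite !RtoC_inv' by lra.
  transitivity (- (/ (4 * a) * (/ s - s) * / om_of z * (2 * a * / (z + a) ^ 2))).
  - unfold Re; simpl. field. repeat split; lra.
  - assert (E1 : z ^ 2 - b ^ 2 = (1 - s * s) * rg2 z / (2 * (z ^ 2 - a ^ 2))).
    { rewrite Ss. replace (1 - - rsq z) with ((rg1 z + rg2 z) / rg2 z) by (unfold rsq; field; exact Hg).
      rewrite even_part_eq. field. split; assumption. }
    rewrite E1. unfold om_of. replace (z ^ 2 - a ^ 2) with ((z - a) * (z + a)) by ring.
    field. repeat split; lra.
Qed.

(** The integrand may be unbounded at both ends, so the antiderivative enters only through its
    one-sided limits. *)
Lemma RInt_gen_lim (f g : R -> R) (x y fx fy v : R) : x < y ->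
  (forall t, x < t < y -> is_derive f t (g t)) -> (forall t, x < t < y -> continuous g t) ->
  filterlim f (at_right x) (locally fx) -> filterlim f (at_left y) (locally fy) ->
  is_RInt_gen g (at_right x) (at_left y) v -> v = fy - fx.
Proof.
  intros Hxy Hd Hc Cx Cy Hv.
  assert (FP : forall P : R * R -> Prop, (forall u w, x < u < y -> x < w < y -> P (u, w)) ->
    filter_prod (at_right x) (at_left y) P).
  { intros P HP. apply Filter_prod with (fun u => x < u < y) (fun u => x < u < y).
    - apply locally_Rabs. exists (y - x). split; [lra|]. intros u Hu Hxu. apply Rabs_def2 in Hu. lra.
    - apply locally_Rabs. exists (y - x). split; [lra|]. intros u Hu Hxu. apply Rabs_def2 in Hu. lra.
    - exact HP. }
  assert (B : forall u w t, x < u < y -> x < w < y -> Rmin u w <= t <= Rmax u w -> x < t < y).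
  { intros u w t Hu Hw [A1 A2]. revert A1 A2. apply Rmin_case; apply Rmax_case; intros; lra. }
  assert (G : is_RInt_gen (Derive f) (at_right x) (at_left y) (fy - fx)).
  { apply is_RInt_gen_Derive.
    - apply FP. intros u w Hu Hw t Ht. exists (g t). apply Hd, (B u w t Hu Hw Ht).
    - apply FP. intros u w Hu Hw t Ht. assert (Ht' := B u w t Hu Hw Ht).
      assert (L : locally t (fun s => g s = Derive f s)).
      { apply locally_Rabs. exists (Rmin (t - x) (y - t)). split; [apply Rmin_glb_lt; lra|].
        intros s Hs. assert (Q1 := Rmin_l (t - x) (y - t)). assert (Q2 := Rmin_r (t - x) (y - t)).
        apply Rabs_def2 in Hs. symmetry. apply is_derive_unique, Hd. lra. }
      unfold continuous. rewrite <- (locally_singleton _ _ L).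
      apply (filterlim_ext_loc g); [exact L|apply Hc, Ht'].
    - exact Cx.
    - exact Cy. }
  assert (G2 : is_RInt_gen g (at_right x) (at_left y) (fy - fx)).
  { apply (is_RInt_gen_ext (V := R_NormedModule) (Derive f)); [|exact G].
    apply FP. intros u w Hu Hw t Ht. apply is_derive_unique, Hd. apply (B u w t Hu Hw). simpl in Ht. lra. }
  apply (is_RInt_gen_unique (V := R_CompleteNormedModule)) in Hv.
  apply (is_RInt_gen_unique (V := R_CompleteNormedModule)) in G2.
  rewrite <- Hv, <- G2. reflexivity.
Qed.

Lemma RInt_gen_FTC (f g : R -> R) (x y v : R) : x < y ->
  (forall t, x < t < y -> is_derive f t (g t)) -> (forall t, x < t < y -> continuous g t) ->
  continuity_pt f x -> continuity_pt f y ->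
  is_RInt_gen g (at_right x) (at_left y) v -> v = f y - f x.
Proof.
  intros Hxy Hd Hc Cx Cy Hv. apply (RInt_gen_lim f g x y (f x) (f y) v); try assumption.
  - apply continuity_pt_filterlim in Cx. apply (filterlim_filter_le_1 (F := locally x)); [|exact Cx].
    intros P HP. unfold at_right, within. apply filter_imp with (2 := HP). auto.
  - apply continuity_pt_filterlim in Cy. apply (filterlim_filter_le_1 (F := locally y)); [|exact Cy].
    intros P HP. unfold at_left, within. apply filter_imp with (2 := HP). auto.
Qed.

Lemma prod4_pos (x y z t : R) : 0 < x -> 0 < y -> 0 < z -> 0 < t -> 0 < x * y * z * t.
Proof. intros; repeat apply Rmult_lt_0_compat; assumption. Qed.

(** The numbers [l], 1, [l1], [l2] cut the nonnegative axis into five intervals, [I0] to [I4], on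
    which the sign of [w ^ 2] alternates. *)
Lemma sign_I0 (z : R) : 0 <= z < l -> 0 < rg2 z /\ 0 < rsq z.
Proof.
  intros H. assert (A2 : 0 < rg2 z).
  { replace (rg2 z) with ((z + l) * (1 - z) * (z + l1) * (l2 - z)) by (unfold rg2; ring). apply prod4_pos; lra. }
  assert (A1 : 0 < rg1 z).
  { replace (rg1 z) with ((l - z) * (z + 1) * (l1 - z) * (z + l2)) by (unfold rg1; ring). apply prod4_pos; lra. }
  split; [exact A2|apply Rdiv_lt_0_compat; assumption].
Qed.

Lemma sign_I1 (z : R) : l < z < 1 -> 0 < rg2 z /\ rsq z < 0.
Proof.
  intros H. assert (A2 : 0 < rg2 z).
  { replace (rg2 z) with ((z + l) * (1 - z) * (z + l1) * (l2 - z)) by (unfold rg2; ring). apply prod4_pos; lra. }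
  assert (A1 : 0 < - rg1 z).
  { replace (- rg1 z) with ((z - l) * (z + 1) * (l1 - z) * (z + l2)) by (unfold rg1; ring). apply prod4_pos; lra. }
  split; [exact A2|]. assert (0 < - rg1 z / rg2 z) by (apply Rdiv_lt_0_compat; assumption).
  unfold rsq. unfold Rdiv in *. lra.
Qed.

Lemma sign_I2 (z : R) : 1 < z < l1 -> rg2 z < 0 /\ 0 < rsq z.
Proof.
  intros H. assert (A2 : 0 < - rg2 z).
  { replace (- rg2 z) with ((z + l) * (z - 1) * (z + l1) * (l2 - z)) by (unfold rg2; ring). apply prod4_pos; lra. }
  assert (A1 : 0 < - rg1 z).
  { replace (- rg1 z) with ((z - l) * (z + 1) * (l1 - z) * (z + l2)) by (unfold rg1; ring). apply prod4_pos; lra. }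
  split; [lra|]. unfold rsq. replace (rg1 z / rg2 z) with (- rg1 z / - rg2 z) by (field; lra).
  apply Rdiv_lt_0_compat; assumption.
Qed.

Lemma sign_I3 (z : R) : l1 < z < l2 -> rg2 z < 0 /\ rsq z < 0.
Proof.
  intros H. assert (A2 : 0 < - rg2 z).
  { replace (- rg2 z) with ((z + l) * (z - 1) * (z + l1) * (l2 - z)) by (unfold rg2; ring). apply prod4_pos; lra. }
  assert (A1 : 0 < rg1 z).
  { replace (rg1 z) with ((z - l) * (z + 1) * (z - l1) * (z + l2)) by (unfold rg1; ring). apply prod4_pos; lra. }
  split; [lra|]. assert (0 < rg1 z / - rg2 z) by (apply Rdiv_lt_0_compat; assumption).
  unfold rsq. replace (rg1 z / rg2 z) with (- (rg1 z / - rg2 z)) by (field; lra). lra.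
Qed.

Lemma sign_I4 (z : R) : l2 < z -> 0 < rg2 z /\ 0 < rsq z.
Proof.
  intros H. assert (A2 : 0 < rg2 z) by (unfold rg2; apply prod4_pos; lra).
  assert (A1 : 0 < rg1 z) by (unfold rg1; apply prod4_pos; lra).
  split; [exact A2|apply Rdiv_lt_0_compat; assumption].
Qed.

(** [odd_part] is [A * z ^ 2 + B] with [A > 0]. Its values at 1 and [l1] follow from [odd_part_eq],
    because [rg2] vanishes at 1 and [rg1] at [l1]; they are negative and positive. The zero [zs] is
    the turning point of [K1] in [K1_1l1]. *)
Lemma odd_part_sign : exists zs, 1 < zs < l1 /\ (forall z, 0 <= z < zs -> odd_part z < 0) /\
  (forall z, zs < z -> 0 < odd_part z).
Proof.
  set (A := 1 - l - l1 + l2). set (B := l * l1 - l * l2 - l1 * l2 + l * l1 * l2).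
  assert (E : forall z, odd_part z = A * z ^ 2 + B) by (intros; unfold odd_part, A, B; ring).
  assert (N1 : A + B < 0).
  { assert (0 < (1 - l) * (l1 - 1) * (1 + l2)) by (repeat apply Rmult_lt_0_compat; lra). unfold A, B; nra. }
  assert (N2 : 0 < A * l1 ^ 2 + B).
  { assert (0 < (l1 + l) * (l1 - 1) * (l2 - l1)) by (repeat apply Rmult_lt_0_compat; lra). unfold A, B; nra. }
  assert (HA : 0 < A) by (unfold A; lra).
  assert (HB : 1 < - B / A). { apply Rmult_lt_reg_r with A; [exact HA|]. replace (- B / A * A) with (- B) by (field; lra). lra. }
  assert (HB2 : - B / A < l1 ^ 2). { apply Rmult_lt_reg_r with A; [exact HA|]. replace (- B / A * A) with (- B) by (field; lra). lra. }
  set (q := - B / A) in *. assert (EB : B = - (A * q)) by (unfold q; field; lra).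
  assert (S := sqrt_sqrt q ltac:(lra)). assert (S0 : 0 < sqrt q) by (apply sqrt_lt_R0; lra).
  exists (sqrt q). split; [split; nra|].
  split; intros z Hz; rewrite E, EB; replace (A * z ^ 2 + - (A * q)) with (A * (z ^ 2 - q)) by ring.
  - assert (0 < A * (q - z ^ 2)); [|nra]. apply Rmult_lt_0_compat; nra.
  - apply Rmult_lt_0_compat; nra.
Qed.

Lemma rg_prod (z : R) : rg1 z * rg2 z = (z ^ 2 - l ^ 2) * (z ^ 2 - 1) * (z ^ 2 - l1 ^ 2) * (z ^ 2 - l2 ^ 2).
Proof. unfold rg1, rg2. ring. Qed.

(** With [s = 1] and [s = -1] this turns the denominators of [K1_deriv_pos] and [K2_deriv_neg] into
    the square roots of the period integrals. *)
Lemma rg2_sqrt (z s : R) : rg2 z < 0 -> 0 < s * rsq z ->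
  rg2 z * sqrt (s * rsq z) = - sqrt (s * (rg1 z * rg2 z)).
Proof.
  intros A1 A2. replace (s * (rg1 z * rg2 z)) with ((s * rsq z) * ((- rg2 z) * (- rg2 z))) by (unfold rsq; field; lra).
  rewrite (sqrt_mult (s * rsq z)); [|lra|apply Rlt_le, Rmult_lt_0_compat; lra]. rewrite sqrt_square by lra. ring.
Qed.

Lemma K1_cont (z : R) : z + a <> 0 -> z <> a -> continuity_pt K1 z.
Proof. intros. apply (axis_cont cc1 (-1) z Rabs_m1); assumption. Qed.

Lemma K2_cont (z : R) : z + a <> 0 -> z <> a -> continuity_pt K2 z.
Proof. intros. apply (axis_cont cc2 1 z Rabs_p1); assumption. Qed.

Lemma K1_xi1 : is_xi1 l l1 l2 0 -> K1 l1 = K1 1.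
Proof.
  intros Hxi. assert (AB := ab_range).
  assert (0 = K1 l1 - K1 1); [|lra].
  apply (RInt_gen_FTC K1 (xi1_integrand l l1 l2)); [lra| | | | |exact Hxi].
  - intros t Ht. destruct (sign_I2 t Ht) as [S1 S2].
    apply (is_derive_eq _ _ _ _ (K1_deriv_pos t ltac:(lra) ltac:(lra) ltac:(lra) S2)).
    assert (Q := rg2_sqrt t 1 S1 ltac:(lra)). rewrite !Rmult_1_l in Q. rewrite Q.
    unfold xi1_integrand. rewrite rg_prod.
    replace ((t ^ 2 - l ^ 2) * (t ^ 2 - 1) * (l1 ^ 2 - t ^ 2) * (l2 ^ 2 - t ^ 2)) with
      ((t ^ 2 - l ^ 2) * (t ^ 2 - 1) * (t ^ 2 - l1 ^ 2) * (t ^ 2 - l2 ^ 2)) by ring.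
    rewrite <- rg_prod.
    assert (0 < sqrt (rg1 t * rg2 t)).
    { apply sqrt_lt_R0. replace (rg1 t * rg2 t) with (rsq t * (rg2 t * rg2 t)) by (unfold rsq; field; lra).
      apply Rmult_lt_0_compat; [exact S2|nra]. }
    assert (D := sq_diff_neq t ltac:(lra) ltac:(lra)). unfold odd_part. field. split; lra.
  - intros t Ht. apply (ex_derive_continuous (K := R_AbsRing) (V := R_NormedModule)).
    unfold xi1_integrand.
    assert (0 < (t ^ 2 - l ^ 2) * (t ^ 2 - 1) * (l1 ^ 2 - t ^ 2) * (l2 ^ 2 - t ^ 2)) by (apply prod4_pos; nra).
    assert (D := sq_diff_neq t ltac:(lra) ltac:(lra)).
    assert (0 < sqrt ((t ^ 2 - l ^ 2) * (t ^ 2 - 1) * (l1 ^ 2 - t ^ 2) * (l2 ^ 2 - t ^ 2))) by (apply sqrt_lt_R0; assumption).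
    auto_derive. split; [assumption|]. split; [|exact I].
    apply Rmult_integral_contrapositive_currified; [exact D|exact (Rgt_not_eq _ _ H0)].
  - apply K1_cont; lra.
  - apply K1_cont; lra.
Qed.

Lemma K2_xi2 : is_xi2 l l1 l2 0 -> K2 l2 = K2 l1.
Proof.
  intros Hxi. assert (AB := ab_range).
  assert (0 = K2 l2 - K2 l1); [|lra].
  apply (RInt_gen_FTC K2 (xi2_integrand l l1 l2)); [lra| | | | |exact Hxi].
  - intros t Ht. destruct (sign_I3 t Ht) as [S1 S2].
    apply (is_derive_eq _ _ _ _ (K2_deriv_neg t ltac:(lra) ltac:(lra) ltac:(lra) S2)).
    assert (Q := rg2_sqrt t (-1) S1 ltac:(lra)).
    replace (-1 * rsq t) with (- rsq t) in Q by ring. rewrite Q.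
    unfold xi2_integrand. rewrite rg_prod.
    replace ((t ^ 2 - l ^ 2) * (t ^ 2 - 1) * (t ^ 2 - l1 ^ 2) * (l2 ^ 2 - t ^ 2)) with
      (-1 * ((t ^ 2 - l ^ 2) * (t ^ 2 - 1) * (t ^ 2 - l1 ^ 2) * (t ^ 2 - l2 ^ 2))) by ring.
    rewrite <- rg_prod.
    assert (0 < sqrt (-1 * (rg1 t * rg2 t))).
    { apply sqrt_lt_R0. replace (-1 * (rg1 t * rg2 t)) with (- rsq t * (rg2 t * rg2 t)) by (unfold rsq; field; lra).
      apply Rmult_lt_0_compat; [lra|nra]. }
    field. lra.
  - intros t Ht. apply (ex_derive_continuous (K := R_AbsRing) (V := R_NormedModule)).
    unfold xi2_integrand.
    assert (0 < (t ^ 2 - l ^ 2) * (t ^ 2 - 1) * (t ^ 2 - l1 ^ 2) * (l2 ^ 2 - t ^ 2)) by (apply prod4_pos; nra).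
    assert (0 < sqrt ((t ^ 2 - l ^ 2) * (t ^ 2 - 1) * (t ^ 2 - l1 ^ 2) * (l2 ^ 2 - t ^ 2))) by (apply sqrt_lt_R0; assumption).
    auto_derive. split; [assumption|]. split; [exact (Rgt_not_eq _ _ H0)|exact I].
  - apply K2_cont; lra.
  - apply K2_cont; lra.
Qed.

Hypothesis Hxi1 : is_xi1 l l1 l2 0.
Hypothesis Hxi2 : is_xi2 l l1 l2 0.

(* The walls of the box filled by [(H1, H2)].  By the period conditions, [K1] takes
   the value [d1] for [l1 <= z <= l2] as well as for [a < z <= 1], and [K2] takes the
   value [e1] for [l2 <= z] as well as for [1 <= z <= l1]. *)
Definition d0 : R := K1 l.
Definition d1 : R := K1 1.
Definition e0 : R := K2 l.
Definition e1 : R := K2 1.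

Lemma K1_near0 (z : R) : 0 <= z < l -> d0 < K1 z.
Proof.
  intros Hz. assert (AB := ab_range).
  apply (strict_decr K1 (fun z => - (z * odd_part z) / (rg2 z * sqrt (rsq z) * (z ^ 2 - a ^ 2)))); [lra| | |].
  - intros t Ht. destruct (sign_I0 t) as [S1 S2]; [lra|]. apply K1_deriv_pos; lra.
  - intros t Ht. apply K1_cont; lra.
  - intros t Ht. destruct (sign_I0 t) as [S1 S2]; [lra|].
    destruct odd_part_sign as [zs [Hzs [N1 _]]]. specialize (N1 t ltac:(lra)).
    assert (Hs : 0 < sqrt (rsq t)) by (apply sqrt_lt_R0, S2).
    replace (- (t * odd_part t) / (rg2 t * sqrt (rsq t) * (t ^ 2 - a ^ 2))) with
      (- (t * - odd_part t / (rg2 t * sqrt (rsq t) * (a ^ 2 - t ^ 2)))) by (field; split; [|split]; nra).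
    apply Ropp_lt_gt_0_contravar. apply Rdiv_lt_0_compat; [apply Rmult_lt_0_compat; lra|].
    apply Rmult_lt_0_compat; [apply Rmult_lt_0_compat; assumption|nra].
Qed.

Lemma K1_la (z : R) : l <= z < a -> K1 z = d0.
Proof.
  intros Hz. assert (AB := ab_range). apply const_deriv0; [lra| |].
  - intros t Ht. destruct (sign_I1 t) as [S1 S2]; [lra|]. apply K1_deriv_neg; lra.
  - intros t Ht. apply K1_cont; lra.
Qed.

Lemma K1_a1 (z : R) : a < z <= 1 -> K1 z = d1.
Proof.
  intros Hz. assert (AB := ab_range). symmetry. apply const_deriv0; [lra| |].
  - intros t Ht. destruct (sign_I1 t) as [S1 S2]; [lra|]. apply K1_deriv_neg; lra.
  - intros t Ht. apply K1_cont; lra.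
Qed.

(** From its value [d1] at 1 the function decreases up to [zs], then it increases to its value at
    [l1], which is again [d1] by the first period condition. *)
Lemma K1_1l1 (z : R) : 1 < z < l1 -> K1 z < d1.
Proof.
  intros Hz. assert (AB := ab_range). destruct odd_part_sign as [zs [Hzs [N1 N2]]].
  assert (D : forall t, 1 < t < l1 -> is_derive K1 t
    (- (t * odd_part t) / (rg2 t * sqrt (rsq t) * (t ^ 2 - a ^ 2)))).
  { intros t Ht. destruct (sign_I2 t Ht) as [S1 S2]. apply K1_deriv_pos; lra. }
  assert (S : forall t, 1 < t < l1 ->
    - (t * odd_part t) / (rg2 t * sqrt (rsq t) * (t ^ 2 - a ^ 2)) =
    odd_part t * (t / (- rg2 t * sqrt (rsq t) * (t ^ 2 - a ^ 2))) /\
    0 < t / (- rg2 t * sqrt (rsq t) * (t ^ 2 - a ^ 2))).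
  { intros t Ht. destruct (sign_I2 t Ht) as [S1 S2].
    assert (Hs : 0 < sqrt (rsq t)) by (apply sqrt_lt_R0, S2).
    assert (0 < t ^ 2 - a ^ 2) by nra. split.
    - field. repeat split; lra.
    - apply Rdiv_lt_0_compat; [lra|]. apply Rmult_lt_0_compat; [apply Rmult_lt_0_compat; lra|assumption]. }
  destruct (Rle_lt_dec z zs) as [H|H].
  - apply (strict_decr K1 (fun t => - (t * odd_part t) / (rg2 t * sqrt (rsq t) * (t ^ 2 - a ^ 2)))); [lra| | |].
    + intros t Ht. apply D. lra.
    + intros t Ht. apply K1_cont; lra.
    + intros t Ht. destruct (S t) as [E P]; [lra|]. rewrite E.
      specialize (N1 t ltac:(lra)). nra.
  - unfold d1. rewrite <- (K1_xi1 Hxi1).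
    apply (strict_incr K1 (fun t => - (t * odd_part t) / (rg2 t * sqrt (rsq t) * (t ^ 2 - a ^ 2)))); [lra| | |].
    + intros t Ht. apply D. lra.
    + intros t Ht. apply K1_cont; lra.
    + intros t Ht. destruct (S t) as [E P]; [lra|]. rewrite E.
      specialize (N2 t ltac:(lra)). nra.
Qed.

Lemma K1_l1l2 (z : R) : l1 <= z <= l2 -> K1 z = d1.
Proof.
  intros Hz. assert (AB := ab_range). unfold d1. rewrite <- (K1_xi1 Hxi1). apply const_deriv0; [lra| |].
  - intros t Ht. destruct (sign_I3 t) as [S1 S2]; [lra|]. apply K1_deriv_neg; lra.
  - intros t Ht. apply K1_cont; lra.
Qed.

Lemma K1_decr_far (x y : R) : l2 <= x < y -> K1 y < K1 x.
Proof.
  intros Hz. assert (AB := ab_range). destruct odd_part_sign as [zs [Hzs [_ N2]]].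
  apply (strict_decr K1 (fun z => - (z * odd_part z) / (rg2 z * sqrt (rsq z) * (z ^ 2 - a ^ 2)))); [lra| | |].
  - intros t Ht. destruct (sign_I4 t) as [S1 S2]; [lra|]. apply K1_deriv_pos; lra.
  - intros t Ht. apply K1_cont; lra.
  - intros t Ht. destruct (sign_I4 t) as [S1 S2]; [lra|]. specialize (N2 t ltac:(lra)).
    assert (Hs : 0 < sqrt (rsq t)) by (apply sqrt_lt_R0, S2). assert (0 < t ^ 2 - a ^ 2) by nra.
    replace (- (t * odd_part t) / (rg2 t * sqrt (rsq t) * (t ^ 2 - a ^ 2))) with
      (- (t * odd_part t / (rg2 t * sqrt (rsq t) * (t ^ 2 - a ^ 2)))) by (field; repeat split; lra).
    apply Ropp_lt_gt_0_contravar. apply Rdiv_lt_0_compat; [apply Rmult_lt_0_compat; lra|].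
    apply Rmult_lt_0_compat; [apply Rmult_lt_0_compat|]; assumption.
Qed.

Lemma K1_far (z : R) : l2 < z -> K1 z < d1.
Proof. intros Hz. rewrite <- (K1_l1l2 l2) by lra. apply K1_decr_far. lra. Qed.

Lemma K2_near0 (z : R) : 0 <= z <= l -> K2 z = e0.
Proof.
  intros Hz. assert (AB := ab_range). symmetry. apply const_deriv0; [lra| |].
  - intros t Ht. destruct (sign_I0 t) as [S1 S2]; [lra|]. apply K2_deriv_pos; lra.
  - intros t Ht. apply K2_cont; lra.
Qed.

Lemma K2_sign_I1 (t : R) : l < t < 1 -> 0 < - (t ^ 2 - b ^ 2) / (rg2 t * sqrt (- rsq t)).
Proof.
  intros Ht. assert (AB := ab_range). destruct (sign_I1 t Ht) as [S1 S2].
  assert (Hs : 0 < sqrt (- rsq t)) by (apply sqrt_lt_R0; lra).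
  apply Rdiv_lt_0_compat; [nra|]. apply Rmult_lt_0_compat; assumption.
Qed.

Lemma K2_la (z : R) : l < z < a -> e0 < K2 z.
Proof.
  intros Hz. assert (AB := ab_range).
  apply (strict_incr K2 (fun t => - (t ^ 2 - b ^ 2) / (rg2 t * sqrt (- rsq t)))); [lra| | |].
  - intros t Ht. destruct (sign_I1 t) as [S1 S2]; [lra|]. apply K2_deriv_neg; lra.
  - intros t Ht. apply K2_cont; lra.
  - intros t Ht. apply K2_sign_I1. lra.
Qed.

Lemma K2_a1 (z : R) : a < z < 1 -> K2 z < e1.
Proof.
  intros Hz. assert (AB := ab_range).
  apply (strict_incr K2 (fun t => - (t ^ 2 - b ^ 2) / (rg2 t * sqrt (- rsq t)))); [lra| | |].
  - intros t Ht. destruct (sign_I1 t) as [S1 S2]; [lra|]. apply K2_deriv_neg; lra.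
  - intros t Ht. apply K2_cont; lra.
  - intros t Ht. apply K2_sign_I1. lra.
Qed.

Lemma K2_1l1 (z : R) : 1 <= z <= l1 -> K2 z = e1.
Proof.
  intros Hz. assert (AB := ab_range). apply const_deriv0; [lra| |].
  - intros t Ht. destruct (sign_I2 t) as [S1 S2]; [lra|]. apply K2_deriv_pos; lra.
  - intros t Ht. apply K2_cont; lra.
Qed.

(** The same argument as for [K1_1l1], with turning point [b] and the second period condition. *)
Lemma K2_l1l2 (z : R) : l1 < z < l2 -> K2 z < e1.
Proof.
  intros Hz. assert (AB := ab_range). rewrite <- (K2_1l1 l1) by lra.
  assert (D : forall t, l1 < t < l2 -> is_derive K2 t (- (t ^ 2 - b ^ 2) / (rg2 t * sqrt (- rsq t)))).
  { intros t Ht. destruct (sign_I3 t Ht) as [S1 S2]. apply K2_deriv_neg; lra. }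
  assert (S : forall t, l1 < t < l2 -> - (t ^ 2 - b ^ 2) / (rg2 t * sqrt (- rsq t)) =
    (t ^ 2 - b ^ 2) * / (- rg2 t * sqrt (- rsq t)) /\ 0 < / (- rg2 t * sqrt (- rsq t))).
  { intros t Ht. destruct (sign_I3 t Ht) as [S1 S2].
    assert (Hs : 0 < sqrt (- rsq t)) by (apply sqrt_lt_R0; lra). split.
    - field. repeat split; lra.
    - apply Rinv_0_lt_compat, Rmult_lt_0_compat; lra. }
  destruct (Rle_lt_dec z b) as [H|H].
  - apply (strict_decr K2 (fun t => - (t ^ 2 - b ^ 2) / (rg2 t * sqrt (- rsq t)))); [lra| | |].
    + intros t Ht. apply D. lra.
    + intros t Ht. apply K2_cont; lra.
    + intros t Ht. destruct (S t) as [E P]; [lra|]. rewrite E. assert (t ^ 2 - b ^ 2 < 0) by nra. nra.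
  - rewrite <- (K2_xi2 Hxi2).
    apply (strict_incr K2 (fun t => - (t ^ 2 - b ^ 2) / (rg2 t * sqrt (- rsq t)))); [lra| | |].
    + intros t Ht. apply D. lra.
    + intros t Ht. apply K2_cont; lra.
    + intros t Ht. destruct (S t) as [E P]; [lra|]. rewrite E. assert (0 < t ^ 2 - b ^ 2) by nra. nra.
Qed.

Lemma K2_far (z : R) : l2 <= z -> K2 z = e1.
Proof.
  intros Hz. assert (AB := ab_range). rewrite <- (K2_1l1 l1) by lra. rewrite <- (K2_xi2 Hxi2).
  apply const_deriv0; [lra| |].
  - intros t Ht. destruct (sign_I4 t) as [S1 S2]; [lra|]. apply K2_deriv_pos; lra.
  - intros t Ht. apply K2_cont; lra.
Qed.

(* In terms of [z] this is [z |-> - conj z], which exchanges [w] with [1 / conj w]. *)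
Definition inv_conj (om : C) : C := (/ Cconj om)%C.

Lemma Cconj_neq0 (u : C) : u <> 0%C -> Cconj u <> 0%C.
Proof.
  intros H E. apply H. apply C_ext; [exact (f_equal Re E)|].
  assert (E2 : - Im u = 0) by exact (f_equal Im E). simpl. lra.
Qed.

Lemma Cconj_inv (u : C) : u <> 0%C -> Cconj (/ u)%C = (/ Cconj u)%C.
Proof.
  intros H. assert (Hc := Cconj_neq0 _ H). apply C_ext.
  - change (Re (Cconj (/ u))%C) with (Re (/ u)%C).
    rewrite (proj1 (Cinv_parts _ H)), (proj1 (Cinv_parts _ Hc)), Cmod_conj. reflexivity.
  - change (Im (Cconj (/ u))%C) with (- Im (/ u)%C).
    rewrite (proj2 (Cinv_parts _ H)), (proj2 (Cinv_parts _ Hc)), Cmod_conj.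
    change (Im (Cconj u)) with (- Im u). unfold Rdiv. ring.
Qed.

Lemma Cconj_RtoC (x : R) : Cconj (RtoC x) = RtoC x.
Proof. apply C_ext; unfold Re, Im; simpl; ring. Qed.

Lemma lin_inv_conj (p : R) (om : C) : om <> 0%C ->
  lin p (inv_conj om) = (Cconj (lin (- p) om) / Cconj om)%C.
Proof.
  intros H. assert (Hc := Cconj_neq0 _ H). unfold lin, inv_conj.
  rewrite Cplus_conj, Cmult_conj, !Cconj_RtoC.
  replace (a - - p) with (a + p) by ring. replace (a + - p) with (a - p) by ring.
  field. exact Hc.
Qed.

Lemma num_inv_conj (om : C) : om <> 0%C ->
  num (inv_conj om) = (Cconj (den om) / (Cconj om * Cconj om * Cconj om * Cconj om))%C.
Proof.
  intros H. assert (Hc := Cconj_neq0 _ H). unfold num, den. rewrite !lin_inv_conj by exact H.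
  rewrite !Cmult_conj. replace (- -1) with 1 by ring. replace (- - l2) with l2 by ring.
  field. exact Hc.
Qed.

Lemma den_inv_conj (om : C) : om <> 0%C ->
  den (inv_conj om) = (Cconj (num om) / (Cconj om * Cconj om * Cconj om * Cconj om))%C.
Proof.
  intros H. assert (Hc := Cconj_neq0 _ H). unfold num, den. rewrite !lin_inv_conj by exact H.
  rewrite !Cmult_conj. replace (- - l) with l by ring. replace (- - l1) with l1 by ring.
  replace (- (1)) with (-1) by ring. field. exact Hc.
Qed.

Lemma regular_inv_conj (om : C) : om <> 0%C -> regular om -> regular (inv_conj om).
Proof.
  intros H [A1 A2]. assert (Hc := Cconj_neq0 _ H).
  assert (P : forall u : C, u <> 0%C -> (Cconj u / (Cconj om * Cconj om * Cconj om * Cconj om) <> 0)%C).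
  { intros u Hu. apply Cmult_neq_0; [apply Cconj_neq0, Hu|].

    intros E. assert (D : (Cconj om * Cconj om * Cconj om * Cconj om <> 0)%C) by (repeat apply Cmult_neq_0; assumption).
    assert (E1 := Cinv_r _ D). rewrite E in E1. apply (RtoC_neq 1 R1_neq_R0). rewrite <- E1. ring. }
  split; [rewrite num_inv_conj by exact H|rewrite den_inv_conj by exact H]; apply P; assumption.
Qed.

Lemma inv_conj_neq0 (om : C) : om <> 0%C -> inv_conj om <> 0%C.
Proof.
  intros H E. assert (E1 := Cinv_r _ (Cconj_neq0 _ H)). unfold inv_conj in E. rewrite E in E1.
  apply (RtoC_neq 1 R1_neq_R0). rewrite <- E1. ring.
Qed.

Lemma gsq_inv_conj (om : C) : om <> 0%C -> regular om -> gsq (inv_conj om) = (/ Cconj (gsq om))%C.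
Proof.
  intros H [A1 A2]. unfold gsq at 1. rewrite num_inv_conj, den_inv_conj by exact H.
  unfold gsq, Cdiv. rewrite Cmult_conj, Cconj_inv by exact A2.
  assert (Hc := Cconj_neq0 _ H). assert (B1 := Cconj_neq0 _ A1). assert (B2 := Cconj_neq0 _ A2).
  field. repeat split; assumption.
Qed.

Lemma inv_conj_Im (om : C) : om <> 0%C -> Im (inv_conj om) = Im om / (Cmod om * Cmod om).
Proof.
  intros H. unfold inv_conj. rewrite (proj2 (Cinv_parts _ (Cconj_neq0 _ H))), Cmod_conj.
  change (Im (Cconj om)) with (- Im om). f_equal. ring.
Qed.

(** Both sides are square roots of the same number with positive real part; [halfplane_sqrt_lip]
    shows that such roots coincide. *)
Lemma gw_inv_conj (om : C) : 0 < Im om -> gw (inv_conj om) = (/ Cconj (gw om))%C.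
Proof.
  intros H. assert (Ho : om <> 0%C) by (apply Cneq0_Im; lra).
  assert (Hr : regular om) by (apply regular_H; lra).
  assert (Hw := gw_neq0 om Hr). assert (Hm := Cmod_neq0 _ Ho).
  assert (Hi : 0 < Im (inv_conj om)).
  { rewrite inv_conj_Im by exact Ho. apply Rdiv_lt_0_compat; [exact H|nra]. }
  assert (Hc := Cconj_neq0 _ Hw).
  assert (P2 : 0 < Re (/ Cconj (gw om))%C).
  { rewrite (proj1 (Cinv_parts _ Hc)). apply Rdiv_lt_0_compat; [apply (gw_H om H)|].
    assert (Hm2 := Cmod_neq0 _ Hc). nra. }
  assert (P1 := proj1 (gw_H _ Hi)).
  assert (L := halfplane_sqrt_lip (gw (inv_conj om)) (/ Cconj (gw om)) ltac:(lra) ltac:(lra)).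
  rewrite gw_sqr, gsq_inv_conj in L by assumption.
  replace (/ Cconj (gsq om) - / Cconj (gw om) * / Cconj (gw om))%C with (RtoC 0) in L.
  - rewrite Cmod_0 in L. assert (N := Cmod_ge_0 (gw (inv_conj om) - / Cconj (gw om))%C).
    assert (Z : Cmod (gw (inv_conj om) - / Cconj (gw om))%C = 0) by nra.
    apply Cmod_eq_0 in Z.
    replace (gw (inv_conj om)) with (gw (inv_conj om) - / Cconj (gw om) + / Cconj (gw om))%C by ring.
    rewrite Z. ring.
  - rewrite <- gw_sqr, Cmult_conj. field. exact Hc.
Qed.

Lemma rderiv_conj (g : R -> C) (t : R) (d : C) : rderiv g t d -> rderiv (fun s => Cconj (g s)) t (Cconj d).
Proof.
  rewrite !rderiv_parts. intros [A1 A2]. split; [exact A1|].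
  apply (is_derive_opp (K := R_AbsRing) (V := R_NormedModule)). exact A2.
Qed.

Lemma rderiv_inv_conj (g : R -> C) (t : R) (d : C) : g t <> 0%C -> rderiv g t d ->
  rderiv (fun s => inv_conj (g s)) t (- Cconj d / (Cconj (g t) * Cconj (g t)))%C.
Proof.
  intros H Hg. assert (Hc := Cconj_neq0 _ H).
  apply (rderiv_eq _ _ (Copp (RtoC 1) / (Cconj (g t) * Cconj (g t)) * Cconj d)%C).
  - apply (rderiv_comp (fun s => Cconj (g s)) (fun u => / u)%C).
    + apply rderiv_conj, Hg.
    + apply (cderiv_inv (fun u => u) (Cconj (g t)) (RtoC 1)); [exact Hc|apply cderiv_id].
  - field. exact Hc.
Qed.

(** The condition on [c] says that [inv_conj] pulls the form back to its conjugate, which has the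
    same real part. So the difference of the two sides is constant along the segment [g] from [Ci]
    to [om], and it vanishes at the fixed point [Ci]. *)
Lemma height_sym_H (c : C) (e : R) (om : C) : e = 1 \/ e = -1 -> (Cconj c * RtoC (- e))%C = c ->
  0 < Im om -> height c e (inv_conj om) = height c e om.
Proof.
  intros He Hc Ho. assert (He1 : Rabs e <= 1) by (destruct He as [-> | ->]; [apply Rabs_p1|apply Rabs_m1]).
  set (g := fun t : R => (Ci + RtoC t * (om - Ci))%C).
  assert (Hg : forall t, rderiv g t (om - Ci)%C).
  { intros t. exists (fun _ => (om - Ci)%C). split; [apply flim_const|split; [reflexivity|]].
    apply filter_forall. intros h. unfold g. rewrite RtoC_minus. ring. }
  assert (Hgi : forall t, Im (g t) = 1 + t * (Im om - 1)) by (intros t; unfold g, Re, Im; simpl; ring).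
  assert (Hgp : forall t, 0 <= t <= 1 -> 0 < Im (g t)) by (intros t Ht; rewrite Hgi; nra).
  assert (D : forall t, 0 <= t <= 1 -> is_derive (fun t => height c e (inv_conj (g t)) - height c e (g t)) t 0).
  { intros t Ht. specialize (Hgp t Ht). assert (H0 : g t <> 0%C) by (apply Cneq0_Im; lra).
    assert (Hr : regular (g t)) by (apply regular_H; lra).
    assert (Hci := rderiv_inv_conj g t _ H0 (Hg t)).
    assert (Hm := Cmod_neq0 _ H0).
    assert (Hi : 0 < Im (inv_conj (g t))).
    { rewrite inv_conj_Im by exact H0. apply Rdiv_lt_0_compat; [exact Hgp|nra]. }
    assert (Pos : forall q : R -> C, filterlim q (locally t) (locally (q t)) -> 0 < Im (q t) -> locally t (fun s => 0 <= Im (q s))).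
    { intros q Hq Hq0. apply flim_Im in Hq. rewrite (flim_Rabs (F := locally t)) in Hq.
      apply filter_imp with (2 := Hq _ Hq0). intros s Hs. apply Rabs_def2 in Hs. lra. }
    assert (D1 := height_curve c e _ t _ He1 Hci (Pos _ (rderiv_cont _ _ _ Hci) Hi) (inv_conj_neq0 _ H0) (regular_inv_conj _ H0 Hr)).
    assert (D2 := height_curve c e _ t _ He1 (Hg t) (Pos _ (rderiv_cont _ _ _ (Hg t)) Hgp) H0 Hr).
    apply (is_derive_eq _ _ _ _ (is_derive_minus (K := R_AbsRing) (V := R_NormedModule) _ _ _ _ _ D1 D2)).
    apply Rminus_diag_eq.
    assert (Hw := gw_neq0 _ Hr).
    assert (B1 := Cconj_neq0 _ H0). assert (B2 := Cconj_neq0 _ Hw).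
    set (d := (om - Ci)%C).
    transitivity (Re (Cconj (form c e (g t) * d))%C); [|reflexivity].
    apply (f_equal Re). unfold form. rewrite gw_inv_conj by exact Hgp. unfold inv_conj.
    set (W := gw (g t)) in *. set (G := g t) in *.
    unfold Cdiv. rewrite !Cmult_conj, Cplus_conj, Cmult_conj, !Cconj_inv, Cconj_RtoC by assumption.
    rewrite <- Hc at 1. destruct He as [-> | ->].
    - rewrite RtoC_opp. field. repeat split; assumption.
    - replace (- -1) with 1 by ring. replace (RtoC (-1)) with (Copp (RtoC 1)) by (apply C_ext; unfold Re, Im; simpl; ring).
      field. repeat split; assumption. }
  assert (E : height c e (inv_conj (g 1)) - height c e (g 1) = height c e (inv_conj (g 0)) - height c e (g 0)).
  { apply (const_deriv0 (fun t => height c e (inv_conj (g t)) - height c e (g t))); [lra| |].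
    - intros t Ht. apply D. lra.
    - intros t Ht. apply (is_derive_continuity_pt _ _ 0), D, Ht. }
  replace (g 1) with om in E by (unfold g; ring).
  replace (g 0) with Ci in E by (unfold g; ring).
  replace (inv_conj Ci) with Ci in E; [lra|].
  apply C_ext; unfold inv_conj, Re, Im; simpl; field.
Qed.

(** On the real axis both sides are limits along the vertical line through [om]. *)
Lemma height_sym (c : C) (e : R) (om : C) : e = 1 \/ e = -1 -> (Cconj c * RtoC (- e))%C = c ->
  0 <= Im om -> om <> 0%C -> height c e (inv_conj om) = height c e om.
Proof.
  intros He Hc Hi H0. destruct (Rle_lt_or_eq_dec _ _ Hi) as [H|H]; [apply height_sym_H; assumption|].
  assert (He1 : Rabs e <= 1) by (destruct He as [-> | ->]; [apply Rabs_p1|apply Rabs_m1]).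
  set (q := fun t : R => (om + Ci * RtoC t)%C).
  assert (Hq : filterlim q (at_right 0) (locally (q 0))).
  { apply (filterlim_filter_le_1 (F := locally 0)).
    - intros P HP. unfold at_right, within. apply filter_imp with (2 := HP). auto.
    - unfold q. flim. }
  replace (q 0) with om in Hq by (unfold q; ring).
  assert (Hqi : at_right 0 (fun t => 0 < Im (q t))).
  { exists (mkposreal 1 Rlt_0_1). intros t _ Ht. unfold q, Re, Im in *; simpl. lra. }
  assert (L1 := height_flim (F := at_right 0) c e q om He1 Hi H0 (filter_imp _ _ (fun t => Rlt_le _ _) Hqi) Hq).
  assert (Hc0 := Cconj_neq0 _ H0).
  assert (Hq2 : filterlim (fun t => inv_conj (q t)) (at_right 0) (locally (inv_conj om))).
  { unfold inv_conj. flim. exact Hc0. }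
  assert (L2 : filterlim (fun t => height c e (inv_conj (q t))) (at_right 0) (locally (height c e (inv_conj om)))).
  { apply height_flim; [exact He1| |apply inv_conj_neq0, H0| |exact Hq2].
    - rewrite inv_conj_Im by exact H0. rewrite <- H. unfold Rdiv. lra.
    - apply filter_imp with (2 := Hqi). intros t Ht.
      assert (Hqt : q t <> 0%C) by (apply Cneq0_Im; lra). assert (Hm := Cmod_neq0 _ Hqt).
      rewrite inv_conj_Im by exact Hqt. apply Rlt_le, Rdiv_lt_0_compat; [exact Ht|nra]. }
  apply (filterlim_locally_unique (F := at_right 0) (V := R_NormedModule) (fun t => height c e (q t))); [|exact L1].
  apply (filterlim_ext_loc (fun t => height c e (inv_conj (q t)))); [|exact L2].
  apply filter_imp with (2 := Hqi). intros t Ht. apply height_sym_H; assumption.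
Qed.

Lemma H1_sym (om : C) : 0 <= Im om -> om <> 0%C -> H1 (inv_conj om) = H1 om.
Proof.
  apply height_sym; [right; reflexivity|]. unfold cc1. rewrite Cconj_RtoC.
  replace (- -1) with 1 by ring. ring.
Qed.

Lemma H2_sym (om : C) : 0 <= Im om -> om <> 0%C -> H2 (inv_conj om) = H2 om.
Proof.
  apply height_sym; [left; reflexivity|]. unfold cc2. rewrite Cmult_conj, Cconj_RtoC, RtoC_opp.
  replace (Cconj Ci) with (- Ci)%C by (apply C_ext; unfold Re, Im; simpl; ring). ring.
Qed.

(** * Values on the real axis and the box *)

(** Negative [om] corresponds to [z] between [- a] and [a], where the lower walls [d0] and [e0] are
    met; positive [om] to the complementary arc through infinity, with the upper walls. *)
Definition left_side (x : R) : Prop :=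
  (regular (RtoC x) -> (Re (gsq (RtoC x)) < 0 /\ H1 (RtoC x) = d0 /\ e0 < H2 (RtoC x)) \/
                (0 < Re (gsq (RtoC x)) /\ d0 < H1 (RtoC x) /\ H2 (RtoC x) = e0)) /\
  (~ regular (RtoC x) -> H1 (RtoC x) = d0 /\ H2 (RtoC x) = e0).

Definition right_side (x : R) : Prop :=
  (regular (RtoC x) -> (Re (gsq (RtoC x)) < 0 /\ H1 (RtoC x) = d1 /\ H2 (RtoC x) < e1) \/
                (0 < Re (gsq (RtoC x)) /\ H1 (RtoC x) < d1 /\ H2 (RtoC x) = e1)) /\
  (~ regular (RtoC x) -> H1 (RtoC x) = d1 /\ H2 (RtoC x) = e1).

Lemma left_side_om (z : R) : 0 <= z < a -> left_side (om_of z).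
Proof.
  intros Hz. assert (AB := ab_range).
  assert (Hza : z + a <> 0) by lra. unfold left_side. rewrite regular_om_of by exact Hza.
  fold (K1 z) (K2 z). destruct (Rtotal_order z l) as [H|[H|H]].
  - destruct (sign_I0 z ltac:(lra)) as [S1 S2]. assert (N := rsq_neq0 z ltac:(lra)).
    rewrite gsq_om_of by lra. split; [|intros Q; exfalso; apply Q; split; lra]. intros _. right.
    split; [exact S2|]. split; [apply K1_near0; lra|apply K2_near0; lra].
  - split.
    + intros [Q _]. exfalso. apply Q. rewrite H. unfold rg1. ring.
    + intros _. split; [apply K1_la; lra|apply K2_near0; lra].
  - destruct (sign_I1 z ltac:(lra)) as [S1 S2]. assert (N := rsq_neq0 z ltac:(lra)).
    rewrite gsq_om_of by lra. split; [|intros Q; exfalso; apply Q; split; lra]. intros _. left.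
    split; [exact S2|]. split; [apply K1_la; lra|apply K2_la; lra].
Qed.

Lemma right_side_om (z : R) : a < z -> right_side (om_of z).
Proof.
  intros Hz. assert (AB := ab_range).
  assert (Hza : z + a <> 0) by lra. unfold right_side. rewrite regular_om_of by exact Hza.
  fold (K1 z) (K2 z).
  assert (N : forall S : Prop, rg2 z <> 0 -> rsq z <> 0 ->
    (Re (RtoC (rsq z)) < 0 /\ K1 z = d1 /\ K2 z < e1 \/ 0 < Re (RtoC (rsq z)) /\ K1 z < d1 /\ K2 z = e1) ->
    (rg1 z <> 0 /\ rg2 z <> 0 ->
     Re (gsq (RtoC (om_of z))) < 0 /\ K1 z = d1 /\ K2 z < e1 \/ 0 < Re (gsq (RtoC (om_of z))) /\ K1 z < d1 /\ K2 z = e1)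
    /\ (~ (rg1 z <> 0 /\ rg2 z <> 0) -> K1 z = d1 /\ K2 z = e1)).
  { intros _ N1 N2 Q. rewrite gsq_om_of by assumption. split; [auto|].
    intros X. exfalso. apply X. split; [apply rsq_neq0; exact N2|exact N1]. }
  destruct (Rtotal_order z 1) as [H|[H|H]].
  - destruct (sign_I1 z ltac:(lra)) as [S1 S2]. apply N; [exact True|lra|lra|]. left.
    split; [exact S2|]. split; [apply K1_a1; lra|apply K2_a1; lra].
  - split; [intros [_ Q]; exfalso; apply Q; rewrite H; unfold rg2; ring|].
    intros _. split; [apply K1_a1; lra|apply K2_1l1; lra].
  - destruct (Rtotal_order z l1) as [G|[G|G]].
    + destruct (sign_I2 z ltac:(lra)) as [S1 S2]. apply N; [exact True|lra|lra|]. right.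
      split; [exact S2|]. split; [apply K1_1l1; lra|apply K2_1l1; lra].
    + split; [intros [Q _]; exfalso; apply Q; rewrite G; unfold rg1; ring|].
      intros _. split; [apply K1_l1l2; lra|apply K2_1l1; lra].
    + destruct (Rtotal_order z l2) as [J|[J|J]].
      * destruct (sign_I3 z ltac:(lra)) as [S1 S2]. apply N; [exact True|lra|lra|]. left.
        split; [exact S2|]. split; [apply K1_l1l2; lra|apply K2_l1l2; lra].
      * split; [intros [_ Q]; exfalso; apply Q; rewrite J; unfold rg2; ring|].
        intros _. split; [apply K1_l1l2; lra|apply K2_far; lra].
      * destruct (sign_I4 z ltac:(lra)) as [S1 S2]. apply N; [exact True|lra|lra|]. right.
        split; [exact S2|]. split; [apply K1_far; lra|apply K2_far; lra].
Qed.

Lemma om_of_inv (x : R) : x <> 1 -> om_of (a * (1 + x) / (1 - x)) = x.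
Proof.
  intros H. assert (Ha := a_pos). unfold om_of. field. split; [lra|].
  replace (a * (1 + x) + a * (1 - x)) with (2 * a) by ring. lra.
Qed.

Lemma gsq_1 : gsq (RtoC 1) = RtoC 1.
Proof.
  assert (Ha := a_pos). assert (E : forall p, rlin p 1 = 2 * a) by (intros; unfold rlin; ring).
  rewrite gsq_real; unfold rnum, rden; rewrite !E.
  - f_equal. field. lra.
  - assert (0 < 2 * a) by lra. apply Rgt_not_eq, prod4_pos; assumption.
Qed.

Lemma regular_1 : regular (RtoC 1).
Proof.
  assert (Ha := a_pos). assert (E : forall p, rlin p 1 = 2 * a) by (intros; unfold rlin; ring).
  assert (0 < 2 * a) by lra.
  split; rewrite ?num_real, ?den_real; unfold rnum, rden; rewrite !E;
    apply RtoC_neq, Rgt_not_eq, prod4_pos; assumption.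
Qed.

Lemma real_axis_cont (c : C) (e x : R) : Rabs e <= 1 -> x <> 0 ->
  continuity_pt (fun x => height c e (RtoC x)) x.
Proof.
  intros He Hx. apply (height_continuity_pt c e RtoC); [exact He|intros s; simpl; lra|apply RtoC_neq, Hx|].
  apply flim_RtoC, flim_id.
Qed.

Lemma near_one (d : R) : 0 < d -> exists z, l2 + 1 < z /\ Rabs (om_of z - 1) < d.
Proof.
  intros Hd. assert (Ha := a_pos). set (z := l2 + 2 + 2 * a / d).
  assert (Hq : 0 < 2 * a / d) by (apply Rdiv_lt_0_compat; lra).
  exists z. split; [unfold z; lra|].
  assert (Hz : 0 < z + a) by (unfold z; lra).
  replace (om_of z - 1) with (- (2 * a / (z + a))) by (unfold om_of; field; lra).
  assert (0 < 2 * a / (z + a)) by (apply Rdiv_lt_0_compat; lra).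
  rewrite Rabs_Ropp, Rabs_right by lra.
  apply Rmult_lt_reg_r with (z + a); [exact Hz|]. replace (2 * a / (z + a) * (z + a)) with (2 * a) by (field; lra).
  unfold z. replace (d * (l2 + 2 + 2 * a / d + a)) with (2 * a + d * (l2 + 2 + a)) by (field; lra).
  assert (0 < d * (l2 + 2 + a)) by (apply Rmult_lt_0_compat; lra). lra.
Qed.

(** Here [z] is infinite, and the values are limits as [z] grows. The strict inequality survives
    because [K1] keeps decreasing beyond [l2 + 1], where it is already below [d1]. *)
Lemma right_side_1 : right_side 1.
Proof.
  split; [|intros Q; exfalso; apply Q, regular_1]. intros _. right.
  rewrite gsq_1. split; [simpl; lra|]. split.
  - apply Rnot_le_lt. intros Hle.
    assert (Cn := real_axis_cont cc1 (-1) 1 Rabs_m1 R1_neq_R0). apply continuity_pt_filterlim in Cn.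
    rewrite (flim_Rabs (F := locally 1)) in Cn.
    assert (G := K1_far (l2 + 1) ltac:(lra)).
    specialize (Cn (H1 (RtoC 1) - K1 (l2 + 1)) ltac:(lra)). apply locally_Rabs in Cn.
    destruct Cn as [d [Hd Cn]]. destruct (near_one d Hd) as [z [Hz Hzd]].
    specialize (Cn _ Hzd). assert (G2 := K1_decr_far (l2 + 1) z ltac:(lra)).
    fold H1 in Cn. change (H1 (RtoC (om_of z))) with (K1 z) in Cn. apply Rabs_def2 in Cn. lra.
  - apply cond_eq. intros eps Heps.
    assert (Cn := real_axis_cont cc2 1 1 Rabs_p1 R1_neq_R0). apply continuity_pt_filterlim in Cn.
    rewrite (flim_Rabs (F := locally 1)) in Cn.
    specialize (Cn eps Heps). apply locally_Rabs in Cn.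
    destruct Cn as [d [Hd Cn]]. destruct (near_one d Hd) as [z [Hz Hzd]].
    specialize (Cn _ Hzd). fold H2 in Cn. change (H2 (RtoC (om_of z))) with (K2 z) in Cn.
    rewrite K2_far in Cn by lra. rewrite Rabs_minus_sym. exact Cn.
Qed.

Lemma inv_conj_real (x : R) : x <> 0 -> inv_conj (RtoC x) = RtoC (/ x).
Proof. intros H. unfold inv_conj. rewrite Cconj_RtoC. apply RtoC_inv', H. Qed.

Lemma axis_sym (x : R) : x <> 0 -> H1 (RtoC (/ x)) = H1 (RtoC x) /\ H2 (RtoC (/ x)) = H2 (RtoC x) /\
  (regular (RtoC x) -> regular (RtoC (/ x)) /\ (0 < Re (gsq (RtoC x)) -> 0 < Re (gsq (RtoC (/ x)))) /\
    (Re (gsq (RtoC x)) < 0 -> Re (gsq (RtoC (/ x))) < 0)).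
Proof.
  intros Hx. assert (Hc := RtoC_neq x Hx). rewrite <- inv_conj_real by exact Hx.
  split; [apply H1_sym; [simpl; lra|exact Hc]|split; [apply H2_sym; [simpl; lra|exact Hc]|]].
  intros Hr. split; [apply regular_inv_conj; assumption|].
  rewrite gsq_inv_conj by assumption.
  assert (Hd : rden x <> 0). { intros E. apply (proj2 Hr). rewrite den_real, E. reflexivity. }
  rewrite gsq_real by exact Hd. set (r := rnum x / rden x). rewrite Cconj_RtoC.
  split; intros Hs; simpl in Hs; rewrite RtoC_inv' by lra; simpl; [apply Rinv_0_lt_compat|apply Rinv_lt_0_compat]; exact Hs.
Qed.

Lemma left_side_all (x : R) : x < 0 -> left_side x.
Proof.
  assert (Ha := a_pos).
  (* This range is [0 <= z < a]. The rest follows from [axis_sym], where [x |-> / x] stands for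
     [z |-> - z]. *)
  assert (In : forall x, -1 <= x < 0 -> left_side x).
  { intros y Hy. rewrite <- (om_of_inv y) by lra. apply left_side_om. split.
    - apply Rdiv_le_0_compat; [apply Rmult_le_pos|]; lra.
    - apply Rmult_lt_reg_r with (1 - y); [lra|]. replace (a * (1 + y) / (1 - y) * (1 - y)) with (a * (1 + y)) by (field; lra). nra. }
  intros Hx. destruct (Rle_lt_dec (-1) x) as [H|H]; [apply In; lra|].
  assert (Hi : -1 <= / x < 0).
  { split; [|apply Rinv_lt_0_compat, Hx]. assert (E : / x * x = 1) by (field; lra). nra. }
  destruct (In _ Hi) as [A1 A2].
  destruct (axis_sym x ltac:(lra)) as [S1 [S2 _]].
  destruct (axis_sym (/ x) ltac:(lra)) as [_ [_ S3']]. rewrite Rinv_inv in S3'.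
  destruct (axis_sym x ltac:(lra)) as [_ [_ S3]].
  rewrite S1, S2 in A1, A2. split.
  - intros Hr. destruct (S3 Hr) as [T1 [T2 T3]]. destruct (S3' T1) as [_ [T4 T5]]. destruct (A1 T1) as [B|B].
    + left. split; [apply T5, B|apply B].
    + right. split; [apply T4, B|apply B].
  - intros Hr. apply A2. intros Q. apply Hr, S3', Q.
Qed.

Lemma right_side_all (x : R) : 0 < x -> right_side x.
Proof.
  assert (Ha := a_pos).
  (* This range is [z > a] together with [z] infinite, at [x = 1]. *)
  assert (In : forall x, 0 < x <= 1 -> right_side x).
  { intros y Hy. destruct (Req_dec y 1) as [->|Hy1]; [apply right_side_1|].
    rewrite <- (om_of_inv y) by lra. apply right_side_om.
    apply Rmult_lt_reg_r with (1 - y); [lra|]. replace (a * (1 + y) / (1 - y) * (1 - y)) with (a * (1 + y)) by (field; lra). nra. }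
  intros Hx. destruct (Rle_lt_dec x 1) as [H|H]; [apply In; lra|].
  assert (Hi : 0 < / x <= 1).
  { split; [apply Rinv_0_lt_compat, Hx|]. rewrite <- Rinv_1. apply Rinv_le_contravar; lra. }
  destruct (In _ Hi) as [A1 A2].
  destruct (axis_sym x ltac:(lra)) as [S1 [S2 _]].
  destruct (axis_sym (/ x) ltac:(lra)) as [_ [_ S3']]. rewrite Rinv_inv in S3'.
  destruct (axis_sym x ltac:(lra)) as [_ [_ S3]].
  rewrite S1, S2 in A1, A2. split.
  - intros Hr. destruct (S3 Hr) as [T1 [T2 T3]]. destruct (S3' T1) as [_ [T4 T5]]. destruct (A1 T1) as [B|B].
    + left. split; [apply T5, B|apply B].
    + right. split; [apply T4, B|apply B].
  - intros Hr. apply A2. intros Q. apply Hr, S3', Q.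
Qed.

Lemma arc_H (k s1 s2 : R) : 0 < k -> -1 <= s1 < s2 -> s2 <= 1 ->
  H1 (arc k s1) < H1 (arc k s2) /\ H2 (arc k s1) < H2 (arc k s2).
Proof.
  intros Hk Hs1 Hs2. split; apply arc_strict; try assumption.
  - apply Rabs_m1.
  - apply form1_turn.
  - apply Rabs_p1.
  - apply form2_turn.
Qed.

Lemma left_bounds (x : R) : x < 0 -> d0 <= H1 (RtoC x) /\ e0 <= H2 (RtoC x).
Proof.
  intros Hx. destruct (left_side_all x Hx) as [A1 A2].
  destruct (Classical_Prop.classic (regular (RtoC x))) as [Hr|Hr].
  - destruct (A1 Hr); lra.
  - destruct (A2 Hr); lra.
Qed.

Lemma right_bounds (x : R) : 0 < x -> H1 (RtoC x) <= d1 /\ H2 (RtoC x) <= e1.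
Proof.
  intros Hx. destruct (right_side_all x Hx) as [A1 A2].
  destruct (Classical_Prop.classic (regular (RtoC x))) as [Hr|Hr].
  - destruct (A1 Hr); lra.
  - destruct (A2 Hr); lra.
Qed.

Lemma axis_strict (k : R) : 0 < k -> H1 (RtoC (- k)) < H1 (RtoC k) /\ H2 (RtoC (- k)) < H2 (RtoC k).
Proof. intros Hk. rewrite <- arc_m1, <- arc_p1. apply arc_H; lra. Qed.

Lemma de_lt : d0 < d1 /\ e0 < e1.
Proof.
  assert (A1 := axis_strict 1 Rlt_0_1). assert (A2 := left_bounds (- (1)) ltac:(lra)).
  assert (A3 := right_bounds 1 Rlt_0_1). lra.
Qed.

(** On the half circle through [om] the heights increase strictly, from a left end where they are at
    least [d0] and [e0] to a right end where they are at most [d1] and [e1]. *)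
Lemma box_interior (om : C) : 0 < Im om -> d0 < H1 om < d1 /\ e0 < H2 om < e1.
Proof.
  intros H. assert (H0 : om <> 0%C) by (apply Cneq0_Im; lra).
  assert (Hm := Cmod_neq0 _ H0). destruct (arc_surj om (Rlt_le _ _ H) H0) as [Hs E].
  set (s := Re om / Cmod om) in *.
  assert (Hs1 : s <> 1). { intros E1. rewrite E1, arc_p1 in E. rewrite <- E in H. simpl in H. lra. }
  assert (Hs2 : s <> -1). { intros E1. rewrite E1, arc_m1 in E. rewrite <- E in H. simpl in H. lra. }
  destruct (arc_H (Cmod om) (-1) s Hm ltac:(lra) ltac:(lra)) as [B1 B2].
  destruct (arc_H (Cmod om) s 1 Hm ltac:(lra) ltac:(lra)) as [B3 B4].
  rewrite arc_m1, E in B1, B2. rewrite arc_p1, E in B3, B4.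
  assert (A2 := left_bounds (- Cmod om) ltac:(lra)). assert (A3 := right_bounds (Cmod om) Hm). lra.
Qed.

Lemma gw_real_cases (x : R) : regular (RtoC x) ->
  (0 < Re (gsq (RtoC x)) -> 0 < Re (gw (RtoC x)) /\ Im (gw (RtoC x)) = 0) /\
  (Re (gsq (RtoC x)) < 0 -> Re (gw (RtoC x)) = 0 /\ Im (gw (RtoC x)) < 0).
Proof.
  intros [_ Hd]. assert (Hd' : rden x <> 0). { intros E. apply Hd. rewrite den_real, E. reflexivity. }
  unfold gw. rewrite gsq_real by exact Hd'. set (r := rnum x / rden x).
  split; intros Hr; simpl in Hr.
  - rewrite csqrt_pos by exact Hr. split; [apply sqrt_lt_R0, Hr|reflexivity].
  - rewrite csqrt_neg by exact Hr. assert (S : 0 < sqrt (- r)) by (apply sqrt_lt_R0; lra).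
    unfold Re, Im; simpl. lra.
Qed.

Definition on_walls (x lo hi : R) : Prop := x = lo \/ x = hi.

(** A real point avoids the walls of the other side: by [axis_strict] its heights differ strictly
    from those at the opposite end of its half circle, which respect these walls. *)
Lemma box (om : C) : 0 <= Im om -> om <> 0%C ->
  (d0 <= H1 om <= d1 /\ e0 <= H2 om <= e1) /\
  (regular om -> (Re (gw om) = 0 -> on_walls (H1 om) d0 d1) /\ (Re (gw om) <> 0 -> d0 < H1 om < d1) /\
                 (Im (gw om) = 0 -> on_walls (H2 om) e0 e1) /\ (Im (gw om) <> 0 -> e0 < H2 om < e1)) /\
  (~ regular om -> on_walls (H1 om) d0 d1 /\ on_walls (H2 om) e0 e1).
Proof.
  intros Hi H0. assert (De := de_lt). destruct (Rle_lt_or_eq_dec _ _ Hi) as [H|H].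
  - assert (B := box_interior om H). assert (G := gw_H om H).
    split; [lra|split]; [|intros Q; exfalso; apply Q, regular_H; lra].
    intros _. repeat split; intros; lra.
  - rewrite (real_of_Im0 om) in H0 |- * by auto. set (x := Re om) in *.
    assert (Hx : x <> 0) by (intros E; apply H0; rewrite E; reflexivity).
    destruct (Rtotal_order x 0) as [Hs|[Hs|Hs]]; [|lra|].
    + assert (A := left_side_all x Hs). assert (B1 := left_bounds x Hs).
      assert (B2 := axis_strict (- x) ltac:(lra)). rewrite Ropp_involutive in B2.
      assert (B3 := right_bounds (- x) ltac:(lra)). destruct A as [A1 A2].
      split; [lra|split].
      * intros Hr. destruct (gw_real_cases x Hr) as [C1 C2].
        destruct (A1 Hr) as [[D1 [D2 D3]]|[D1 [D2 D3]]].
        -- specialize (C2 D1). repeat split; intros; try lra. left; exact D2.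
        -- specialize (C1 D1). repeat split; intros; try lra. left; exact D3.
      * intros Hr. split; left; apply A2, Hr.
    + assert (A := right_side_all x Hs). assert (B1 := right_bounds x Hs).
      assert (B2 := axis_strict x Hs).
      assert (B3 := left_bounds (- x) ltac:(lra)). destruct A as [A1 A2].
      split; [lra|split].
      * intros Hr. destruct (gw_real_cases x Hr) as [C1 C2].
        destruct (A1 Hr) as [[D1 [D2 D3]]|[D1 [D2 D3]]].
        -- specialize (C2 D1). repeat split; intros; try lra. right; exact D2.
        -- specialize (C1 D1). repeat split; intros; try lra. right; exact D3.
      * intros Hr. split; right; apply A2, Hr.
Qed.

(** * Single-valued functions on [R] *)

(** The heights live on the closed upper half plane. Reading them at the conjugate point over the
    lower one amounts to continuation by reflection. *)
Definition up (om : C) : C := (Re om, Rabs (Im om)).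

Lemma up_Im (om : C) : 0 <= Im (up om).
Proof. apply Rabs_pos. Qed.

Lemma up_pos (om : C) : 0 <= Im om -> up om = om.
Proof. intros H. apply C_ext; [reflexivity|]. apply Rabs_right. lra. Qed.

Lemma up_neg (om : C) : Im om <= 0 -> up om = Cconj om.
Proof. intros H. apply C_ext; [reflexivity|]. apply Rabs_left1, H. Qed.

Lemma up_lip (u v : C) : Cmod (up u - up v) <= Cmod (u - v).
Proof.
  apply Rsqr_incr_0; [|apply Cmod_ge_0|apply Cmod_ge_0]. unfold Rsqr. rewrite !Cmod_sqr.
  change (Re (up u - up v)%C) with (Re u - Re v). change (Im (up u - up v)%C) with (Rabs (Im u) - Rabs (Im v)).
  change (Re (u - v)%C) with (Re u - Re v). change (Im (u - v)%C) with (Im u - Im v).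
  assert (H := Rsqr_le_abs_1 _ _ (Rabs_triang_inv2 (Im u) (Im v))). unfold Rsqr in H. lra.
Qed.

Lemma up_flim {T : Type} {F : (T -> Prop) -> Prop} {FF : Filter F} (g : T -> C) (om : C) :
  filterlim g F (locally om) -> filterlim (fun x => up (g x)) F (locally (up om)).
Proof.
  rewrite !flim_Cmod. intros H e He. apply filter_imp with (2 := H e He). intros x Hx.
  apply Rle_lt_trans with (2 := Hx). apply up_lip.
Qed.

Lemma up_Cmod (om : C) : Cmod (up om) = Cmod om.
Proof.
  destruct (Rle_lt_dec 0 (Im om)); [rewrite up_pos by assumption; reflexivity|].
  rewrite up_neg by lra. apply Cmod_conj.
Qed.

Lemma up_neq0 (om : C) : om <> 0%C -> up om <> 0%C.
Proof.
  intros H E. assert (Hm := Cmod_neq0 _ H). rewrite <- up_Cmod, E, Cmod_0 in Hm. lra.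
Qed.

Lemma lin_conj (p : R) (om : C) : lin p (Cconj om) = Cconj (lin p om).
Proof. unfold lin. rewrite Cplus_conj, Cmult_conj, !Cconj_RtoC. reflexivity. Qed.

Lemma num_conj (om : C) : num (Cconj om) = Cconj (num om).
Proof. unfold num. rewrite !Cmult_conj, !lin_conj. reflexivity. Qed.

Lemma den_conj (om : C) : den (Cconj om) = Cconj (den om).
Proof. unfold den. rewrite !Cmult_conj, !lin_conj. reflexivity. Qed.

Lemma regular_up (om : C) : regular om <-> regular (up om).
Proof.
  destruct (Rle_lt_dec 0 (Im om)); [rewrite up_pos by assumption; tauto|].
  rewrite up_neg by lra. unfold regular. rewrite num_conj, den_conj. split; intros [A1 A2].
  - split; apply Cconj_neq0; assumption.
  - split; intros E; [apply A1|apply A2]; rewrite E; apply Cconj_RtoC.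
Qed.

Lemma gsq_conj (om : C) : regular om -> gsq (Cconj om) = Cconj (gsq om).
Proof.
  intros [_ H]. unfold gsq, Cdiv. rewrite num_conj, den_conj, Cmult_conj, Cconj_inv by exact H. reflexivity.
Qed.

(** The equation of [R] in the coordinate [om]. The ends lie at 0 and infinity, so [om] ranges over
    the nonzero complex numbers. *)
Definition point_over (om : C) (w : Chat) : Prop :=
  om <> 0%C /\ match w with Fin w => (den om * (w * w) = num om)%C | Inf => den om = 0%C end.

(** The difference of the two is a nonzero multiple of [om - 1], and at [om = 1] every [lin p]
    equals [2 * a]. *)
Lemma lin_distinct (p q : R) (om : C) : p <> q -> lin p om = 0%C -> lin q om = 0%C -> False.
Proof.
  intros Hpq A1 A2. assert (Ha := a_pos).
  assert (E : ((RtoC (p - q)) * (om - 1))%C = (lin p om - lin q om)%C).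
  { unfold lin. rewrite !RtoC_minus, !RtoC_plus. ring. }
  rewrite A1, A2 in E.
  assert (Eo : om = 1%C).
  { destruct (Ceq_dec (om - 1)%C 0%C) as [E0|E0].
    - replace om with (om - 1 + 1)%C by ring. rewrite E0. ring.
    - exfalso. apply (Cmult_neq_0 (RtoC (p - q)) (om - 1)%C).
      + apply RtoC_neq. lra.
      + exact E0.
      + rewrite E. ring. }
  rewrite Eo, lin_real in A1. apply (f_equal Re) in A1. unfold rlin in A1. simpl in A1. lra.
Qed.

Lemma Cmult_zero (u v : C) : (u * v = 0)%C -> u = 0%C \/ v = 0%C.
Proof.
  intros H. destruct (Ceq_dec u 0%C) as [E|E]; [left; exact E|]. right.
  destruct (Ceq_dec v 0%C) as [E'|E']; [exact E'|]. exfalso. apply (Cmult_neq_0 u v E E' H).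
Qed.

Lemma num_den_coprime (om : C) : num om = 0%C -> den om = 0%C -> False.
Proof.
  unfold num, den. intros A B.
  apply Cmult_zero in A. destruct A as [A|A]; [apply Cmult_zero in A; destruct A as [A|A]; [apply Cmult_zero in A; destruct A as [A|A]|]|];
  (apply Cmult_zero in B; destruct B as [B|B]; [apply Cmult_zero in B; destruct B as [B|B]; [apply Cmult_zero in B; destruct B as [B|B]|]|]);
  refine (lin_distinct _ _ om _ A B); lra.
Qed.

Lemma point_regular (om w : C) : point_over om (Fin w) -> w <> 0%C ->
  regular om /\ (w * w = gsq om)%C.
Proof.
  intros [H0 H] Hw. assert (Hd : den om <> 0%C).
  { intros E. apply (num_den_coprime om); [|exact E]. rewrite <- H, E. ring. }
  assert (Hn : num om <> 0%C) by (rewrite <- H; apply Cmult_neq_0; [exact Hd|apply Cmult_neq_0; exact Hw]).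
  split; [split; assumption|]. unfold gsq. rewrite <- H. field. exact Hd.
Qed.

Lemma point_singular (om : C) (w : Chat) : point_over om w -> ~ regular om ->
  (w = Fin 0 /\ num om = 0%C) \/ (w = Inf /\ den om = 0%C).
Proof.
  intros [H0 H] Hr. destruct w as [w|]; [|right; auto].
  left. destruct (Ceq_dec w 0%C) as [->|E].
  - split; [reflexivity|]. rewrite <- H. ring.
  - exfalso. apply Hr. apply (point_regular om w); [split; assumption|exact E].
Qed.

Lemma point_singular' (om : C) (w : Chat) : point_over om w -> w = Fin 0 \/ w = Inf -> ~ regular om.
Proof.
  intros [H0 H] Hw [R1 R2]. destruct Hw as [-> | ->].
  - apply R1. rewrite <- H. ring.
  - exact (R2 H).
Qed.

Definition s1 (w : C) : R := sign (Re w).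
(** Over the upper half plane [w] is [gw] or its opposite, and [gw] has positive real and negative
    imaginary part. With the minus sign, [s1] and [s2] are equal there; over the lower half plane
    they are opposite. *)
Definition s2 (w : C) : R := sign (- Im w).

Lemma sign_cases (x : R) : (0 < x /\ sign x = 1) \/ (x = 0 /\ sign x = 0) \/ (x < 0 /\ sign x = -1).
Proof.
  destruct (Rtotal_order x 0) as [H|[H|H]].
  - right; right. split; [exact H|apply sign_eq_m1, H].
  - right; left. split; [exact H|rewrite H; apply sign_0].
  - left. split; [exact H|apply sign_eq_1, H].
Qed.

(** The coefficient of [phi_1] or [phi_2] with respect to [d om] at an arbitrary point of [R];
    [form] is its value on the branch [w = gw om]. *)
Definition ph (c : C) (e : R) (om w : C) : C := (c * (/ w + RtoC e * w) / om)%C.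

Lemma sqr_eq (u v : C) : (u * u = v * v)%C -> exists s, (s = 1 \/ s = -1) /\ u = (RtoC s * v)%C.
Proof.
  intros H. assert (E : ((u - v) * (u + v) = 0)%C).
  { replace ((u - v) * (u + v))%C with (u * u - v * v)%C by ring. rewrite H. ring. }
  apply Cmult_zero in E. destruct E as [E|E].
  - exists 1. split; [left; reflexivity|]. replace u with (u - v + v)%C by ring. rewrite E. ring.
  - exists (-1). split; [right; reflexivity|]. replace u with (u + v - v)%C by ring. rewrite E.
    apply C_ext; unfold Re, Im; simpl; ring.
Qed.

Lemma point_gw (om w : C) : point_over om (Fin w) -> w <> 0%C ->
  exists s, (s = 1 \/ s = -1) /\ (0 <= Im om -> w = (RtoC s * gw (up om))%C) /\
     (Im om < 0 -> w = (RtoC s * Cconj (gw (up om)))%C).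
Proof.
  intros H Hw. destruct (point_regular om w H Hw) as [Hr E].
  destruct (Rle_lt_dec 0 (Im om)) as [Hi|Hi].
  - rewrite up_pos by exact Hi. rewrite <- gw_sqr in E. destruct (sqr_eq _ _ E) as [s [Hs Es]].
    exists s. split; [exact Hs|split; [auto|lra]].
  - rewrite up_neg by lra. assert (E2 : (w * w = Cconj (gw (Cconj om)) * Cconj (gw (Cconj om)))%C).
    { rewrite <- Cmult_conj, gw_sqr, gsq_conj by exact Hr. rewrite Cconj_conj. exact E. }
    destruct (sqr_eq _ _ E2) as [s [Hs Es]]. exists s. split; [exact Hs|split; [lra|auto]].
Qed.

Lemma Re_s (s : R) (u : C) : Re (RtoC s * u)%C = s * Re u.
Proof. apply Re_scal. Qed.

Lemma ph_scal (c : C) (e s : R) (om u : C) : s = 1 \/ s = -1 -> u <> 0%C -> om <> 0%C ->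
  ph c e om (RtoC s * u)%C = (RtoC s * ph c e om u)%C.
Proof.
  intros Hs Hu Ho. unfold ph. destruct Hs as [-> | ->].
  - replace (RtoC 1 * u)%C with u by ring. ring.
  - replace (RtoC (-1)) with (Copp (RtoC 1)) by (apply C_ext; unfold Re, Im; simpl; ring).
    field. split; assumption.
Qed.

Lemma ph_conj (c : C) (e k : R) (om u : C) : u <> 0%C -> om <> 0%C -> Cconj c = (RtoC k * c)%C ->
  ph c e (Cconj om) (Cconj u) = Cconj (ph (RtoC k * c) e om u).
Proof.
  intros Hu Ho Hc. unfold ph, Cdiv.
  assert (Hc2 : (RtoC k * Cconj c)%C = c).
  { apply (f_equal Cconj) in Hc. rewrite Cconj_conj, Cmult_conj, Cconj_RtoC in Hc. symmetry. exact Hc. }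
  rewrite !Cmult_conj, Cplus_conj, Cmult_conj, !Cconj_inv, !Cconj_RtoC by assumption.
  rewrite Hc2. reflexivity.
Qed.

Lemma gw_axis (x : R) : regular (RtoC x) -> Re (gw (RtoC x)) = 0 \/ Im (gw (RtoC x)) = 0.
Proof.
  intros Hr. destruct (gw_real_cases x Hr) as [A1 A2].
  assert (E : Im (gw (RtoC x) * gw (RtoC x))%C = 0).
  { rewrite gw_sqr. destruct Hr as [_ Hd]. rewrite gsq_real; [reflexivity|].
    intros E. apply Hd. rewrite den_real, E. reflexivity. }
  rewrite Im_sqr in E. apply Rmult_integral. lra.
Qed.

(* [S] is the sign that determines on which side of the walls the values of
   [X] lie, [T] is the sign for the other family of walls. *)
Definition coherent (c : C) (e : R) (S T : C -> R) : Prop :=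
  forall om w : C, point_over om (Fin w) -> w <> 0%C ->
  (S w = 0 \/ S w = 1 \/ S w = -1) /\
  (S w <> 0 ->
     (0 < Im om -> ph c e om w = (RtoC (S w) * form c e (up om))%C) /\
     (Im om < 0 -> ph c e om w = (RtoC (S w) * Cconj (form c e (up om)))%C) /\
     (Im om = 0 -> ph c e om w = (RtoC (S w) * form c e (up om))%C /\ Im (form c e (up om)) = 0)) /\
  (S w = 0 -> Im om = 0 /\ (T w = 1 \/ T w = -1) /\
     ph c e om w = (RtoC (T w) * form c e (up om))%C /\ Re (form c e (up om)) = 0) /\
  (0 < Im om -> S w = T w) /\ (Im om < 0 -> S w = - T w).

Lemma form_real1 (x : R) (W : C) : x <> 0 -> W <> 0%C -> gw (RtoC x) = W ->
  (Re W = 0 -> Re (form1 (RtoC x)) = 0 /\ Im (form2 (RtoC x)) = 0) /\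
  (Im W = 0 -> Im (form1 (RtoC x)) = 0 /\ Re (form2 (RtoC x)) = 0).
Proof.
  intros Hx HW E. unfold form1, form2, form, cc1, cc2, Cdiv. rewrite E, RtoC_inv' by exact Hx.
  destruct (Cinv_parts W HW) as [I1 I2]. set (V := (/ W)%C) in *.
  destruct W as [p q], V as [r s]. unfold Re, Im in *; simpl in *.
  split; intros H; rewrite H in *; unfold Rdiv in *; rewrite ?Rmult_0_l, ?Ropp_0, ?Rmult_0_l in *.
  - rewrite I1. split; ring.
  - assert (s = 0) by (rewrite I2; ring). subst s. split; ring.
Qed.

Lemma point_signs (om w : C) : point_over om (Fin w) -> w <> 0%C ->
  (0 < Im om -> Re w * Im w < 0) /\ (Im om < 0 -> 0 < Re w * Im w).
Proof.
  intros H Hw. destruct (point_regular om w H Hw) as [Hr E].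
  assert (E2 : Im (gsq om) = 2 * (Re w * Im w)) by (rewrite <- E; apply Im_sqr).
  split; intros Hi.
  - assert (N := gsq_Im_neg om Hi). lra.
  - assert (N := gsq_Im_neg (Cconj om)). rewrite gsq_conj in N by exact Hr.
    change (Im (Cconj om)) with (- Im om) in N. change (Im (Cconj (gsq om))) with (- Im (gsq om)) in N.
    specialize (N ltac:(lra)). lra.
Qed.

Lemma sign_scal (s x : R) : s = 1 \/ s = -1 -> sign (s * x) = s * sign x.
Proof.
  intros [-> | ->].
  - rewrite !Rmult_1_l. reflexivity.
  - replace (-1 * x) with (- x) by ring. rewrite sign_opp. ring.
Qed.

(** On the sheet [s], the value [w] is [s] times [gw] or its conjugate. Conjugation keeps [Re w],
    and [cc1] is real, so [s1 w] is the sheet sign [s] over both half planes. Where [Re w = 0] the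
    sheet sign is read from [s2 w]. *)
Lemma coherent1 : coherent cc1 (-1) s1 s2.
Proof.
  intros om w H Hw. assert (Sg := point_signs om w H Hw).
  destruct (point_regular om w H Hw) as [Hr E].
  destruct (point_gw om w H Hw) as [s [Hs [P1 P2]]].
  assert (Ho := proj1 H). assert (Hu := up_neq0 om Ho). assert (Hru := proj1 (regular_up om) Hr).
  assert (HW := gw_neq0 _ Hru).
  destruct (gw_closed (up om) (up_Im om) Hru) as [Q1 Q2].
  split; [unfold s1; destruct (sign_cases (Re w)) as [[_ ->]|[[_ ->]|[_ ->]]]; auto|].
  split; [|split; [|split]].
  - intros Hn. assert (Es : s1 w = s).
    { unfold s1 in *. destruct (Rle_lt_dec 0 (Im om)) as [Hi|Hi].
      - rewrite (P1 Hi), Re_s, sign_scal in * by exact Hs.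
        destruct (sign_cases (Re (gw (up om)))) as [[_ G]|[[_ G]|[G _]]]; [rewrite G; ring|rewrite G in Hn; lra|lra].
      - rewrite (P2 Hi), Re_s, sign_scal in * by exact Hs. change (Re (Cconj ?u)) with (Re u) in *.
        destruct (sign_cases (Re (gw (up om)))) as [[_ G]|[[_ G]|[G _]]]; [rewrite G; ring|rewrite G in Hn; lra|lra]. }
    rewrite Es. split; [|split]; intros Hi.
    + rewrite (P1 ltac:(lra)), ph_scal by assumption. rewrite up_pos by lra. reflexivity.
    + rewrite (P2 Hi), ph_scal; [|exact Hs|apply Cconj_neq0, HW|exact Ho]. f_equal.
      rewrite up_neg in * by lra. rewrite <- (Cconj_conj om) at 1.
      rewrite (ph_conj cc1 (-1) 1); [|exact HW|exact Hu|unfold cc1; rewrite Cconj_RtoC; ring].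
      replace (RtoC 1 * cc1)%C with cc1 by ring. reflexivity.
    + rewrite (P1 ltac:(lra)), ph_scal by assumption. rewrite up_pos in * by lra. split; [reflexivity|].
      assert (Eo := real_of_Im0 om Hi). rewrite Eo in *. set (x := Re om) in *.
      assert (Hx : x <> 0) by (intros E0; apply Ho; rewrite E0; reflexivity).
      destruct (gw_axis x Hr) as [G|G].
      * exfalso. apply Hn. unfold s1. rewrite (P1 ltac:(lra)), Re_s, G, Rmult_0_r. apply sign_0.
      * apply (form_real1 x _ Hx HW eq_refl), G.
  - intros H0. assert (Hre : Re w = 0).
    { unfold s1 in H0. destruct (sign_cases (Re w)) as [[_ G]|[[G _]|[_ G]]]; lra. }
    assert (Hi : Im om = 0).
    { destruct (Rtotal_order (Im om) 0) as [G|[G|G]]; [|exact G|]; rewrite Hre in Sg; exfalso.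
      - apply (proj2 Sg) in G. lra.
      - apply (proj1 Sg) in G. lra. }
    assert (HIm : Im w <> 0) by (intros G; apply Hw, C_ext; assumption).
    split; [exact Hi|].
    assert (Et : s2 w = s).
    { unfold s2. rewrite (P1 ltac:(lra)), Im_scal in *. rewrite Ropp_mult_distr_r, sign_scal by exact Hs.
      destruct (sign_cases (- Im (gw (up om)))) as [[_ G]|[[G _]|[G _]]]; [rewrite G; ring| |lra].
      exfalso. apply HIm. replace (Im (gw (up om))) with 0 by lra. ring. }
    rewrite Et. split; [exact Hs|].
    rewrite (P1 ltac:(lra)), ph_scal by assumption. rewrite up_pos in * by lra. split; [reflexivity|].
    assert (Eo := real_of_Im0 om Hi). rewrite Eo in *. set (x := Re om) in *.
    assert (Hx : x <> 0) by (intros E0; apply Ho; rewrite E0; reflexivity).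
    apply (form_real1 x _ Hx HW eq_refl).
    rewrite (P1 ltac:(lra)), Re_s in Hre. destruct Hs as [-> | ->]; lra.
  - intros Hi. apply (proj1 Sg) in Hi. unfold s1, s2.
    destruct (sign_cases (Re w)) as [[G1 ->]|[[G1 ->]|[G1 ->]]];
    destruct (sign_cases (- Im w)) as [[G2 ->]|[[G2 ->]|[G2 ->]]]; nra.
  - intros Hi. apply (proj2 Sg) in Hi. unfold s1, s2.
    destruct (sign_cases (Re w)) as [[G1 ->]|[[G1 ->]|[G1 ->]]];
    destruct (sign_cases (- Im w)) as [[G2 ->]|[[G2 ->]|[G2 ->]]]; nra.
Qed.

(** Conjugation reverses [Im w], so [s2 w] is [- s] over the lower half plane. This matches the
    form, since [cc2] is imaginary and conjugation changes its sign as well. *)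
Lemma coherent2 : coherent cc2 1 s2 s1.
Proof.
  intros om w H Hw. assert (Sg := point_signs om w H Hw).
  destruct (point_regular om w H Hw) as [Hr E].
  destruct (point_gw om w H Hw) as [s [Hs [P1 P2]]].
  assert (Ho := proj1 H). assert (Hu := up_neq0 om Ho). assert (Hru := proj1 (regular_up om) Hr).
  assert (HW := gw_neq0 _ Hru).
  destruct (gw_closed (up om) (up_Im om) Hru) as [Q1 Q2].
  split; [unfold s2; destruct (sign_cases (- Im w)) as [[_ ->]|[[_ ->]|[_ ->]]]; auto|].
  split; [|split; [|split]].
  - intros Hn. split; [|split]; intros Hi.
    + assert (Es : s2 w = s).
      { unfold s2 in *. rewrite (P1 ltac:(lra)), Im_scal, Ropp_mult_distr_r, sign_scal in * by exact Hs.
        destruct (sign_cases (- Im (gw (up om)))) as [[_ G]|[[_ G]|[G _]]]; [rewrite G; ring|rewrite G in Hn; lra|lra]. }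
      rewrite Es, (P1 ltac:(lra)), ph_scal by assumption. rewrite up_pos by lra. reflexivity.
    + assert (Es : s2 w = - s).
      { unfold s2 in *. rewrite (P2 Hi), Im_scal, Ropp_mult_distr_r, sign_scal in * by exact Hs.
        change (Im (Cconj (gw (up om)))) with (- Im (gw (up om))) in *.
        destruct (sign_cases (- - Im (gw (up om)))) as [[G _]|[[_ G]|[_ G]]]; [lra|rewrite G in Hn; lra|rewrite G; ring]. }
      rewrite Es, (P2 Hi), ph_scal; [|exact Hs|apply Cconj_neq0, HW|exact Ho].
      rewrite up_neg in * by lra. rewrite <- (Cconj_conj om) at 1.
      rewrite (ph_conj cc2 1 (-1)); [|exact HW|exact Hu|].
      * rewrite RtoC_opp. unfold form. unfold ph.
        replace (RtoC (-1) * cc2 * (/ gw (Cconj om) + 1 * gw (Cconj om)) / Cconj om)%C with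
          (- (cc2 * (/ gw (Cconj om) + 1 * gw (Cconj om)) / Cconj om))%C.
        -- rewrite Copp_conj. ring.
        -- replace (RtoC (-1)) with (Copp (RtoC 1)) by (apply C_ext; unfold Re, Im; simpl; ring).
           unfold Cdiv. ring.
      * unfold cc2. rewrite Cmult_conj, Cconj_RtoC. apply C_ext; unfold Re, Im; simpl; ring.
    + assert (Es : s2 w = s).
      { unfold s2 in *. rewrite (P1 ltac:(lra)), Im_scal, Ropp_mult_distr_r, sign_scal in * by exact Hs.
        destruct (sign_cases (- Im (gw (up om)))) as [[_ G]|[[_ G]|[G _]]]; [rewrite G; ring|rewrite G in Hn; lra|lra]. }
      rewrite Es, (P1 ltac:(lra)), ph_scal by assumption. rewrite up_pos in * by lra. split; [reflexivity|].
      assert (Eo := real_of_Im0 om Hi). rewrite Eo in *. set (x := Re om) in *.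
      assert (Hx : x <> 0) by (intros E0; apply Ho; rewrite E0; reflexivity).
      destruct (gw_axis x Hr) as [G|G].
      * apply (form_real1 x _ Hx HW eq_refl), G.
      * exfalso. apply Hn. unfold s2. rewrite (P1 ltac:(lra)), Im_scal, G, Rmult_0_r, Ropp_0. apply sign_0.
  - intros H0. assert (Him : Im w = 0).
    { unfold s2 in H0. destruct (sign_cases (- Im w)) as [[_ G]|[[G _]|[_ G]]]; lra. }
    assert (Hi : Im om = 0).
    { destruct (Rtotal_order (Im om) 0) as [G|[G|G]]; [|exact G|]; rewrite Him in Sg; exfalso.
      - apply (proj2 Sg) in G. lra.
      - apply (proj1 Sg) in G. lra. }
    assert (HRe : Re w <> 0) by (intros G; apply Hw, C_ext; assumption).
    split; [exact Hi|].
    assert (Et : s1 w = s).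
    { unfold s1. rewrite (P1 ltac:(lra)), Re_s in *. rewrite sign_scal by exact Hs.
      destruct (sign_cases (Re (gw (up om)))) as [[_ G]|[[G _]|[G _]]]; [rewrite G; ring| |lra].
      exfalso. apply HRe. rewrite G. ring. }
    rewrite Et. split; [exact Hs|].
    rewrite (P1 ltac:(lra)), ph_scal by assumption. rewrite up_pos in * by lra. split; [reflexivity|].
    assert (Eo := real_of_Im0 om Hi). rewrite Eo in *. set (x := Re om) in *.
    assert (Hx : x <> 0) by (intros E0; apply Ho; rewrite E0; reflexivity).
    apply (form_real1 x _ Hx HW eq_refl).
    rewrite (P1 ltac:(lra)), Im_scal in Him. destruct Hs as [-> | ->]; lra.
  - intros Hi. apply (proj1 Sg) in Hi. unfold s1, s2.
    destruct (sign_cases (Re w)) as [[G1 ->]|[[G1 ->]|[G1 ->]]];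
    destruct (sign_cases (- Im w)) as [[G2 ->]|[[G2 ->]|[G2 ->]]]; nra.
  - intros Hi. apply (proj2 Sg) in Hi. unfold s1, s2.
    destruct (sign_cases (Re w)) as [[G1 ->]|[[G1 ->]|[G1 ->]]];
    destruct (sign_cases (- Im w)) as [[G2 ->]|[[G2 ->]|[G2 ->]]]; nra.
Qed.

(** * Derivatives along curves that meet the walls *)

(** The pair [(cos A, sg * sin A)] turns with speed [p] whatever the sign is: [A] moves with speed
    [s * p], and [s * s = 1]. *)
Lemma trig_lift_const (A sg : R -> R) (t s p : R) : s = 1 \/ s = -1 ->
  locally t (fun u => sg u = s) -> is_derive A t (s * p) ->
  is_derive (fun u => cos (A u)) t (- p * (sg t * sin (A t))) /\
  is_derive (fun u => sg u * sin (A u)) t (p * cos (A t)).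
Proof.
  intros Hs Hsg HA. assert (E := locally_singleton _ _ Hsg). split.
  - apply (is_derive_eq _ _ (s * p * - sin (A t))); [|rewrite E; ring].
    apply (is_derive_comp cos A); [apply is_derive_cos|exact HA].
  - apply (is_derive_ext_loc (fun u => s * sin (A u))).
    + apply filter_imp with (2 := Hsg). intros u Hu. rewrite Hu. reflexivity.
    + apply (is_derive_eq _ _ (s * (s * p * cos (A t)))); [|destruct Hs as [-> | ->]; ring].
      apply is_derive_scal. apply (is_derive_comp sin A); [apply is_derive_sin|exact HA].
Qed.

(* The case where [A] reaches a wall: [A] may be non-differentiable there, but
   the sign compensates. *)
Lemma trig_lift_wall (A sg : R -> R) (t p M : R) :
  sin (A t) = 0 -> (forall u, Rabs (sg u) <= 1) -> sg t = 0 ->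
  locally t (fun u => Rabs (A u - A t) <= M * Rabs (u - t)) ->
  (forall e, 0 < e -> locally t (fun u => Rabs (sg u * (A u - A t) - (u - t) * p) <= e * Rabs (u - t))) ->
  is_derive (fun u => cos (A u)) t (- p * (sg t * sin (A t))) /\
  is_derive (fun u => sg u * sin (A u)) t (p * cos (A t)).
Proof.
  intros HA Hsg Hsg0 HM Hp.
  set (N := Rabs M + 1). assert (HN : 0 < N) by (assert (H := Rabs_pos M); unfold N; lra).
  assert (HN' : locally t (fun u => Rabs (A u - A t) <= N * Rabs (u - t))).
  { apply filter_imp with (2 := HM). intros u Hu. apply Rle_trans with (1 := Hu).
    apply Rmult_le_compat_r; [apply Rabs_pos|]. assert (H := Rle_abs M). unfold N. lra. }
  assert (Small : forall P : R -> Prop, locally 0 P -> locally t (fun u => P (A u - A t))).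
  { intros P HP. apply locally_Rabs in HP. destruct HP as [d [Hd HP]].
    assert (L : locally t (fun u => Rabs (u - t) < d / N)).
    { apply locally_Rabs. exists (d / N). split; [apply Rdiv_lt_0_compat; assumption|auto]. }
    apply filter_imp with (2 := filter_and _ _ HN' L). intros u [H1' H2'].
    apply HP. rewrite Rminus_0_r. apply Rle_lt_trans with (1 := H1').
    apply Rlt_le_trans with (N * (d / N)); [apply Rmult_lt_compat_l; assumption|right; field; lra]. }
  assert (Hc : Rabs (cos (A t)) <= 1) by apply Rabs_le, COS_bound.
  assert (Ec : forall u, cos (A u) = cos (A t) * cos (A u - A t)).
  { intros u. replace (A u) with (A t + (A u - A t)) at 1 by ring. rewrite cos_plus, HA. ring. }
  assert (Es : forall u, sin (A u) = cos (A t) * sin (A u - A t)).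
  { intros u. replace (A u) with (A t + (A u - A t)) at 1 by ring. rewrite sin_plus, HA. ring. }
  split; apply is_derive_eps; intros e He.
  - assert (He' : 0 < e / N) by (apply Rdiv_lt_0_compat; assumption).
    assert (D := proj1 (is_derive_eps cos 0 _) (is_derive_cos 0) _ He'). apply Small in D.
    apply filter_imp with (2 := filter_and _ _ D HN'). intros u [H1' H2'].
    rewrite HA, !Rmult_0_r, Rminus_0_r, Ec.
    rewrite sin_0, cos_0, Ropp_0, Rmult_0_r, !Rminus_0_r in H1'.
    replace (cos (A t) * cos (A u - A t) - cos (A t)) with (cos (A t) * (cos (A u - A t) - 1)) by ring.
    rewrite Rabs_mult. apply Rle_trans with (1 * (e / N * Rabs (A u - A t))).
    + apply Rmult_le_compat; [apply Rabs_pos|apply Rabs_pos|exact Hc|exact H1'].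
    + rewrite Rmult_1_l. apply Rle_trans with (e / N * (N * Rabs (u - t))).
      * apply Rmult_le_compat_l; [lra|exact H2'].
      * right. field. lra.
  - assert (He' : 0 < e / 2 / N) by (apply Rdiv_lt_0_compat; lra).
    assert (D := proj1 (is_derive_eps sin 0 _) (is_derive_sin 0) _ He'). apply Small in D.
    assert (He2 : 0 < e / 2) by lra.
    apply filter_imp with (2 := filter_and _ _ (filter_and _ _ D HN') (Hp _ He2)).
    intros u [[H1' H2'] H3'].
    rewrite Hsg0, Rmult_0_l, Rminus_0_r, Es.
    rewrite sin_0, cos_0, Rmult_1_r, !Rminus_0_r in H1'.
    replace (sg u * (cos (A t) * sin (A u - A t)) - (u - t) * (p * cos (A t))) with
      (cos (A t) * (sg u * (sin (A u - A t) - (A u - A t)) + (sg u * (A u - A t) - (u - t) * p))) by ring.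
    rewrite Rabs_mult. apply Rle_trans with (1 * (e * Rabs (u - t))); [|lra].
    apply Rmult_le_compat; [apply Rabs_pos|apply Rabs_pos|exact Hc|].
    apply Rle_trans with (1 := Rabs_triang _ _). rewrite Rabs_mult.
    assert (Rabs (sg u) * Rabs (sin (A u - A t) - (A u - A t)) <= 1 * (e / 2 / N * (N * Rabs (u - t)))).
    { apply Rmult_le_compat; [apply Rabs_pos|apply Rabs_pos|apply Hsg|].
      apply Rle_trans with (1 := H1'). apply Rmult_le_compat_l; [lra|exact H2']. }
    replace (1 * (e / 2 / N * (N * Rabs (u - t)))) with (e / 2 * Rabs (u - t)) in H by (field; lra). lra.
Qed.

Lemma rderiv_lip (g : R -> C) (t : R) (d : C) : rderiv g t d ->
  locally t (fun s => Cmod (g s - g t) <= (1 + Cmod d) * Rabs (s - t)).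
Proof.
  intros [q [Hq [Eq Hg]]]. rewrite (flim_Cmod (F := locally t)) in Hq.
  apply filter_imp with (2 := filter_and _ _ (Hq 1 Rlt_0_1) Hg). intros s [E1 E2].
  rewrite E2, Cmod_mult, Cmod_R. apply Rmult_le_compat_r; [apply Rabs_pos|].
  replace (q s) with (q s - d + d)%C by ring. eapply Rle_trans; [apply Cmod_triangle|lra].
Qed.

(** [up] is Lipschitz but not differentiable on the real axis, so the increment of [up (g s)] is
    kept in the expansion as it is. *)
Lemma up_expand (c : C) (e : R) (g : R -> C) (t : R) (d : C) : Rabs e <= 1 ->
  rderiv g t d -> g t <> 0%C -> regular (g t) ->
  forall eps, 0 < eps -> locally t (fun s =>
    Rabs (height c e (up (g s)) - height c e (up (g t)) -
          Re (form c e (up (g t)) * (up (g s) - up (g t)))%C) <= eps * Rabs (s - t)).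
Proof.
  intros He Hg H0 Hr eps Heps. assert (Hc := up_flim g _ (rderiv_cont _ _ _ Hg)).
  set (M := 1 + Cmod d). assert (HM : 0 < M) by (assert (Q := Cmod_ge_0 d); unfold M; lra).
  assert (He2 : 0 < eps / M) by (apply Rdiv_lt_0_compat; assumption).
  assert (D := height_diff c e (up (g t)) He (up_Im _) (up_neq0 _ H0) (proj1 (regular_up _) Hr) _ He2).
  apply Hc in D. unfold filtermap in D.
  apply filter_imp with (2 := filter_and _ _ D (rderiv_lip _ _ _ Hg)). intros s [E1 E2].
  specialize (E1 (up_Im _)). apply Rle_trans with (1 := E1).
  apply Rle_trans with (eps / M * (M * Rabs (s - t))); [|right; field; lra].
  apply Rmult_le_compat_l; [lra|]. apply Rle_trans with (2 := E2). apply up_lip.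
Qed.

Lemma curve_Im_pos (g : R -> C) (t : R) (d : C) : rderiv g t d -> 0 < Im (g t) ->
  locally t (fun s => 0 < Im (g s)).
Proof.
  intros Hg Hi. assert (Hc := flim_Im _ _ (rderiv_cont _ _ _ Hg)).
  rewrite (flim_Rabs (F := locally t)) in Hc. apply filter_imp with (2 := Hc _ Hi).
  intros s Hs. apply Rabs_def2 in Hs. lra.
Qed.

Definition locally_const_sign (S : C -> R) : Prop :=
  forall w0 : C, S w0 <> 0 -> locally w0 (fun w => S w = S w0).

Lemma sign_locally (f : C -> R) : (forall w, filterlim f (locally w) (locally (f w))) ->
  locally_const_sign (fun w => sign (f w)).
Proof.
  intros Hf w0 H0. specialize (Hf w0). rewrite (flim_Rabs (F := locally w0)) in Hf.
  destruct (sign_cases (f w0)) as [[A1 A2]|[[A1 A2]|[A1 A2]]]; [|contradiction|].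
  - apply filter_imp with (2 := Hf _ A1). intros w Hw. apply Rabs_def2 in Hw.
    rewrite A2. apply sign_eq_1. lra.
  - apply filter_imp with (2 := Hf (- f w0) ltac:(lra)). intros w Hw. apply Rabs_def2 in Hw.
    rewrite A2. apply sign_eq_m1. lra.
Qed.

Lemma sign_abs (x : R) : Rabs (sign x) <= 1.
Proof. apply Rabs_le. destruct (sign_cases x) as [[_ ->]|[[_ ->]|[_ ->]]]; lra. Qed.

Lemma s1_locally : locally_const_sign s1.
Proof. apply sign_locally. intros w. apply flim_Re, flim_id. Qed.

Lemma s2_locally : locally_const_sign s2.
Proof. apply (sign_locally (fun w => - Im w)). intros w. apply flim_Ropp, flim_Im, flim_id. Qed.

(** The rotation equation in its three cases. Over an open half plane it is the chain rule. On the
    axis with nonzero [S] the form is real, and folding by [up] does no harm. With [S = 0] the point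
    is on a wall and [trig_lift_wall] applies. *)
Lemma lift_deriv (c : C) (e : R) (S T : C -> R) (k lo : R) (g w : R -> C) (t : R) (d : C) :
  Rabs e <= 1 -> coherent c e S T -> locally_const_sign S -> locally_const_sign T ->
  rderiv g t d -> filterlim w (locally t) (locally (w t)) ->
  (forall u, Rabs (S u) <= 1) ->
  locally t (fun s => point_over (g s) (Fin (w s)) /\ w s <> 0%C) ->
  (S (w t) = 0 -> sin (k * (height c e (up (g t)) - lo)) = 0) ->
  is_derive (fun s => cos (k * (height c e (up (g s)) - lo))) t
    (- (k * Re (ph c e (g t) (w t) * d)%C) * (S (w t) * sin (k * (height c e (up (g t)) - lo)))) /\
  is_derive (fun s => S (w s) * sin (k * (height c e (up (g s)) - lo))) t
    (k * Re (ph c e (g t) (w t) * d)%C * cos (k * (height c e (up (g t)) - lo))).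
Proof.
  intros He HC LS LT Hg Hw HP0 HP Hwall.
  destruct (locally_singleton _ _ HP) as [Pt Wt]. assert (Ho := proj1 Pt).
  destruct (point_regular _ _ Pt Wt) as [Hr _].
  destruct (HC _ _ Pt Wt) as [S0 [CA [CB _]]].
  assert (Ex := up_expand c e g t d He Hg Ho Hr).
  set (p := Re (ph c e (g t) (w t) * d)%C).
  assert (Hgd := proj1 (rderiv_parts g t d) Hg).
  destruct (Req_dec (S (w t)) 0) as [Hz|Hnz].
  (* On the wall the form is imaginary, so to first order the height changes by
     [- Im f0 * Rabs (Im (g s))]. *)
  - destruct (CB Hz) as [Hi [HT [Eph HRe]]].
    set (f0 := form c e (up (g t))) in *.
    assert (Cst := Hw _ (LT (w t) ltac:(destruct HT as [-> | ->]; lra))).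
    apply (trig_lift_wall (fun s => k * (height c e (up (g s)) - lo)) (fun s => S (w s)) t (k * p)
       (Rabs k * (1 + Cmod f0 * (1 + Cmod d)))).
    + exact (Hwall Hz).
    + intros u. apply HP0.
    + exact Hz.
    + apply filter_imp with (2 := filter_and _ _ (Ex 1 Rlt_0_1) (rderiv_lip _ _ _ Hg)). intros s [E1 E2].
      replace (k * (height c e (up (g s)) - lo) - k * (height c e (up (g t)) - lo)) with
        (k * (height c e (up (g s)) - height c e (up (g t)))) by ring.
      rewrite Rabs_mult, Rmult_assoc. apply Rmult_le_compat_l; [apply Rabs_pos|].
      assert (B := Re_le (f0 * (up (g s) - up (g t)))%C). rewrite Cmod_mult in B.
      assert (B2 : Cmod f0 * Cmod (up (g s) - up (g t)) <= Cmod f0 * ((1 + Cmod d) * Rabs (s - t))).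
      { apply Rmult_le_compat_l; [apply Cmod_ge_0|]. apply Rle_trans with (2 := E2). apply up_lip. }
      apply Rabs_le_between in E1. apply Rabs_le_between in B. apply Rabs_le. lra.
    + intros eps Heps.
      assert (Hk : 0 < 1 + Rabs k + Rabs (k * Im f0)).
      { assert (Q1 := Rabs_pos k). assert (Q2 := Rabs_pos (k * Im f0)). lra. }
      set (N := 1 + Rabs k + Rabs (k * Im f0)) in *.
      assert (He2 : 0 < eps / N) by (apply Rdiv_lt_0_compat; assumption).
      assert (DI := proj1 (is_derive_eps _ _ _) (proj2 Hgd) _ He2).
      apply filter_imp with (2 := filter_and _ _ (filter_and _ _ (Ex _ He2) DI) (filter_and _ _ HP Cst)).
      intros s [[E1 E2] [[P1 P2] E3]]. rewrite Hi, Rminus_0_r in E2.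
      destruct (HC _ _ P1 P2) as [Sv [_ [_ [Sp Sn]]]].
      (* The kink of the absolute value is undone by the sign [S], because [S] is [T] above and
         [- T] below the axis, while [T] is constant near [t]. *)
      assert (Ei : S (w s) * Rabs (Im (g s)) = T (w t) * Im (g s)).
      { rewrite <- E3. destruct (Rtotal_order (Im (g s)) 0) as [G|[G|G]].
        - rewrite (Sn G), Rabs_left by exact G. ring.
        - rewrite G, Rabs_R0. ring.
        - rewrite (Sp G), Rabs_right by lra. ring. }
      assert (Er : Re (f0 * (up (g s) - up (g t)))%C = - (Im f0 * Rabs (Im (g s)))).
      { transitivity (Re f0 * (Re (g s) - Re (g t)) - Im f0 * (Rabs (Im (g s)) - Rabs (Im (g t)))); [reflexivity|].
        rewrite HRe, Hi, Rabs_R0. ring. }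
      rewrite Er in E1.
      assert (Ep : p = - (T (w t) * (Im f0 * Im d))).
      { unfold p. rewrite Eph. transitivity ((T (w t) * Re f0 - 0 * Im f0) * Re d - (T (w t) * Im f0 + 0 * Re f0) * Im d); [reflexivity|].
        rewrite HRe. ring. }
      assert (Sb := HP0 (w s)).
      assert (Tb : Rabs (T (w t)) = 1).
      { destruct HT as [-> | ->]; [apply Rabs_R1|rewrite Rabs_left; lra]. }
      set (X := height c e (up (g s)) - height c e (up (g t)) - - (Im f0 * Rabs (Im (g s)))) in *.
      replace (S (w s) * (k * (height c e (up (g s)) - lo) - k * (height c e (up (g t)) - lo)) - (s - t) * (k * p))
        with (k * (S (w s) * X) + - (T (w t) * (k * Im f0)) * (Im (g s) - (s - t) * Im d)).
      * apply Rle_trans with (1 := Rabs_triang _ _). rewrite !Rabs_mult, Rabs_Ropp, Rabs_mult, Tb, Rmult_1_l.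
        assert (V1 : Rabs k * (Rabs (S (w s)) * Rabs X) <= Rabs k * (1 * (eps / N * Rabs (s - t)))).
        { apply Rmult_le_compat_l; [apply Rabs_pos|]. apply Rmult_le_compat; [apply Rabs_pos|apply Rabs_pos|exact Sb|exact E1]. }
        assert (V2 : Rabs (k * Im f0) * Rabs (Im (g s) - (s - t) * Im d) <= Rabs (k * Im f0) * (eps / N * Rabs (s - t))).
        { apply Rmult_le_compat_l; [apply Rabs_pos|exact E2]. }
        replace (eps * Rabs (s - t)) with (N * (eps / N * Rabs (s - t))) by (field; lra).
        assert (0 <= eps / N * Rabs (s - t)) by (apply Rmult_le_pos; [lra|apply Rabs_pos]).
        set (Z := eps / N * Rabs (s - t)) in *. unfold N. lra.
      * rewrite Ep. unfold X.
        replace (S (w s) * (height c e (up (g s)) - height c e (up (g t)) - - (Im f0 * Rabs (Im (g s))))) with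
          (S (w s) * (height c e (up (g s)) - height c e (up (g t))) + Im f0 * (S (w s) * Rabs (Im (g s)))) by ring.
        rewrite Ei. ring.
  - assert (Sv : S (w t) = 1 \/ S (w t) = -1) by (destruct S0 as [Q|[Q|Q]]; [contradiction|auto|auto]).
    destruct (CA Hnz) as [C1' [C2' C3']].
    apply (trig_lift_const (fun s => k * (height c e (up (g s)) - lo)) (fun s => S (w s)) t (S (w t)) (k * p) Sv (Hw _ (LS _ Hnz))).
    apply (is_derive_eq _ _ (k * (S (w t) * p))); [|ring]. apply is_derive_scal.
    apply (is_derive_eq _ _ (S (w t) * p - 0)); [|ring].
    apply (is_derive_minus (K := R_AbsRing) (V := R_NormedModule)); [|apply is_derive_const_R].
    destruct (Rtotal_order (Im (g t)) 0) as [G|[G|G]].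
    + assert (Hgc := rderiv_conj _ _ _ Hg).
      assert (Gp : 0 < Im (Cconj (g t))) by (change (0 < - Im (g t)); lra).
      assert (L := curve_Im_pos _ _ _ Hgc Gp).
      apply (is_derive_ext_loc (fun s => height c e (Cconj (g s)))).
      * apply filter_imp with (2 := L). intros s Hs. change (0 < - Im (g s)) in Hs. rewrite up_neg by lra. reflexivity.
      * assert (Hr' : regular (Cconj (g t))) by (rewrite <- up_neg by lra; apply (proj1 (regular_up (g t))), Hr).
        apply (is_derive_eq _ _ _ _ (height_curve c e _ t _ He Hgc (filter_imp _ _ (fun s => Rlt_le _ _) L) (Cconj_neq0 _ Ho) Hr')).
        unfold p. rewrite (C2' G), up_neg by lra. set (f0 := form c e (Cconj (g t))).
        transitivity (Re f0 * Re d - Im f0 * - Im d); [reflexivity|].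
        transitivity (S (w t) * ((S (w t) * Re f0 - 0 * - Im f0) * Re d - (S (w t) * - Im f0 + 0 * Re f0) * Im d)); [|reflexivity].
        destruct Sv as [-> | ->]; ring.
    (* As [f0] is real, only [Re (g s)] enters to first order, and [up] leaves it unchanged. *)
    + destruct (C3' G) as [Eph HIm]. set (f0 := form c e (up (g t))) in *.
      assert (DR := is_derive_scal _ _ (Re f0) _ (proj1 Hgd)).
      assert (Ep : S (w t) * p = Re f0 * Re d).
      { unfold p. rewrite Eph. transitivity (S (w t) * ((S (w t) * Re f0 - 0 * Im f0) * Re d - (S (w t) * Im f0 + 0 * Re f0) * Im d)); [reflexivity|].
        rewrite HIm. destruct Sv as [-> | ->]; ring. }
      apply is_derive_eps. intros eps Heps. assert (He2 : 0 < eps / 2) by lra.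
      apply filter_imp with (2 := filter_and _ _ (Ex _ He2) (proj1 (is_derive_eps _ _ _) DR _ He2)).
      intros s [E1 E2].
      assert (Er : Re (f0 * (up (g s) - up (g t)))%C = Re f0 * Re (g s) - Re f0 * Re (g t)).
      { transitivity (Re f0 * (Re (g s) - Re (g t)) - Im f0 * (Rabs (Im (g s)) - Rabs (Im (g t)))); [reflexivity|].
        rewrite HIm. ring. }
      rewrite Er in E1. rewrite Ep. apply Rabs_le_between in E1. apply Rabs_le_between in E2. apply Rabs_le. lra.
    + assert (L := curve_Im_pos _ _ _ Hg G).
      apply (is_derive_ext_loc (fun s => height c e (g s))).
      * apply filter_imp with (2 := L). intros s Hs. rewrite up_pos by lra. reflexivity.
      * apply (is_derive_eq _ _ _ _ (height_curve c e _ t _ He Hg (filter_imp _ _ (fun s => Rlt_le _ _) L) Ho Hr)).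
        unfold p. rewrite (C1' G), up_pos by lra. set (f0 := form c e (g t)).
        transitivity (Re f0 * Re d - Im f0 * Im d); [reflexivity|].
        transitivity (S (w t) * ((S (w t) * Re f0 - 0 * Im f0) * Re d - (S (w t) * Im f0 + 0 * Re f0) * Im d)); [|reflexivity].
        destruct Sv as [-> | ->]; ring.
Qed.

(** * The surface [R] in the coordinate [om] *)

Definition coord (z : Chat) : C :=
  match z with Fin z => ((z - RtoC a) / (z + RtoC a))%C | Inf => RtoC 1 end.

Definition sphere (om : C) : Chat :=
  if Ceq_dec om (RtoC 1) then Inf else Fin (RtoC a * (1 + om) / (1 - om))%C.

Lemma lin_coord (p : R) (z : C) : (z + RtoC a <> 0)%C ->
  lin p (coord (Fin z)) = (2 * RtoC a / (z + RtoC a) * (z - RtoC p))%C.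
Proof. intros H. rewrite lin_hom. simpl. field. exact H. Qed.

Lemma num_coord (z : C) : (z + RtoC a <> 0)%C -> num (coord (Fin z)) =
  (2 * RtoC a / (z + RtoC a) * (2 * RtoC a / (z + RtoC a)) * (2 * RtoC a / (z + RtoC a)) *
   (2 * RtoC a / (z + RtoC a)) * g1 l l1 l2 z)%C.
Proof.
  intros H. unfold num, g1. rewrite !lin_coord by exact H. rewrite RtoC_opp.
  replace (RtoC (-1)) with (Copp (RtoC 1)) by (apply C_ext; unfold Re, Im; simpl; ring). ring.
Qed.

Lemma den_coord (z : C) : (z + RtoC a <> 0)%C -> den (coord (Fin z)) =
  (2 * RtoC a / (z + RtoC a) * (2 * RtoC a / (z + RtoC a)) * (2 * RtoC a / (z + RtoC a)) *
   (2 * RtoC a / (z + RtoC a)) * g2 l l1 l2 z)%C.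
Proof. intros H. unfold den, g2. rewrite !lin_coord by exact H. rewrite !RtoC_opp. ring. Qed.

Lemma scale_C_neq0 (z : C) : (z + RtoC a <> 0)%C ->
  (2 * RtoC a / (z + RtoC a) * (2 * RtoC a / (z + RtoC a)) * (2 * RtoC a / (z + RtoC a)) *
   (2 * RtoC a / (z + RtoC a)) <> 0)%C.
Proof.
  intros H. assert (Ha := a_pos).
  assert (K : (2 * RtoC a / (z + RtoC a) <> 0)%C).
  { apply Cmult_neq_0; [apply Cmult_neq_0; apply RtoC_neq; lra|].
    intros E. assert (E1 := Cinv_r _ H). rewrite E in E1. apply (RtoC_neq 1 R1_neq_R0). rewrite <- E1. ring. }
  apply Cmult_neq_0; [apply Cmult_neq_0; [apply Cmult_neq_0|]|]; exact K.
Qed.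

Lemma g_real (z : R) : g1 l l1 l2 (RtoC z) = RtoC (rg1 z) /\ g2 l l1 l2 (RtoC z) = RtoC (rg2 z).
Proof.
  unfold g1, g2, rg1, rg2. rewrite !RtoC_mult, !RtoC_minus, !RtoC_plus. split; ring.
Qed.

(** [even_part_eq] gives [w ^ 2 = -1] there, so the four removed points are all the points over [a]
    and [- a]. *)
Lemma w_at_end (z : R) (w : C) : z ^ 2 = a ^ 2 -> rg2 z <> 0 ->
  (g2 l l1 l2 (RtoC z) * (w * w))%C = g1 l l1 l2 (RtoC z) -> w = Ci \/ w = (- Ci)%C.
Proof.
  intros Hz Hg H. destruct (g_real z) as [G1 G2]. rewrite G1, G2 in H.
  assert (E := even_part_eq z). rewrite Hz in E.
  assert (E1 : rg1 z = - rg2 z) by lra. rewrite E1, RtoC_opp in H.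
  assert (HC := RtoC_neq _ Hg).
  assert (E2 : (w * w = Ci * Ci)%C).
  { replace (Ci * Ci)%C with (Copp (RtoC 1)) by (apply C_ext; unfold Re, Im; simpl; ring).
    replace (w * w)%C with (/ RtoC (rg2 z) * (RtoC (rg2 z) * (w * w)))%C by (field; exact HC).
    rewrite H. field. exact HC. }
  destruct (sqr_eq _ _ E2) as [s [[-> | ->] ->]]; [left|right]; apply C_ext; unfold Re, Im; simpl; ring.
Qed.

Lemma rg2_ends : rg2 a <> 0 /\ rg2 (- a) <> 0.
Proof.
  assert (AB := ab_range). split; unfold rg2;
    repeat apply Rmult_integral_contrapositive_currified; lra.
Qed.

Lemma on_R_not_end (z : C) (w : Chat) : on_R l l1 l2 (Fin z, w) ->
  (z + RtoC a <> 0)%C /\ (z - RtoC a <> 0)%C.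
Proof.
  intros [H [N1 [N2 [N3 N4]]]]. destruct rg2_ends as [E1 E2].
  split; intros E.
  - assert (Ez : z = RtoC (- a)). { replace z with (z + RtoC a - RtoC a)%C by ring. rewrite E, RtoC_opp. ring. }
    destruct w as [w|]; simpl in H; rewrite Ez in H.
    + rewrite Ez, RtoC_opp in *. destruct (w_at_end (- a) w) as [-> | ->]; [ring|exact E2| | |].
      * rewrite RtoC_opp. exact H.
      * apply N2. reflexivity.
      * apply N4. reflexivity.
    + rewrite (proj2 (g_real (- a))) in H. apply E2. injection H. auto.
  - assert (Ez : z = RtoC a). { replace z with (z - RtoC a + RtoC a)%C by ring. rewrite E. ring. }
    destruct w as [w|]; simpl in H; rewrite Ez in H.
    + rewrite Ez in *. destruct (w_at_end a w) as [-> | ->]; [ring|exact E1|exact H| |].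
      * apply N1. reflexivity.
      * apply N3. reflexivity.
    + rewrite (proj2 (g_real a)) in H. apply E1. injection H. auto.
Qed.

Lemma num_1 : num (RtoC 1) = den (RtoC 1).
Proof. rewrite num_real, den_real. unfold rnum, rden, rlin. f_equal. ring. Qed.

Lemma Cmult_cancel (k u v : C) : k <> 0%C -> (k * u = k * v)%C -> u = v.
Proof.
  intros Hk H. replace u with (/ k * (k * u))%C by (field; exact Hk). rewrite H. field. exact Hk.
Qed.

Lemma on_R_point (p : Chat * Chat) : on_R l l1 l2 p -> point_over (coord (fst p)) (snd p).
Proof.
  intros H. destruct p as [z w]. destruct z as [z|].
  - destruct (on_R_not_end z w H) as [A1 A2]. destruct H as [H _]. split.
    + simpl. apply Cmult_neq_0; [exact A2|]. intros E. assert (E1 := Cinv_r _ A1). rewrite E in E1.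
      apply (RtoC_neq 1 R1_neq_R0). rewrite <- E1. ring.
    + change (fst (Fin z, w)) with (Fin z). change (snd (Fin z, w)) with w.
      destruct w as [w|]; simpl in H.
      * rewrite num_coord, den_coord, <- H by exact A1. ring.
      * rewrite den_coord, H by exact A1. ring.
  - destruct H as [H _]. split; [apply RtoC_neq; lra|].
    change (fst (Inf, w)) with Inf. change (snd (Inf, w)) with w. change (coord Inf) with (RtoC 1).
    destruct w as [w|]; simpl in H; [|contradiction]. rewrite H, num_1. ring.
Qed.

Lemma coord_sphere (om : C) : coord (sphere om) = om.
Proof.
  unfold sphere. destruct (Ceq_dec om (RtoC 1)) as [E|E]; [symmetry; exact E|].
  assert (Ha := RtoC_neq _ (Rgt_not_eq _ _ a_pos)).
  assert (H1' : (1 - om <> 0)%C). { intros E0. apply E. replace om with (RtoC 1 - (1 - om))%C by ring. rewrite E0. ring. }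
  simpl. field. repeat split; try assumption.
  - replace (RtoC a * (1 + om) + RtoC a * (1 - om))%C with (2 * RtoC a)%C by ring.
    apply Cmult_neq_0; [apply RtoC_neq; lra|exact Ha].
Qed.

Lemma sphere_coord (z : Chat) : match z with Fin z => (z + RtoC a <> 0)%C | Inf => True end ->
  sphere (coord z) = z.
Proof.
  intros H. assert (Ha := RtoC_neq _ (Rgt_not_eq _ _ a_pos)). unfold sphere. destruct z as [z|].
  - destruct (Ceq_dec (coord (Fin z)) (RtoC 1)) as [E|E].
    + exfalso. simpl in E. apply (Cmult_neq_0 (RtoC 2) (RtoC a)); [apply RtoC_neq; lra|exact Ha|].
      replace (RtoC 2 * RtoC a)%C with ((z + RtoC a) - (z + RtoC a) * ((z - RtoC a) / (z + RtoC a)))%C by (field; exact H).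
      rewrite E. ring.
    + f_equal. simpl. field. split; [exact H|].
      replace (z + RtoC a - (z - RtoC a))%C with (2 * RtoC a)%C by ring.
      apply Cmult_neq_0; [apply RtoC_neq; lra|exact Ha].
  - destruct (Ceq_dec (coord Inf) (RtoC 1)) as [E|E]; [reflexivity|]. exfalso. apply E. reflexivity.
Qed.

Lemma point_on_R (om : C) (w : Chat) : point_over om w -> on_R l l1 l2 (sphere om, w).
Proof.
  intros [H0 H]. assert (Ha := a_pos). assert (HaC := RtoC_neq _ (Rgt_not_eq _ _ Ha)).
  unfold sphere. destruct (Ceq_dec om (RtoC 1)) as [E|E].
  - split; [|repeat split; discriminate]. rewrite E in H. simpl. destruct w as [w|].
    + rewrite num_1 in H. assert (Hd := proj2 regular_1).
      apply (Cmult_cancel (den (RtoC 1))); [exact Hd|]. rewrite H. ring.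
    + exact (proj2 regular_1 H).
  - assert (H1' : (1 - om <> 0)%C). { intros E0. apply E. replace om with (RtoC 1 - (1 - om))%C by ring. rewrite E0. ring. }
    set (z := (RtoC a * (1 + om) / (1 - om))%C).
    assert (Hz : (z + RtoC a <> 0)%C).
    { unfold z. replace (RtoC a * (1 + om) / (1 - om) + RtoC a)%C with (2 * RtoC a / (1 - om))%C by (field; exact H1').
      apply Cmult_neq_0; [apply Cmult_neq_0; [apply RtoC_neq; lra|exact HaC]|].
      intros E0. assert (E1 := Cinv_r _ H1'). rewrite E0 in E1. apply (RtoC_neq 1 R1_neq_R0). rewrite <- E1. ring. }
    assert (Hz2 : (z - RtoC a <> 0)%C).
    { unfold z. replace (RtoC a * (1 + om) / (1 - om) - RtoC a)%C with (2 * RtoC a * om / (1 - om))%C by (field; exact H1').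
      apply Cmult_neq_0; [apply Cmult_neq_0; [apply Cmult_neq_0; [apply RtoC_neq; lra|exact HaC]|exact H0]|].
      intros E0. assert (E1 := Cinv_r _ H1'). rewrite E0 in E1. apply (RtoC_neq 1 R1_neq_R0). rewrite <- E1. ring. }
    assert (Ec : coord (Fin z) = om).
    { rewrite <- (coord_sphere om). unfold sphere. destruct (Ceq_dec om (RtoC 1)); [contradiction|reflexivity]. }
    rewrite <- Ec in H.
    split.
    + assert (Sc := scale_C_neq0 z Hz). destruct w as [w|]; simpl.
      * rewrite num_coord, den_coord in H by exact Hz. apply (Cmult_cancel _ _ _ Sc). rewrite <- H. ring.
      * rewrite den_coord in H by exact Hz. apply Cmult_zero in H. destruct H as [H|H]; [contradiction|exact H].
    + assert (Q1 : z <> RtoC a) by (intros Q; apply Hz2; rewrite Q; ring).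
      assert (Q2 : z <> (- RtoC a)%C) by (intros Q; apply Hz; rewrite Q; ring).
      set (pr := fun p : Chat * Chat => match fst p with Fin u => u | Inf => RtoC 0 end).
      repeat split; intros Q; [apply Q1|apply Q2|apply Q1|apply Q2]; exact (f_equal pr Q).
Qed.

Definition sg1 (w : Chat) : R := match w with Fin w => s1 w | Inf => 0 end.
Definition sg2 (w : Chat) : R := match w with Fin w => s2 w | Inf => 0 end.
(** The scaling turns each side of the box into the interval from 0 to [PI]: the walls become zeros
    of the sine, and the cosine is injective in between. *)
Definition k1 : R := PI / (d1 - d0).
Definition k2 : R := PI / (e1 - e0).
Definition A1 (om : C) : R := k1 * (H1 (up om) - d0).
Definition A2 (om : C) : R := k2 * (H2 (up om) - e0).

(* [cos1 p + i sin1 p] is [exp (i k1 X_1)] up to a constant factor: it is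
   single-valued on [R], and [2 pi / k1] is the period of [X_1]. *)
Definition cos1 (p : Chat * Chat) : R := cos (A1 (coord (fst p))).
Definition sin1 (p : Chat * Chat) : R := sg1 (snd p) * sin (A1 (coord (fst p))).
Definition cos2 (p : Chat * Chat) : R := cos (A2 (coord (fst p))).
Definition sin2 (p : Chat * Chat) : R := sg2 (snd p) * sin (A2 (coord (fst p))).
Definition X3 (p : Chat * Chat) : R := ln (Cmod (coord (fst p))) / (2 * a).

Lemma k_pos : 0 < k1 /\ 0 < k2.
Proof. assert (H := de_lt). assert (P := PI_RGT_0). split; apply Rdiv_lt_0_compat; lra. Qed.

Lemma A_scaled (x lo hi : R) : lo < hi ->
  (lo <= x <= hi -> 0 <= PI / (hi - lo) * (x - lo) <= PI) /\
  (lo < x < hi -> 0 < PI / (hi - lo) * (x - lo) < PI) /\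
  (on_walls x lo hi -> sin (PI / (hi - lo) * (x - lo)) = 0).
Proof.
  intros H. assert (P := PI_RGT_0). assert (K : 0 < PI / (hi - lo)) by (apply Rdiv_lt_0_compat; lra).
  assert (E : PI / (hi - lo) * (hi - lo) = PI) by (field; lra).
  split; [|split].
  - intros Hx. split; [apply Rmult_le_pos; lra|]. rewrite <- E at 2. apply Rmult_le_compat_l; lra.
  - intros Hx. split; [apply Rmult_lt_0_compat; lra|]. rewrite <- E at 2. apply Rmult_lt_compat_l; lra.
  - intros [-> | ->].
    + replace (PI / (hi - lo) * (lo - lo)) with 0 by ring. apply sin_0.
    + rewrite E. apply sin_PI.
Qed.

(** [box] puts [H1] (resp. [H2]) on a wall exactly where the sign vanishes. So the signed sines are
    continuous where the signs jump, and their signs are those of [w]. *)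
Lemma point_sg (om : C) (w : Chat) : point_over om w ->
  (sg1 w = 0 -> sin (A1 om) = 0) /\ (sg1 w <> 0 -> 0 < sin (A1 om)) /\
  (sg2 w = 0 -> sin (A2 om) = 0) /\ (sg2 w <> 0 -> 0 < sin (A2 om)).
Proof.
  intros Hp. assert (Ho := proj1 Hp). assert (Hu := up_neq0 om Ho).
  destruct (box (up om) (up_Im om) Hu) as [_ [B1 B2]]. destruct de_lt as [D1 D2].
  destruct (Classical_Prop.classic (regular (up om))) as [Hr|Hr].
  - destruct (B1 Hr) as [R1 [R2 [R3 R4]]].
    destruct w as [w|]; [|exfalso; apply (point_singular' om Inf Hp (or_intror eq_refl)), regular_up, Hr].
    assert (Hw : w <> 0%C).
    { intros ->. apply (point_singular' om (Fin 0) Hp (or_introl eq_refl)), regular_up, Hr. }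
    destruct (point_gw om w Hp Hw) as [s [Hs [P1 P2]]].
    assert (W : Rabs (Re w) = Rabs (Re (gw (up om))) /\ Rabs (Im w) = Rabs (Im (gw (up om)))).
    { assert (Rs : Rabs s = 1) by (destruct Hs as [-> | ->]; [apply Rabs_R1|rewrite Rabs_left; lra]).
      destruct (Rle_lt_dec 0 (Im om)) as [Hi|Hi].
      - rewrite (P1 Hi), Re_scal, Im_scal, !Rabs_mult, Rs, !Rmult_1_l. split; reflexivity.
      - rewrite (P2 Hi), Re_scal, Im_scal, !Rabs_mult, Rs, !Rmult_1_l. split; [reflexivity|].
        change (Im (Cconj (gw (up om)))) with (- Im (gw (up om))). apply Rabs_Ropp. }
    assert (Z : forall x y, Rabs x = Rabs y -> (x = 0 <-> y = 0)).
    { intros x y Hxy. split; intros E; rewrite E, Rabs_R0 in Hxy; apply Rabs_eq_0; congruence. }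
    assert (Z1 := Z _ _ (proj1 W)). assert (Z2 := Z _ _ (proj2 W)).
    assert (G1 : s1 w = 0 <-> Re w = 0).
    { unfold s1. destruct (sign_cases (Re w)) as [[Q ->]|[[Q ->]|[Q ->]]]; lra. }
    assert (G2 : s2 w = 0 <-> Im w = 0).
    { unfold s2. destruct (sign_cases (- Im w)) as [[Q ->]|[[Q ->]|[Q ->]]]; lra. }
    change (sg1 (Fin w)) with (s1 w). change (sg2 (Fin w)) with (s2 w).
    split; [|split; [|split]]; intros Hq.
    + apply (A_scaled _ _ _ D1). apply R1, Z1, G1, Hq.
    + apply sin_gt_0; apply (A_scaled _ _ _ D1); apply R2; intros Q; apply Hq, G1, Z1, Q.
    + apply (A_scaled _ _ _ D2). apply R3, Z2, G2, Hq.
    + apply sin_gt_0; apply (A_scaled _ _ _ D2); apply R4; intros Q; apply Hq, G2, Z2, Q.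
  - destruct (B2 Hr) as [W1 W2].
    assert (Hr' : ~ regular om) by (intros Q; apply Hr, (proj1 (regular_up om)), Q).
    assert (S0 : sg1 w = 0 /\ sg2 w = 0).
    { destruct (point_singular om w Hp Hr') as [[-> _]|[-> _]]; simpl; [|lra].
      unfold s1, s2; simpl. rewrite Ropp_0, sign_0. lra. }
    destruct S0 as [S1 S2].
    split; [intros _; apply (A_scaled _ _ _ D1), W1|split; [intros; contradiction|]].
    split; [intros _; apply (A_scaled _ _ _ D2), W2|intros; contradiction].
Qed.

Lemma coord_lim (z0 : Chat) : match z0 with Fin z0 => (z0 + RtoC a <> 0)%C | Inf => True end ->
  filterlim coord (Chat_locally z0) (locally (coord z0)).
Proof.
  intros H. destruct z0 as [z0|].
  - intros P HP. unfold filtermap, Chat_locally.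
    assert (L : filterlim (fun u : C => ((u - RtoC a) / (u + RtoC a))%C) (locally z0) (locally (coord (Fin z0)))).
    { simpl. flim. exact H. }
    exact (L P HP).
  - intros P HP. apply locally_Cmod in HP. destruct HP as [d [Hd HP]]. assert (Ha := a_pos).
    (* The distance from [coord (Fin u)] to 1 is [2 * a / Cmod (u + a)]. *)
    exists (a + 2 * a / d). split.
    + apply HP. simpl. replace (RtoC 1 - RtoC 1)%C with (RtoC 0) by ring. rewrite Cmod_0. exact Hd.
    + intros u Hu. apply HP.
      assert (Hq : 0 < 2 * a / d) by (apply Rdiv_lt_0_compat; lra).
      assert (T := Cmod_triangle (u + RtoC a) (- RtoC a)). replace (u + RtoC a + - RtoC a)%C with u in T by ring.
      rewrite Cmod_opp, Cmod_R, Rabs_right in T by lra.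
      assert (Hm : 2 * a / d < Cmod (u + RtoC a)) by lra.
      assert (Hn : (u + RtoC a <> 0)%C) by (intros E; rewrite E, Cmod_0 in Hm; lra).
      simpl. replace ((u - RtoC a) / (u + RtoC a) - RtoC 1)%C with (RtoC (- (2 * a)) / (u + RtoC a))%C
        by (rewrite RtoC_opp, RtoC_mult; field; exact Hn).
      unfold Cdiv. rewrite Cmod_mult, Cmod_inv, Cmod_R, Rabs_Ropp, Rabs_right by (try exact Hn; lra).
      apply Rmult_lt_reg_r with (Cmod (u + RtoC a)); [lra|].
      replace (2 * a * / Cmod (u + RtoC a) * Cmod (u + RtoC a)) with (2 * a) by (field; lra).
      apply Rmult_lt_compat_l with (r := d) in Hm; [|exact Hd]. replace (d * (2 * a / d)) with (2 * a) in Hm by (field; lra). exact Hm.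
Qed.

Lemma Chat_locally_true (z : Chat) : Chat_locally z (fun _ => True).
Proof. destruct z; [apply filter_true|]. exists 0. auto. Qed.

(** Either the sign is eventually constant, or it is only bounded but the sine tends to 0. *)
Lemma sgn_sin_lim {T : Type} {F : (T -> Prop) -> Prop} {FF : Filter F} (s B : T -> R) (s0 b0 : R) :
  filterlim B F (locally b0) -> (forall t, Rabs (s t) <= 1) ->
  (s0 <> 0 -> F (fun t => s t = s0)) -> (s0 = 0 -> sin b0 = 0) ->
  filterlim (fun t => s t * sin (B t)) F (locally (s0 * sin b0)).
Proof.
  intros HB Hs Hn Hz.
  assert (HS : filterlim (fun t => sin (B t)) F (locally (sin b0))).
  { apply (flim_Rcomp sin); [apply continuous_sin|exact HB]. }
  destruct (Req_dec s0 0) as [E|E].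
  - rewrite (Hz E) in *. rewrite Rmult_0_r. apply flim_Rabs. intros e He.
    rewrite flim_Rabs in HS. apply filter_imp with (2 := HS e He). intros t Ht.
    rewrite Rminus_0_r in *. rewrite Rabs_mult. apply Rle_lt_trans with (2 := Ht).
    rewrite <- (Rmult_1_l (Rabs (sin (B t)))) at 2. apply Rmult_le_compat_r; [apply Rabs_pos|apply Hs].
  - apply (filterlim_ext_loc (fun t => s0 * sin (B t))).
    + apply filter_imp with (2 := Hn E). intros t ->. reflexivity.
    + apply flim_Rmult; [apply flim_const|exact HS].
Qed.

Lemma sg_abs (w : Chat) : Rabs (sg1 w) <= 1 /\ Rabs (sg2 w) <= 1.
Proof.
  destruct w as [w|]; simpl; [split; apply sign_abs|]. rewrite Rabs_R0. lra.
Qed.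

(** This includes branch points and the points with [z] infinite, where arcs may end although they
    are not ordinary. *)
Lemma maps_lim {T : Type} {F : (T -> Prop) -> Prop} {FF : Filter F} (g : T -> Chat * Chat) (p : Chat * Chat) :
  on_R l l1 l2 p -> filterlim g F (Chat2_locally p) ->
  filterlim (fun t => cos1 (g t)) F (locally (cos1 p)) /\
  filterlim (fun t => sin1 (g t)) F (locally (sin1 p)) /\
  filterlim (fun t => cos2 (g t)) F (locally (cos2 p)) /\
  filterlim (fun t => sin2 (g t)) F (locally (sin2 p)) /\
  filterlim (fun t => X3 (g t)) F (locally (X3 p)).
Proof.
  intros Hp Hg. assert (Pt := on_R_point p Hp). assert (Ho := proj1 Pt).
  assert (L1 : filterlim (fun t => coord (fst (g t))) F (locally (coord (fst p)))).
  { apply (filterlim_comp _ _ _ (fun t => fst (g t)) coord _ (Chat_locally (fst p))).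
    - intros P HP. apply (Hg (fun q => P (fst q))).
      apply Filter_prod with P (fun _ => True); [exact HP|apply Chat_locally_true|auto].
    - apply coord_lim. destruct p as [z w]. simpl. destruct z as [z|]; [|exact I].
      apply (on_R_not_end z w Hp). }
  assert (Sg : forall (S : C -> R) (sg : Chat -> R), locally_const_sign S ->
    (forall w, sg (Fin w) = S w) -> sg Inf = 0 ->
    sg (snd p) <> 0 -> F (fun t => sg (snd (g t)) = sg (snd p))).
  { intros S sg HS E1 E2 Hn. apply (Hg (fun q => sg (snd q) = sg (snd p))).
    apply Filter_prod with (fun _ => True) (fun w => sg w = sg (snd p)); [apply Chat_locally_true| |auto].
    destruct (snd p) as [w0|]; [|contradiction]. simpl. rewrite E1 in *.
    apply filter_imp with (2 := HS w0 Hn). intros w Hw. rewrite E1. exact Hw. }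
  destruct (point_sg _ _ Pt) as [Q1 [_ [Q3 _]]].
  assert (LU := up_flim _ _ L1). assert (Hu := up_neq0 _ Ho).
  assert (LA1 : filterlim (fun t => A1 (coord (fst (g t)))) F (locally (A1 (coord (fst p))))).
  { apply flim_Rmult; [apply flim_const|]. apply flim_Rminus; [|apply flim_const].
    apply height_flim; [apply Rabs_m1|apply up_Im|exact Hu| |exact LU]. apply filter_forall. intros t. apply up_Im. }
  assert (LA2 : filterlim (fun t => A2 (coord (fst (g t)))) F (locally (A2 (coord (fst p))))).
  { apply flim_Rmult; [apply flim_const|]. apply flim_Rminus; [|apply flim_const].
    apply height_flim; [apply Rabs_p1|apply up_Im|exact Hu| |exact LU]. apply filter_forall. intros t. apply up_Im. }
  split; [|split; [|split; [|split]]].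
  - apply (flim_Rcomp cos); [apply continuous_cos|exact LA1].
  - apply sgn_sin_lim; [exact LA1|intros t; apply sg_abs|apply (Sg s1 sg1 s1_locally); reflexivity|exact Q1].
  - apply (flim_Rcomp cos); [apply continuous_cos|exact LA2].
  - apply sgn_sin_lim; [exact LA2|intros t; apply sg_abs|apply (Sg s2 sg2 s2_locally); reflexivity|exact Q3].
  - apply flim_Rmult; [|apply flim_const]. apply (flim_Rcomp ln); [|apply flim_Cmod_comp, L1].
    apply continuity_pt_filterlim. apply (is_derive_continuity_pt _ _ (/ Cmod (coord (fst p)))).
    apply is_derive_ln, Cmod_neq0, Ho.
Qed.

(** * Displacements along arcs *)

Definition rot_cos (k x c s : R) : R := cos (k * x) * c - sin (k * x) * s.
Definition rot_sin (k x c s : R) : R := sin (k * x) * c + cos (k * x) * s.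

(** The equation is that of a rotation with speed [k * p]. It is solved on compact subintervals and
    passed to the ends, with the improper integral as the total displacement. *)
Lemma rot_limit (c s p : R -> R) (k v c0 s0 c1 s1' : R) :
  (forall t, 0 < t < 1 -> is_derive c t (- (k * p t) * s t)) ->
  (forall t, 0 < t < 1 -> is_derive s t (k * p t * c t)) ->
  (forall t, 0 < t < 1 -> continuous p t) ->
  filterlim c (at_right 0) (locally c0) -> filterlim s (at_right 0) (locally s0) ->
  filterlim c (at_left 1) (locally c1) -> filterlim s (at_left 1) (locally s1') ->
  is_RInt_gen p (at_right 0) (at_left 1) v ->
  c1 = rot_cos k v c0 s0 /\ s1' = rot_sin k v c0 s0.
Proof.
  intros Dc Ds Hp Lc0 Ls0 Lc1 Ls1 Hv.
  (* The base point is interior because [p] may be unbounded near 0 and 1. *)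
  set (J := fun t => RInt p (1 / 2) t).
  assert (B : forall u w t, 0 < u < 1 -> 0 < w < 1 -> Rmin u w <= t <= Rmax u w -> 0 < t < 1).
  { intros u w t Hu Hw [Q1 Q2]. revert Q1 Q2. apply Rmin_case; apply Rmax_case; intros; lra. }
  assert (Ex : forall u w, 0 < u < 1 -> 0 < w < 1 -> ex_RInt p u w).
  { intros u w Hu Hw. apply (ex_RInt_continuous (V := R_CompleteNormedModule)). intros t Ht.
    apply Hp, (B u w); assumption. }
  assert (DJ : forall t, 0 < t < 1 -> is_derive J t (p t)).
  { intros t Ht. apply is_derive_RInt_upper; [|apply Hp, Ht].
    apply locally_Rabs. exists (Rmin t (1 - t)). split; [apply Rmin_glb_lt; lra|].
    intros u Hu. assert (Q1 := Rmin_l t (1 - t)). assert (Q2 := Rmin_r t (1 - t)).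
    apply Rabs_def2 in Hu. apply Ex; lra. }
  assert (Dkc : forall t, 0 < t < 1 -> is_derive (fun t => cos (k * J t)) t (k * p t * - sin (k * J t))).
  { intros t Ht. apply (is_derive_comp cos (fun t => k * J t)); [apply is_derive_cos|apply is_derive_scal, DJ, Ht]. }
  assert (Dks : forall t, 0 < t < 1 -> is_derive (fun t => sin (k * J t)) t (k * p t * cos (k * J t))).
  { intros t Ht. apply (is_derive_comp sin (fun t => k * J t)); [apply is_derive_sin|apply is_derive_scal, DJ, Ht]. }
  assert (DM : forall f g (df dg t : R), is_derive f t df -> is_derive g t dg ->
    is_derive (fun t : R => f t * g t) t (df * g t + f t * dg)).
  { intros f g df dg t Hf Hg. apply (is_derive_mult (K := R_AbsRing) f g t df dg Hf Hg). intros; apply Rmult_comm. }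
  (* [(P, Q)] is the vector [(c, s)] turned back by the angle [k * J t]; the equation makes it
     constant. *)
  set (P := fun t => cos (k * J t) * c t + sin (k * J t) * s t).
  set (Q := fun t => cos (k * J t) * s t - sin (k * J t) * c t).
  assert (DP : forall t, 0 < t < 1 -> is_derive P t 0).
  { intros t Ht. eapply is_derive_eq.
    - apply (is_derive_plus (K := R_AbsRing) (V := R_NormedModule)); apply DM; [apply Dkc, Ht|apply Dc, Ht|apply Dks, Ht|apply Ds, Ht].
    - unfold plus; simpl. ring. }
  assert (DQ : forall t, 0 < t < 1 -> is_derive Q t 0).
  { intros t Ht. eapply is_derive_eq.
    - apply (is_derive_minus (K := R_AbsRing) (V := R_NormedModule)); apply DM; [apply Dkc, Ht|apply Ds, Ht|apply Dks, Ht|apply Dc, Ht].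
    - unfold minus, plus, opp; simpl. ring. }
  assert (Cst : forall f, (forall t, 0 < t < 1 -> is_derive f t 0) -> forall u w, 0 < u < 1 -> 0 < w < 1 -> f u = f w).
  { intros f Df u w Hu Hw. destruct (MVT_gen f w u (fun _ => 0)) as [x [_ E]]; [| |lra].
    - intros t Ht. apply Df, (B w u); [exact Hw|exact Hu|lra].
    - intros t Ht. apply (is_derive_continuity_pt _ _ 0), Df, (B w u); assumption. }
  assert (U : forall t, cos (k * J t) * cos (k * J t) + sin (k * J t) * sin (k * J t) = 1).
  { intros t. assert (E := sin2_cos2 (k * J t)). unfold Rsqr in E. lra. }
  assert (Rel : forall u w, 0 < u < 1 -> 0 < w < 1 ->
    c w = rot_cos k (J w - J u) (c u) (s u) /\ s w = rot_sin k (J w - J u) (c u) (s u)).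
  { intros u w Hu Hw. assert (E1 := Cst P DP u w Hu Hw). assert (E2 := Cst Q DQ u w Hu Hw).
    unfold P in E1. unfold Q in E2. unfold rot_cos, rot_sin.
    replace (k * (J w - J u)) with (k * J w - k * J u) by ring. rewrite cos_minus, sin_minus.
    assert (Uu := U u). assert (Uw := U w).
    set (Cu := cos (k * J u)) in *. set (Su := sin (k * J u)) in *.
    set (Cw := cos (k * J w)) in *. set (Sw := sin (k * J w)) in *.
    split.
    - transitivity (Cw * (Cu * c u + Su * s u) - Sw * (Cu * s u - Su * c u)); [|ring].
      rewrite E1, E2. transitivity ((Cw * Cw + Sw * Sw) * c w); [rewrite Uw; ring|ring].
    - transitivity (Sw * (Cu * c u + Su * s u) + Cw * (Cu * s u - Su * c u)); [|ring].
      rewrite E1, E2. transitivity ((Cw * Cw + Sw * Sw) * s w); [rewrite Uw; ring|ring]. }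
  set (FP := filter_prod (at_right 0) (at_left 1)).
  assert (PF : ProperFilter FP) by apply filter_prod_proper.
  assert (In : FP (fun ab => 0 < fst ab < 1 /\ 0 < snd ab < 1)).
  { apply Filter_prod with (fun u => 0 < u < 1) (fun u => 0 < u < 1).
    - apply locally_Rabs. exists 1. split; [lra|]. intros u Hu Hxu. apply Rabs_def2 in Hu. lra.
    - apply locally_Rabs. exists 1. split; [lra|]. intros u Hu Hxu. apply Rabs_def2 in Hu. lra.
    - auto. }
  assert (LJ : filterlim (fun ab : R * R => J (snd ab) - J (fst ab)) FP (locally v)).
  { intros O HO. specialize (Hv O HO). unfold filtermapi in Hv. unfold filtermap.
    apply filter_imp with (2 := filter_and _ _ Hv In). intros [u w] [[y [Hy HyO]] [Hu Hw]]. simpl in *.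
    replace (J w - J u) with y; [exact HyO|].
    apply (is_RInt_unique (V := R_CompleteNormedModule)) in Hy. rewrite <- Hy. unfold J.
    assert (Ch := RInt_Chasles (V := R_CompleteNormedModule) p (1 / 2) u w (Ex (1 / 2) u ltac:(lra) Hu) (Ex u w Hu Hw)).
    unfold plus in Ch; simpl in Ch. lra. }
  assert (Lk : filterlim (fun ab : R * R => k * (J (snd ab) - J (fst ab))) FP (locally (k * v))).
  { apply flim_Rmult; [apply flim_const|exact LJ]. }
  assert (Lcos := flim_Rcomp cos _ _ (continuous_cos (k * v)) Lk).
  assert (Lsin := flim_Rcomp sin _ _ (continuous_sin (k * v)) Lk).
  assert (F1 : filterlim (fun ab : R * R => fst ab) FP (at_right 0)) by apply filterlim_fst.
  assert (F2 : filterlim (fun ab : R * R => snd ab) FP (at_left 1)) by apply filterlim_snd.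
  assert (M1 := filterlim_comp _ _ _ _ _ _ _ _ F1 Lc0). assert (M2 := filterlim_comp _ _ _ _ _ _ _ _ F1 Ls0).
  assert (M3 := filterlim_comp _ _ _ _ _ _ _ _ F2 Lc1). assert (M4 := filterlim_comp _ _ _ _ _ _ _ _ F2 Ls1).
  split.
  - apply (filterlim_locally_unique (F := FP) (V := R_NormedModule) (fun ab => c (snd ab))); [exact M3|].
    apply (filterlim_ext_loc (fun ab : R * R => rot_cos k (J (snd ab) - J (fst ab)) (c (fst ab)) (s (fst ab)))).
    + apply filter_imp with (2 := In). intros [u w] [Hu Hw]. symmetry. apply Rel; assumption.
    + unfold rot_cos. apply flim_Rminus; apply flim_Rmult; assumption.
  - apply (filterlim_locally_unique (F := FP) (V := R_NormedModule) (fun ab => s (snd ab))); [exact M4|].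
    apply (filterlim_ext_loc (fun ab : R * R => rot_sin k (J (snd ab) - J (fst ab)) (c (fst ab)) (s (fst ab)))).
    + apply filter_imp with (2 := In). intros [u w] [Hu Hw]. symmetry. apply Rel; assumption.
    + unfold rot_sin. apply flim_Rplus; apply flim_Rmult; assumption.
Qed.

Lemma coord_rderiv (z : R -> C) (t : R) (d : C) : (z t + RtoC a <> 0)%C -> rderiv z t d ->
  rderiv (fun s => coord (Fin (z s))) t (2 * RtoC a / ((z t + RtoC a) * (z t + RtoC a)) * d)%C.
Proof.
  intros H Hz. simpl. apply (rderiv_comp z (fun u => (u - RtoC a) / (u + RtoC a))%C); [exact Hz|].
  apply (cderiv_eq _ _ ((1 - 0) * / (z t + RtoC a) + (z t - RtoC a) * (- (1 + 0) / ((z t + RtoC a) * (z t + RtoC a))))%C).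
  - apply (cderiv_mult (fun u => u - RtoC a)%C (fun u => / (u + RtoC a))%C).
    + apply cderiv_minus; [apply cderiv_id|apply cderiv_const].
    + apply (cderiv_inv (fun u => u + RtoC a)%C); [exact H|].
      apply cderiv_plus; [apply cderiv_id|apply cderiv_const].
  - field. exact H.
Qed.

Lemma ordinary_point (z w : C) : ordinary l l1 l2 z w ->
  point_over (coord (Fin z)) (Fin w) /\ w <> 0%C /\ (z + RtoC a <> 0)%C /\ (z - RtoC a <> 0)%C.
Proof.
  intros [H Hw]. destruct (on_R_not_end z (Fin w) H) as [Q1 Q2].
  split; [apply (on_R_point (Fin z, Fin w) H)|auto].
Qed.

Lemma ph_pullback (c : C) (e : R) (z w d : C) : (z + RtoC a <> 0)%C -> (z - RtoC a <> 0)%C -> w <> 0%C ->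
  (ph (c * RtoC (/ (4 * a))) e (coord (Fin z)) w * (2 * RtoC a / ((z + RtoC a) * (z + RtoC a)) * d) =
   / 2 * c * (/ w + RtoC e * w) * dh l l1 l2 z * d)%C.
Proof.
  intros P1 P2 P3. assert (Ha := a_pos). assert (HaC := RtoC_neq _ (Rgt_not_eq _ _ Ha)).
  unfold ph, dh. simpl. rewrite RtoC_inv, RtoC_mult by lra. field.
  repeat split; try assumption; try (apply RtoC_neq; lra).
  replace (z * z - RtoC a * RtoC a)%C with ((z - RtoC a) * (z + RtoC a))%C by ring.
  apply Cmult_neq_0; assumption.
Qed.

Lemma phi1_pullback (z w d : C) : (z + RtoC a <> 0)%C -> (z - RtoC a <> 0)%C -> w <> 0%C ->
  (ph cc1 (-1) (coord (Fin z)) w * (2 * RtoC a / ((z + RtoC a) * (z + RtoC a)) * d) = phi1 l l1 l2 z w * d)%C.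
Proof.
  intros P1 P2 P3. unfold cc1. replace (RtoC (/ (4 * a))) with (1 * RtoC (/ (4 * a)))%C by ring.
  rewrite ph_pullback by assumption. unfold phi1.
  replace (RtoC (-1)) with (Copp (RtoC 1)) by (apply C_ext; unfold Re, Im; simpl; ring). ring.
Qed.

Lemma phi2_pullback (z w d : C) : (z + RtoC a <> 0)%C -> (z - RtoC a <> 0)%C -> w <> 0%C ->
  (ph cc2 1 (coord (Fin z)) w * (2 * RtoC a / ((z + RtoC a) * (z + RtoC a)) * d) = phi2 l l1 l2 z w * d)%C.
Proof.
  intros P1 P2 P3. unfold cc2. rewrite ph_pullback by assumption. unfold phi2, Cdiv. ring.
Qed.

Lemma Cdh_flim {T : Type} {F : (T -> Prop) -> Prop} {FF : Filter F} (z : T -> C) (z0 : C) :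
  (z0 + RtoC a <> 0)%C -> (z0 - RtoC a <> 0)%C -> filterlim z F (locally z0) ->
  filterlim (fun t => dh l l1 l2 (z t)) F (locally (dh l l1 l2 z0)).
Proof.
  intros P1 P2 Hz. unfold dh. flim.
  replace (z0 * z0 - RtoC a * RtoC a)%C with ((z0 - RtoC a) * (z0 + RtoC a))%C by ring.
  apply Cmult_neq_0; assumption.
Qed.

Lemma X3_deriv (z : R -> C) (t : R) (d : C) : (z t + RtoC a <> 0)%C -> (z t - RtoC a <> 0)%C ->
  rderiv z t d ->
  is_derive (fun s => ln (Cmod (coord (Fin (z s)))) / (2 * a)) t (Re (dh l l1 l2 (z t) * d)%C).
Proof.
  intros P1 P2 Hz. assert (Ha := a_pos). assert (Hc := coord_rderiv z t d P1 Hz).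
  set (g := fun s => coord (Fin (z s))) in *. set (D := (2 * RtoC a / ((z t + RtoC a) * (z t + RtoC a)) * d)%C) in *.
  assert (Hg : g t <> 0%C).
  { unfold g; simpl. apply Cmult_neq_0; [exact P2|]. intros E. assert (E1 := Cinv_r _ P1). rewrite E in E1.
    apply (RtoC_neq 1 R1_neq_R0). rewrite <- E1. ring. }
  assert (Hm := Cmod_neq0 _ Hg).
  destruct (proj1 (rderiv_parts _ _ _) Hc) as [D1 D2].
  assert (DM : forall f (df : R), is_derive f t df -> is_derive (fun s : R => f s * f s) t (2 * f t * df)).
  { intros f df Hf. apply (is_derive_eq _ _ (df * f t + f t * df)); [|ring].
    apply (is_derive_mult (K := R_AbsRing) f f t df df Hf Hf). intros; apply Rmult_comm. }
  (* The logarithm of the squared modulus avoids the derivative of a square root, at the price of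
     another factor 2 in the denominator. *)
  apply (is_derive_ext_loc (fun s => / (4 * a) * ln (Re (g s) * Re (g s) + Im (g s) * Im (g s)))).
  - apply filter_imp with (2 := flim_nonzero _ _ Hg (rderiv_cont _ _ _ Hc)). intros s Hs.
    apply Cmod_neq0 in Hs. rewrite <- Cmod_sqr. fold (g s). rewrite ln_mult by assumption.
    match goal with |- ?x = ?y => change (@eq R x y) end. field. lra.
  - apply (is_derive_eq _ _ (/ (4 * a) * ((2 * Re (g t) * Re D + 2 * Im (g t) * Im D) * / (Re (g t) * Re (g t) + Im (g t) * Im (g t))))).
    + apply is_derive_scal. apply (is_derive_comp ln (fun s => Re (g s) * Re (g s) + Im (g s) * Im (g s))).
      * apply is_derive_ln. rewrite <- Cmod_sqr. nra.
      * apply (is_derive_plus (K := R_AbsRing) (V := R_NormedModule)); [apply (DM (fun s => Re (g s))), D1|apply (DM (fun s => Im (g s))), D2].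
    + transitivity (Re (RtoC (/ (2 * a)) * (D / g t))%C).
      * unfold Cdiv. rewrite Re_scal.
        replace (Re (D * / g t)%C) with (Re D * Re (/ g t)%C - Im D * Im (/ g t)%C) by reflexivity.
        destruct (Cinv_parts _ Hg) as [-> ->]. rewrite <- Cmod_sqr. field. split; lra.
      * f_equal. unfold D, g, dh. simpl. rewrite RtoC_inv, RtoC_mult by lra.
        assert (HaC := RtoC_neq _ (Rgt_not_eq _ _ Ha)). field.
        repeat split; try assumption; try (apply RtoC_neq; lra).
        replace (z t * z t - RtoC a * RtoC a)%C with ((z t - RtoC a) * (z t + RtoC a))%C by ring.
        apply Cmult_neq_0; assumption.
Qed.

(** What a displacement [v] of [X] from [p] to [q] leaves visible on [R]: it determines [v] up to
    periods and does not refer to a path. *)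
Definition moved (p q : Chat * Chat) (v : R * R * R) : Prop :=
  cos1 q = rot_cos k1 (fst (fst v)) (cos1 p) (sin1 p) /\ sin1 q = rot_sin k1 (fst (fst v)) (cos1 p) (sin1 p) /\
  cos2 q = rot_cos k2 (snd (fst v)) (cos2 p) (sin2 p) /\ sin2 q = rot_sin k2 (snd (fst v)) (cos2 p) (sin2 p) /\
  X3 q = X3 p + snd v.

Lemma arc_moved (p q : Chat * Chat) (v : R * R * R) : arc_integral l l1 l2 p q v -> moved p q v.
Proof.
  intros [z [w [dz [[Hp [Hq [HA [L0 L1]]]] [I1 [I2 I3]]]]]].
  assert (Ord : forall t, 0 < t < 1 -> locally t (fun s => 0 < s < 1)).
  { intros t Ht. apply locally_Rabs. exists (Rmin t (1 - t)). split; [apply Rmin_glb_lt; lra|].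
    intros u Hu. assert (Q1 := Rmin_l t (1 - t)). assert (Q2 := Rmin_r t (1 - t)). apply Rabs_def2 in Hu. lra. }
  assert (Pt : forall t, 0 < t < 1 -> locally t (fun s => point_over (coord (Fin (z s))) (Fin (w s)) /\ w s <> 0%C)).
  { intros t Ht. apply filter_imp with (2 := Ord t Ht). intros s Hs. destruct (HA s Hs) as [O _].
    destruct (ordinary_point _ _ O) as [Q1 [Q2 _]]. auto. }
  assert (Dz : forall t, 0 < t < 1 -> rderiv z t (dz t)).
  { intros t Ht. apply rderiv_is_derive, HA, Ht. }
  destruct (maps_lim _ p Hp L0) as [B1 [B2 [B3 [B4 B5]]]].
  destruct (maps_lim _ q Hq L1) as [G1 [G2 [G3 [G4 G5]]]].
  assert (D1 : forall t, 0 < t < 1 ->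
    is_derive (fun t => cos1 (Fin (z t), Fin (w t))) t (- (k1 * Re (phi1 l l1 l2 (z t) (w t) * dz t)%C) * sin1 (Fin (z t), Fin (w t))) /\
    is_derive (fun t => sin1 (Fin (z t), Fin (w t))) t (k1 * Re (phi1 l l1 l2 (z t) (w t) * dz t)%C * cos1 (Fin (z t), Fin (w t)))).
  { intros t Ht. destruct (HA t Ht) as [O [_ [_ Cw]]]. destruct (ordinary_point _ _ O) as [Q1 [Q2 [Q3 Q4]]].
    rewrite <- phi1_pullback by assumption.
    apply (lift_deriv cc1 (-1) s1 s2 k1 d0 (fun s => coord (Fin (z s))) w t).
    - apply Rabs_m1. - apply coherent1. - apply s1_locally. - apply s2_locally.
    - apply coord_rderiv; [exact Q3|apply Dz, Ht]. - exact Cw. - intros u. apply sign_abs. - apply Pt, Ht.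
    - apply (point_sg _ _ Q1). }
  assert (D2 : forall t, 0 < t < 1 ->
    is_derive (fun t => cos2 (Fin (z t), Fin (w t))) t (- (k2 * Re (phi2 l l1 l2 (z t) (w t) * dz t)%C) * sin2 (Fin (z t), Fin (w t))) /\
    is_derive (fun t => sin2 (Fin (z t), Fin (w t))) t (k2 * Re (phi2 l l1 l2 (z t) (w t) * dz t)%C * cos2 (Fin (z t), Fin (w t)))).
  { intros t Ht. destruct (HA t Ht) as [O [_ [_ Cw]]]. destruct (ordinary_point _ _ O) as [Q1 [Q2 [Q3 Q4]]].
    rewrite <- phi2_pullback by assumption.
    apply (lift_deriv cc2 1 s2 s1 k2 e0 (fun s => coord (Fin (z s))) w t).
    - apply Rabs_p1. - apply coherent2. - apply s2_locally. - apply s1_locally.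
    - apply coord_rderiv; [exact Q3|apply Dz, Ht]. - exact Cw. - intros u. apply sign_abs. - apply Pt, Ht.
    - apply (point_sg _ _ Q1). }
  assert (Cz : forall t, 0 < t < 1 -> filterlim z (locally t) (locally (z t))).
  { intros t Ht. exact (rderiv_cont _ _ _ (Dz t Ht)). }
  assert (Cphi : forall (P : C -> C -> C), (forall t, 0 < t < 1 -> filterlim (fun s => P (z s) (w s)) (locally t) (locally (P (z t) (w t)))) ->
     forall t, 0 < t < 1 -> continuous (fun t => Re (P (z t) (w t) * dz t)%C) t).
  { intros P HP t Ht. destruct (HA t Ht) as [_ [_ [Cd _]]]. apply flim_Re. apply flim_Cmult; [apply HP, Ht|exact Cd]. }
  assert (C12 : forall t, 0 < t < 1 ->
    filterlim (fun s => phi1 l l1 l2 (z s) (w s)) (locally t) (locally (phi1 l l1 l2 (z t) (w t))) /\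
    filterlim (fun s => phi2 l l1 l2 (z s) (w s)) (locally t) (locally (phi2 l l1 l2 (z t) (w t))) /\
    filterlim (fun s => phi3 l l1 l2 (z s) (w s)) (locally t) (locally (phi3 l l1 l2 (z t) (w t)))).
  { intros t Ht. destruct (HA t Ht) as [O [_ [_ Cw]]]. destruct (ordinary_point _ _ O) as [Q1 [Q2 [Q3 Q4]]].
    assert (Cd := Cdh_flim z (z t) Q3 Q4 (Cz t Ht)).
    split; [|split; [|exact Cd]]; (apply flim_Cmult; [|exact Cd]); flim; exact Q2. }
  destruct (rot_limit _ _ _ k1 _ _ _ _ _ (fun t Ht => proj1 (D1 t Ht)) (fun t Ht => proj2 (D1 t Ht))
    (Cphi (phi1 l l1 l2) (fun t Ht => proj1 (C12 t Ht))) B1 B2 G1 G2 I1) as [R1 R2].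
  destruct (rot_limit _ _ _ k2 _ _ _ _ _ (fun t Ht => proj1 (D2 t Ht)) (fun t Ht => proj2 (D2 t Ht))
    (Cphi (phi2 l l1 l2) (fun t Ht => proj1 (proj2 (C12 t Ht)))) B3 B4 G3 G4 I2) as [R3 R4].
  assert (R5 := RInt_gen_lim (fun t => X3 (Fin (z t), Fin (w t))) _ 0 1 _ _ _ Rlt_0_1
    (fun t Ht => X3_deriv z t (dz t) (proj1 (proj2 (proj2 (ordinary_point _ _ (proj1 (HA t Ht))))))
       (proj2 (proj2 (proj2 (ordinary_point _ _ (proj1 (HA t Ht)))))) (Dz t Ht))
    (Cphi (phi3 l l1 l2) (fun t Ht => proj2 (proj2 (C12 t Ht)))) B5 G5 I3).
  repeat split; try assumption. lra.
Qed.

(** * Recovering a point of [R] from its image *)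

Lemma cos_strict (x y : R) : 0 <= x <= PI -> 0 <= y <= PI -> x < y -> cos y < cos x.
Proof. intros. apply cos_decreasing_1; lra. Qed.

Definition arc_cos (k s : R) : R := cos (k1 * (H1 (arc k s) - d0)).

Lemma arc_cos_strict (k s t : R) : 0 < k -> -1 <= s < t -> t <= 1 -> arc_cos k t < arc_cos k s.
Proof.
  intros Hk Hs Ht. destruct (arc_H k s t Hk Hs Ht) as [M _]. destruct k_pos as [K _].
  assert (R : forall u, -1 <= u <= 1 -> 0 <= k1 * (H1 (arc k u) - d0) <= PI).
  { intros u Hu. assert (N := arc_neq0 k u Hk Hu). assert (I := arc_Im k u Hk).
    apply (A_scaled _ _ _ (proj1 de_lt)). apply (box _ I N). }
  apply cos_strict; [apply R; lra|apply R; lra|]. apply Rmult_lt_compat_l; lra.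
Qed.

Lemma arc_cos_cont (k s : R) : 0 < k -> -1 <= s <= 1 ->
  filterlim (fun k => arc_cos k s) (locally k) (locally (arc_cos k s)).
Proof.
  intros Hk Hs. apply (flim_Rcomp cos); [apply continuous_cos|].
  apply flim_Rmult; [apply flim_const|]. apply flim_Rminus; [|apply flim_const].
  apply height_flim; [apply Rabs_m1|apply arc_Im, Hk|apply arc_neq0; assumption| |].
  - apply locally_Rabs. exists k. split; [exact Hk|]. intros u Hu. apply Rabs_def2 in Hu. apply arc_Im. lra.
  - apply (arc_flim (F := locally k) (fun k => k) (fun _ => s)); [apply flim_id|apply flim_const].
Qed.

(** The inverse of the decreasing function [arc_cos k] is continuous, jointly with the radius. At
    [s + eta] and [s - eta] the values differ from that at [s] by some [2 * q]; they change by less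
    than [q] for nearby radii, and monotonicity at the radius [k'] confines [s']. *)
Lemma arc_angle_near (k s eta : R) : 0 < k -> -1 <= s <= 1 -> 0 < eta -> exists d, 0 < d /\
  forall k' s', 0 < k' -> -1 <= s' <= 1 -> Rabs (k' - k) < d ->
    Rabs (arc_cos k' s' - arc_cos k s) < d -> Rabs (s' - s) < eta.
Proof.
  intros Hk Hs Heta.
  assert (U : exists d, 0 < d /\ forall k' s', 0 < k' -> -1 <= s' <= 1 -> Rabs (k' - k) < d ->
    Rabs (arc_cos k' s' - arc_cos k s) < d -> s' < s + eta).
  { destruct (Rlt_le_dec 1 (s + eta)) as [H|H].
    - exists 1. split; [lra|]. intros. lra.
    - assert (M := arc_cos_strict k s (s + eta) Hk ltac:(lra) H).
      set (q := (arc_cos k s - arc_cos k (s + eta)) / 2). assert (Hq : 0 < q) by (unfold q; lra).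
      assert (C := arc_cos_cont k (s + eta) Hk ltac:(lra)). rewrite (flim_Rabs (F := locally k)) in C.
      specialize (C q Hq). apply locally_Rabs in C. destruct C as [d [Hd C]].
      exists (Rmin d q). split; [apply Rmin_glb_lt; assumption|].
      intros k' s' Hk' Hs' Q1 Q2. assert (B1 := Rmin_l d q). assert (B2 := Rmin_r d q).
      specialize (C k' ltac:(lra)). apply Rabs_def2 in C. apply Rabs_def2 in Q2. unfold q in *.
      apply Rnot_le_lt. intros Hle. destruct (Rle_lt_or_eq_dec _ _ Hle) as [G|G].
      + assert (M2 := arc_cos_strict k' (s + eta) s' Hk' ltac:(lra) ltac:(lra)). lra.
      + subst s'. lra. }
  assert (L : exists d, 0 < d /\ forall k' s', 0 < k' -> -1 <= s' <= 1 -> Rabs (k' - k) < d ->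
    Rabs (arc_cos k' s' - arc_cos k s) < d -> s - eta < s').
  { destruct (Rlt_le_dec (s - eta) (-1)) as [H|H].
    - exists 1. split; [lra|]. intros. lra.
    - assert (M := arc_cos_strict k (s - eta) s Hk ltac:(lra) ltac:(lra)).
      set (q := (arc_cos k (s - eta) - arc_cos k s) / 2). assert (Hq : 0 < q) by (unfold q; lra).
      assert (C := arc_cos_cont k (s - eta) Hk ltac:(lra)). rewrite (flim_Rabs (F := locally k)) in C.
      specialize (C q Hq). apply locally_Rabs in C. destruct C as [d [Hd C]].
      exists (Rmin d q). split; [apply Rmin_glb_lt; assumption|].
      intros k' s' Hk' Hs' Q1 Q2. assert (B1 := Rmin_l d q). assert (B2 := Rmin_r d q).
      specialize (C k' ltac:(lra)). apply Rabs_def2 in C. apply Rabs_def2 in Q2. unfold q in *.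
      apply Rnot_le_lt. intros Hle. destruct (Rle_lt_or_eq_dec _ _ Hle) as [G|G].
      + assert (M2 := arc_cos_strict k' s' (s - eta) Hk' ltac:(lra) ltac:(lra)). lra.
      + subst s'. lra. }
  destruct U as [dU [HU U]], L as [dL [HL L]].
  exists (Rmin dU dL). split; [apply Rmin_glb_lt; assumption|].
  intros k' s' Hk' Hs' Q1 Q2. assert (B1 := Rmin_l dU dL). assert (B2 := Rmin_r dU dL).
  apply Rabs_def1.
  - assert (G := U k' s' Hk' Hs' ltac:(lra) ltac:(lra)). lra.
  - assert (G := L k' s' Hk' Hs' ltac:(lra) ltac:(lra)). lra.
Qed.

Lemma X3_radius (p : Chat * Chat) : coord (fst p) <> 0%C -> Cmod (coord (fst p)) = exp (2 * a * X3 p).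
Proof.
  intros H. assert (Ha := a_pos). unfold X3.
  replace (2 * a * (ln (Cmod (coord (fst p))) / (2 * a))) with (ln (Cmod (coord (fst p)))) by (field; lra).
  symmetry. apply exp_ln, Cmod_neq0, H.
Qed.

(** [X3] gives the modulus of [om], and on the half circle of this radius [cos1] gives the argument
    up to sign. *)
Lemma up_coord_near (p : Chat * Chat) (rho : R) : on_R l l1 l2 p -> 0 < rho -> exists d, 0 < d /\
  forall q, on_R l l1 l2 q -> Rabs (cos1 q - cos1 p) < d -> Rabs (X3 q - X3 p) < d ->
  Cmod (up (coord (fst q)) - up (coord (fst p))) < rho.
Proof.
  intros Hp Hrho. assert (Ho := proj1 (on_R_point p Hp)). set (om := coord (fst p)) in *.
  assert (Hu := up_neq0 om Ho). assert (Hk := Cmod_neq0 _ Hu).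
  destruct (arc_surj (up om) (up_Im om) Hu) as [Hs Es].
  set (k := Cmod (up om)) in *. set (s := Re (up om) / k) in *.
  assert (CA : filterlim (fun ks : R * R => arc (fst ks) (snd ks)) (filter_prod (locally k) (locally s)) (locally (arc k s))).
  { apply arc_flim; [apply filterlim_fst|apply filterlim_snd]. }
  rewrite flim_Cmod in CA. destruct (CA rho Hrho) as [P Q HP HQ PQ].
  apply locally_Rabs in HP. destruct HP as [dk [Hdk HP]].
  apply locally_Rabs in HQ. destruct HQ as [ds [Hds HQ]].
  destruct (arc_angle_near k s ds Hk Hs Hds) as [d1' [Hd1 HA]].
  assert (Ep : k = exp (2 * a * X3 p)) by (unfold k; rewrite up_Cmod; apply X3_radius, Ho).
  assert (CE : filterlim (fun x => exp (2 * a * x)) (locally (X3 p)) (locally k)).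
  { rewrite Ep. apply (flim_Rcomp exp); [apply continuous_exp|]. apply flim_Rmult; [apply flim_const|apply flim_id]. }
  rewrite (flim_Rabs (F := locally (X3 p))) in CE.
  destruct (proj1 (locally_Rabs _ _) (CE (Rmin dk d1') ltac:(apply Rmin_glb_lt; assumption))) as [dx [Hdx HX]].
  exists (Rmin dx d1'). split; [apply Rmin_glb_lt; assumption|].
  intros q Hq Q1 Q2. assert (B1 := Rmin_l dx d1'). assert (B2 := Rmin_r dx d1').
  assert (Hoq := proj1 (on_R_point q Hq)). set (omq := coord (fst q)) in *.
  assert (Huq := up_neq0 omq Hoq). assert (Hkq := Cmod_neq0 _ Huq).
  destruct (arc_surj (up omq) (up_Im omq) Huq) as [Hsq Esq].
  set (kq := Cmod (up omq)) in *. set (sq := Re (up omq) / kq) in *.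
  assert (Eq : kq = exp (2 * a * X3 q)) by (unfold kq; rewrite up_Cmod; apply X3_radius, Hoq).
  specialize (HX (X3 q) ltac:(lra)). rewrite <- Eq in HX.
  assert (B3 := Rmin_l dk d1'). assert (B4 := Rmin_r dk d1').
  assert (G : Rabs (sq - s) < ds).
  { apply (HA kq sq Hkq Hsq); [lra|]. unfold arc_cos. rewrite Es, Esq.
    change (Rabs (cos1 q - cos1 p) < d1'). lra. }
  rewrite <- Es, <- Esq. apply (PQ kq sq); [apply HP; lra|apply HQ, G].
Qed.

Lemma sign_stable (u v x y : R) : (u = 0 \/ u = 1 \/ u = -1) -> (v = 1 \/ v = -1) ->
  0 <= x -> 0 < y -> Rabs (u * x - v * y) < y -> u = v.
Proof.
  intros [->|[->| ->]] [-> | ->] Hx Hy H; try reflexivity; exfalso; apply Rabs_def2 in H; lra.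
Qed.

Lemma sg_values (w : Chat) : (sg1 w = 0 \/ sg1 w = 1 \/ sg1 w = -1) /\ (sg2 w = 0 \/ sg2 w = 1 \/ sg2 w = -1).
Proof.
  destruct w as [w|]; simpl; [|auto]. unfold s1, s2. split.
  - destruct (sign_cases (Re w)) as [[_ ->]|[[_ ->]|[_ ->]]]; auto.
  - destruct (sign_cases (- Im w)) as [[_ ->]|[[_ ->]|[_ ->]]]; auto.
Qed.

(** A nonzero sign comes with a positive sine, and a change of the signed sine smaller than this
    sine can neither annihilate nor reverse the sign. *)
Lemma signs_near (p : Chat * Chat) : on_R l l1 l2 p -> exists d, 0 < d /\
  forall q, on_R l l1 l2 q -> Rabs (sin1 q - sin1 p) < d -> Rabs (sin2 q - sin2 p) < d ->
  (sg1 (snd p) <> 0 -> sg1 (snd q) = sg1 (snd p)) /\ (sg2 (snd p) <> 0 -> sg2 (snd q) = sg2 (snd p)).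
Proof.
  intros Hp. destruct (point_sg _ _ (on_R_point p Hp)) as [_ [P1 [_ P2]]].
  set (x1 := sin (A1 (coord (fst p)))) in *. set (x2 := sin (A2 (coord (fst p)))) in *.
  assert (Q : forall (s x : R), (s <> 0 -> 0 < x) -> exists d, 0 < d /\ (s <> 0 -> d <= x)).
  { intros s x H. destruct (Req_dec s 0) as [E|E]; [exists 1; split; [lra|contradiction]|].
    exists x. split; [apply H, E|lra]. }
  destruct (Q _ _ P1) as [da [Hda Da]]. destruct (Q _ _ P2) as [db [Hdb Db]].
  exists (Rmin da db). split; [apply Rmin_glb_lt; assumption|].
  intros q Hq G1 G2. assert (B1 := Rmin_l da db). assert (B2 := Rmin_r da db).
  destruct (point_sg _ _ (on_R_point q Hq)) as [R1 [R2 [R3 R4]]].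
  destruct (sg_values (snd p)) as [V1 V2]. destruct (sg_values (snd q)) as [V3 V4].
  assert (N1 : 0 <= sin (A1 (coord (fst q)))).
  { destruct (Req_dec (sg1 (snd q)) 0) as [E|E]; [rewrite (R1 E); lra|apply Rlt_le, R2, E]. }
  assert (N2 : 0 <= sin (A2 (coord (fst q)))).
  { destruct (Req_dec (sg2 (snd q)) 0) as [E|E]; [rewrite (R3 E); lra|apply Rlt_le, R4, E]. }
  unfold sin1 in G1. unfold sin2 in G2. fold x1 in G1. fold x2 in G2.
  set (y1 := sin (A1 (coord (fst q)))) in *. set (y2 := sin (A2 (coord (fst q)))) in *.
  clearbody x1 x2 y1 y2.
  split; intros Hn.
  - apply (sign_stable _ _ y1 x1 V3); [destruct V1 as [V|V]; [contradiction|exact V]|exact N1|apply P1, Hn|].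
    specialize (Da Hn). lra.
  - apply (sign_stable _ _ y2 x2 V4); [destruct V2 as [V|V]; [contradiction|exact V]|exact N2|apply P2, Hn|].
    specialize (Db Hn). lra.
Qed.

Definition close (d : R) (p q : Chat * Chat) : Prop :=
  Rabs (cos1 q - cos1 p) < d /\ Rabs (sin1 q - sin1 p) < d /\
  Rabs (cos2 q - cos2 p) < d /\ Rabs (sin2 q - sin2 p) < d /\ Rabs (X3 q - X3 p) < d.

Lemma nonreal_signs (om : C) (w : Chat) : point_over om w -> Im om <> 0 ->
  sg1 w <> 0 /\ sg2 w <> 0 /\ (0 < Im om -> sg1 w = sg2 w) /\ (Im om < 0 -> sg1 w = - sg2 w).
Proof.
  intros Hp Hi. assert (Hr := regular_H om Hi).
  destruct w as [w|]; [|exfalso; exact (point_singular' om Inf Hp (or_intror eq_refl) Hr)].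
  assert (Hw : w <> 0%C).
  { intros ->. exact (point_singular' om (Fin 0) Hp (or_introl eq_refl) Hr). }
  destruct (coherent1 om w Hp Hw) as [_ [_ [Z1 [Z2 Z3]]]].
  destruct (coherent2 om w Hp Hw) as [_ [_ [Y1 _]]]. simpl.
  split; [intros E; apply Hi, (Z1 E)|split; [intros E; apply Hi, (Y1 E)|split; assumption]].
Qed.

(** [up_coord_near] leaves the choice between a point and its conjugate. The two signs agree over
    the upper half plane and are opposite over the lower one, and by [signs_near] they are the same
    at [p] and [q]. *)
Lemma proper (p : Chat * Chat) (rho : R) : on_R l l1 l2 p -> 0 < rho -> exists d, 0 < d /\
  forall q, on_R l l1 l2 q -> close d p q ->
  Cmod (coord (fst q) - coord (fst p)) < rho /\
  (sg1 (snd p) <> 0 -> sg1 (snd q) = sg1 (snd p)) /\ (sg2 (snd p) <> 0 -> sg2 (snd q) = sg2 (snd p)).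
Proof.
  intros Hp Hrho. assert (Pp := on_R_point p Hp). set (om := coord (fst p)) in *.
  destruct (signs_near p Hp) as [ds [Hds Sn]].
  (* If [om] is not real, this choice keeps the coordinate of [q] off the real axis as well, so that
     its signs reveal the half plane. *)
  assert (Hr : exists r, 0 < r /\ r <= rho /\ (Im om <> 0 -> r <= Rabs (Im om))).
  { destruct (Req_dec (Im om) 0) as [E|E]; [exists rho; split; [exact Hrho|split; [lra|contradiction]]|].
    exists (Rmin rho (Rabs (Im om))). split; [apply Rmin_glb_lt; [exact Hrho|apply Rabs_pos_lt, E]|].
    split; [apply Rmin_l|intros _; apply Rmin_r]. }
  destruct Hr as [r [Hr [Hr1 Hr2]]].
  destruct (up_coord_near p r Hp Hr) as [du [Hdu Un]]. fold om in Un.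
  exists (Rmin ds du). split; [apply Rmin_glb_lt; assumption|].
  intros q Hq [C1 [C2 [C3 [C4 C5]]]]. assert (B1 := Rmin_l ds du). assert (B2 := Rmin_r ds du).
  destruct (Sn q Hq ltac:(lra) ltac:(lra)) as [G1 G2].
  specialize (Un q Hq ltac:(lra) ltac:(lra)).
  split; [|split; assumption].
  assert (Pq := on_R_point q Hq). set (omq := coord (fst q)) in *.
  apply Rlt_le_trans with (2 := Hr1). apply Rle_lt_trans with (2 := Un). right.
  assert (Iu := Rle_lt_trans _ _ _ (Im_le _) Un).
  change (Im (up omq - up om)%C) with (Rabs (Im omq) - Rabs (Im om)) in Iu.
  destruct (Req_dec (Im om) 0) as [E|E].
  - destruct (Rle_lt_dec 0 (Im omq)) as [I|I].
    + rewrite !up_pos by lra. reflexivity.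
    + rewrite up_neg, (up_neg om) by lra. rewrite <- Cminus_conj, Cmod_conj. reflexivity.
  - specialize (Hr2 E). apply Rabs_def2 in Iu.
    assert (Eq : Im omq <> 0) by (intros Q; rewrite Q, Rabs_R0 in Iu; lra).
    destruct (nonreal_signs om _ Pp E) as [N1 [N2 [N3 N4]]].
    destruct (nonreal_signs omq _ Pq Eq) as [M1 [M2 [M3 M4]]].
    rewrite (G1 N1), (G2 N2) in *.
    destruct (Rtotal_order (Im om) 0) as [I|[I|I]]; [|contradiction|];
    destruct (Rtotal_order (Im omq) 0) as [J|[J|J]]; try contradiction.
    + rewrite up_neg, (up_neg om) by lra. rewrite <- Cminus_conj, Cmod_conj. reflexivity.
    + exfalso. specialize (N4 I). specialize (M3 J). lra.
    + exfalso. specialize (N3 I). specialize (M4 J). lra.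
    + rewrite !up_pos by lra. reflexivity.
Qed.

(** At a regular point the other candidate is [- w], whose signs are opposite, and the two signs of
    a nonzero [w] are not both 0. Over a branch point there is one point only. *)
Lemma point_eq (om : C) (w w' : Chat) : point_over om w -> point_over om w' ->
  (sg1 w <> 0 -> sg1 w' = sg1 w) -> (sg2 w <> 0 -> sg2 w' = sg2 w) -> w' = w.
Proof.
  intros P P' E1 E2. destruct (Classical_Prop.classic (regular om)) as [Hr|Hr].
  - assert (F : forall u, point_over om u -> exists z, u = Fin z /\ z <> 0%C).
    { intros u Pu. destruct u as [u|]; [|exfalso; exact (point_singular' om Inf Pu (or_intror eq_refl) Hr)].
      exists u. split; [reflexivity|]. intros ->. exact (point_singular' om (Fin 0) Pu (or_introl eq_refl) Hr). }
    destruct (F w P) as [z [-> Hz]]. destruct (F w' P') as [z' [-> Hz']]. simpl in E1, E2.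
    destruct (point_regular _ _ P Hz) as [_ S]. destruct (point_regular _ _ P' Hz') as [_ S'].
    rewrite <- S in S'. destruct (sqr_eq _ _ S') as [s [[-> | ->] ->]]; [f_equal; ring|].
    exfalso. apply Hz. unfold s1, s2 in *.
    rewrite Re_scal, sign_scal in E1 by (right; reflexivity).
    rewrite Im_scal, Ropp_mult_distr_r, sign_scal in E2 by (right; reflexivity).
    apply C_ext; simpl.
    + destruct (sign_cases (Re z)) as [[Q R]|[[Q R]|[Q R]]]; [|exact Q|]; rewrite R in E1; specialize (E1 ltac:(lra)); lra.
    + destruct (sign_cases (- Im z)) as [[Q R]|[[Q R]|[Q R]]]; [|lra|]; rewrite R in E2; specialize (E2 ltac:(lra)); lra.
  - destruct (point_singular om w P Hr) as [[-> N]|[-> D]]; destruct (point_singular om w' P' Hr) as [[-> N']|[-> D']]; try reflexivity.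
    + exfalso. exact (num_den_coprime om N D').
    + exfalso. exact (num_den_coprime om N' D).
Qed.

Lemma sphere_coord_R (p : Chat * Chat) : on_R l l1 l2 p -> sphere (coord (fst p)) = fst p.
Proof.
  intros Hp. apply sphere_coord. destruct p as [[z|] w]; simpl; [|exact I].
  apply (on_R_not_end z w Hp).
Qed.

Lemma maps_inj (p q : Chat * Chat) : on_R l l1 l2 p -> on_R l l1 l2 q ->
  cos1 q = cos1 p -> sin1 q = sin1 p -> cos2 q = cos2 p -> sin2 q = sin2 p -> X3 q = X3 p -> q = p.
Proof.
  intros Hp Hq E1 E2 E3 E4 E5.
  assert (Z : forall d, 0 < d -> close d p q).
  { intros d Hd. unfold close. rewrite E1, E2, E3, E4, E5. unfold Rminus. rewrite !Rplus_opp_r, Rabs_R0. auto. }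
  assert (Ec : coord (fst q) = coord (fst p)).
  { destruct (Ceq_dec (coord (fst q)) (coord (fst p))) as [E|E]; [exact E|]. exfalso.
    assert (N : 0 < Cmod (coord (fst q) - coord (fst p))).
    { apply Cmod_neq0. intros Q. apply E. replace (coord (fst q)) with (coord (fst q) - coord (fst p) + coord (fst p))%C by ring. rewrite Q. ring. }
    (* The radius is the supposed distance itself, which contradicts the strict inequality of
       [proper]. *)
    destruct (proper p _ Hp N) as [d [Hd H]]. destruct (H q Hq (Z d Hd)) as [G _]. lra. }
  destruct (proper p 1 Hp Rlt_0_1) as [d [Hd H]]. destruct (H q Hq (Z d Hd)) as [_ [G1 G2]].
  assert (Es : snd q = snd p).
  { apply (point_eq (coord (fst p))); [apply on_R_point, Hp|rewrite <- Ec; apply on_R_point, Hq|exact G1|exact G2]. }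
  assert (Ef : fst q = fst p) by (rewrite <- sphere_coord_R, <- (sphere_coord_R p), Ec by assumption; reflexivity).
  destruct p, q. simpl in *. congruence.
Qed.

(** * Values of [X] and their periods *)

Lemma rot_compose (k x y c s : R) :
  rot_cos k (x + y) c s = rot_cos k y (rot_cos k x c s) (rot_sin k x c s) /\
  rot_sin k (x + y) c s = rot_sin k y (rot_cos k x c s) (rot_sin k x c s).
Proof.
  unfold rot_cos, rot_sin. replace (k * (x + y)) with (k * x + k * y) by ring.
  rewrite cos_plus, sin_plus. split; ring.
Qed.

Lemma moved_0 (p : Chat * Chat) : moved p p (0, 0, 0).
Proof.
  unfold moved, rot_cos, rot_sin; simpl. rewrite !Rmult_0_r, cos_0, sin_0. repeat split; ring.
Qed.

Lemma moved_trans (p q r : Chat * Chat) (u v : R * R * R) : moved p q u -> moved q r v -> moved p r (plus u v).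
Proof.
  destruct u as [[u1 u2] u3], v as [[v1 v2] v3].
  intros [A1' [A2' [A3' [A4' A5']]]] [B1 [B2 [B3 [B4 B5]]]]. simpl in *.
  unfold moved. simpl. unfold plus; simpl. unfold plus; simpl.
  destruct (rot_compose k1 u1 v1 (cos1 p) (sin1 p)) as [-> ->].
  destruct (rot_compose k2 u2 v2 (cos2 p) (sin2 p)) as [-> ->].
  rewrite <- A1', <- A2', <- A3', <- A4'. repeat split; try assumption. lra.
Qed.

Lemma X_value_moved (p0 p : Chat * Chat) (x : R * R * R) : on_R l l1 l2 p0 ->
  X_value l l1 l2 p0 p x -> on_R l l1 l2 p /\ moved p0 p x.
Proof.
  intros Hp0 H. induction H as [|p q x v H [IH1 IH2] Ha].
  - split; [exact Hp0|apply moved_0].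
  - split.
    + destruct Ha as [z [w [dz [[_ [Hq _]] _]]]]. exact Hq.
    + apply moved_trans with p; [exact IH2|apply arc_moved, Ha].
Qed.

Lemma X_injective (p0 p q : Chat * Chat) (x : R * R * R) : on_R l l1 l2 p0 ->
  X_value l l1 l2 p0 p x -> X_value l l1 l2 p0 q x -> p = q.
Proof.
  intros Hp0 Hp Hq.
  destruct (X_value_moved p0 p x Hp0 Hp) as [Rp [A1' [A2' [A3' [A4' A5']]]]].
  destruct (X_value_moved p0 q x Hp0 Hq) as [Rq [B1 [B2 [B3 [B4 B5]]]]].
  apply maps_inj; try assumption; congruence.
Qed.

Lemma maps_unit (p : Chat * Chat) : on_R l l1 l2 p ->
  cos1 p * cos1 p + sin1 p * sin1 p = 1 /\ cos2 p * cos2 p + sin2 p * sin2 p = 1.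
Proof.
  intros Hp. destruct (point_sg _ _ (on_R_point p Hp)) as [P1 [_ [P2 _]]].
  destruct (sg_values (snd p)) as [V1 V2]. unfold cos1, sin1, cos2, sin2.
  set (x1 := A1 (coord (fst p))) in *. set (x2 := A2 (coord (fst p))) in *.
  assert (U1 := sin2_cos2 x1). assert (U2 := sin2_cos2 x2). unfold Rsqr in *.
  split.
  - destruct V1 as [E|[E|E]]; rewrite E; [rewrite (P1 E) in *|..]; lra.
  - destruct V2 as [E|[E|E]]; rewrite E; [rewrite (P2 E) in *|..]; lra.
Qed.

Lemma cos_eq_1 (x : R) : cos x = 1 -> Rabs x < 2 * PI -> x = 0.
Proof.
  intros H Hx. assert (P := PI_RGT_0).
  assert (E : sin (x / 2) = 0).
  { assert (D := cos_2a_sin (x / 2)). replace (2 * (x / 2)) with x in D by field.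
    rewrite H in D. assert (sin (x / 2) * sin (x / 2) = 0) by lra. apply Rmult_integral in H0. tauto. }
  apply Rabs_def2 in Hx. destruct (Rtotal_order x 0) as [Q|[Q|Q]]; [|exact Q|]; exfalso.
  - assert (S := sin_gt_0 (- (x / 2)) ltac:(lra) ltac:(lra)). rewrite sin_neg in S. lra.
  - assert (S := sin_gt_0 (x / 2) ltac:(lra) ltac:(lra)). lra.
Qed.

(** Rotations act freely on the unit circle, so the image of one point determines [k * x] modulo
    [2 * PI]. *)
Lemma rot_unique (k c s x y : R) : 0 < k -> c * c + s * s = 1 ->
  rot_cos k x c s = rot_cos k y c s -> rot_sin k x c s = rot_sin k y c s ->
  Rabs (x - y) < 2 * PI / k -> x = y.
Proof.
  intros Hk Hu E1 E2 Hd. unfold rot_cos, rot_sin in *.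
  set (cx := cos (k * x)) in *. set (sx := sin (k * x)) in *. set (cy := cos (k * y)) in *. set (sy := sin (k * y)) in *.
  assert (Ec : cx = cy).
  { transitivity (cx * (c * c + s * s)); [rewrite Hu; ring|].
    transitivity ((cx * c - sx * s) * c + (sx * c + cx * s) * s); [ring|]. rewrite E1, E2.
    transitivity (cy * (c * c + s * s)); [ring|rewrite Hu; ring]. }
  assert (Es : sx = sy).
  { transitivity (sx * (c * c + s * s)); [rewrite Hu; ring|].
    transitivity ((sx * c + cx * s) * c - (cx * c - sx * s) * s); [ring|]. rewrite E1, E2.
    transitivity (sy * (c * c + s * s)); [ring|rewrite Hu; ring]. }
  assert (C : cos (k * x - k * y) = 1).
  { rewrite cos_minus. fold cx sx cy sy. rewrite Ec, Es. assert (U := sin2_cos2 (k * y)). unfold Rsqr in U. fold cy sy in U. lra. }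
  assert (Z : k * x - k * y = 0).
  { apply cos_eq_1; [exact C|]. replace (k * x - k * y) with (k * (x - y)) by ring.
    rewrite Rabs_mult, (Rabs_right k) by lra. apply Rmult_lt_compat_l with (r := k) in Hd; [|exact Hk].
    replace (k * (2 * PI / k)) with (2 * PI) in Hd by (field; lra). exact Hd. }
  apply Rmult_eq_reg_l with k; lra.
Qed.

(* Two values of [X] at the same point differ by periods. *)
Lemma moved_unique (p q : Chat * Chat) (u v : R * R * R) : on_R l l1 l2 p -> moved p q u -> moved p q v ->
  Rabs (fst (fst u) - fst (fst v)) < 2 * PI / k1 -> Rabs (snd (fst u) - snd (fst v)) < 2 * PI / k2 -> u = v.
Proof.
  intros Hp [U1 [U2 [U3 [U4 U5]]]] [V1 [V2 [V3 [V4 V5]]]] D1 D2.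
  destruct k_pos as [K1' K2']. destruct (maps_unit p Hp) as [N1 N2].
  assert (E1 := rot_unique k1 _ _ _ _ K1' N1 (eq_trans (eq_sym U1) V1) (eq_trans (eq_sym U2) V2) D1).
  assert (E2 := rot_unique k2 _ _ _ _ K2' N2 (eq_trans (eq_sym U3) V3) (eq_trans (eq_sym U4) V4) D2).
  destruct u as [[u1 u2] u3], v as [[v1 v2] v3]. simpl in *. subst. f_equal. lra.
Qed.

Lemma moved_close (p0 p : Chat * Chat) (x : R * R * R) (d : R) : moved p0 p x -> 0 < d ->
  exists eta, 0 < eta /\ forall q y, moved p0 q y ->
    Rabs (fst (fst y) - fst (fst x)) < eta -> Rabs (snd (fst y) - snd (fst x)) < eta ->
    Rabs (snd y - snd x) < eta -> close d p q.
Proof.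
  intros [M1 [M2 [M3 [M4 M5]]]] Hd.
  assert (Rc : forall k c s x0, exists eta, 0 < eta /\ forall y0, Rabs (y0 - x0) < eta ->
    Rabs (rot_cos k y0 c s - rot_cos k x0 c s) < d /\ Rabs (rot_sin k y0 c s - rot_sin k x0 c s) < d).
  { intros k c s x0.
    assert (Lk : filterlim (fun y => k * y) (locally x0) (locally (k * x0))) by (apply flim_Rmult; [apply flim_const|apply flim_id]).
    assert (Lc := flim_Rcomp cos _ _ (continuous_cos (k * x0)) Lk).
    assert (Ls := flim_Rcomp sin _ _ (continuous_sin (k * x0)) Lk).
    assert (R1 : filterlim (fun y => rot_cos k y c s) (locally x0) (locally (rot_cos k x0 c s))) by (unfold rot_cos; flim).
    assert (R2 : filterlim (fun y => rot_sin k y c s) (locally x0) (locally (rot_sin k x0 c s))) by (unfold rot_sin; flim).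
    rewrite (flim_Rabs (F := locally x0)) in R1, R2.
    exact (proj1 (locally_Rabs _ _) (filter_and _ _ (R1 d Hd) (R2 d Hd))). }
  destruct (Rc k1 (cos1 p0) (sin1 p0) (fst (fst x))) as [n1 [Hn1 R1]].
  destruct (Rc k2 (cos2 p0) (sin2 p0) (snd (fst x))) as [n2 [Hn2 R2]].
  exists (Rmin (Rmin n1 n2) d). split; [repeat apply Rmin_glb_lt; assumption|].
  intros q y [Q1 [Q2 [Q3 [Q4 Q5]]]] D1 D2 D3.
  assert (B1 := Rmin_l (Rmin n1 n2) d). assert (B2 := Rmin_r (Rmin n1 n2) d).
  assert (B3 := Rmin_l n1 n2). assert (B4 := Rmin_r n1 n2).
  destruct (R1 (fst (fst y)) ltac:(lra)) as [T1 T2]. destruct (R2 (snd (fst y)) ltac:(lra)) as [T3 T4].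
  unfold close. rewrite Q1, Q2, Q3, Q4, Q5, M1, M2, M3, M4, M5. repeat split; try assumption.
  replace (X3 p0 + snd y - (X3 p0 + snd x)) with (snd y - snd x) by ring. lra.
Qed.

(** * Integrals along segments in a chart *)

Lemma RInt_gen_01 (f : R -> R) (B : R) : (forall t, 0 <= t <= 1 -> continuous f t) ->
  (forall t, 0 <= t <= 1 -> Rabs (f t) <= B) ->
  is_RInt_gen f (at_right 0) (at_left 1) (RInt f 0 1).
Proof.
  intros Hc HB P HP. apply locally_Rabs in HP. destruct HP as [d [Hd HP]].
  assert (HB0 : 0 <= B) by (apply Rle_trans with (2 := HB 0 ltac:(lra)); apply Rabs_pos).
  (* Cutting off a length [q] at either end changes the integral by less than [d / 2]. *)
  set (q := Rmin 1 (d / (2 * (B + 1)))).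
  assert (Hq : 0 < q) by (apply Rmin_glb_lt; [lra|apply Rdiv_lt_0_compat; lra]).
  assert (Q1 : q <= 1) by apply Rmin_l. assert (Q2 : q <= d / (2 * (B + 1))) by apply Rmin_r.
  assert (Q3 : B * q < d / 2).
  { apply Rle_lt_trans with (B * (d / (2 * (B + 1)))); [apply Rmult_le_compat_l; assumption|].
    apply Rmult_lt_reg_r with (2 * (B + 1)); [lra|]. replace (B * (d / (2 * (B + 1))) * (2 * (B + 1))) with (B * d) by (field; lra). nra. }
  assert (Ex : forall u w, 0 <= u <= 1 -> 0 <= w <= 1 -> ex_RInt f u w).
  { intros u w Hu Hw. apply (ex_RInt_continuous (V := R_CompleteNormedModule)). intros t [T1 T2]. apply Hc.
    revert T1 T2. apply Rmin_case; apply Rmax_case; intros; lra. }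
  assert (Bd : forall u w, 0 <= u -> u <= w -> w <= 1 -> Rabs (RInt f u w) <= B * (w - u)).
  { intros u w Hu Huw Hw. rewrite Rmult_comm. apply abs_RInt_le_const; [exact Huw|apply Ex; lra|].
    intros t Ht. apply HB. lra. }
  apply Filter_prod with (fun u => 0 < u < q) (fun w => 1 - q < w < 1).
  - apply locally_Rabs. exists q. split; [exact Hq|]. intros u Hu Hxu. apply Rabs_def2 in Hu. lra.
  - apply locally_Rabs. exists q. split; [exact Hq|]. intros u Hu Hxu. apply Rabs_def2 in Hu. lra.
  - intros u w Hu Hw. exists (RInt f u w). split.
    + simpl. apply (RInt_correct (V := R_CompleteNormedModule)). apply Ex; lra.
    + apply HP.
      assert (C1 := RInt_Chasles (V := R_CompleteNormedModule) f 0 u 1 (Ex 0 u ltac:(lra) ltac:(lra)) (Ex u 1 ltac:(lra) ltac:(lra))).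
      assert (C2 := RInt_Chasles (V := R_CompleteNormedModule) f u w 1 (Ex u w ltac:(lra) ltac:(lra)) (Ex w 1 ltac:(lra) ltac:(lra))).
      unfold plus in C1, C2; simpl in C1, C2.
      assert (D1 := Bd 0 u ltac:(lra) ltac:(lra) ltac:(lra)). assert (D2 := Bd w 1 ltac:(lra) ltac:(lra) ltac:(lra)).
      apply Rabs_le_between in D1. apply Rabs_le_between in D2.
      assert (B * (u - 0) <= B * q) by (apply Rmult_le_compat_l; lra).
      assert (B * (1 - w) <= B * q) by (apply Rmult_le_compat_l; lra).
      apply Rabs_def1; lra.
Qed.

Definition seg (s s' : C) (t : R) : C := (s + RtoC t * (s' - s))%C.

Lemma seg_rderiv (s s' : C) (t : R) : rderiv (seg s s') t (s' - s)%C.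
Proof.
  exists (fun _ => (s' - s)%C). split; [apply flim_const|split; [reflexivity|]].
  apply filter_forall. intros h. unfold seg. rewrite RtoC_minus. ring.
Qed.

Lemma seg_ball (s s' : C) (t r : R) : 0 <= t <= 1 -> Cmod s < r -> Cmod s' < r -> Cmod (seg s s' t) < r.
Proof.
  intros Ht Hs Hs'. replace (seg s s' t) with (RtoC (1 - t) * s + RtoC t * s')%C by (unfold seg; rewrite RtoC_minus; ring).
  eapply Rle_lt_trans; [apply Cmod_triangle|]. rewrite !Cmod_mult, !Cmod_R, !Rabs_right by lra.
  destruct (Req_dec t 0) as [->|E]; [lra|].
  assert (t * Cmod s' < t * r) by (apply Rmult_lt_compat_l; lra).
  assert ((1 - t) * Cmod s <= (1 - t) * r) by (apply Rmult_le_compat_l; lra). lra.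
Qed.

Definition seg_int (psi : C -> C) (s s' : C) : R :=
  RInt (fun t => Re (psi (seg s s' t) * (s' - s))%C) 0 1.

Lemma seg_int_bound (psi : C -> C) (s s' s0 : C) (k : C) (e r : R) : Cmod s < r -> Cmod s' < r ->
  (forall u, Cmod u < r -> filterlim psi (locally u) (locally (psi u))) ->
  (forall t, 0 <= t <= 1 -> Cmod (psi (seg s s' t) - k) <= e) ->
  Rabs (seg_int psi s s' - Re (k * (s' - s))%C) <= e * Cmod (s' - s).
Proof.
  intros Hs Hs' Hc He. unfold seg_int.
  assert (Cf : forall t, 0 <= t <= 1 -> continuous (fun t => Re (psi (seg s s' t) * (s' - s))%C) t).
  { intros t Ht. apply flim_Re. apply flim_Cmult; [|apply flim_const].
    eapply filterlim_comp; [exact (rderiv_cont _ _ _ (seg_rderiv s s' t))|].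
    apply Hc, seg_ball; assumption. }
  assert (Ex : ex_RInt (fun t => Re (psi (seg s s' t) * (s' - s))%C) 0 1).
  { apply (ex_RInt_continuous (V := R_CompleteNormedModule)). rewrite Rmin_left, Rmax_right by lra. exact Cf. }
  assert (Em : RInt (fun t => Re (psi (seg s s' t) * (s' - s))%C - Re (k * (s' - s))%C) 0 1 =
     RInt (fun t => Re (psi (seg s s' t) * (s' - s))%C) 0 1 - Re (k * (s' - s))%C).
  { assert (E := is_RInt_minus (V := R_NormedModule) _ _ 0 1 _ _ (RInt_correct (V := R_CompleteNormedModule) _ _ _ Ex) (is_RInt_const (V := R_NormedModule) 0 1 (Re (k * (s' - s))%C))).
    etransitivity; [apply (is_RInt_unique (V := R_CompleteNormedModule)); exact E|].
    unfold minus, plus, opp, scal; simpl; unfold mult; simpl.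
    match goal with |- ?x = ?y => change (@eq R x y) end. ring. }
  rewrite <- Em. replace (e * Cmod (s' - s)) with ((1 - 0) * (e * Cmod (s' - s))) by ring.
  apply abs_RInt_le_const; [lra| |].
  - apply (ex_RInt_minus (V := R_NormedModule)); [exact Ex|apply ex_RInt_const].
  - intros t Ht. replace (Re (psi (seg s s' t) * (s' - s))%C - Re (k * (s' - s))%C) with
      (Re ((psi (seg s s' t) - k) * (s' - s))%C) by (unfold Re, Im; simpl; ring).
    eapply Rle_trans; [apply Re_le|]. rewrite Cmod_mult. apply Rmult_le_compat_r; [apply Cmod_ge_0|apply He, Ht].
Qed.

(** [p1], [p2], [p3] are the coefficients of the forms with respect to the parameter [s]. They are
    continuous at 0 too, where those with respect to [dz] may blow up. The last two conditions say
    that [X] is conformal and regular, which makes it an immersion. *)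
Definition chart (r : R) (c : C -> Chat * Chat) (p1 p2 p3 : C -> C) : Prop :=
  local_param l l1 l2 r c /\
  (exists z w dz : C -> C, forall s, 0 < Cmod s < r ->
     c s = (Fin (z s), Fin (w s)) /\ ordinary l l1 l2 (z s) (w s) /\ cderiv z s (dz s) /\
     filterlim dz (locally s) (locally (dz s)) /\ filterlim w (locally s) (locally (w s)) /\
     (phi1 l l1 l2 (z s) (w s) * dz s = p1 s)%C /\ (phi2 l l1 l2 (z s) (w s) * dz s = p2 s)%C /\
     (phi3 l l1 l2 (z s) (w s) * dz s = p3 s)%C) /\
  (forall s, Cmod s < r -> filterlim p1 (locally s) (locally (p1 s)) /\ filterlim p2 (locally s) (locally (p2 s)) /\
     filterlim p3 (locally s) (locally (p3 s)) /\ (p1 s * p1 s + p2 s * p2 s + p3 s * p3 s = 0)%C /\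
     (p1 s <> 0%C \/ p2 s <> 0%C \/ p3 s <> 0%C)).

(** The point at parameter 0 need not be ordinary, so a segment may start or end there but not pass
    through it. *)
Lemma chart_arc (r : R) (c : C -> Chat * Chat) (p1 p2 p3 : C -> C) (s s' : C) :
  chart r c p1 p2 p3 -> Cmod s < r -> Cmod s' < r -> (forall t, 0 < t < 1 -> seg s s' t <> 0%C) ->
  arc_integral l l1 l2 (c s) (c s') (seg_int p1 s s', seg_int p2 s s', seg_int p3 s s').
Proof.
  intros [[Hr [Lc [_ _]]] [[z [w [dz Hz]]] Hp]] Hs Hs' Hn.
  assert (Ss : forall t, 0 < t < 1 -> 0 < Cmod (seg s s' t) < r).
  { intros t Ht. split; [apply Cmod_neq0, Hn, Ht|apply seg_ball; lra]. }
  exists (fun t => z (seg s s' t)), (fun t => w (seg s s' t)), (fun t => (dz (seg s s' t) * (s' - s))%C).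
  assert (Sc : forall t, filterlim (seg s s') (locally t) (locally (seg s s' t))).
  { intros t. exact (rderiv_cont _ _ _ (seg_rderiv s s' t)). }
  assert (E0 : seg s s' 0 = s) by (unfold seg; ring). assert (E1 : seg s s' 1 = s') by (unfold seg; ring).
  split; [split; [apply Lc, Hs|split; [apply Lc, Hs'|split; [|split]]]|].
  - intros t Ht. destruct (Hz _ (Ss t Ht)) as [_ [O [D [Cd [Cw _]]]]].
    split; [exact O|split; [|split]].
    + apply rderiv_is_derive. apply rderiv_comp; [apply seg_rderiv|exact D].
    + apply (flim_Cmult (F := locally t)); [|apply flim_const].
      eapply filterlim_comp; [apply Sc|exact Cd].
    + eapply filterlim_comp; [apply Sc|exact Cw].
  - apply (filterlim_ext_loc (fun t => c (seg s s' t))).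
    + exists (mkposreal 1 Rlt_0_1). intros t Ht Ht0. change (Rabs (t - 0) < 1) in Ht. apply Rabs_def2 in Ht.
      apply (Hz _ (Ss t ltac:(lra))).
    + apply (filterlim_comp _ _ _ (seg s s') c _ (locally s)); [|apply Lc, Hs].
      rewrite <- E0 at 2. apply (filterlim_filter_le_1 (F := locally 0)); [|apply Sc].
      intros P HP. unfold at_right, within. apply filter_imp with (2 := HP). auto.
  - apply (filterlim_ext_loc (fun t => c (seg s s' t))).
    + exists (mkposreal 1 Rlt_0_1). intros t Ht Ht0. change (Rabs (t - 1) < 1) in Ht. apply Rabs_def2 in Ht.
      apply (Hz _ (Ss t ltac:(lra))).
    + apply (filterlim_comp _ _ _ (seg s s') c _ (locally s')); [|apply Lc, Hs'].
      rewrite <- E1 at 2. apply (filterlim_filter_le_1 (F := locally 1)); [|apply Sc].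
      intros P HP. unfold at_left, within. apply filter_imp with (2 := HP). auto.
  - assert (G : forall P : C -> C -> C, forall psi : C -> C,
      (forall u, 0 < Cmod u < r -> (P (z u) (w u) * dz u = psi u)%C) ->
      (forall u, Cmod u < r -> filterlim psi (locally u) (locally (psi u))) ->
      is_RInt_gen (fun t => Re (P (z (seg s s' t)) (w (seg s s' t)) * (dz (seg s s' t) * (s' - s)))%C)
        (at_right 0) (at_left 1) (seg_int psi s s')).
    { intros P psi HP Hc.
      assert (Cf : forall t, 0 <= t <= 1 -> continuous (fun t => Re (psi (seg s s' t) * (s' - s))%C) t).
      { intros t Ht. apply flim_Re. apply flim_Cmult; [|apply flim_const].
        eapply filterlim_comp; [apply Sc|]. apply Hc, seg_ball; assumption. }
      apply (is_RInt_gen_ext (V := R_NormedModule) (fun t => Re (psi (seg s s' t) * (s' - s))%C)).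
      - apply Filter_prod with (fun u => 0 < u < 1) (fun u => 0 < u < 1).
        + apply locally_Rabs. exists 1. split; [lra|]. intros u Hu Hxu. apply Rabs_def2 in Hu. lra.
        + apply locally_Rabs. exists 1. split; [lra|]. intros u Hu Hxu. apply Rabs_def2 in Hu. lra.
        + intros u v Hu Hv t Ht. simpl in Ht.
          assert (Ht' : 0 < t < 1).
          { destruct Ht as [T1 T2]. revert T1 T2. apply Rmin_case; apply Rmax_case; intros; lra. }
          f_equal. rewrite <- (HP _ (Ss t Ht')). ring.
      - destruct (continuity_ab_maj (fun t => Rabs (Re (psi (seg s s' t) * (s' - s))%C)) 0 1 ltac:(lra)) as [Mx [HM _]].
        + intros t Ht. apply continuity_pt_filterlim. apply (flim_Rcomp Rabs); [apply continuous_Rabs|apply Cf, Ht].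
        + apply (RInt_gen_01 _ (Rabs (Re (psi (seg s s' Mx) * (s' - s))%C))); [exact Cf|exact HM]. }
    split; [|split].
    + apply (G (phi1 l l1 l2) p1); intros u Hu; [apply (Hz u Hu)|apply (Hp u Hu)].
    + apply (G (phi2 l l1 l2) p2); intros u Hu; [apply (Hz u Hu)|apply (Hp u Hu)].
    + apply (G (phi3 l l1 l2) p3); intros u Hu; [apply (Hz u Hu)|apply (Hp u Hu)].
Qed.

(** * Charts of [R] and branches of [X] *)

Lemma norm_CR (h : C) : norm (K := R_AbsRing) (V := C_R_NormedModule) h = Cmod h.
Proof.
  change (sqrt (Rabs (fst h) ^ 2 + Rabs (snd h) ^ 2) = sqrt (fst h ^ 2 + snd h ^ 2)).
  rewrite !pow2_abs. reflexivity.
Qed.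

Lemma norm_R3 (x y z : R) :
  norm (K := R_AbsRing) (V := prod_NormedModule R_AbsRing (prod_NormedModule R_AbsRing R_NormedModule R_NormedModule) R_NormedModule)
    ((x, y), z) <= Rabs x + Rabs y + Rabs z.
Proof.
  change (sqrt ((sqrt (Rabs x ^ 2 + Rabs y ^ 2)) ^ 2 + Rabs z ^ 2) <= Rabs x + Rabs y + Rabs z).
  assert (Q1 := Rabs_pos x). assert (Q2 := Rabs_pos y). assert (Q3 := Rabs_pos z).
  rewrite pow2_sqrt by nra.
  rewrite <- (sqrt_pow2 (Rabs x + Rabs y + Rabs z)) by lra. apply sqrt_le_1_alt. nra.
Qed.

Lemma filterdiff_R3 (Y : C -> R * R * R) (s0 q1 q2 q3 : C) :
  (forall e, 0 < e -> locally s0 (fun s =>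
     Rabs (fst (fst (Y s)) - fst (fst (Y s0)) - Re (q1 * (s - s0))%C) <= e * Cmod (s - s0) /\
     Rabs (snd (fst (Y s)) - snd (fst (Y s0)) - Re (q2 * (s - s0))%C) <= e * Cmod (s - s0) /\
     Rabs (snd (Y s) - snd (Y s0) - Re (q3 * (s - s0))%C) <= e * Cmod (s - s0))) ->
  filterdiff (K := R_AbsRing) (U := C_R_NormedModule) Y (locally s0)
    (fun h : C => (Re (q1 * h)%C, Re (q2 * h)%C, Re (q3 * h)%C)).
Proof.
  intros H. split.
  - split.
    + intros u v. change (@plus C_R_NormedModule u v) with (u + v)%C. rewrite !Cmult_plus_distr_l, !Re_plus. reflexivity.
    + intros k u.
      assert (T : forall q : C, Re (q * scal (V := C_R_NormedModule) k u)%C = k * Re (q * u)%C).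
      { intros q. rewrite scal_R_Cmult. destruct q, u. unfold Re; simpl. ring. }
      rewrite !T. reflexivity.
    + exists (Cmod q1 + Cmod q2 + Cmod q3 + 1).
      assert (B1 := Cmod_ge_0 q1). assert (B2 := Cmod_ge_0 q2). assert (B3 := Cmod_ge_0 q3).
      split; [lra|]. intros h. eapply Rle_trans; [apply norm_R3|]. rewrite norm_CR.
      assert (T : forall q : C, Rabs (Re (q * h)%C) <= Cmod q * Cmod h).
      { intros q. eapply Rle_trans; [apply Re_le|]. rewrite Cmod_mult. apply Rle_refl. }
      assert (T1 := T q1). assert (T2 := T q2). assert (T3 := T q3). assert (B := Cmod_ge_0 h). nra.
  - intros x Hx.
    assert (x = s0) as ->.
    { symmetry. apply (is_filter_lim_locally_unique (K := R_AbsRing) (V := C_R_NormedModule)). exact Hx. }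
    intros e. assert (He : 0 < e / 3) by (assert (Q := cond_pos e); lra).
    apply filter_imp with (2 := H _ He). intros s [E1 [E2 E3]].
    change (norm (K := R_AbsRing) (V := prod_NormedModule R_AbsRing (prod_NormedModule R_AbsRing R_NormedModule R_NormedModule) R_NormedModule)
      ((fst (fst (Y s)) - fst (fst (Y s0)) - Re (q1 * (s - s0))%C,
        snd (fst (Y s)) - snd (fst (Y s0)) - Re (q2 * (s - s0))%C),
        snd (Y s) - snd (Y s0) - Re (q3 * (s - s0))%C) <= e * norm (K := R_AbsRing) (V := C_R_NormedModule) (s - s0)%C).
    rewrite norm_CR. eapply Rle_trans; [apply norm_R3|]. lra.
Qed.

(** If the three products with [h] are purely imaginary, the sum of their squares is minus a sum of
    real squares. It is 0, so all three products vanish. *)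
Lemma null_forms (q1 q2 q3 h : C) : (q1 * q1 + q2 * q2 + q3 * q3 = 0)%C ->
  q1 <> 0%C \/ q2 <> 0%C \/ q3 <> 0%C ->
  (Re (q1 * h)%C, Re (q2 * h)%C, Re (q3 * h)%C) = (0, 0, 0) -> h = RtoC 0.
Proof.
  intros Hz Hn E. injection E as E1 E2 E3.
  destruct (Ceq_dec h (RtoC 0)) as [Hh|Hh]; [exact Hh|]. exfalso.
  assert (S : Re ((q1 * h) * (q1 * h) + (q2 * h) * (q2 * h) + (q3 * h) * (q3 * h))%C = 0).
  { replace ((q1 * h) * (q1 * h) + (q2 * h) * (q2 * h) + (q3 * h) * (q3 * h))%C with ((q1 * q1 + q2 * q2 + q3 * q3) * (h * h))%C by ring.
    rewrite Hz. unfold Re; simpl. ring. }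
  rewrite !Re_plus, !Re_sqr in S.
  change (Re (q1 * h)%C = 0) in E1. change (Re (q2 * h)%C = 0) in E2. change (Re (q3 * h)%C = 0) in E3.
  rewrite E1, E2, E3 in S.
  assert (N : forall q : C, Re (q * h)%C = 0 -> Im (q * h)%C = 0 -> q = 0%C).
  { intros q R1 I1. assert (Z : (q * h = 0)%C) by (apply C_ext; assumption).
    apply Cmult_zero in Z. destruct Z; [assumption|contradiction]. }
  set (i1 := Im (q1 * h)%C) in *. set (i2 := Im (q2 * h)%C) in *. set (i3 := Im (q3 * h)%C) in *.
  destruct Hn as [Hn|[Hn|Hn]]; apply Hn; apply N; try assumption; fold i1 i2 i3; nra.
Qed.

Lemma local_param_shrink (r r' : R) (c : C -> Chat * Chat) : 0 < r' <= r ->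
  local_param l l1 l2 r c -> local_param l l1 l2 r' c.
Proof.
  intros Hr [_ [L1 [L2 [z [w L3]]]]]. split; [lra|split; [|split]].
  - intros s Hs. apply L1. lra.
  - intros s s' Hs Hs'. apply L2; lra.
  - exists z, w. intros s Hs. apply L3. lra.
Qed.

(** The branch is [x] plus the integral along the segment from the centre. Its additivity ([Chain])
    comes from [moved_unique]: two displacements from [p] to one point differ by periods, and the
    disc is too small for a nonzero one. The last hypothesis says that the chart covers a
    neighbourhood of [p]. *)
Lemma chart_sheet (p0 p : Chat * Chat) (x : R * R * R) (r0 : R) (c : C -> Chat * Chat) (f1 f2 f3 : C -> C) :
  on_R l l1 l2 p0 -> X_value l l1 l2 p0 p x -> chart r0 c f1 f2 f3 -> c (RtoC 0) = p ->
  (forall rho, 0 < rho -> exists d, 0 < d /\ forall q, on_R l l1 l2 q ->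
     Cmod (coord (fst q) - coord (fst p)) < d ->
     (sg1 (snd p) <> 0 -> sg1 (snd q) = sg1 (snd p)) -> (sg2 (snd p) <> 0 -> sg2 (snd q) = sg2 (snd p)) ->
     exists s, Cmod s < rho /\ q = c s) ->
  exists (r : R) (c : C -> Chat * Chat) (Y : C -> R * R * R),
    local_param l l1 l2 r c /\ c (RtoC 0) = p /\ Y (RtoC 0) = x /\
    (forall s : C, Cmod s < r ->
       X_value l l1 l2 p0 (c s) (Y s) /\
       exists L : C -> R * R * R,
         filterdiff (K := R_AbsRing) (U := C_R_NormedModule) Y (locally s) L /\
         (forall h : C, L h = (0, 0, 0) -> h = RtoC 0)) /\
    (forall rho : R, 0 < rho < r ->
       locally x (fun y => forall q : Chat * Chat, X_value l l1 l2 p0 q y ->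
         exists s : C, Cmod s < rho /\ q = c s /\ y = Y s)).
Proof.
  intros Hp0 Hx Hch Hc0 Hopen. destruct (X_value_moved p0 p x Hp0 Hx) as [Hp Mx].
  assert (Hch' := Hch). destruct Hch' as [LP [_ HF]]. assert (Hr0 := proj1 LP).
  destruct k_pos as [K1' K2'].
  set (M := 1 + Cmod (f1 (RtoC 0)) + Cmod (f2 (RtoC 0)) + Cmod (f3 (RtoC 0))).
  assert (N1 := Cmod_ge_0 (f1 (RtoC 0))). assert (N2 := Cmod_ge_0 (f2 (RtoC 0))). assert (N3 := Cmod_ge_0 (f3 (RtoC 0))).
  assert (HM : 0 < M) by (unfold M; lra).
  assert (Z0 : Cmod (RtoC 0) = 0) by apply Cmod_0.
  assert (Bd : exists r1, 0 < r1 /\ forall s, Cmod s < r1 -> Cmod (f1 s) <= M /\ Cmod (f2 s) <= M /\ Cmod (f3 s) <= M).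
  { destruct (HF (RtoC 0) ltac:(lra)) as [C1 [C2 [C3 _]]].
    rewrite (flim_Cmod (F := locally (RtoC 0))) in C1, C2, C3.
    destruct (proj1 (locally_Cmod _ _) (filter_and _ _ (C1 1 Rlt_0_1) (filter_and _ _ (C2 1 Rlt_0_1) (C3 1 Rlt_0_1)))) as [r1 [Hr1 H]].
    exists r1. split; [exact Hr1|]. intros s Hs.
    destruct (H s) as [E1 [E2 E3]]; [replace (s - RtoC 0)%C with s by ring; exact Hs|].
    assert (T : forall u v : C, Cmod (u - v) < 1 -> Cmod u <= 1 + Cmod v).
    { intros u v Huv. replace u with (u - v + v)%C at 1 by ring. eapply Rle_trans; [apply Cmod_triangle|lra]. }
    apply T in E1. apply T in E2. apply T in E3. unfold M. lra. }
  destruct Bd as [r1 [Hr1 Bd]].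
  (* [M] bounds the coefficients, so the three integrals compared in [Chain] add up to at most
     [4 * (M * r)]. The choice of [r] makes this at most [4 / k1] and [4 / k2], below the periods
     [2 * PI / k1] and [2 * PI / k2]. *)
  set (r := Rmin (Rmin r0 r1) (Rmin (/ (M * k1)) (/ (M * k2)))).
  assert (Hik : 0 < / (M * k1) /\ 0 < / (M * k2)) by (split; apply Rinv_0_lt_compat, Rmult_lt_0_compat; assumption).
  assert (Hr : 0 < r) by (repeat apply Rmin_glb_lt; tauto).
  assert (R1 : r <= r0) by (eapply Rle_trans; [apply Rmin_l|apply Rmin_l]).
  assert (R2 : r <= r1) by (eapply Rle_trans; [apply Rmin_l|apply Rmin_r]).
  assert (P3 : 3 < PI) by (assert (Q := PI2_3_2); lra).
  assert (R3 : 4 * (M * r) < 2 * PI / k1).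
  { assert (Q : r <= / (M * k1)) by (eapply Rle_trans; [apply Rmin_r|apply Rmin_l]).
    apply Rle_lt_trans with (4 * / k1).
    - replace (4 * / k1) with (4 * (M * / (M * k1))) by (field; lra).
      apply Rmult_le_compat_l; [lra|]. apply Rmult_le_compat_l; lra.
    - unfold Rdiv. apply Rmult_lt_compat_r; [apply Rinv_0_lt_compat; exact K1'|lra]. }
  assert (R4 : 4 * (M * r) < 2 * PI / k2).
  { assert (Q : r <= / (M * k2)) by (eapply Rle_trans; [apply Rmin_r|apply Rmin_r]).
    apply Rle_lt_trans with (4 * / k2).
    - replace (4 * / k2) with (4 * (M * / (M * k2))) by (field; lra).
      apply Rmult_le_compat_l; [lra|]. apply Rmult_le_compat_l; lra.
    - unfold Rdiv. apply Rmult_lt_compat_r; [apply Rinv_0_lt_compat; exact K2'|lra]. }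
  clearbody r.
  set (V := fun s s' : C => (seg_int f1 s s', seg_int f2 s s', seg_int f3 s s') : R * R * R).
  set (Y := fun s : C => plus x (V (RtoC 0) s)).
  assert (Sb : forall (f : C -> C) s s', (forall u, Cmod u < r0 -> filterlim f (locally u) (locally (f u))) ->
    (forall u, Cmod u < r1 -> Cmod (f u) <= M) -> Cmod s < r -> Cmod s' < r ->
    Rabs (seg_int f s s') <= M * Cmod (s' - s)).
  { intros f s s' Cf Bf Hs Hs'.
    assert (Q := seg_int_bound f s s' s (RtoC 0) M r0 ltac:(lra) ltac:(lra) Cf).
    replace (Re (RtoC 0 * (s' - s))%C) with 0 in Q by (unfold Re; simpl; ring).
    rewrite Rminus_0_r in Q. apply Q. intros t Ht. replace (f (seg s s' t) - RtoC 0)%C with (f (seg s s' t)) by ring.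
    apply Bf. apply seg_ball; lra. }
  assert (Vb : forall s s', Cmod s < r -> Cmod s' < r ->
    Rabs (seg_int f1 s s') <= 2 * (M * r) /\ Rabs (seg_int f2 s s') <= 2 * (M * r)).
  { intros s s' Hs Hs'. assert (D : Cmod (s' - s) <= 2 * r).
    { unfold Cminus. eapply Rle_trans; [apply Cmod_triangle|]. rewrite Cmod_opp. lra. }
    assert (D2 : M * Cmod (s' - s) <= 2 * (M * r)) by nra.
    split; (eapply Rle_trans; [apply Sb; [| |exact Hs|exact Hs']|exact D2]).
    - intros u Hu. apply HF, Hu. - intros u Hu. apply Bd, Hu.
    - intros u Hu. apply HF, Hu. - intros u Hu. apply Bd, Hu. }
  assert (Vb0 : forall s, Cmod s < r ->
    Rabs (seg_int f1 (RtoC 0) s) <= M * r /\ Rabs (seg_int f2 (RtoC 0) s) <= M * r).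
  { intros s Hs. assert (D2 : M * Cmod (s - RtoC 0) <= M * r).
    { replace (s - RtoC 0)%C with s by ring. apply Rmult_le_compat_l; lra. }
    split; (eapply Rle_trans; [apply Sb; [| |lra|exact Hs]|exact D2]).
    - intros u Hu. apply HF, Hu. - intros u Hu. apply Bd, Hu.
    - intros u Hu. apply HF, Hu. - intros u Hu. apply Bd, Hu. }
  assert (Rc : forall s, Cmod s < r -> on_R l l1 l2 (c s)).
  { intros s Hs. apply LP. lra. }
  assert (V00 : V (RtoC 0) (RtoC 0) = (0, 0, 0)).
  { assert (Q : forall f, seg_int f (RtoC 0) (RtoC 0) = 0).
    { intros f. unfold seg_int. transitivity (RInt (fun _ : R => 0) 0 1).
      - apply RInt_ext. intros t Ht. replace (RtoC 0 - RtoC 0)%C with (RtoC 0) by ring. unfold Re; simpl; ring.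
      - rewrite RInt_const. unfold scal; simpl; unfold mult; simpl. ring. }
    unfold V. rewrite !Q. reflexivity. }
  assert (x0 : plus x (0, 0, 0) = x).
  { destruct x as [[xa xb] xc]. change ((xa + 0, xb + 0, xc + 0) = (xa, xb, xc)). rewrite !Rplus_0_r. reflexivity. }
  assert (Mv0 : forall s, Cmod s < r -> moved p (c s) (V (RtoC 0) s) /\ X_value l l1 l2 p0 (c s) (Y s)).
  { intros s Hs. destruct (Ceq_dec s (RtoC 0)) as [->|Hs0].
    - unfold Y. rewrite Hc0, V00, x0. split; [apply moved_0|exact Hx].
    - assert (A : arc_integral l l1 l2 (c (RtoC 0)) (c s) (V (RtoC 0) s)).
      { apply (chart_arc r0); [exact Hch|lra|lra|]. intros t Ht.
        unfold seg. replace (RtoC 0 + RtoC t * (s - RtoC 0))%C with (RtoC t * s)%C by ring.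
        apply Cmult_neq_0; [apply RtoC_neq; lra|exact Hs0]. }
      rewrite Hc0 in A. split; [apply arc_moved, A|]. unfold Y. apply (X_step _ _ _ _ p); assumption. }
  assert (Chain : forall s s', Cmod s < r -> Cmod s' < r -> (forall t, 0 < t < 1 -> seg s s' t <> 0%C) ->
    V (RtoC 0) s' = plus (V (RtoC 0) s) (V s s')).
  { intros s s' Hs Hs' Hn.
    assert (A := arc_moved _ _ _ (chart_arc r0 c f1 f2 f3 s s' Hch ltac:(lra) ltac:(lra) Hn)).
    apply (moved_unique p (c s')); [exact Hp|apply (Mv0 s' Hs')|apply moved_trans with (c s); [apply (Mv0 s Hs)|exact A]| |].
    - destruct (Vb0 s Hs) as [B1 _]. destruct (Vb0 s' Hs') as [B2 _]. destruct (Vb s s' Hs Hs') as [B3 _].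
      apply Rle_lt_trans with (2 := R3).
      change (Rabs (seg_int f1 (RtoC 0) s' - (seg_int f1 (RtoC 0) s + seg_int f1 s s')) <= 4 * (M * r)).
      apply Rabs_le_between in B1. apply Rabs_le_between in B2. apply Rabs_le_between in B3. apply Rabs_le. lra.
    - destruct (Vb0 s Hs) as [_ B1]. destruct (Vb0 s' Hs') as [_ B2]. destruct (Vb s s' Hs Hs') as [_ B3].
      apply Rle_lt_trans with (2 := R4).
      change (Rabs (seg_int f2 (RtoC 0) s' - (seg_int f2 (RtoC 0) s + seg_int f2 s s')) <= 4 * (M * r)).
      apply Rabs_le_between in B1. apply Rabs_le_between in B2. apply Rabs_le_between in B3. apply Rabs_le. lra. }
  exists r, c, Y. split; [apply (local_param_shrink r0); [lra|exact LP]|].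
  split; [exact Hc0|split; [unfold Y; rewrite V00; exact x0|split]].
  - intros s Hs. split; [apply Mv0, Hs|].
    destruct (HF s ltac:(lra)) as [C1 [C2 [C3 [Z Nz]]]].
    exists (fun h : C => (Re (f1 s * h)%C, Re (f2 s * h)%C, Re (f3 s * h)%C)).
    split; [|intros h; apply null_forms; assumption].
    apply filterdiff_R3. intros e He.
    (* Within this distance the segment from [s] to another point does not meet 0, except at its
       start when [s = 0]. *)
    set (d1' := if Ceq_dec s (RtoC 0) then 1 else Cmod s).
    assert (Hd1 : 0 < d1') by (unfold d1'; destruct (Ceq_dec s (RtoC 0)) as [E|E]; [lra|apply Cmod_neq0, E]).
    rewrite (flim_Cmod (F := locally s)) in C1, C2, C3.
    destruct (proj1 (locally_Cmod _ _) (filter_and _ _ (C1 e He) (filter_and _ _ (C2 e He) (C3 e He)))) as [d2 [Hd2 Hc]].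
    apply locally_Cmod. exists (Rmin (r - Cmod s) (Rmin d1' d2)). split; [repeat apply Rmin_glb_lt; lra|].
    intros s' Hs'. assert (B1 := Rmin_l (r - Cmod s) (Rmin d1' d2)). assert (B2 := Rmin_r (r - Cmod s) (Rmin d1' d2)).
    assert (B3 := Rmin_l d1' d2). assert (B4 := Rmin_r d1' d2).
    assert (Hs'r : Cmod s' < r).
    { assert (T := Cmod_triangle (s' - s) s). replace (s' - s + s)%C with s' in T by ring. lra. }
    assert (Near : forall t, 0 <= t <= 1 -> Cmod (seg s s' t - s) <= Cmod (s' - s)).
    { intros t Ht. replace (seg s s' t - s)%C with (RtoC t * (s' - s))%C by (unfold seg; ring).
      rewrite Cmod_mult, Cmod_R, Rabs_right by lra. assert (Q := Cmod_ge_0 (s' - s)%C). nra. }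
    assert (Ey : s' = s \/ (forall t, 0 < t < 1 -> seg s s' t <> 0%C)).
    { destruct (Ceq_dec s' s) as [E|E]; [left; exact E|right]. intros t Ht E0. unfold d1' in *.
      destruct (Ceq_dec s (RtoC 0)) as [Es|Es].
      - unfold seg in E0. rewrite Es in E0. replace (RtoC 0 + RtoC t * (s' - RtoC 0))%C with (RtoC t * s')%C in E0 by ring.
        apply Cmult_zero in E0. destruct E0 as [E0|E0].
        + apply (RtoC_neq t); [lra|exact E0].
        + apply E. rewrite E0, Es. reflexivity.
      - specialize (Near t ltac:(lra)). rewrite E0, Cmod_minus_sym in Near. replace (s - 0)%C with s in Near by ring. lra. }
    assert (Goal3 : forall f, (forall u, Cmod u < r0 -> filterlim f (locally u) (locally (f u))) ->
      (forall u, Cmod (u - s) < d2 -> Cmod (f u - f s) < e) ->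
      Rabs (seg_int f s s' - Re (f s * (s' - s))%C) <= e * Cmod (s' - s)).
    { intros f Cf Df. apply (seg_int_bound f s s' s (f s) e r0); [lra|lra|exact Cf|].
      intros t Ht. apply Rlt_le, Df. apply Rle_lt_trans with (1 := Near t Ht). lra. }
    assert (G1 := Goal3 f1 (fun u Hu => proj1 (HF u Hu)) (fun u Hu => proj1 (Hc u Hu))).
    assert (G2 := Goal3 f2 (fun u Hu => proj1 (proj2 (HF u Hu))) (fun u Hu => proj1 (proj2 (Hc u Hu)))).
    assert (G3 := Goal3 f3 (fun u Hu => proj1 (proj2 (proj2 (HF u Hu)))) (fun u Hu => proj2 (proj2 (Hc u Hu)))).
    destruct Ey as [->|Hn].
    + replace (s - s)%C with (RtoC 0) by ring. rewrite Z0.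
      assert (Q : forall q : C, Re (q * RtoC 0)%C = 0) by (intros q; unfold Re; simpl; ring).
      rewrite !Q. assert (Q0 : forall u : R, Rabs (u - u - 0) <= e * 0).
      { intros u. replace (u - u - 0) with 0 by ring. rewrite Rabs_R0. lra. }
      split; [|split]; apply Q0.
    + assert (Ch := Chain s s' Hs Hs'r Hn). unfold Y. rewrite Ch.
      destruct x as [[xa xb] xc]. unfold V.
      change (Rabs (xa + (seg_int f1 (RtoC 0) s + seg_int f1 s s') - (xa + seg_int f1 (RtoC 0) s) - Re (f1 s * (s' - s))%C) <= e * Cmod (s' - s) /\
        Rabs (xb + (seg_int f2 (RtoC 0) s + seg_int f2 s s') - (xb + seg_int f2 (RtoC 0) s) - Re (f2 s * (s' - s))%C) <= e * Cmod (s' - s) /\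
        Rabs (xc + (seg_int f3 (RtoC 0) s + seg_int f3 s s') - (xc + seg_int f3 (RtoC 0) s) - Re (f3 s * (s' - s))%C) <= e * Cmod (s' - s)).
      split; [|split].
      * replace (xa + (seg_int f1 (RtoC 0) s + seg_int f1 s s') - (xa + seg_int f1 (RtoC 0) s)) with (seg_int f1 s s') by ring. exact G1.
      * replace (xb + (seg_int f2 (RtoC 0) s + seg_int f2 s s') - (xb + seg_int f2 (RtoC 0) s)) with (seg_int f2 s s') by ring. exact G2.
      * replace (xc + (seg_int f3 (RtoC 0) s + seg_int f3 s s') - (xc + seg_int f3 (RtoC 0) s)) with (seg_int f3 s s') by ring. exact G3.
  - intros rho Hrho. destruct (Hopen rho (proj1 Hrho)) as [d1' [Hd1 Ho]].
    destruct (proper p d1' Hp Hd1) as [d2 [Hd2 Hpr]].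
    destruct (moved_close p0 p x d2 Mx Hd2) as [eta [Heta Hcl]].
    (* [eta] makes [q] close to [p], so that [q] lies in the chart. The bound [M * r] keeps [y]
       within a period of [Y s], and [moved_unique] identifies the two. *)
    set (eta' := Rmin eta (M * r)).
    assert (He : 0 < eta') by (apply Rmin_glb_lt; [exact Heta|apply Rmult_lt_0_compat; assumption]).
    exists (mkposreal eta' He). intros [[ya yb] yc] [[Ba Bb] Bc] q Hq.
    destruct x as [[xa xb] xc].
    change (Rabs (ya - xa) < eta') in Ba. change (Rabs (yb - xb) < eta') in Bb. change (Rabs (yc - xc) < eta') in Bc.
    assert (E1 := Rmin_l eta (M * r)). assert (E2 := Rmin_r eta (M * r)). fold eta' in E1, E2.
    destruct (X_value_moved p0 q _ Hp0 Hq) as [Rq Mq].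
    assert (Cq : close d2 p q) by (apply (Hcl q _ Mq); simpl; lra).
    destruct (Hpr q Rq Cq) as [P1 [P2 P3']].
    destruct (Ho q Rq P1 P2 P3') as [s [Hs Es]].
    exists s. split; [exact Hs|split; [exact Es|]].
    assert (Hsr : Cmod s < r) by lra.
    assert (Mq2 : moved p0 q (Y s)).
    { unfold Y. apply moved_trans with p; [exact Mx|]. rewrite Es. apply Mv0, Hsr. }
    destruct (Vb0 s Hsr) as [V1 V2].
    apply (moved_unique p0 q); [exact Hp0|exact Mq|exact Mq2| |].
    + apply Rle_lt_trans with (2 := R3).
      change (Rabs (ya - (xa + seg_int f1 (RtoC 0) s)) <= 4 * (M * r)).
      assert (0 < M * r) by (apply Rmult_lt_0_compat; assumption).
      apply Rabs_def2 in Ba. apply Rabs_le_between in V1. apply Rabs_le. lra.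
    + apply Rle_lt_trans with (2 := R4).
      change (Rabs (yb - (xb + seg_int f2 (RtoC 0) s)) <= 4 * (M * r)).
      assert (0 < M * r) by (apply Rmult_lt_0_compat; assumption).
      apply Rabs_def2 in Bb. apply Rabs_le_between in V2. apply Rabs_le. lra.
Qed.

(** * Charts at regular points and at branch points *)

(** At [om = 1], where [z] is infinite, continuity is checked in the coordinate [1 / z]. *)
Lemma sphere_cont (om : C) : filterlim sphere (locally om) (Chat_locally (sphere om)).
Proof.
  assert (Ha := RtoC_neq _ (Rgt_not_eq _ _ a_pos)).
  assert (Lm : forall v : C, filterlim (fun u : C => (1 - u)%C) (locally v) (locally (1 - v)%C)).
  { intros v. apply (flim_Cminus (fun _ => RtoC 1) (fun u => u)); [apply flim_const|apply flim_id]. }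
  assert (Lp : forall v : C, filterlim (fun u : C => (1 + u)%C) (locally v) (locally (1 + v)%C)).
  { intros v. apply (flim_Cplus (fun _ => RtoC 1) (fun u => u)); [apply flim_const|apply flim_id]. }
  assert (Lap : forall v : C, filterlim (fun u : C => (RtoC a * (1 + u))%C) (locally v) (locally (RtoC a * (1 + v))%C)).
  { intros v. apply (flim_Cmult (fun _ => RtoC a) (fun u => 1 + u)%C); [apply flim_const|apply Lp]. }
  destruct (Ceq_dec om (RtoC 1)) as [->|E].
  - assert (L : filterlim (fun u : C => ((1 - u) / (RtoC a * (1 + u)))%C) (locally (RtoC 1)) (locally (RtoC 0))).
    { replace (RtoC 0) with ((1 - RtoC 1) / (RtoC a * (1 + RtoC 1)))%C by (unfold Cdiv; ring).
      apply (flim_Cmult (fun u => 1 - u)%C (fun u => / (RtoC a * (1 + u)))%C); [apply Lm|].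
      apply (flim_Cinv (fun u => RtoC a * (1 + u))%C); [|apply Lap].
      apply Cmult_neq_0; [exact Ha|]. rewrite <- RtoC_plus. apply RtoC_neq. lra. }
    assert (E1 : sphere (RtoC 1) = flip true (RtoC 0)).
    { unfold sphere, flip. destruct (Ceq_dec (RtoC 1) (RtoC 1)); [|contradiction].
      destruct (Ceq_dec (RtoC 0) 0%C); [reflexivity|contradiction]. }
    rewrite E1. apply (filterlim_ext_loc (fun u : C => flip true ((1 - u) / (RtoC a * (1 + u)))%C)).
    + assert (N : locally (RtoC 1) (fun u => (1 + u <> 0)%C)).
      { apply (flim_nonzero _ (1 + RtoC 1)%C); [rewrite <- RtoC_plus; apply RtoC_neq; lra|apply Lp]. }
      apply filter_imp with (2 := N). intros u Hu. unfold sphere, flip.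
      destruct (Ceq_dec u (RtoC 1)) as [->|Eu].
      * destruct (Ceq_dec ((1 - RtoC 1) / (RtoC a * (1 + RtoC 1)))%C 0%C) as [Q|Q]; [reflexivity|].
        exfalso. apply Q. unfold Cdiv. ring.
      * assert (Du : (1 - u <> 0)%C). { intros Q. apply Eu. replace u with (RtoC 1 - (1 - u))%C by ring. rewrite Q. ring. }
        destruct (Ceq_dec ((1 - u) / (RtoC a * (1 + u)))%C 0%C) as [Q|Q].
        -- exfalso. apply Du. replace (1 - u)%C with ((1 - u) / (RtoC a * (1 + u)) * (RtoC a * (1 + u)))%C by (field; split; assumption).
           rewrite Q. ring.
        -- f_equal. field. repeat split; assumption.
    + eapply filterlim_comp; [exact L|apply flip_cont].
  - assert (Du : (1 - om <> 0)%C). { intros Q. apply E. replace om with (RtoC 1 - (1 - om))%C by ring. rewrite Q. ring. }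
    assert (E1 : sphere om = Fin (RtoC a * (1 + om) / (1 - om))%C).
    { unfold sphere. destruct (Ceq_dec om (RtoC 1)); [contradiction|reflexivity]. }
    rewrite E1. apply (filterlim_ext_loc (fun u : C => Fin (RtoC a * (1 + u) / (1 - u))%C)).
    + assert (N : locally om (fun u => (1 - u <> 0)%C)) by (apply (flim_nonzero _ (1 - om)%C); [exact Du|apply Lm]).
      apply filter_imp with (2 := N). intros u Hu. unfold sphere. destruct (Ceq_dec u (RtoC 1)) as [->|Eu]; [|reflexivity].
      exfalso. apply Hu. ring.
    + apply (filterlim_comp _ _ _ (fun u : C => (RtoC a * (1 + u) / (1 - u))%C) Fin _ (locally (RtoC a * (1 + om) / (1 - om))%C)).
      * apply (flim_Cmult (fun u => RtoC a * (1 + u))%C (fun u => / (1 - u))%C); [apply Lap|].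
        apply (flim_Cinv (fun u => 1 - u)%C); [exact Du|apply Lm].
      * intros P HP. exact HP.
Qed.

(* At branch points ([br = true]) [om - om0] is the square of the parameter [s];
   [inv = true] at the poles of [w], where [1 / w] is used. *)
Definition fold_by (br : bool) (s : C) : C := if br then s else RtoC 1.
Definition chart_om (br : bool) (om0 s : C) : C := (om0 + s * fold_by br s)%C.
Definition chart_deg (br : bool) : R := if br then 2 else 1.
Definition chart_w (br : bool) (om0 : C) (h : C -> C) (s : C) : C := (fold_by br s * h (chart_om br om0 s))%C.
Definition chart_map (br inv : bool) (om0 : C) (h : C -> C) (s : C) : Chat * Chat :=
  (sphere (chart_om br om0 s), flip inv (chart_w br om0 h s)).

(** At a branch point [/ w + e * w] has a simple pole in [s], and [d om] contributes the factor [K].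
    The product is written with [K] already cancelled, so that it is defined and continuous at
    [s = 0]. *)
Definition chart_form (br inv : bool) (om0 : C) (h : C -> C) (c : C) (e : R) (s : C) : C :=
  let H := h (chart_om br om0 s) in let K := fold_by br s in
  (c * RtoC (chart_deg br) * (if inv then RtoC e * / H + K * K * H else / H + RtoC e * (K * K * H)) / chart_om br om0 s)%C.
Definition chart_form3 (br : bool) (om0 s : C) : C :=
  (RtoC (chart_deg br) * fold_by br s * / (2 * RtoC a * chart_om br om0 s))%C.

(** [h] is what remains of [w], or of [1 / w] if [inv], after the square root of [om - om0] has been
    taken out at a branch point; hence it has no zero. The clause on [om = 1] allows [z] to be
    infinite at the centre only, and the last one fixes the sheet at a regular point. *)
Definition germ (br inv : bool) (om0 : C) (h : C -> C) (r : R) : Prop :=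
  0 < r /\ forall om, Cmod (om - om0) < r ->
    hol_at h om /\ h om <> 0%C /\ om <> 0%C /\ (om = RtoC 1 -> om = om0) /\
    (let T := ((if br then om - om0 else RtoC 1) * (h om * h om))%C in
     if inv then (num om * T = den om)%C /\ num om <> 0%C else (den om * T = num om)%C) /\
    (br = false -> inv = false /\ 0 < Re (h om * Cconj (h om0))%C).

Lemma chart_om_cderiv (br : bool) (om0 s : C) :
  cderiv (chart_om br om0) s (RtoC (chart_deg br) * fold_by br s)%C.
Proof.
  unfold chart_om, chart_deg, fold_by. destruct br.
  - apply (cderiv_eq _ _ (0 + (1 * s + s * 1))%C); [|replace (RtoC 2) with (RtoC 1 + RtoC 1)%C by (rewrite <- RtoC_plus; f_equal; lra); ring].
    apply cderiv_plus; [apply cderiv_const|]. apply cderiv_mult; apply cderiv_id.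
  - apply (cderiv_eq _ _ (0 + (1 * RtoC 1 + s * 0))%C); [|ring].
    apply cderiv_plus; [apply cderiv_const|]. apply cderiv_mult; [apply cderiv_id|apply cderiv_const].
Qed.

Lemma fold_by_hol (br : bool) (s : C) : hol_at (fold_by br) s.
Proof. unfold fold_by. destruct br; [apply hol_id|apply hol_const]. Qed.

Lemma chart_om_hol (br : bool) (om0 s : C) : hol_at (chart_om br om0) s.
Proof. apply hol_plus; [apply hol_const|apply hol_mult; [apply hol_id|apply fold_by_hol]]. Qed.

Lemma chart_om_ball (br : bool) (om0 s : C) (r : R) : Cmod s < Rmin 1 r -> Cmod (chart_om br om0 s - om0) < r.
Proof.
  intros Hs. assert (B1 := Rmin_l 1 r). assert (B2 := Rmin_r 1 r). assert (Q := Cmod_ge_0 s).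
  unfold chart_om, fold_by. destruct br.
  - replace (om0 + s * s - om0)%C with (s * s)%C by ring. rewrite Cmod_mult. nra.
  - replace (om0 + s * RtoC 1 - om0)%C with s by ring. lra.
Qed.

Lemma germ_point (br inv : bool) (om0 : C) (h : C -> C) (r : R) (s : C) : germ br inv om0 h r -> Cmod s < Rmin 1 r ->
  point_over (chart_om br om0 s) (flip inv (chart_w br om0 h s)).
Proof.
  intros [_ G] Hs. destruct (G _ (chart_om_ball br om0 s r Hs)) as [_ [_ [O [_ [E _]]]]]. cbv zeta in E.
  assert (T : ((if br then chart_om br om0 s - om0 else RtoC 1) * (h (chart_om br om0 s) * h (chart_om br om0 s)) =
    chart_w br om0 h s * chart_w br om0 h s)%C).
  { unfold chart_w. unfold chart_om at 1. unfold fold_by. destruct br; ring. }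
  rewrite T in E. split; [exact O|]. destruct inv; simpl.
  - destruct E as [E N]. destruct (Ceq_dec (chart_w br om0 h s) 0%C) as [Ew|Ew].
    + rewrite <- E, Ew. ring.
    + rewrite <- E. field. exact Ew.
  - exact E.
Qed.

Lemma fold_by_neq0 (br : bool) (s : C) : s <> 0%C -> fold_by br s <> 0%C.
Proof. intros H. unfold fold_by. destruct br; [exact H|apply RtoC_neq; lra]. Qed.

Lemma germ_w_hol (br inv : bool) (om0 : C) (h : C -> C) (r : R) (s : C) : germ br inv om0 h r -> Cmod s < Rmin 1 r ->
  hol_at (fun s => h (chart_om br om0 s)) s /\ hol_at (chart_w br om0 h) s.
Proof.
  intros [_ G] Hs. destruct (G _ (chart_om_ball br om0 s r Hs)) as [Hh _].
  assert (Q : hol_at (fun s => h (chart_om br om0 s)) s) by (apply hol_comp; [apply chart_om_hol|exact Hh]).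
  split; [exact Q|]. apply hol_mult; [apply fold_by_hol|exact Q].
Qed.

Lemma germ_w_neq0 (br inv : bool) (om0 : C) (h : C -> C) (r : R) (s : C) : germ br inv om0 h r -> 0 < Cmod s < Rmin 1 r ->
  s <> 0%C /\ chart_w br om0 h s <> 0%C /\ chart_om br om0 s <> RtoC 1.
Proof.
  intros [_ G] [Hs0 Hs]. destruct (G _ (chart_om_ball br om0 s r Hs)) as [_ [Hh [_ [H1' _]]]].
  assert (Sn : s <> 0%C). { intros ->. rewrite Cmod_0 in Hs0. lra. }
  assert (Kn := fold_by_neq0 br s Sn).
  split; [exact Sn|split; [apply Cmult_neq_0; assumption|]]. intros E. specialize (H1' E).
  apply (Cmult_neq_0 s (fold_by br s) Sn Kn).
  replace (s * fold_by br s)%C with (chart_om br om0 s - om0)%C by (unfold chart_om; ring). rewrite H1'. ring.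
Qed.

(** At a branch point [om] determines [s * s], and the coordinate [s * h om] then determines [s],
    since [h] has no zero. *)
Lemma chart_map_inj (br inv : bool) (om0 : C) (h : C -> C) (r : R) (s s' : C) : germ br inv om0 h r ->
  Cmod s < Rmin 1 r -> Cmod s' < Rmin 1 r -> chart_map br inv om0 h s = chart_map br inv om0 h s' -> s = s'.
Proof.
  intros G Hs Hs' E.
  assert (E1 : chart_om br om0 s = chart_om br om0 s').
  { apply (f_equal (fun p => coord (fst p))) in E. simpl in E. rewrite !coord_sphere in E. exact E. }
  assert (E2 : chart_w br om0 h s = chart_w br om0 h s').
  { apply (f_equal snd) in E. apply flip_inj in E. exact E. }
  destruct (Ceq_dec s (RtoC 0)) as [Z|Z].
  - destruct (Ceq_dec s' (RtoC 0)) as [Z'|Z']; [congruence|]. exfalso. rewrite Z in E1.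
    apply (Cmult_neq_0 _ _ Z' (fold_by_neq0 br s' Z')).
    replace (s' * fold_by br s')%C with (chart_om br om0 s' - om0)%C by (unfold chart_om; ring).
    rewrite <- E1. unfold chart_om. ring.
  - assert (Q := Cmod_neq0 _ Z). destruct (germ_w_neq0 br inv om0 h r s G (conj Q Hs)) as [_ [Wn _]].
    assert (Hn : h (chart_om br om0 s) <> 0%C). { intros E0. apply Wn. unfold chart_w. rewrite E0. ring. }
    unfold chart_w in E2. rewrite <- E1 in E2.
    assert (K : fold_by br s = fold_by br s').
    { apply (Cmult_cancel (h (chart_om br om0 s))); [exact Hn|]. rewrite Cmult_comm, E2. ring. }
    apply (Cmult_cancel (fold_by br s)); [apply fold_by_neq0, Z|].
    transitivity (chart_om br om0 s - om0)%C; [unfold chart_om; ring|]. rewrite E1, K. unfold chart_om. ring.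
Qed.

Lemma chart_map_cont (br inv : bool) (om0 : C) (h : C -> C) (r : R) (s : C) : germ br inv om0 h r -> Cmod s < Rmin 1 r ->
  filterlim (chart_map br inv om0 h) (locally s) (Chat2_locally (chart_map br inv om0 h s)).
Proof.
  intros G Hs. destruct (germ_w_hol br inv om0 h r s G Hs) as [_ Hw]. unfold Chat2_locally, chart_map.
  apply filterlim_pair.
  - eapply filterlim_comp; [exact (hol_cont _ _ (chart_om_hol br om0 s))|apply sphere_cont].
  - eapply filterlim_comp; [exact (hol_cont _ _ Hw)|apply flip_cont].
Qed.

Definition z_of (om : C) : C := (RtoC a * (1 + om) / (1 - om))%C.

Lemma z_of_cderiv (om : C) : om <> RtoC 1 -> cderiv z_of om (2 * RtoC a / ((1 - om) * (1 - om)))%C.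
Proof.
  intros E. assert (Du : (1 - om <> 0)%C). { intros Q. apply E. replace om with (RtoC 1 - (1 - om))%C by ring. rewrite Q. ring. }
  apply (cderiv_eq _ _ ((0 * (1 + om) + RtoC a * (0 + 1)) * / (1 - om) + RtoC a * (1 + om) * (- (0 - 1) / ((1 - om) * (1 - om))))%C); [|field; exact Du].
  apply (cderiv_mult (fun u => RtoC a * (1 + u))%C (fun u => / (1 - u))%C).
  - apply (cderiv_mult (fun _ => RtoC a) (fun u => 1 + u)%C); [apply cderiv_const|].
    apply (cderiv_plus (fun _ => RtoC 1) (fun u => u)); [apply cderiv_const|apply cderiv_id].
  - apply (cderiv_inv (fun u => 1 - u)%C); [exact Du|].
    apply (cderiv_minus (fun _ => RtoC 1) (fun u => u)); [apply cderiv_const|apply cderiv_id].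
Qed.

Lemma z_of_shift (om : C) : om <> RtoC 1 ->
  (1 - om <> 0)%C /\ (z_of om + RtoC a = 2 * RtoC a / (1 - om))%C /\ (z_of om - RtoC a = 2 * RtoC a * om / (1 - om))%C.
Proof.
  intros E. assert (Du : (1 - om <> 0)%C). { intros Q. apply E. replace om with (RtoC 1 - (1 - om))%C by ring. rewrite Q. ring. }
  unfold z_of. split; [exact Du|split; field; exact Du].
Qed.

Lemma chart_form_ph (br inv : bool) (om0 : C) (h : C -> C) (c : C) (e : R) (s w : C) : e * e = 1 ->
  chart_om br om0 s <> 0%C -> chart_w br om0 h s <> 0%C ->
  w = (if inv then / chart_w br om0 h s else chart_w br om0 h s)%C ->
  (ph c e (chart_om br om0 s) w * (RtoC (chart_deg br) * fold_by br s))%C = chart_form br inv om0 h c e s.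
Proof.
  intros He Ho Hw ->. unfold ph, chart_form, chart_w in *.
  set (K := fold_by br s) in *. set (H := h (chart_om br om0 s)) in *. set (om := chart_om br om0 s) in *.
  assert (Kn : K <> 0%C). { intros E. apply Hw. rewrite E. ring. }
  assert (Hn : H <> 0%C). { intros E. apply Hw. rewrite E. ring. }
  destruct inv; field; repeat split; assumption.
Qed.

Lemma chart_form3_dh (br : bool) (om0 s : C) : chart_om br om0 s <> 0%C -> chart_om br om0 s <> RtoC 1 ->
  (dh l l1 l2 (z_of (chart_om br om0 s)) *
   (2 * RtoC a / ((1 - chart_om br om0 s) * (1 - chart_om br om0 s)) * (RtoC (chart_deg br) * fold_by br s)) =
   chart_form3 br om0 s)%C.
Proof.
  intros Ho H1'. assert (HaC := RtoC_neq _ (Rgt_not_eq _ _ a_pos)). destruct (z_of_shift _ H1') as [Du [Z1 Z2]].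
  unfold dh, chart_form3. set (om := chart_om br om0 s) in *.
  replace (z_of om * z_of om - RtoC a * RtoC a)%C with ((z_of om - RtoC a) * (z_of om + RtoC a))%C by ring.
  rewrite Z1, Z2. field. repeat split; try assumption; apply RtoC_neq; lra.
Qed.

(** This rests on the identity [(/ w - w) ^ 2 - (/ w + w) ^ 2 + 4 = 0], where the minus sign comes
    from [Ci * Ci]. *)
Lemma chart_forms_null (br inv : bool) (om0 : C) (h : C -> C) (s : C) :
  chart_om br om0 s <> 0%C -> h (chart_om br om0 s) <> 0%C ->
  (chart_form br inv om0 h cc1 (-1) s * chart_form br inv om0 h cc1 (-1) s +
   chart_form br inv om0 h cc2 1 s * chart_form br inv om0 h cc2 1 s +
   chart_form3 br om0 s * chart_form3 br om0 s = 0)%C /\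
  (chart_form br inv om0 h cc1 (-1) s <> 0%C \/ chart_form br inv om0 h cc2 1 s <> 0%C \/ chart_form3 br om0 s <> 0%C).
Proof.
  intros Ho Hh. assert (Ha := a_pos). assert (HaC := RtoC_neq _ (Rgt_not_eq _ _ Ha)).
  unfold chart_form, chart_form3, cc1, cc2.
  set (K := fold_by br s) in *. set (H := h (chart_om br om0 s)) in *. set (om := chart_om br om0 s) in *.
  assert (E1 : RtoC (-1) = Copp (RtoC 1)) by (apply C_ext; unfold Re, Im; simpl; ring).
  assert (E4 : RtoC (/ (4 * a)) = (/ ((1 + 1) * (1 + 1) * RtoC a))%C).
  { rewrite RtoC_inv by lra. f_equal. replace (4 * a) with ((1 + 1) * (1 + 1) * a) by ring. rewrite !RtoC_mult, !RtoC_plus. reflexivity. }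
  assert (E2 : RtoC 2 = (1 + 1)%C) by (rewrite <- RtoC_plus; f_equal; lra).
  assert (T2 : (1 + 1)%C <> 0%C) by (rewrite <- E2; apply RtoC_neq; lra).
  assert (Dn : RtoC (chart_deg br) <> 0%C) by (apply RtoC_neq; unfold chart_deg; destruct br; lra).
  set (D := RtoC (chart_deg br)) in *.
  assert (CiCi : (Ci * Ci)%C = Copp (RtoC 1)) by (apply C_ext; unfold Re, Im; simpl; ring).
  assert (Cin : Ci <> 0%C). { intros E. rewrite E in CiCi. apply (RtoC_neq (-1)); [lra|]. rewrite E1, <- CiCi. ring. }
  rewrite E1, E4, E2. clearbody D K H om.
  set (A := RtoC a) in *. clearbody A.
  (* For nonzero [K], [u] is [K * (/ w - w)] and [v] is [K * (/ w + w)]. According to [inv], [v - u]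
     or [u + v] equals [2 / H], so they do not vanish together, even at [K = 0]. *)
  set (u := if inv then (- (1) * / H + K * K * H)%C else (/ H + - (1) * (K * K * H))%C).
  set (v := if inv then (1 * / H + K * K * H)%C else (/ H + 1 * (K * K * H))%C).
  assert (UV : (u * u - v * v = - ((1 + 1) * (1 + 1)) * (K * K))%C).
  { unfold u, v. destruct inv; field; exact Hh. }
  assert (UV2 : u = 0%C -> v = 0%C -> False).
  { intros Eu Ev. apply (Cmult_neq_0 (1 + 1)%C (/ H)%C T2).
    - intros E. apply (RtoC_neq 1 R1_neq_R0). rewrite <- (Cinv_r H Hh), E. ring.
    - clear UV. unfold u, v in *. destruct inv.
      + transitivity ((1 * / H + K * K * H) - (- (1) * / H + K * K * H))%C; [ring|]. rewrite Eu, Ev. ring.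
      + transitivity ((1 * (/ H + 1 * (K * K * H))) + (/ H + - (1) * (K * K * H)))%C; [ring|]. rewrite Eu, Ev. ring. }
  clearbody u v. split.
  - transitivity ((D * D / (((1 + 1) * (1 + 1) * A * om) * ((1 + 1) * (1 + 1) * A * om))) *
      (u * u + (Ci * Ci) * (v * v) + (1 + 1) * (1 + 1) * (K * K)))%C; [field; repeat split; assumption|].
    rewrite CiCi. replace (u * u + - (1) * (v * v) + (1 + 1) * (1 + 1) * (K * K))%C with ((u * u - v * v) + (1 + 1) * (1 + 1) * (K * K))%C by ring.
    rewrite UV. ring.
  - destruct (Ceq_dec u 0%C) as [Eu|Eu].
    + right; left. intros E. apply UV2; [exact Eu|].
      transitivity ((Ci * / ((1 + 1) * (1 + 1) * A) * D * v / om) * (om * ((1 + 1) * (1 + 1) * A) / (D * Ci)))%C; [field; repeat split; assumption|].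
      rewrite E. ring.
    + left. intros E. apply Eu.
      transitivity ((/ ((1 + 1) * (1 + 1) * A) * D * u / om) * (om * ((1 + 1) * (1 + 1) * A) / D))%C; [field; repeat split; assumption|].
      rewrite E. ring.
Qed.

Lemma Cinv_neq0 (u : C) : u <> 0%C -> (/ u)%C <> 0%C.
Proof. intros Hu E. apply (RtoC_neq 1 R1_neq_R0). rewrite <- (Cinv_r u Hu), E. ring. Qed.

Lemma chart_form_flim (br inv : bool) (om0 : C) (h : C -> C) (c : C) (e : R) (s : C) :
  chart_om br om0 s <> 0%C -> h (chart_om br om0 s) <> 0%C -> hol_at (fun s => h (chart_om br om0 s)) s ->
  filterlim (chart_form br inv om0 h c e) (locally s) (locally (chart_form br inv om0 h c e s)).
Proof.
  intros Ho Hh HH.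
  assert (CH := hol_cont _ _ HH). assert (CK := hol_cont _ _ (fold_by_hol br s)). assert (CO := hol_cont _ _ (chart_om_hol br om0 s)).
  assert (CI := flim_Cinv _ _ Hh CH).
  assert (CKH := flim_Cmult _ _ _ _ (flim_Cmult _ _ _ _ CK CK) CH).
  unfold chart_form, Cdiv. apply flim_Cmult; [|apply flim_Cinv; assumption].
  apply flim_Cmult; [apply flim_const|]. destruct inv.
  - apply flim_Cplus; [|exact CKH]. apply flim_Cmult; [apply flim_const|exact CI].
  - apply flim_Cplus; [exact CI|]. apply flim_Cmult; [apply flim_const|exact CKH].
Qed.

Lemma chart_form3_flim (br : bool) (om0 s : C) : chart_om br om0 s <> 0%C ->
  filterlim (chart_form3 br om0) (locally s) (locally (chart_form3 br om0 s)).
Proof.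
  intros Ho. assert (CK := hol_cont _ _ (fold_by_hol br s)). assert (CO := hol_cont _ _ (chart_om_hol br om0 s)).
  assert (HaC := RtoC_neq _ (Rgt_not_eq _ _ a_pos)).
  unfold chart_form3. apply flim_Cmult; [apply flim_Cmult; [apply flim_const|exact CK]|].
  apply flim_Cinv; [|apply flim_Cmult; [apply flim_const|exact CO]].
  apply Cmult_neq_0; [apply Cmult_neq_0; [apply RtoC_neq; lra|exact HaC]|exact Ho].
Qed.

Lemma germ_chart (br inv : bool) (om0 : C) (h : C -> C) (r : R) : germ br inv om0 h r ->
  chart (Rmin 1 r) (chart_map br inv om0 h) (chart_form br inv om0 h cc1 (-1)) (chart_form br inv om0 h cc2 1)
    (chart_form3 br om0).
Proof.
  intros G. assert (HaC := RtoC_neq _ (Rgt_not_eq _ _ a_pos)).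
  assert (Hr : 0 < Rmin 1 r) by (apply Rmin_glb_lt; [lra|apply G]).
  set (z := fun s => z_of (chart_om br om0 s)).
  set (w := fun s => (if inv then / chart_w br om0 h s else chart_w br om0 h s)%C).
  set (dz := fun s => (2 * RtoC a / ((1 - chart_om br om0 s) * (1 - chart_om br om0 s)) * (RtoC (chart_deg br) * fold_by br s))%C).
  assert (Nz : forall s, Cmod s < Rmin 1 r -> chart_om br om0 s <> 0%C /\ h (chart_om br om0 s) <> 0%C).
  { intros s Hs. destruct (proj2 G _ (chart_om_ball br om0 s r Hs)) as [_ [N1 [N2 _]]]. split; assumption. }
  assert (Pc : forall s, 0 < Cmod s < Rmin 1 r -> chart_map br inv om0 h s = (Fin (z s), Fin (w s)) /\ w s <> 0%C).
  { intros s Hs. destruct (germ_w_neq0 _ _ _ _ _ _ G Hs) as [_ [Wn On]]. split.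
    - unfold chart_map. f_equal.
      + unfold sphere. destruct (Ceq_dec (chart_om br om0 s) (RtoC 1)); [contradiction|reflexivity].
      + unfold flip, w. destruct inv; [|reflexivity]. destruct (Ceq_dec (chart_w br om0 h s) 0%C); [contradiction|reflexivity].
    - unfold w. destruct inv; [|exact Wn]. intros E. apply (RtoC_neq 1 R1_neq_R0). rewrite <- (Cinv_r _ Wn), E. ring. }
  assert (On : forall s, Cmod s < Rmin 1 r -> on_R l l1 l2 (chart_map br inv om0 h s)).
  { intros s Hs. apply point_on_R, (germ_point _ _ _ _ _ _ G Hs). }
  assert (Or : forall s, 0 < Cmod s < Rmin 1 r -> ordinary l l1 l2 (z s) (w s)).
  { intros s Hs. destruct (Pc s Hs) as [E Wn]. split; [|exact Wn]. rewrite <- E. apply On, Hs. }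
  assert (Dz : forall s, 0 < Cmod s < Rmin 1 r -> cderiv z s (dz s)).
  { intros s Hs. destruct (germ_w_neq0 _ _ _ _ _ _ G Hs) as [_ [_ O1]].
    apply (cderiv_comp (chart_om br om0) z_of); [apply chart_om_cderiv|apply z_of_cderiv, O1]. }
  assert (Hw : forall s, 0 < Cmod s < Rmin 1 r -> hol_at w s).
  { intros s Hs. destruct (germ_w_neq0 _ _ _ _ _ _ G Hs) as [_ [Wn _]].
    destruct (germ_w_hol br inv om0 h r s G (proj2 Hs)) as [_ HW]. unfold w.
    destruct inv; [apply hol_inv; assumption|exact HW]. }
  split; [|split].
  - split; [exact Hr|split; [|split]].
    + intros s Hs. split; [apply On, Hs|apply (chart_map_cont _ _ _ _ _ _ G Hs)].
    + intros s s' Hs Hs'. apply (chart_map_inj _ _ _ _ _ _ _ G Hs Hs').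
    + exists z, w. intros s Hs. destruct (Pc s Hs) as [E _]. destruct (hol_cderiv _ _ (Hw s Hs)) as [d Hd].
      split; [exact E|split; [apply Or, Hs|split]].
      * exists (dz s). apply cderiv_is_derive, Dz, Hs.
      * exists d. apply cderiv_is_derive, Hd.
  - exists z, w, dz. intros s Hs. destruct (Pc s Hs) as [E Wn']. destruct (germ_w_neq0 _ _ _ _ _ _ G Hs) as [_ [Wn O1]].
    destruct (Nz s (proj2 Hs)) as [O0 _]. destruct (z_of_shift _ O1) as [Du [Z1 Z2]].
    assert (P1 : (z s + RtoC a <> 0)%C).
    { unfold z. rewrite Z1. apply Cmult_neq_0; [apply Cmult_neq_0; [apply RtoC_neq; lra|exact HaC]|]. apply Cinv_neq0, Du. }
    assert (P2 : (z s - RtoC a <> 0)%C).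
    { unfold z. rewrite Z2. apply Cmult_neq_0; [apply Cmult_neq_0; [apply Cmult_neq_0; [apply RtoC_neq; lra|exact HaC]|exact O0]|].
      apply Cinv_neq0, Du. }
    assert (Ec : coord (Fin (z s)) = chart_om br om0 s).
    { change (coord (Fin (z s))) with ((z s - RtoC a) / (z s + RtoC a))%C. unfold z. rewrite Z1, Z2. field.
      repeat split; try assumption; apply RtoC_neq; lra. }
    assert (Ed : (2 * RtoC a / ((z s + RtoC a) * (z s + RtoC a)) * dz s = RtoC (chart_deg br) * fold_by br s)%C).
    { unfold z, dz. rewrite Z1. field. repeat split; try assumption; apply RtoC_neq; lra. }
    split; [exact E|split; [apply Or, Hs|split; [apply Dz, Hs|split; [|split; [apply hol_cont, Hw, Hs|split; [|split]]]]]].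
    + unfold dz. assert (CO := hol_cont _ _ (chart_om_hol br om0 s)). assert (CK := hol_cont _ _ (fold_by_hol br s)).
      assert (C1 : filterlim (fun s => (1 - chart_om br om0 s)%C) (locally s) (locally (1 - chart_om br om0 s)%C))
        by (apply (flim_Cminus (fun _ => RtoC 1) (chart_om br om0)); [apply flim_const|exact CO]).
      apply flim_Cmult; [|apply flim_Cmult; [apply flim_const|exact CK]].
      unfold Cdiv. apply flim_Cmult; [apply flim_const|]. apply flim_Cinv; [apply Cmult_neq_0; assumption|apply flim_Cmult; assumption].
    + rewrite <- phi1_pullback, Ec, Ed by assumption. apply chart_form_ph; [ring|exact O0|exact Wn|reflexivity].
    + rewrite <- phi2_pullback, Ec, Ed by assumption. apply chart_form_ph; [ring|exact O0|exact Wn|reflexivity].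
    + apply chart_form3_dh; assumption.
  - intros s Hs. destruct (Nz s Hs) as [O0 Hn]. destruct (germ_w_hol br inv om0 h r s G Hs) as [HH _].
    split; [apply chart_form_flim; assumption|split; [apply chart_form_flim; assumption|split; [apply chart_form3_flim; assumption|]]].
    apply chart_forms_null; assumption.
Qed.

(** * Openness and existence of charts *)

Lemma point_pm (om w : C) (w' : Chat) : point_over om (Fin w) -> w <> 0%C -> point_over om w' ->
  w' = Fin w \/ w' = Fin (- w)%C.
Proof.
  intros P Hw P'. destruct (point_regular om w P Hw) as [Hr E].
  destruct w' as [u|]; [|exfalso; exact (point_singular' om Inf P' (or_intror eq_refl) Hr)].
  assert (Hu : u <> 0%C) by (intros ->; exact (point_singular' om (Fin 0) P' (or_introl eq_refl) Hr)).
  destruct (point_regular om u P' Hu) as [_ E']. rewrite <- E in E'.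
  destruct (sqr_eq u w E') as [s [[-> | ->] Es]]; [left|right]; f_equal; rewrite Es; [ring|].
  apply C_ext; unfold Re, Im; simpl; ring.
Qed.

Lemma same_signs_dot (u v : C) : v <> 0%C -> (s1 v <> 0 -> s1 u = s1 v) -> (s2 v <> 0 -> s2 u = s2 v) ->
  0 < Re (u * Cconj v)%C.
Proof.
  intros Hv E1 E2. replace (Re (u * Cconj v)%C) with (Re u * Re v + Im u * Im v) by (unfold Re, Im; simpl; ring).
  unfold s1, s2 in *.
  assert (Q : forall x y : R, (sign y <> 0 -> sign x = sign y) -> (y = 0 \/ 0 < x * y)).
  { intros x y H. destruct (sign_cases x) as [[X1 X2]|[[X1 X2]|[X1 X2]]], (sign_cases y) as [[Y1 Y2]|[[Y1 Y2]|[Y1 Y2]]];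
      rewrite X2, Y2 in H; try (left; exact Y1); try (exfalso; assert (T := H ltac:(lra)); lra); right; nra. }
  apply Q in E1. apply Q in E2.
  destruct E1 as [E1|E1], E2 as [E2|E2].
  - exfalso. apply Hv. apply C_ext; simpl; [exact E1|]. change (Im v = 0). lra.
  - rewrite E1. lra.
  - assert (Z : Im v = 0) by lra. rewrite Z. lra.
  - lra.
Qed.

(** Near a branch point the two points over one [om] are reached from [s] and [- s], so both sheets
    are covered. At a regular point the signs exclude the opposite sheet, because [h] stays within a
    right angle of [h om0]. *)
Lemma germ_open (br inv : bool) (om0 : C) (h : C -> C) (r rho : R) : germ br inv om0 h r -> 0 < rho ->
  exists d, 0 < d /\ forall q, on_R l l1 l2 q -> Cmod (coord (fst q) - om0) < d ->
    (let w0 := flip inv (chart_w br om0 h (RtoC 0)) in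
     (sg1 w0 <> 0 -> sg1 (snd q) = sg1 w0) /\ (sg2 w0 <> 0 -> sg2 (snd q) = sg2 w0)) ->
    exists s, Cmod s < rho /\ q = chart_map br inv om0 h s.
Proof.
  intros G Hrho. set (t := Rmin rho (Rmin 1 r)).
  assert (Ht : 0 < t) by (apply Rmin_glb_lt; [exact Hrho|apply Rmin_glb_lt; [lra|apply G]]).
  assert (T1 : t <= rho) by apply Rmin_l. assert (T2 : t <= Rmin 1 r) by apply Rmin_r.
  exists (if br then t * t else t). split; [destruct br; nra|].
  intros q Hq Hd Sg. cbv zeta in Sg. assert (Pq := on_R_point q Hq).
  assert (Fq := sphere_coord_R q Hq).
  assert (Done : forall s, chart_om br om0 s = coord (fst q) -> snd q = flip inv (chart_w br om0 h s) -> q = chart_map br inv om0 h s).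
  { intros s Es Ew. unfold chart_map. rewrite Es, Fq, <- Ew. destruct q; reflexivity. }
  set (v := (coord (fst q) - om0)%C) in *.
  destruct br.
  - assert (Sq : forall s, (s * s = v)%C -> Cmod s < t /\ chart_om true om0 s = coord (fst q)).
    { intros s Es. split.
      - rewrite <- Es, Cmod_mult in Hd. assert (Q := Cmod_ge_0 s). nra.
      - unfold chart_om, fold_by. rewrite Es. unfold v. ring. }
    destruct (Ceq_dec v 0%C) as [Ev|Ev].
    + destruct (Sq (RtoC 0)) as [S1 S2]; [rewrite Ev; ring|]. exists (RtoC 0). split; [lra|].
      apply Done; [exact S2|]. apply (point_eq (coord (fst q))).
      * rewrite <- S2. apply (germ_point _ _ _ _ _ _ G). lra.
      * exact Pq.
      * apply Sg.
      * apply Sg.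
    + destruct (Sq (csqrt v) (csqrt_sqr v)) as [S1 S2]. set (s := csqrt v) in *.
      assert (Sn : s <> 0%C). { intros E. apply Ev. rewrite <- (csqrt_sqr v). fold s. rewrite E. ring. }
      destruct (Sq (- s)%C) as [S3 S4]; [rewrite <- (csqrt_sqr v); fold s; ring|].
      assert (Q : 0 < Cmod s) by (apply Cmod_neq0, Sn).
      destruct (germ_w_neq0 _ _ _ _ _ s G ltac:(lra)) as [_ [Wn _]].
      assert (P : point_over (coord (fst q)) (flip inv (chart_w true om0 h s))).
      { rewrite <- S2. apply (germ_point _ _ _ _ _ _ G). lra. }
      assert (Fw : flip inv (chart_w true om0 h s) = Fin (if inv then / chart_w true om0 h s else chart_w true om0 h s)%C).
      { unfold flip. destruct inv; [|reflexivity]. destruct (Ceq_dec (chart_w true om0 h s) 0%C); [contradiction|reflexivity]. }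
      assert (Em : chart_w true om0 h (- s)%C = (- chart_w true om0 h s)%C).
      { unfold chart_w. rewrite S4, S2. unfold fold_by. ring. }
      assert (Wn2 : (- chart_w true om0 h s <> 0)%C).
      { intros E. apply Wn. replace (chart_w true om0 h s) with (- - chart_w true om0 h s)%C by ring. rewrite E. ring. }
      rewrite Fw in P. destruct (point_pm _ _ (snd q) P) as [E|E]; [|exact Pq| |].
      * destruct inv; [apply Cinv_neq0, Wn|exact Wn].
      * exists s. split; [lra|]. apply Done; [exact S2|]. rewrite E. symmetry. exact Fw.
      * exists (- s)%C. split; [lra|]. apply Done; [exact S4|]. rewrite E, Em. unfold flip. destruct inv; [|reflexivity].
        destruct (Ceq_dec (- chart_w true om0 h s)%C 0%C); [contradiction|]. f_equal. field. exact Wn.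
  - assert (S2 : chart_om false om0 v = coord (fst q)) by (unfold chart_om, fold_by, v; ring).
    exists v. split; [lra|]. apply Done; [exact S2|].
    destruct (proj2 G _ (chart_om_ball false om0 v r ltac:(lra))) as [_ [Hn [_ [_ [_ Hp]]]]].
    destruct (Hp eq_refl) as [-> Hp']. clear Hp.
    destruct (proj2 G om0) as [_ [Hn0 _]]. { replace (om0 - om0)%C with (RtoC 0) by ring. rewrite Cmod_0. apply G. }
    assert (W : forall s, chart_w false om0 h s = h (chart_om false om0 s)) by (intros s; unfold chart_w, fold_by; ring).
    assert (E0 : chart_om false om0 (RtoC 0) = om0) by (unfold chart_om; ring).
    assert (P := germ_point _ _ _ _ _ v G ltac:(lra)). rewrite S2 in P. simpl in P. simpl in Sg.
    rewrite S2 in Hn, Hp'. rewrite W, S2 in P. simpl. rewrite W, S2. rewrite !W, E0 in Sg.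
    destruct (point_pm _ _ (snd q) P Hn Pq) as [E|E]; [exact E|]. exfalso.
    rewrite E in Sg. simpl in Sg.
    assert (D := same_signs_dot _ _ Hn0 (proj1 Sg) (proj2 Sg)).
    assert (D2 : Re (- h (coord (fst q)) * Cconj (h om0))%C = - Re (h (coord (fst q)) * Cconj (h om0))%C) by (unfold Re; simpl; ring).
    rewrite D2 in D. lra.
Qed.

Lemma lin_factor (p : R) (om0 om : C) : lin p om0 = 0%C -> lin p om = ((om - om0) * RtoC (a + p))%C.
Proof.
  intros E. transitivity (lin p om - lin p om0)%C; [rewrite E; ring|]. unfold lin. ring.
Qed.

(** By [lin_distinct] exactly one factor vanishes at [om0], so the zero of the product is simple. *)
Lemma four_lin_factor (p q r t : R) (om0 : C) : p <> q -> p <> r -> p <> t -> q <> r -> q <> t -> r <> t ->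
  a + p <> 0 -> a + q <> 0 -> a + r <> 0 -> a + t <> 0 ->
  (lin p om0 * lin q om0 * lin r om0 * lin t om0 = 0)%C ->
  exists n : C -> C, (forall om, hol_at n om) /\ n om0 <> 0%C /\
    forall om, (lin p om * lin q om * lin r om * lin t om = (om - om0) * n om)%C.
Proof.
  intros D1 D2 D3 D4 D5 D6 N1 N2 N3 N4 E.
  assert (T : forall x y z u, x <> y -> x <> z -> x <> u -> a + x <> 0 -> lin x om0 = 0%C ->
    exists n : C -> C, (forall om, hol_at n om) /\ n om0 <> 0%C /\
      forall om, (lin x om * (lin y om * lin z om * lin u om) = (om - om0) * n om)%C).
  { intros x y z u Q1 Q2 Q3 Q4 Ex. exists (fun om => RtoC (a + x) * (lin y om * lin z om * lin u om))%C.
    split; [|split].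
    - intros om. apply hol_mult; [apply hol_const|]. apply hol_mult; [apply hol_mult|]; apply hol_lin.
    - apply Cmult_neq_0; [apply RtoC_neq, Q4|].
      apply Cmult_neq_0; [apply Cmult_neq_0|]; intros Ey; (eapply lin_distinct; [|exact Ex|exact Ey]; assumption).
    - intros om. rewrite (lin_factor x om0 om Ex). ring. }
  apply Cmult_zero in E. destruct E as [E|E]; [apply Cmult_zero in E; destruct E as [E|E]; [apply Cmult_zero in E; destruct E as [E|E]|]|].
  - destruct (T p q r t) as [n [A1' [A2' A3']]]; try assumption. exists n. split; [exact A1'|split; [exact A2'|]].
    intros om. rewrite <- A3'. ring.
  - destruct (T q p r t) as [n [A1' [A2' A3']]]; try assumption; [auto|]. exists n. split; [exact A1'|split; [exact A2'|]].
    intros om. rewrite <- A3'. ring.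
  - destruct (T r p q t) as [n [A1' [A2' A3']]]; try assumption; [auto|auto|]. exists n. split; [exact A1'|split; [exact A2'|]].
    intros om. rewrite <- A3'. ring.
  - destruct (T t p q r) as [n [A1' [A2' A3']]]; try assumption; [auto|auto|auto|]. exists n. split; [exact A1'|split; [exact A2'|]].
    intros om. rewrite <- A3'. ring.
Qed.

Lemma germ_of_sqrt (br inv : bool) (om0 : C) (m : C -> C) (h0 : C) : om0 <> 0%C ->
  locally om0 (fun om => hol_at m om) -> m om0 <> 0%C -> (h0 * h0 = m om0)%C -> (br = false -> inv = false) ->
  locally om0 (fun om => let T := ((if br then om - om0 else RtoC 1) * m om)%C in
     if inv then (num om * T = den om)%C /\ num om <> 0%C else (den om * T = num om)%C) ->
  exists h r, germ br inv om0 h r /\ h om0 = h0.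
Proof.
  intros Ho Hm Hn Hh Hb HT. destruct (hol_sqrt_germ m om0 h0 Hm Hn Hh) as [h [r1 [Hr1 [E0 H]]]].
  destruct (proj1 (locally_Cmod _ _) (filter_and _ _ HT (flim_nonzero (fun u => u) om0 Ho (flim_id om0)))) as [r2 [Hr2 H']].
  (* The disc of radius [d] avoids [om = 1] unless that is its centre. *)
  set (d := if Ceq_dec om0 (RtoC 1) then 1 else Cmod (RtoC 1 - om0)).
  assert (Hd : 0 < d).
  { unfold d. destruct (Ceq_dec om0 (RtoC 1)) as [E|E]; [lra|]. apply Cmod_neq0. intros Q. apply E.
    replace om0 with (RtoC 1 - (RtoC 1 - om0))%C by ring. rewrite Q. ring. }
  exists h, (Rmin d (Rmin r1 r2)). split; [|exact E0].
  split; [repeat apply Rmin_glb_lt; assumption|]. intros om Hom.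
  assert (B1 := Rmin_l d (Rmin r1 r2)). assert (B2 := Rmin_r d (Rmin r1 r2)).
  assert (B3 := Rmin_l r1 r2). assert (B4 := Rmin_r r1 r2).
  destruct (H om ltac:(lra)) as [Q1 [Q2 [Q3 Q4]]]. destruct (H' om ltac:(lra)) as [Q5 Q6].
  split; [exact Q1|split; [exact Q2|split; [exact Q6|split; [|split]]]].
  - intros E. assert (B : Cmod (om - om0) < d) by lra. unfold d in B.
    destruct (Ceq_dec om0 (RtoC 1)) as [E'|E']; [congruence|]. rewrite E in B. lra.
  - rewrite Q3. exact Q5.
  - intros E. split; [apply Hb, E|]. rewrite E0. exact Q4.
Qed.

(** At a regular point [h] is a root of [gsq]. At a zero or a pole of [w], [four_lin_factor] takes
    the factor [om - om0] out of [num] or [den], and [h] is a root of what is left of [gsq] or of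
    its inverse. *)
Lemma germ_exists (p : Chat * Chat) : on_R l l1 l2 p -> exists br inv h r,
  germ br inv (coord (fst p)) h r /\ chart_map br inv (coord (fst p)) h (RtoC 0) = p.
Proof.
  intros Hp. assert (P := on_R_point p Hp). assert (F := sphere_coord_R p Hp).
  set (om0 := coord (fst p)) in *. destruct a_plus_neq as [N1 [N2 [N3 [N4 [N5 [N6 [N7 N8]]]]]]].
  assert (E0 : forall br, chart_om br om0 (RtoC 0) = om0) by (intros br; unfold chart_om; ring).
  assert (Fin_map : forall br inv h, flip inv (fold_by br (RtoC 0) * h om0)%C = snd p ->
    chart_map br inv om0 h (RtoC 0) = p).
  { intros br inv h E. unfold chart_map, chart_w. rewrite E0, F, E. destruct p; reflexivity. }
  assert (Ln : forall f, (forall om, hol_at f om) -> f om0 <> 0%C -> locally om0 (fun om => f om <> 0%C)).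
  { intros f Hf Hn. apply (flim_nonzero f (f om0) Hn). apply hol_cont, Hf. }
  assert (Hquot : forall f g, (forall om, hol_at f om) -> (forall om, hol_at g om) -> g om0 <> 0%C ->
    locally om0 (fun om => hol_at (fun u => f u / g u)%C om)).
  { intros f g Hf Hg Hn. apply filter_imp with (2 := Ln g Hg Hn). intros om Hom. unfold Cdiv.
    apply hol_mult; [apply Hf|]. apply hol_inv; [exact Hom|apply Hg]. }
  assert (Nq : forall u v : C, u <> 0%C -> v <> 0%C -> (u / v)%C <> 0%C).
  { intros u v Hu Hv. apply Cmult_neq_0; [exact Hu|apply Cinv_neq0, Hv]. }
  destruct (Classical_Prop.classic (regular om0)) as [Hr|Hr].
  - destruct (snd p) as [u|] eqn:Eu; [|exfalso; exact (point_singular' om0 Inf P (or_intror eq_refl) Hr)].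
    assert (Hu : u <> 0%C) by (intros ->; exact (point_singular' om0 (Fin 0) P (or_introl eq_refl) Hr)).
    destruct (point_regular om0 u P Hu) as [_ Es].
    destruct (germ_of_sqrt false false om0 gsq u) as [h [r [G Eh]]].
    + exact (proj1 P).
    + apply (Hquot num den hol_num hol_den), Hr.
    + apply gsq_neq0, Hr.
    + exact Es.
    + reflexivity.
    + apply filter_imp with (2 := Ln den hol_den (proj2 Hr)). intros om Hom. unfold gsq. field. exact Hom.
    + exists false, false, h, r. split; [exact G|]. apply Fin_map. simpl. rewrite Eh. f_equal. ring.
  - destruct (point_singular om0 _ P Hr) as [[Ew En]|[Ew En]].
    + destruct (four_lin_factor l (-1) l1 (- l2) om0) as [n [Hn [Nn Fn]]]; try lra; [exact En|].
      assert (Nd : den om0 <> 0%C) by (intros E; exact (num_den_coprime om0 En E)).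
      destruct (germ_of_sqrt true false om0 (fun om => n om / den om)%C (csqrt (n om0 / den om0)%C)) as [h [r [G Eh]]].
      * exact (proj1 P).
      * apply Hquot; [exact Hn|exact hol_den|exact Nd].
      * apply Nq; assumption.
      * apply csqrt_sqr.
      * reflexivity.
      * apply filter_imp with (2 := Ln den hol_den Nd). intros om Hom. unfold num. rewrite Fn. field. exact Hom.
      * exists true, false, h, r. split; [exact G|]. apply Fin_map. rewrite Ew. simpl. f_equal. ring.
    + destruct (four_lin_factor (- l) 1 (- l1) l2 om0) as [n [Hn [Nn Fn]]]; try lra; [exact En|].
      assert (Nd : num om0 <> 0%C) by (intros E; exact (num_den_coprime om0 E En)).
      destruct (germ_of_sqrt true true om0 (fun om => n om / num om)%C (csqrt (n om0 / num om0)%C)) as [h [r [G Eh]]].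
      * exact (proj1 P).
      * apply Hquot; [exact Hn|exact hol_num|exact Nd].
      * apply Nq; assumption.
      * apply csqrt_sqr.
      * auto.
      * apply filter_imp with (2 := Ln num hol_num Nd). intros om Hom. split; [|exact Hom]. unfold den. rewrite Fn. field. exact Hom.
      * exists true, true, h, r. split; [exact G|]. apply Fin_map. rewrite Ew. simpl.
        destruct (Ceq_dec (RtoC 0 * h om0)%C 0%C) as [Q|Q]; [reflexivity|]. exfalso. apply Q. ring.
Qed.

Lemma embedded_R (p0 : Chat * Chat) : on_R l l1 l2 p0 -> embedded l l1 l2 p0.
Proof.
  intros Hp0. split.
  - intros p q x Hx Hy. apply (X_injective p0 p q x Hp0 Hx Hy).
  - intros p x Hx. destruct (X_value_moved p0 p x Hp0 Hx) as [Hp _].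
    destruct (germ_exists p Hp) as [br [inv [h [r [G Ep]]]]].
    apply (chart_sheet p0 p x _ _ _ _ _ Hp0 Hx (germ_chart _ _ _ _ _ G) Ep).
    intros rho Hrho. destruct (germ_open _ _ _ _ _ rho G Hrho) as [d [Hd H]].
    exists d. split; [exact Hd|]. intros q Hq Hc S1 S2. apply H; [exact Hq|exact Hc|].
    assert (Es : flip inv (chart_w br (coord (fst p)) h (RtoC 0)) = snd p) by (rewrite <- Ep at 2; reflexivity).
    cbv zeta. rewrite Es. split; assumption.
Qed.

End Surface.

Theorem proposition4p1 (a1 a2 : R)
  (ha : 0 <= a1 < a2 /\ a2 <= 1)
  (hsolvable : forall l : R, a1 < l < a2 ->
     exists l1 l2 : R, 1 < l1 < l2 /\ is_xi1 l l1 l2 0 /\ is_xi2 l l1 l2 0)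
  (l l1 l2 : R)
  (hl : a1 < l < a2)
  (hl12 : 1 < l1 < l2)
  (hxi1 : is_xi1 l l1 l2 0)
  (hxi2 : is_xi2 l l1 l2 0)
  (p0 : Chat * Chat)
  (hp0 : on_R l l1 l2 p0) :
  embedded l l1 l2 p0.
Proof.
  assert (Hl : 0 < l < 1) by lra.
  exact (embedded_R l l1 l2 Hl hl12 hxi1 hxi2 p0 hp0).
Qed.
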